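(* Let $n\ge 2$, and assume that the coefficient functions $a_i,b_i,c_i,\lambda_i,d_i,K_i$ ($1\le i\le n$), $q_i$ ($1\le i\le n-1$), $\hat q_1,\hat q_2$ and $y_i$ ($1\le i\le n$) satisfy hypotheses (H1), (H2) on $\Omega=\mathbb{R}\times[0,\infty)$, and (H3), as listed in the context. Let $\phi=(\phi_1,\dots,\phi_n)\in L^2(\mathbb{R})^n$. Then the initial value problem $$u_t+G(t)u=f(t,u),\quad t>0,\qquad u(0)=\phi,$$ has a unique global mild solution $u=(u_1,\dots,u_n)\in C([0,\infty),L^2(\mathbb{R})^n)$, i.e. there is exactly one $u\in C([0,\infty),L^2(\mathbb{R})^n)$ with $$u(t)=U(t,0)\phi+\int_0^tU(t,\tau)f(\tau,u(\tau))\,d\tau,\qquad t\ge 0.$$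
   Context: Norm: $\|\psi\|=\max_{1\le i\le n}\|\psi_i\|_{L^2(\mathbb{R})}$ on $L^2(\mathbb{R})^n$. Coefficients: $a_i,b_i,c_i,\lambda_i,d_i,K_i$ ($1\le i\le n$), $q_i$ ($1\le i\le n-1$), $\hat q_1,\hat q_2$ are nonnegative real functions of $x\in\mathbb{R}$; $y_i=y_i(x,t)$ is a given real function; $u_e\in\mathbb{R}$ and $E>0$ are constants; $g(\theta)=e^{-E/\theta}$ for $\theta>0$ and $g(\theta)=0$ for $\theta\le 0$. Hypotheses. (H1): $a_i,b_i,c_i,\lambda_i$ are twice differentiable; there are constants $0<k_1<k_2$ with $a_i(x),\lambda_i(x)\in[k_1,k_2]$ and $b_i(x),c_i(x)\in[0,k_2]$ for all $x\in\mathbb{R}$; and the derivatives of orders $0,1,2$ of $a_i,b_i,c_i,\lambda_i$ belong to $L^\infty(\mathbb{R})$. (H2) on $\Omega=\mathbb{R}\times[0,\infty)$: $y_i\ge 0$; (i) $y_i$ is twice differentiable in $x$ and differentiable in $t$ on $\Omega$, with $y_i,(y_i)_x,(y_i)_{xx},(y_i)_t\in L^\infty(\Omega)$ and $\|y_i\|_{L^\infty(\Omega)}\le k_3$ for a constant $k_3>0$; (ii) $t\mapsto (y_i)_t(x,t)$ is integrable on $[0,T]$ for all $x\in\mathbb{R}$ and all $T>0$; (iii) $(y_i)_t$ is twice differentiable in $x$, $(y_i)_{tx}\in L^\infty(\Omega)$, and $x\mapsto (y_i)_{txx}(x,t)$ is in $L^2(\mathbb{R})$ for all $t\ge0$. (H3):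 $d_i,q_i,K_i\in L^\infty(\mathbb{R})$ and $\hat q_1,\hat q_2\in L^2(\mathbb{R})$. Operator: $G(t)u=(G_1(t)u_1,\dots,G_n(t)u_n)$, where $G_i(t)$ is the operator in $L^2(\mathbb{R})$ with domain $H^2(\mathbb{R})$ given by $G_i(t)\psi=-\alpha_i(\cdot,t)\psi''+\beta_i(\cdot,t)\psi'$, with $\alpha_i=\dfrac{\lambda_i}{a_i+b_iy_i}$, $\beta_i=\dfrac{c_i}{a_i+b_iy_i}$. Source: $f(t,w)(x)=(f_1(x,t,w(x)),\dots,f_n(x,t,w(x)))$, where, with $D_i=a_i(x)+b_i(x)y_i(x,t)$ and $w=(w_1,\dots,w_n)$, $f_1=\frac1{D_1}\big[-(c_1)_xw_1+(K_1b_1w_1+d_1)y_1g(w_1)+q_1(w_2-w_1)-\hat q_1(w_1-u_e)\big]$; $f_i=\frac1{D_i}\big[-(c_i)_xw_i+(K_ib_iw_i+d_i)y_ig(w_i)-q_{i-1}(w_i-w_{i-1})+q_i(w_{i+1}-w_i)\big]$ for $2\le i\le n-1$; $f_n=\frac1{D_n}\big[-(c_n)_xw_n+(K_nb_nw_n+d_n)y_ng(w_n)-q_{n-1}(w_n-w_{n-1})-\hat q_2(w_n-u_e)\big]$. Evolution operator: $U(t,s)=(U_1(t,s),\dots,U_n(t,s))$ (acting componentwise), $0\le s\le t<\infty$, where $U_i$ is the evolution operator associated (in Kato's sense) with $\{G_i(t)\}$: the unique family $U_i(t,s)\in\mathcal{B}(L^2(\mathbb{R}))$, strongly continuous in $(t,s)$,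 with $U_i(t,t)=I$, $U_i(t,r)=U_i(t,s)U_i(s,r)$ for $r\le s\le t$, mapping $H^2(\mathbb{R})$ into itself and strongly continuous there, and such that for $\psi\in H^2(\mathbb{R})$, in $L^2(\mathbb{R})$, $\partial_tU_i(t,s)\psi=-G_i(t)U_i(t,s)\psi$ and $\partial_sU_i(t,s)\psi=U_i(t,s)G_i(s)\psi$. Under (H1) and (H2) it is known (earlier work) that this family exists, and that there is $\beta>0$ with $\|U(t,s)\psi\|\le e^{\beta t}\|\psi\|$ for all $\psi\in L^2(\mathbb{R})^n$ and $0\le s\le t$. *)

(* Defs.v *)
From HB Require Import structures.
From mathcomp Require Import all_boot all_order all_algebra.
From mathcomp Require Import all_classical all_reals all_analysis.
From mathcomp Require Import measurable_realfun ess_sup_inf.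
Set Implicit Arguments.
Unset Strict Implicit.
Unset Printing Implicit Defensive.
Import Order.TTheory GRing.Theory Num.Theory.
Import numFieldNormedType.Exports.
Local Open Scope classical_set_scope.
Local Open Scope ring_scope.

Lemma eq_Lnorm_ae d (T : measurableType d) (R : realType)
    (mu : {measure set T -> \bar R}) (p : \bar R) (f g : T -> R) :
  (1 <= p)%E -> measurable_fun setT f -> measurable_fun setT g ->
  {ae mu, forall x, f x = g x} ->
  ('N[mu]_p[EFin \o f] = 'N[mu]_p[EFin \o g])%E.
Proof.
move=> p1 mf mg fg; rewrite unlock; case: p p1 => [r|//|//] _ /=.
  congr (_ `^ _)%E; apply: ae_eq_integral => //.
  - apply/measurable_EFinP; apply: (measurableT_comp (measurable_powR _)).
    exact: measurableT_comp.
  - apply/measurable_EFinP; apply: (measurableT_comp (measurable_powR _)).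
    exact: measurableT_comp.
  - by apply: filterS fg => x /= -> _.
by case: ifP => // _; apply: eq_ess_sup; apply: filterS fg => x /= ->.
Qed.

Section Lspace_normedModType.
Context d (T : measurableType d) (R : realType).
Variables (mu : {measure set T -> \bar R}) (p : \bar R) (p1 : (1 <= p)%E).
Local Notation Lp := (LspaceType mu p1).
Local Notation Lfun := (Lfun mu p).
Local Open Scope quotient_scope.

Lemma LspaceP (f : Lp) : (f : T -> R) \in Lfun.
Proof.
rewrite inE; apply/andP; split; last by rewrite inE; exact: Lebesgue_finite.
rewrite inE; exact: (@measurable_funPT _ _ T (measurableTypeR R)).
Qed.

Lemma eq_Lspace (f g : Lp) : f = g %[ae mu] -> f = g.
Proof.
move=> fg.
have {}fg : (f : {mfun_ mu, T >-> measurableTypeR R}) = g.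
  by rewrite -[LHS]reprK -[RHS]reprK; apply/eqmodP/asboolP.
case: f fg => f [[f1]]; case: g => g [[g1]] /= fg.
by subst g; rewrite (Prop_irrelevance f1 g1).
Qed.

Section Lclass.
Context (f : T -> R) (fP : f \in Lfun).

Let mf : {mfun T >-> measurableTypeR R} :=
  HB.pack (f : T -> measurableTypeR R)
    (@isMeasurableFun.Build _ _ T (measurableTypeR R) f
       (set_mem (sub_Lfun_mfun fP))).

Let cf : {mfun_ mu, T >-> measurableTypeR R} := \pi_({mfun_ mu, T >-> measurableTypeR R}) mf.

Let cfE : (cf : T -> R) = f %[ae mu].
Proof.
have : repr cf = mf %[mod {mfun_ mu, T >-> measurableTypeR R}] by rewrite reprK.
by move/eqmodP/asboolP.
Qed.

Let finite_cf : finite_norm mu p cf.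
Proof.
move: (sub_Lfun_finLfun fP); rewrite inE/= /finite_norm; congr (_ < _)%E.
apply: eq_Lnorm_ae => //.
- by case/andP: fP; rewrite inE.
- exact: (@measurable_funPT _ _ T (measurableTypeR R)).
- by apply: filterS cfE => x /= ->.
Qed.

Definition Lclass : Lp :=
  HB.pack cf (@isFinLebesgue.Build _ _ _ mu p p1 cf finite_cf).

Lemma LclassE : Lclass = f %[ae mu].
Proof. exact: cfE. Qed.
End Lclass.

HB.instance Definition _ := gen_eqMixin Lp.
HB.instance Definition _ := gen_choiceMixin Lp.

Let LfunSub (f : Lp) : LfunType mu p1 := Lfun_Sub p1 (LspaceP f).

Let cst0P : cst 0 \in Lfun.
Proof. exact: (LfunP (cst 0 : LfunType mu p1)). Qed.
Let oppP (f : Lp) : \- (f : T -> R) \in Lfun.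
Proof. exact: (LfunP (- LfunSub f)). Qed.
Let addP (f g : Lp) : (f : T -> R) \+ g \in Lfun.
Proof. exact: (LfunP (LfunSub f + LfunSub g)). Qed.
Let scaleP a (f : Lp) : a \*: (f : T -> R) \in Lfun.
Proof. exact: (LfunP (a *: LfunSub f)). Qed.

Let zero := Lclass cst0P.
Let opp f := Lclass (oppP f).
Let add f g := Lclass (addP f g).
Let scale a f := Lclass (scaleP a f).

Let zeroE : {ae mu, forall x, zero x = 0}.
Proof. by apply: filterS (LclassE cst0P) => x; apply. Qed.
Let oppE f : {ae mu, forall x, opp f x = - f x}.
Proof. by apply: filterS (LclassE (oppP f)) => x; apply. Qed.
Let addE f g : {ae mu, forall x, add f g x = f x + g x}.
Proof. by apply: filterS (LclassE (addP f g)) => x; apply. Qed.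
Let scaleE a f : {ae mu, forall x, scale a f x = a * f x}.
Proof. by apply: filterS (LclassE (scaleP a f)) => x; apply. Qed.

Let addA : associative add.
Proof.
move=> f g h; apply: eq_Lspace.
near=> x => _; rewrite (near (addE f (add g h)) x)// (near (addE g h) x)//.
by rewrite (near (addE (add f g) h) x)// (near (addE f g) x)// addrA.
Unshelve. all: by end_near. Qed.

Let addC : commutative add.
Proof.
move=> f g; apply: eq_Lspace.
by near=> x => _; rewrite (near (addE f g) x)// (near (addE g f) x)// addrC.
Unshelve. all: by end_near. Qed.

Let add0 : left_id zero add.
Proof.
move=> f; apply: eq_Lspace; near=> x => _.
by rewrite (near (addE zero f) x)// (near zeroE x)// add0r.
Unshelve. all: by end_near. Qed.

Let addN : left_inverse zero opp add.
Proof.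
move=> f; apply: eq_Lspace; near=> x => _.
rewrite (near (addE (opp f) f) x)// (near (oppE f) x)// (near zeroE x)//.
by rewrite addNr.
Unshelve. all: by end_near. Qed.

HB.instance Definition _ := GRing.isZmodule.Build Lp addA addC add0 addN.

Let scaleA a b f : scale a (scale b f) = scale (a * b) f.
Proof.
apply: eq_Lspace; near=> x => _.
rewrite (near (scaleE a (scale b f)) x)// (near (scaleE b f) x)//.
by rewrite (near (scaleE (a * b) f) x)// mulrA.
Unshelve. all: by end_near. Qed.

Let scale1 : left_id 1 scale.
Proof.
move=> f; apply: eq_Lspace; near=> x => _.
by rewrite (near (scaleE 1 f) x)// mul1r.
Unshelve. all: by end_near. Qed.

Let scaleDr : right_distributive scale +%R.
Proof.
move=> a f g; apply: eq_Lspace; near=> x => _.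
rewrite (near (scaleE a (f + g)) x)// (near (addE f g) x)//.
rewrite (near (addE (scale a f) (scale a g)) x)//.
by rewrite (near (scaleE a f) x)// (near (scaleE a g) x)// mulrDr.
Unshelve. all: by end_near. Qed.

Let scaleDl f : {morph scale^~ f : a b / a + b}.
Proof.
move=> a b; apply: eq_Lspace; near=> x => _.
rewrite (near (scaleE (a + b) f) x)//.
rewrite (near (addE (scale a f) (scale b f)) x)//.
by rewrite (near (scaleE a f) x)// (near (scaleE b f) x)// mulrDl.
Unshelve. all: by end_near. Qed.

HB.instance Definition _ :=
  GRing.Zmodule_isLmodule.Build R Lp scaleA scale1 scaleDr scaleDl.

Lemma Lspace0E : {ae mu, forall x, (0 : Lp) x = 0}.
Proof. exact: zeroE. Qed.

Lemma LspaceNE (f : Lp) : {ae mu, forall x, (- f) x = - f x}.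
Proof. exact: oppE. Qed.

Lemma LspaceDE (f g : Lp) : {ae mu, forall x, (f + g) x = f x + g x}.
Proof. exact: addE. Qed.

Lemma LspaceZE a (f : Lp) : {ae mu, forall x, (a *: f) x = a * f x}.
Proof. exact: scaleE. Qed.

Let nrm (f : Lp) : R := fine 'N[mu]_p[EFin \o f]%E.

Let nrmE (f : Lp) (g : LfunType mu p1) :
  f = g %[ae mu] -> nrm f = fine 'N[mu]_p[EFin \o g]%E.
Proof.
move=> fg; congr fine; apply: eq_Lnorm_ae => //.
- exact: (@measurable_funPT _ _ T (measurableTypeR R)).
- by apply: filterS fg => x /= ->.
Qed.

Let ler_normD f g : nrm (f + g) <= nrm f + nrm g.
Proof.
rewrite (@nrmE (f + g) (LfunSub f + LfunSub g)).
  exact: (ler_LnormD (LfunSub f) (LfunSub g)).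
by apply: filterS (LspaceDE f g) => x /= ->.
Qed.

Let normZ a f : nrm (a *: f) = `|a| * nrm f.
Proof.
rewrite (@nrmE (a *: f) (a *: LfunSub f)).
  by apply: EFin_inj; rewrite EFinM !(finite_norm_fine (LfunSub f), finite_norm_fine (a *: LfunSub f)) -LnormZ.
by apply: filterS (LspaceZE a f) => x /= ->.
Qed.

Let norm0_eq0 f : nrm f = 0 -> f = 0.
Proof.
move=> f0; apply: eq_Lspace.
have := @fine_Lnormr_eq0 _ _ _ mu p p1 (LfunSub f) f0.
by apply: filterS2 Lspace0E => x /= -> fx _; rewrite fx.
Qed.

HB.instance Definition _ := @Lmodule_isNormed.Build R Lp nrm
  ler_normD normZ norm0_eq0.

Lemma normLspaceE (f : Lp) : (`|f|%:E = 'N[mu]_p[EFin \o f])%E.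
Proof. exact: (finite_norm_fine (LfunSub f)). Qed.

Definition Lclassd (f : T -> R) : Lp :=
  if pselect (f \in Lfun) is left fP then Lclass fP else 0.
End Lspace_normedModType.

Section max_norm.
Context (R : realType) (V : normedModType R) (n : nat).

Definition vecfun : Type := {ffun 'I_n -> V}.
HB.instance Definition _ := GRing.Lmodule.on vecfun.

Let nrm (u : vecfun) : R := \big[Order.max/0]_(i < n) `|u i|.

Let nrm_ge (u : vecfun) i : `|u i| <= nrm u.
Proof. exact: le_bigmax. Qed.

Let nrm_ge0 (u : vecfun) : 0 <= nrm u.
Proof. exact: bigmax_ge_id. Qed.

Let ler_nrmD (u v : vecfun) : nrm (u + v) <= nrm u + nrm v.
Proof.
apply/bigmax_leP; split=> [|i _]; first by rewrite addr_ge0.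
by rewrite ffunE (le_trans (ler_normD _ _))// lerD.
Qed.

Let nrmZ (a : R) (u : vecfun) : nrm (a *: u) = `|a| * nrm u.
Proof.
rewrite /nrm (big_morph _ (fun x y => @maxr_pMr _ `|a| x y _) (mulr0 _))//.
by apply: eq_bigr => i _; rewrite ffunE normrZ.
Qed.

Let nrm0_eq0 (u : vecfun) : nrm u = 0 -> u = 0.
Proof.
move=> u0; apply/ffunP => i; rewrite ffunE; apply/normr0_eq0/eqP.
by rewrite eq_le normr_ge0 -u0 nrm_ge.
Qed.

HB.instance Definition _ := @Lmodule_isNormed.Build R vecfun nrm
  ler_nrmD nrmZ nrm0_eq0.

Lemma norm_vecfunE (u : vecfun) : `|u| = \big[Order.max/0]_(i < n) `|u i|.
Proof. by []. Qed.

End max_norm.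

Definition L2 (R : realType) : Type :=
  LspaceType (@lebesgue_measure R) (lee1n 2).
HB.instance Definition _ (R : realType) := NormedModule.on (L2 R).

Notation L2vec R n := (vecfun (L2 R) n).

Definition inL2 (R : realType) (f : R -> R) : Prop :=
  f \in Lfun (@lebesgue_measure R) 2%:E.

(* the class of f in L2, or 0 when f is not square integrable *)
Definition toL2 (R : realType) (f : R -> R) : L2 R := Lclassd (@lebesgue_measure R) (lee1n 2) f.

Lemma toL2E (R : realType) (f : R -> R) :
  inL2 f -> toL2 f = f %[ae lebesgue_measure].
Proof.
by rewrite /toL2 /Lclassd => f2; case: pselect => // ?; exact: LclassE.
Qed.

Definition inLoo (R : realType) (f : R -> R) : Prop :=
  f \in Lfun (@lebesgue_measure R) +oo%E.

Section one_sided_derivative.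
Context (R : realType) (V : normedModType R).
Implicit Types (A : set R) (f : R -> V).

(* derivatives relative to a subset of the line; they are one-sided at the
   endpoints of an interval *)
Definition diff_quotient_in A f t : set_system V :=
  h^-1 *: (f (t + h) - f t) @[h --> within [set h | A (t + h)] 0^'].

Definition is_derive_in A f t (l : V) := diff_quotient_in A f t --> l.
Definition derivable_in A f t := cvg (diff_quotient_in A f t).
Definition derive_in A f t : V := lim (diff_quotient_in A f t).

End one_sided_derivative.

Section bochner.
Context d (T : measurableType d) (R : realType) (V : normedModType R).
Variables (mu : {measure set T -> \bar R}) (D : set T).

Definition simple_on (s : T -> V) :=
  finite_set (s @` D) /\
  forall v, measurable (D `&` s @^-1` [set v]) /\
            (v != 0 -> (mu (D `&` s @^-1` [set v]) < +oo)%E).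

Definition simple_integral (s : T -> V) : V :=
  \sum_(v \in s @` D) fine (mu (D `&` s @^-1` [set v])) *: v.

(* f is Bochner integrable on D, with integral I *)
Definition is_bochner_integral (f : T -> V) (I : V) :=
  exists s : nat -> T -> V,
    [/\ forall k, simple_on (s k),
        {ae mu, forall x, D x -> s k x @[k --> \oo] --> f x},
        (\int[mu]_(x in D) (`|f x - s k x|)%:E)%E @[k --> \oo] --> 0%E
      & simple_integral (s k) @[k --> \oo] --> I].

End bochner.

Section sobolev.
Context (R : realType).
Implicit Types (phi : R -> R) (psi : L2 R).

Definition test_function phi :=
  (forall k x, derivable (derive1n k phi) x 1) /\
  exists M : R, forall x, M < `|x| -> phi x = 0.

Definition weak_derivative psi (psi' : L2 R) :=
  forall phi, test_function phi ->
    (\int[lebesgue_measure]_x (psi x * derive1 phi x) =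
     - \int[lebesgue_measure]_x (psi' x * phi x))%R.

(* the weak derivative, when there is one in L2 *)
Definition wderiv psi : L2 R := xget 0 [set psi' | weak_derivative psi psi'].

Definition inH2 psi := exists psi' psi'' : L2 R,
  weak_derivative psi psi' /\ weak_derivative psi' psi''.

Definition H2norm psi : R :=
  Num.sqrt (`|psi| ^+ 2 + `|wderiv psi| ^+ 2 + `|wderiv (wderiv psi)| ^+ 2).

End sobolev.

Section evolution.
Context (R : realType).
Implicit Types (t s r : R) (psi : L2 R).

Definition time_triangle : set (R * R) := [set ts | 0 <= ts.2 <= ts.1].

(* G t is an operator in L2 with domain H2; only its values on H2 matter *)
Record evolution_operator (G : R -> L2 R -> L2 R) (U : R -> R -> L2 R -> L2 R)
    : Prop := EvolutionOperator {
  evol_linear : forall t s, 0 <= s <= t -> linear (U t s) ;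
  evol_bounded : forall t s, 0 <= s <= t -> continuous (U t s) ;
  evol_continuous : forall psi,
    {within time_triangle, continuous (fun ts : R * R => U ts.1 ts.2 psi)} ;
  evol_id : forall t psi, 0 <= t -> U t t psi = psi ;
  evol_comp : forall t s r psi, 0 <= r -> r <= s -> s <= t ->
    U t r psi = U t s (U s r psi) ;
  evol_H2 : forall t s psi, 0 <= s <= t -> inH2 psi -> inH2 (U t s psi) ;
  evol_H2_continuous : forall psi, inH2 psi -> forall ts, time_triangle ts ->
    H2norm (U us.1 us.2 psi - U ts.1 ts.2 psi)
      @[us --> within time_triangle (nbhs ts)] --> 0 ;
  evol_derive_t : forall t s psi, 0 <= s <= t -> inH2 psi ->
    is_derive_in `[s, +oo[ (fun t' => U t' s psi) t (- G t (U t s psi)) ;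
  evol_derive_s : forall t s psi, 0 <= s <= t -> inH2 psi ->
    is_derive_in `[0, t] (fun s' => U t s' psi) s (U t s (G s psi)) }.

End evolution.

(* Layers are numbered from 0 to n.-1; cq k is the exchange coefficient between
   the layers k and k.+1, and is only relevant when k.+1 < n. *)
Record coefficients (R : realType) (n : nat) := Coefficients {
  ca : 'I_n -> R -> R ;
  cb : 'I_n -> R -> R ;
  cc : 'I_n -> R -> R ;
  clambda : 'I_n -> R -> R ;
  cd : 'I_n -> R -> R ;
  cK : 'I_n -> R -> R ;
  cq : nat -> R -> R ;
  cqhat1 : R -> R ;
  cqhat2 : R -> R ;
  cy : 'I_n -> R -> R -> R ;
  cue : R ;
  cE : R }.

Section hypotheses.
Context (R : realType) (n : nat).
Implicit Types (P : coefficients R n) (f : R -> R) (v : R -> R -> R).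
Local Notation leb := (@lebesgue_measure R).

Definition nonneg_coefficients P :=
  [/\ forall i x, [/\ 0 <= ca P i x, 0 <= cb P i x, 0 <= cc P i x
                    & 0 <= clambda P i x],
      forall i x, 0 <= cd P i x /\ 0 <= cK P i x,
      forall k x, (k.+1 < n)%N -> 0 <= cq P k x,
      forall x, 0 <= cqhat1 P x
    & forall x, 0 <= cqhat2 P x].

Definition twice_differentiable f :=
  forall x, derivable f x 1 /\ derivable (derive1 f) x 1.

Definition hypH1 P :=
  (forall i f, [\/ f = ca P i, f = cb P i, f = cc P i | f = clambda P i] ->
     twice_differentiable f /\
     forall k, (k <= 2)%N -> inLoo (derive1n k f)) /\
  exists k1 k2 : R, [/\ 0 < k1, k1 < k2 &
    forall i x, [/\ k1 <= ca P i x <= k2, k1 <= clambda P i x <= k2,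
                    0 <= cb P i x <= k2 & 0 <= cc P i x <= k2]].

Definition Omega : set (R * R) := [set: R] `*` `[0, +oo[.

Definition on_Omega v : R * R -> R := (fun xt => v xt.1 xt.2) \_ Omega.

Definition inLoo_Omega v : Prop := on_Omega v \in Lfun (leb \x leb)%E +oo%E.

Definition dx v x t : R := derive1 (v ^~ t) x.
Definition dt v x t : R := derive_in `[0, +oo[ (v x) t.

Definition hypH2 P :=
  exists2 k3 : R, 0 < k3 & forall i, let y := cy P i in
  [/\ forall x t : R, 0 <= t -> 0 <= y x t,
      [/\ forall t : R, 0 <= t -> twice_differentiable (y ^~ t),
          forall x t : R, 0 <= t -> derivable_in `[0, +oo[ (y x) t,
          [/\ inLoo_Omega y, inLoo_Omega (dx y), inLoo_Omega (dx (dx y))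
            & inLoo_Omega (dt y)]
        & ('N[leb \x leb]_+oo[EFin \o on_Omega y] <= k3%:E)%E],
      forall x T : R, 0 < T -> leb.-integrable `[0, T] (EFin \o dt y x)
    & [/\ forall t : R, 0 <= t -> twice_differentiable (dt y ^~ t),
          inLoo_Omega (dx (dt y))
        & forall t : R, 0 <= t -> inL2 (dx (dx (dt y)) ^~ t)]].

Definition hypH3 P :=
  [/\ forall i, inLoo (cd P i) /\ inLoo (cK P i),
      forall k, (k.+1 < n)%N -> inLoo (cq P k),
      inL2 (cqhat1 P)
    & inL2 (cqhat2 P)].

End hypotheses.

Section problem.
Context (R : realType) (n : nat) (P : coefficients R n).
Implicit Types (i : 'I_n) (w : 'I_n -> R).

Definition denom i x t : R := ca P i x + cb P i x * cy P i x t.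
Definition alpha i x t : R := clambda P i x / denom i x t.
Definition beta i x t : R := cc P i x / denom i x t.

Definition Gop i (t : R) (psi : L2 R) : L2 R :=
  toL2 (fun x => - alpha i x t * wderiv (wderiv psi) x
                 + beta i x t * wderiv psi x).

Definition arrhenius (E theta : R) : R :=
  if 0 < theta then expR (- E / theta) else 0.

(* ord_pred and ordS are cyclic, but are not used here at the two ends *)
Definition exchange_prev i x w : R :=
  if i == 0 :> nat then - cqhat1 P x * (w i - cue P)
  else - cq P i.-1 x * (w i - w (ord_pred i)).

Definition exchange_next i x w : R :=
  if i.+1 == n then - cqhat2 P x * (w i - cue P)
  else cq P i x * (w (ordS i) - w i).

Definition source_fun i x t w : R :=
  (denom i x t)^-1 *
  (- derive1 (cc P i) x * w i
   + (cK P i x * cb P i x * w i + cd P i x) * cy P i x t * arrhenius (cE P) (w i)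
   + exchange_prev i x w + exchange_next i x w).

Definition source_at (t : R) (w : L2vec R n) i (x : R) : R :=
  source_fun i x t (fun j => w j x).

(* cqhat1 and cqhat2 are not assumed to be bounded, so that source_at t w need
   not be square integrable for every w in L2vec *)
Definition source_defined t (w : L2vec R n) := forall i, inL2 (source_at t w i).

Definition source t (w : L2vec R n) : L2vec R n := [ffun i => toL2 (source_at t w i)].

Definition evolve (U : 'I_n -> R -> R -> L2 R -> L2 R) t s (w : L2vec R n)
  : L2vec R n := [ffun i => U i t s (w i)].

Definition mild_solution (U : 'I_n -> R -> R -> L2 R -> L2 R)
    (phi : L2vec R n) (u : R -> L2vec R n) :=
  [/\ {within `[0, +oo[, continuous u},
      {ae lebesgue_measure, forall tau : R, 0 <= tau -> source_defined tau (u tau)}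
    & forall t : R, 0 <= t ->
        is_bochner_integral lebesgue_measure `[0, t]
          (fun tau => evolve U t tau (source tau (u tau)))
          (u t - evolve U t 0 phi)].

End problem.

(* Main.v *)
(* Energy estimates for |u|^2 + k (t-s) |u'|^2 and |A u|^2 + k (t-s) |u|^2 along
   u = U_i(t,s) psi, with A = (1 + d/dx)^-1, show that U_i(t,s) is bounded in L2
   with |U_i(t,s) psi|_oo <= C (t-s)^(-1/4) |psi| and
   |U_i(t,s) psi| <= C (t-s)^(-1/2) |A psi|. Multiplication by a function of L2,
   such as the unbounded coefficients qhat, is bounded from L2 to the dual of H1,
   where |A psi| is the norm. Hence the operators z |-> U_i(t,s) (qhat z) extend
   to L2 with norm O((t-s)^(-1/2)), and the mild formulation becomes a weakly
   singular Volterra equation with a Lipschitz nonlinearity, which Picard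
   iteration solves uniquely. Splitting U_i(t,s) = U_i(t,r) U_i(r,s) at the midpoint
   bounds the integrand in Loo by C (t-s)^(-3/4), so that qhat u(t) is in L2 for
   t > 0, and the extended integrand is the original one. *)

Require Import Defs.
From HB Require Import structures.
From mathcomp Require Import all_boot all_order all_algebra.
From mathcomp Require Import all_classical all_reals all_analysis.
From mathcomp Require Import measurable_realfun ess_sup_inf.
From mathcomp Require Import ring lra.
Set Implicit Arguments.
Unset Strict Implicit.
Unset Printing Implicit Defensive.
Import Order.TTheory GRing.Theory Num.Theory.
Import numFieldNormedType.Exports.
Local Open Scope classical_set_scope.
Local Open Scope ring_scope.

(** * Square integrable functions *)

(** The obstacle is that [qhat] is only square integrable: for w in L2 the product qhat w is merely
    integrable, so the source does not map L2 to itself and no fixed point argument applies to the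
    equation as stated. The equation is solved instead with the kernel [Phi], defined on all of L2,
    and the two formulations are compared at the end. For a solution of the stated equation they
    agree because the source is defined at almost every time; for the fixed point this has to be
    proved, which is the purpose of the Loo bound. Dissipation comes from alpha >= k > 0. Commuting
    A with the operator costs two x-derivatives of alpha, bounded uniformly in t, whereas the
    hypotheses bound derivatives only almost everywhere and do not make the highest ones continuous;
    hence the separate study of differentiable functions whose derivative is bounded almost
    everywhere. The exponent 3/4 = 1/4 + 1/2 of [kernel] is that of the midpoint splitting. It also
    dominates the exponent 1/2 of the Volterra equation, so that one kernel serves both purposes. *)

Section L2_basics.
Context {R : realType}.
Local Notation leb := (@lebesgue_measure R).
Implicit Types (f g h : R -> R) (u v w : L2 R).

Global Instance ae_leb_filter : Filter (nbhs (almost_everywhere leb)).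
Proof. exact: ae_filter_ringOfSetsType. Qed.

Lemma Lnorm2_sq f : (('N[leb]_2%:E[EFin \o f] `^ 2) = \int[leb]_x (f x ^+ 2)%:E)%E.
Proof.
rewrite powR_Lnorm//; apply: eq_integral => x _ /=.
by rewrite powR_mulrn// real_normK ?num_real.
Qed.

Lemma inL2P f : inL2 f <->
  measurable_fun setT f /\ (\int[leb]_x (f x ^+ 2)%:E < +oo)%E.
Proof.
rewrite -Lnorm2_sq; split=> [|[mf fi]].
  rewrite /inL2 inE => /andP[/set_mem mf /set_mem fi]; split => //.
  move: fi; rewrite /finLfun/= /finite_norm => fi.
  have := Lnorm_ge0 leb 2%:E (EFin \o f); move: fi.
  by case: ('N[leb]_2%:E[EFin \o f])%E => //= r _ _; rewrite ltry.
rewrite /inL2 inE; apply/andP; split; rewrite inE//=.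
by apply: (@lty_poweRy _ _ 2) => //; rewrite pnatr_eq0.
Qed.

Lemma inL2_measurable f : inL2 f -> measurable_fun setT f.
Proof. by move/inL2P=> []. Qed.

Lemma inL2_L2 u : inL2 u.
Proof. exact: LspaceP. Qed.

Lemma measurable_L2 u : measurable_fun setT (u : R -> R).
Proof. exact: inL2_measurable (inL2_L2 u). Qed.

Hint Resolve inL2_L2 measurable_L2 : core.

Lemma measurable_sqr f : measurable_fun setT f ->
  measurable_fun setT (fun x => (f x ^+ 2)%:E).
Proof. by move=> mf; apply/measurable_EFinP; exact: measurable_funX. Qed.

Lemma normL2_sq u : (`|u| ^+ 2)%:E = (\int[leb]_x (u x ^+ 2)%:E)%E.
Proof.
rewrite -Lnorm2_sq -(normLspaceE (u : LspaceType _ _)) poweR_EFin.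
by rewrite powR_mulrn.
Qed.

Lemma inL2_le f g : measurable_fun setT f -> inL2 g ->
  {ae leb, forall x, `|f x| <= `|g x|} -> inL2 f.
Proof.
move=> mf /inL2P[mg gi] fg; apply/inL2P; split => //.
apply: le_lt_trans gi; apply: ae_ge0_le_integral => //.
- by move=> x _; rewrite lee_fin sqr_ge0.
- exact: measurable_sqr.
- by move=> x _; rewrite lee_fin sqr_ge0.
- exact: measurable_sqr.
apply: filterS fg => x fg _; rewrite lee_fin.
by rewrite -(@real_normK _ (f x)) ?num_real// -(@real_normK _ (g x)) ?num_real//
  ler_sqr ?nnegrE.
Qed.

Lemma normL2_le u v : {ae leb, forall x, `|u x| <= `|v x|} -> `|u| <= `|v|.
Proof.
move=> uv; rewrite -ler_sqr ?nnegrE// -lee_fin !normL2_sq.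
apply: ae_ge0_le_integral => //.
- by move=> x _; rewrite lee_fin sqr_ge0.
- exact: measurable_sqr.
- by move=> x _; rewrite lee_fin sqr_ge0.
- exact: measurable_sqr.
apply: filterS uv => x fg _; rewrite lee_fin.
by rewrite -(@real_normK _ (u x)) ?num_real// -(@real_normK _ (v x)) ?num_real//
  ler_sqr ?nnegrE.
Qed.

Lemma toL2_ae f : inL2 f -> {ae leb, forall x, toL2 f x = f x}.
Proof. by move=> f2; apply: filterS (toL2E f2) => x; apply. Qed.

Lemma L2_eq u v : {ae leb, forall x, u x = v x} -> u = v.
Proof. by move=> uv; apply: eq_Lspace; apply: filterS uv => x uv _. Qed.

Lemma toL2_id u : toL2 u = u.
Proof. by apply: L2_eq; exact: toL2_ae. Qed.

Lemma L2D_ae u v : {ae leb, forall x, (u + v) x = u x + v x}.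
Proof. exact: (LspaceDE (p1 := lee1n 2)). Qed.

Lemma L2N_ae u : {ae leb, forall x, (- u) x = - u x}.
Proof. exact: (LspaceNE (p1 := lee1n 2)). Qed.

Lemma L2B_ae u v : {ae leb, forall x, (u - v) x = u x - v x}.
Proof. by apply: filterS2 (L2D_ae u (- v)) (L2N_ae v) => x -> ->. Qed.

Lemma L2Z_ae (a : R) u : {ae leb, forall x, (a *: u) x = a * u x}.
Proof. exact: (LspaceZE (p1 := lee1n 2)). Qed.

Lemma L20_ae : {ae leb, forall x, (0 : L2 R) x = 0}.
Proof. exact: (@Lspace0E _ _ _ leb _ (lee1n 2)). Qed.

Lemma inL2D f g : inL2 f -> inL2 g -> inL2 (f \+ g).
Proof.
by move=> fL gL; have := (Lfun_addr_closed leb (lee1n 2)).2 f g fL gL.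
Qed.

Lemma inL2Z (a : R) f : inL2 f -> inL2 (fun x => a * f x).
Proof.
move=> fL; have := inL2_L2 (a *: toL2 f) => aL.
apply: (inL2_le _ aL); first exact: measurable_funM (inL2_measurable fL).
by apply: filterS2 (L2Z_ae a (toL2 f)) (toL2_ae fL) => x -> ->.
Qed.

Lemma inL2N f : inL2 f -> inL2 (fun x => - f x).
Proof.
move=> fL; have := inL2Z (-1) fL.
by congr inL2; apply/funext => x; rewrite mulN1r.
Qed.

Lemma inL2B f g : inL2 f -> inL2 g -> inL2 (f \- g).
Proof. by move=> fL gL; exact: inL2D fL (inL2N gL). Qed.

Lemma toL2D f g : inL2 f -> inL2 g -> toL2 (f \+ g) = toL2 f + toL2 g.
Proof.
move=> fL gL; apply: L2_eq.
near=> x; rewrite (near (L2D_ae _ _) x)// (near (toL2_ae fL) x)//.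
by rewrite (near (toL2_ae gL) x)// (near (toL2_ae (inL2D fL gL)) x).
Unshelve. all: by end_near. Qed.

Lemma toL2N f : inL2 f -> toL2 (\- f) = - toL2 f.
Proof.
move=> fL; apply: L2_eq.
near=> x; rewrite (near (L2N_ae _) x)// (near (toL2_ae fL) x)//.
by rewrite (near (toL2_ae (inL2N fL)) x).
Unshelve. all: by end_near. Qed.

Lemma toL2B f g : inL2 f -> inL2 g -> toL2 (f \- g) = toL2 f - toL2 g.
Proof. by move=> fL gL; rewrite -toL2N// -toL2D//; exact: inL2N. Qed.

Lemma inL2M f g (K : R) : measurable_fun setT f -> (forall x, `|f x| <= K) ->
  inL2 g -> inL2 (fun x => f x * g x).
Proof.
move=> mf fK gL; have := inL2Z K gL => KL.
apply: (inL2_le _ KL); first by apply: measurable_funM => //; exact: inL2_measurable.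
apply: aeW => x; rewrite !normrM ler_wpM2r//.
by rewrite (le_trans (fK x))// ler_norm.
Qed.

Definition mulL2 f u : L2 R := toL2 (fun x => f x * u x).

Definition bddfun f (K : R) := measurable_fun setT f /\ forall x, `|f x| <= K.

Lemma mulL2_ae f (K : R) u : bddfun f K ->
  {ae leb, forall x, mulL2 f u x = f x * u x}.
Proof. by case=> mf fK; apply: toL2_ae; exact: inL2M fK _. Qed.

Lemma norm_mulL2 f (K : R) u : bddfun f K -> `|mulL2 f u| <= K * `|u|.
Proof.
move=> fK; have K0 : 0 <= K by case: fK => _ /(_ 0); exact: le_trans.
rewrite -(ger0_norm K0) -normrZ; apply: normL2_le.
apply: filterS2 (mulL2_ae u fK) (L2Z_ae K u) => x -> ->.
by rewrite !normrM ler_wpM2r// (ger0_norm K0); case: fK.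
Qed.

Lemma norm_toL2 f u (K : R) : measurable_fun setT f -> 0 <= K ->
  {ae leb, forall x, `|f x| <= K * `|u x|} -> inL2 f /\ `|toL2 f| <= K * `|u|.
Proof.
move=> mf K0 fu.
have fL : inL2 f.
  apply: (inL2_le mf (inL2Z K (inL2_L2 u))).
  by apply: filterS fu => x; rewrite normrM (ger0_norm K0).
split => //; rewrite -(ger0_norm K0) -normrZ; apply: normL2_le.
apply: filterS3 (toL2_ae fL) (L2Z_ae K u) fu => x -> ->.
by rewrite normrM (ger0_norm K0).
Qed.

Definition dot u v : R := \int[leb]_x (u x * v x).

Lemma integrable_mul f g : inL2 f -> inL2 g ->
  leb.-integrable setT (EFin \o (fun x => f x * g x)).
Proof.
by move=> fL gL; apply/Lfun1_integrable; exact: Lfun2_mul_Lfun1 fL gL.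
Qed.

Lemma eq_Rintegral_ae f g : measurable_fun setT f -> measurable_fun setT g ->
  {ae leb, forall x, f x = g x} -> \int[leb]_x f x = \int[leb]_x g x.
Proof.
move=> mf mg fg; congr fine; apply: ae_eq_integral => //.
- exact/measurable_EFinP.
- exact/measurable_EFinP.
- by apply: filterS fg => x -> _.
Qed.

Lemma dotE u v f g : measurable_fun setT f -> measurable_fun setT g ->
  {ae leb, forall x, u x = f x} -> {ae leb, forall x, v x = g x} ->
  dot u v = \int[leb]_x (f x * g x).
Proof.
move=> mf mg uf vg; apply: eq_Rintegral_ae.
- exact: measurable_funM.
- exact: measurable_funM.
- by apply: filterS2 uf vg => x -> ->.
Qed.

Lemma dot_toL2 u f : inL2 f -> dot u (toL2 f) = \int[leb]_x (u x * f x).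
Proof.
move=> fL; apply: dotE => //; [exact: inL2_measurable| |exact: toL2_ae].
exact: aeW.
Qed.

Lemma dotC u v : dot u v = dot v u.
Proof. by apply: eq_Rintegral => x _; rewrite mulrC. Qed.

Lemma dotDl u v w : dot (u + v) w = dot u w + dot v w.
Proof.
rewrite -RintegralD//; [|exact: integrable_mul|exact: integrable_mul].
apply: eq_Rintegral_ae.
- exact: measurable_funM.
- by apply: measurable_funD; exact: measurable_funM.
- by apply: filterS (L2D_ae u v) => x ->; rewrite mulrDl.
Qed.

Lemma dotZl (a : R) u w : dot (a *: u) w = a * dot u w.
Proof.
rewrite -RintegralZl//; last exact: integrable_mul.
apply: eq_Rintegral_ae.
- exact: measurable_funM.
- by apply: measurable_funM => //; exact: measurable_funM.
- by apply: filterS (L2Z_ae a u) => x ->; rewrite mulrA.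
Qed.

Lemma dotNl u w : dot (- u) w = - dot u w.
Proof. by rewrite -scaleN1r dotZl mulN1r. Qed.
Lemma dotBl u v w : dot (u - v) w = dot u w - dot v w.
Proof. by rewrite dotDl dotNl. Qed.
Lemma dotDr u v w : dot u (v + w) = dot u v + dot u w.
Proof. by rewrite dotC dotDl !(dotC u). Qed.
Lemma dotZr (a : R) u w : dot u (a *: w) = a * dot u w.
Proof. by rewrite dotC dotZl dotC. Qed.
Lemma dotNr u w : dot u (- w) = - dot u w.
Proof. by rewrite dotC dotNl dotC. Qed.
Lemma dotBr u v w : dot u (v - w) = dot u v - dot u w.
Proof. by rewrite dotDr dotNr. Qed.
Lemma dot0l u : dot 0 u = 0.
Proof. by rewrite -(scale0r (0 : L2 R)) dotZl mul0r. Qed.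
Lemma dot0r u : dot u 0 = 0.
Proof. by rewrite dotC dot0l. Qed.

Lemma dot_normE u : dot u u = `|u| ^+ 2.
Proof.
apply: EFin_inj; rewrite normL2_sq /dot /Rintegral fineK.
  by apply: eq_integral => x _; rewrite expr2.
exact: integrable_fin_num (integrable_mul _ _).
Qed.

Lemma dot_le u v : `|dot u v| <= `|u| * `|v|.
Proof.
have [->|u0] := eqVneq u 0; first by rewrite dot0l !normr0 mul0r.
have [->|v0] := eqVneq v 0; first by rewrite dot0r !normr0 mulr0.
have uv0 : 0 < `|u| * `|v| by rewrite mulr_gt0// normr_gt0.
(* Expansion of the squared norm of |v| u - s |u| v; the signs s = 1 and s = -1 give the two sides
   of the inequality. *)
have key s : s ^+ 2 = 1 -> 0 <= (`|u| * `|v|) * ((`|u| * `|v|) - s * dot u v).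
  move=> s1; have : 0 <= dot (`|v| *: u - (s * `|u|) *: v) (`|v| *: u - (s * `|u|) *: v).
    by rewrite dot_normE sqr_ge0.
  rewrite !(dotBl, dotBr, dotZl, dotZr) !dot_normE (dotC v u) => h.
  have -> : `|u| * `|v| * (`|u| * `|v| - s * dot u v) =
     2^-1 * (`|v| * (`|v| * `|u| ^+ 2) - s * `|u| * (`|v| * dot u v) -
     s * `|u| * (`|v| * dot u v - s * `|u| * `|v| ^+ 2))
     + 2^-1 * (1 - s ^+ 2) * (`|u| ^+ 2 * `|v| ^+ 2) by field.
  by rewrite s1 subrr mulr0 mul0r addr0 mulr_ge0.
have h1 := key 1 (expr1n _ _); have h2 := key (-1) (etrans (sqrrN 1) (expr1n _ _)).
by move: h1 h2; rewrite !pmulr_rge0// !subr_ge0 mul1r mulN1r ler_norml lerNl => -> ->.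
Qed.

Lemma dot_mulL2 f (K : R) u v : bddfun f K -> dot (mulL2 f u) v = dot u (mulL2 f v).
Proof.
move=> fK; have mf : measurable_fun setT f by case: fK.
rewrite (@dotE _ _ (fun x => f x * u x) v)//; last 3 first.
- exact: measurable_funM.
- exact: mulL2_ae fK.
- exact: aeW.
rewrite (@dotE _ _ u (fun x => f x * v x))//; last 3 first.
- exact: measurable_funM.
- exact: aeW.
- exact: mulL2_ae fK.
by apply: eq_Rintegral => x _; rewrite mulrCA mulrA.
Qed.

Lemma mulL2D f (K : R) u v : bddfun f K -> mulL2 f (u + v) = mulL2 f u + mulL2 f v.
Proof.
move=> fK; apply: L2_eq; near=> x.
rewrite (near (mulL2_ae (u + v) fK) x)// (near (L2D_ae u v) x)//.
rewrite (near (L2D_ae (mulL2 f u) _) x)// (near (mulL2_ae u fK) x)//.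
by rewrite (near (mulL2_ae v fK) x)// mulrDr.
Unshelve. all: by end_near. Qed.

Lemma mulL2Z f (K a : R) u : bddfun f K -> mulL2 f (a *: u) = a *: mulL2 f u.
Proof.
move=> fK; apply: L2_eq; near=> x.
rewrite (near (mulL2_ae (a *: u) fK) x)// (near (L2Z_ae a u) x)//.
rewrite (near (L2Z_ae a (mulL2 f u)) x)// (near (mulL2_ae u fK) x)//.
by rewrite mulrCA.
Unshelve. all: by end_near. Qed.

Lemma mulL2N f (K : R) u : bddfun f K -> mulL2 f (- u) = - mulL2 f u.
Proof. by move=> fK; rewrite -scaleN1r (mulL2Z _ _ fK) scaleN1r. Qed.

Lemma mulL2B f (K : R) u v : bddfun f K -> mulL2 f (u - v) = mulL2 f u - mulL2 f v.
Proof. by move=> fK; rewrite (mulL2D _ _ fK) (mulL2N _ fK). Qed.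

End L2_basics.
#[global] Hint Resolve inL2_L2 measurable_L2 : core.

(** * Fatou's lemma and rapidly convergent sequences in L2 *)

Section L2_convergence.
Context {R : realType}.
Local Notation leb := (@lebesgue_measure R).
Implicit Types (f g h : R -> R) (u v w : L2 R).

Lemma cvg_normP (V : normedModType R) (T : Type) (F : set_system T) {FF : Filter F}
  (a : T -> V) (l : V) : (a @ F --> l) <-> (`|a t - l| @[t --> F] --> (0 : R)).
Proof.
split=> [al|/cvgrPdist_lt al].
  by apply/norm_cvg0P; rewrite -[X in _ --> X](subrr l); apply: cvgB => //; exact: cvg_cst.
apply/cvgrPdist_lt => e e0; apply: filterS (al _ e0) => t.
by rewrite sub0r normrN normr_id distrC.
Qed.

Lemma cvg_norm_le (V : normedModType R) (T : Type) (F : set_system T) {FF : Filter F}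
  (a : T -> V) (l : V) (b : T -> R) : (\forall t \near F, `|a t - l| <= b t) ->
  b @ F --> (0 : R) -> a @ F --> l.
Proof.
move=> ab b0; apply/cvg_normP; apply: (squeeze_cvgr _ (cvg_cst 0) b0).
by apply: filterS ab => t ->; rewrite normr_ge0.
Qed.

Lemma limn_esup_le (a : nat -> \bar R) (C : \bar R) : (forall n, a n <= C)%E ->
  (limn_esup a <= C)%E.
Proof.
move=> aC; apply: le_trans (_ : ereal_sup (a @` setT) <= _)%E.
  by apply: ereal_inf_lbound; exists setT => //; exact: filterT.
by apply: ge_ereal_sup => _ [n _ <-].
Qed.

(** Fatou's lemma for the squares. It shows that a pointwise limit is square integrable when no
    dominating function is known: for completeness, and later for qhat u(t). *)
Lemma L2_fatou (a : nat -> L2 R) f (C : R) : 0 <= C -> measurable_fun setT f ->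
  (forall n, `|a n| <= C) ->
  {ae leb, forall x, (a n x : R) @[n --> \oo] --> f x} ->
  inL2 f /\ `|toL2 f| <= C.
Proof.
move=> C0 mf aC af.
have fC : (\int[leb]_x (f x ^+ 2)%:E <= (C ^+ 2)%:E)%E.
  apply: (@le_trans _ _ (\int[leb]_x limn_einf (fun n => (a n x ^+ 2)%:E))%E).
    apply: ae_ge0_le_integral => //.
    - by move=> x _; rewrite lee_fin sqr_ge0.
    - exact: measurable_sqr.
    - move=> x _; rewrite /limn_einf -[leLHS]oppe0 leeN2.
      apply: limn_esup_le => n.
      by rewrite -EFinN lee_fin oppr_le0 sqr_ge0.
    - apply: measurableT_comp => //; apply: measurable_fun_limn_esup => n.
      by apply: measurableT_comp => //; exact: measurable_sqr.
    apply: filterS af => x af _.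
    have : (a n x ^+ 2)%:E @[n --> \oo] --> (f x ^+ 2)%:E.
      by apply: cvg_EFin; [exact: nearW|rewrite expr2; under eq_fun do rewrite /= expr2; exact: cvgM].
    by move/cvg_limn_einf_sup => [-> _].
  apply: le_trans.
    apply: fatou => // [n|n x _]; first exact: measurable_sqr.
    by rewrite lee_fin sqr_ge0.
  apply: le_trans (limn_einf_sup _) _.
  apply: limn_esup_le => n.
  by rewrite -normL2_sq lee_fin ler_sqr ?nnegrE.
have fL : inL2 f by apply/inL2P; split => //; rewrite (le_lt_trans fC)// ltry.
split => //; rewrite -ler_sqr ?nnegrE// -lee_fin normL2_sq.
apply: le_trans fC; rewrite le_eqVlt; apply/orP; left; apply/eqP.
apply: ae_eq_integral => //; [exact: measurable_sqr|exact: measurable_sqr|].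
by apply: filterS (toL2_ae fL) => x -> _.
Qed.

Lemma integral_lty_ae (F : R -> \bar R) : measurable_fun setT F ->
  (forall x, 0 <= F x)%E -> (\int[leb]_x F x < +oo)%E ->
  {ae leb, forall x, F x \is a fin_num}.
Proof.
move=> mF F0 Foo.
have : leb.-integrable setT F.
  apply/integrableP; split => //.
  by under eq_integral do rewrite gee0_abs//.
by move/integrable_ae => /(_ measurableT); apply: filterS => x; apply.
Qed.

(** The heart of the Riesz-Fischer theorem. Since 4^k 64^-k = 16^-k is summable, the sum over k of
    4^k |u (k+1) - u k|^2 is integrable, hence finite almost everywhere; there the increments are
    O(2^-k) and the sequence converges pointwise. Fatou's lemma turns this into convergence in
    norm. *)
Lemma L2_cvg_fast (u : nat -> L2 R) :
  (forall k, `|u k.+1 - u k| <= 8^-1 ^+ k) -> exists l : L2 R, u n @[n --> \oo] --> l.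
Proof.
move=> uk; pose d (k : nat) (x : R) : R := u k.+1 x - u k x.
pose G (k : nat) (x : R) := (4 ^+ k * d k x ^+ 2)%:E.
have md k : measurable_fun setT (d k) by exact: (measurable_funB (measurable_L2 _) (measurable_L2 _)).
have mG k : measurable_fun setT (G k).
  by apply/measurable_EFinP; apply: measurable_funM => //; exact: measurable_funX.
have G0 k x : (0 <= G k x)%E by rewrite lee_fin mulr_ge0// ?sqr_ge0// exprn_ge0.
(* 2 / 2^(k+1) is 2^-k, in the form in which the geometric series is summed below. *)
have iG k : (\int[leb]_x G k x <= (2 / (2 ^ (k + 1))%:R)%:E)%E.
  have -> : (\int[leb]_x G k x = (4 ^+ k * `|u k.+1 - u k| ^+ 2)%:E)%E.
    rewrite EFinM normL2_sq -ge0_integralZl//; last 2 first.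
    - exact: measurable_sqr.
    - by move=> x _; rewrite lee_fin sqr_ge0.
    apply: ae_eq_integral => //.
    - exact: mG.
    - apply/measurable_EFinP; apply: measurable_funM => //.
      exact: (measurable_funX 2 (measurable_L2 _)).
    by apply: filterS (L2B_ae (u k.+1) (u k)) => x -> _.
  rewrite lee_fin.
  apply: (@le_trans _ _ (4 ^+ k * (8^-1 ^+ k) ^+ 2)).
    by rewrite ler_wpM2l ?exprn_ge0// ler_sqr ?nnegrE ?exprn_ge0// invr_ge0.
  have -> : 2 / (2 ^ (k + 1))%:R = 2^-1 ^+ k :> R.
    by rewrite addn1 expnS natrM invfM mulrA divff// mul1r natrX exprVn.
  by rewrite exprAC -exprMn lerXn2r ?nnegrE//; lra.
pose S x := (\sum_(0 <= k <oo) G k x)%E.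
have mS : measurable_fun setT S by apply: ge0_emeasurable_sum.
have Sae : {ae leb, forall x, S x \is a fin_num}.
  apply: integral_lty_ae => // [x|]; first exact: nneseries_ge0.
  rewrite integral_nneseries//.
  apply: (@le_lt_trans _ _ (\sum_(0 <= k <oo) (2 / (2 ^ (k + 1))%:R)%:E)%E).
    by apply: lee_nneseries => // n _ _; exact: integral_ge0.
  have := @cvg_geometric_eseries_half R 2 0; move/cvg_lim => ->//.
  by rewrite expr0 ltry.
have cu : {ae leb, forall x, cvgn (fun k => u k x : R)}.
  apply: filterS Sae => x Sx.
  have [s s0 sS] : exists2 s, 0 <= s & S x = (s ^+ 2)%:E.
    exists (Num.sqrt (fine (S x))) => //.
    by rewrite sqr_sqrtr ?fineK// fine_ge0// nneseries_ge0.
  have dx k : `|d k x| <= s * 2^-1 ^+ k.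
    have : (G k x <= S x)%E.
      have := @nneseries_lim_ge R (G^~ x) xpredT 0 k.+1 (fun n _ _ => G0 n x).
      apply: le_trans; rewrite big_nat_recr//= leeDr//.
      by apply: sume_ge0.
    rewrite sS lee_fin => H.
    have : (2 ^+ k * `|d k x|) ^+ 2 <= s ^+ 2.
      apply: le_trans H; rewrite exprMn real_normK ?num_real// -exprM mulnC exprM.
      by rewrite (_ : 2 ^+ 2 = 4 :> R)// expr2 -natrM.
    rewrite ler_sqr ?nnegrE// ?mulr_ge0// ?exprn_ge0// => H2.
    rewrite -(@ler_pM2l _ (2 ^+ k)) ?exprn_gt0//.
    by rewrite mulrCA -exprMn divff ?pnatr_eq0// expr1n mulr1.
  rewrite (_ : (fun k => u k x : R) = (fun k => u 0%N x + series (d^~ x) k)); last first.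
    by apply/funext => k; rewrite -[RHS](eq_sum_telescope (fun k => u k x : R)).
  apply: is_cvgD; first exact: is_cvg_cst.
  apply: normed_cvg; apply: (@series_le_cvg _ _ (geometric s 2^-1)) => //.
  - by move=> n; rewrite /=.
  - by move=> n; rewrite /geometric/= mulr_ge0// exprn_ge0.
  - by apply: is_cvg_geometric_series; rewrite ger0_norm; lra.
(* An upper limit is measurable and defined everywhere; it is the limit wherever there is one. *)
pose f (x : R) : R := fine (limn_esup (fun k => (u k x)%:E)).
have mf : measurable_fun setT f.
  apply: measurableT_comp; first exact: fine_measurable.
  by apply: measurable_fun_limn_esup => n; apply/measurable_EFinP; exact: (measurable_L2 (u n)).
have uf : {ae leb, forall x, (u k x : R) @[k --> \oo] --> f x}.
  apply: filterS cu => x /cvg_ex[l ul].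
  suff -> : f x = l by [].
  rewrite /f; have /cvg_limn_einf_sup[_ ->]// : (u k x : R)%:E @[k --> \oo] --> l%:E.
  by apply: cvg_EFin => //; exact: nearW.
have dist k m : `|u (m + k)%N - u k| <= 2 * 8^-1 ^+ k.
  (* The factor 1 - 8^-m makes the induction on m go through. *)
  suff : `|u (m + k)%N - u k| <= 2 * 8^-1 ^+ k * (1 - 8^-1 ^+ m).
    move=> /le_trans; apply; rewrite ler_piMr ?mulr_ge0 ?exprn_ge0 ?invr_ge0//.
  elim: m => [|m IH]; first by rewrite add0n subrr normr0 expr0 subrr mulr0.
  rewrite -(subrK (u (m + k)%N) (u (m.+1 + k)%N)) -addrA.
  apply: le_trans (ler_normD _ _) _; apply: le_trans (lerD (uk _) IH) _.
  rewrite exprD exprS; have : 0 <= 8^-1 ^+ m * 8^-1 ^+ k :> R by rewrite mulr_ge0// exprn_ge0// invr_ge0.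
  nra.
have main k : inL2 (fun x => f x - u k x) /\ `|toL2 (fun x => f x - u k x)| <= 2 * 8^-1 ^+ k.
  apply: (@L2_fatou (fun m => u (m + k)%N - u k)).
  - by rewrite mulr_ge0// exprn_ge0// invr_ge0.
  - exact: (measurable_funB mf (measurable_L2 _)).
  - by move=> m; exact: dist.
  have B : {ae leb, forall x, forall m, (u (m + k)%N - u k) x = u (m + k)%N x - u k x}.
    by apply: ae_foralln => m; exact: L2B_ae.
  apply: filterS2 uf B => x ux Bx.
  under eq_fun do rewrite Bx.
  apply: cvgB; last exact: cvg_cst.
  by rewrite (cvg_shiftn k (fun n => u n x : R)).
have fL : inL2 f.
  have := inL2D (main 0%N).1 (inL2_L2 (u 0%N)).
  by congr inL2; apply/funext => x /=; rewrite subrK.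
exists (toL2 f); apply: (@cvg_norm_le _ _ _ _ _ _ (geometric 2 8^-1)).
  near=> k; rewrite distrC -(toL2_id (u k)) -toL2B//.
  by have [_] := main k.
by apply: cvg_geometric; rewrite ger0_norm; lra.
Unshelve. all: by end_near. Qed.

End L2_convergence.

(** * Completeness of L2 and dominated convergence *)

Section L2_limits.
Context {R : realType}.
Local Notation leb := (@lebesgue_measure R).
Implicit Types (f g h : R -> R) (u v w : L2 R).

Lemma L2_complete (u : nat -> L2 R) :
  (forall e, 0 < e -> exists N, forall m n, (N <= m)%N -> (N <= n)%N ->
    `|u m - u n| <= e) ->
  exists l : L2 R, u n @[n --> \oo] --> l.
Proof.
move=> cu.
have /choice[N NP] : forall k : nat, exists N, forall m n, (N <= m)%N -> (N <= n)%N ->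
    `|u m - u n| <= 8^-1 ^+ k by move=> k; apply: cu; rewrite exprn_gt0.
(* Summing the thresholds gives a nondecreasing sequence of indices that stays above [N]. *)
pose phi k := (\sum_(i < k.+1) N i)%N.
have Nphi k : (N k <= phi k)%N by rewrite /phi big_ord_recr/= leq_addl.
have phiS k : (phi k <= phi k.+1)%N by rewrite /phi [leqRHS]big_ord_recr/= leq_addr.
have [l ul] : exists l : L2 R, u (phi n) @[n --> \oo] --> l.
  apply: L2_cvg_fast => k; apply: NP => //.
  exact: leq_trans (Nphi k) (phiS k).
exists l; apply/cvgrPdist_le => e e0.
have e20 : 0 < e / 2 by rewrite divr_gt0.
have [M MP] := cu _ e20.
move/cvgrPdist_le: ul => /(_ _ e20)[K _ KP].
near=> n.
have : exists2 j, (K <= j)%N & `|u (phi j) - u n| <= e / 2.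
  have [j Kj] : exists2 j, (K <= j)%N & 8^-1 ^+ j <= e / 2.
    have : 8^-1 ^+ j @[j --> \oo] --> (0 : R) by apply: cvg_expr; rewrite ger0_norm; lra.
    move/cvgrPdist_le => /(_ _ e20)[J _ JP]; exists (maxn K J); first exact: leq_maxl.
    by have := JP (maxn K J) (leq_maxr _ _); rewrite sub0r normrN ger0_norm// exprn_ge0.
  move=> je; exists j => //.
  have [Mphi|/ltnW phiM] := leqP M (phi j).
    by apply: MP => //; near: n; exact: nbhs_infty_ge.
  apply: le_trans je; apply: NP => //.
  by apply: (leq_trans (leq_trans (Nphi j) phiM)); near: n; exact: nbhs_infty_ge.
move=> [j Kj je].
rewrite (le_trans (ler_distD (u (phi j)) _ _))// [leRHS](splitr e) lerD//.
exact: KP.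
Unshelve. all: by end_near. Qed.

(** Limits along a real parameter are reduced to sequences, for which dominated convergence is
    stated. *)
Lemma cvg_within_seq (V : normedModType R) (A : set R) (F : R -> V) (p : R) (l : V) :
  (forall s : nat -> R, (forall n, A (s n)) -> s n @[n --> \oo] --> p ->
    F (s n) @[n --> \oo] --> l) -> F x @[x --> within A (nbhs p)] --> l.
Proof.
move=> H; apply/cvgrPdist_le => e e0.
apply: contrapT => nF.
have /choice[s sP] : forall n : nat, exists y : R,
    [/\ A y, `|p - y| < n.+1%:R^-1 & ~ (`|l - F y| <= e)].
  move=> n; apply: contrapT => nex; apply: nF.
  have n0 : 0 < n.+1%:R^-1 :> R by rewrite invr_gt0.
  change (\forall y \near p, A y -> `|l - F y| <= e).
  have : \forall y \near p, `|p - y| < n.+1%:R^-1 by exact: (nbhsx_ballx p _ n0).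
  apply: filterS => y py Ay.
  by apply: contrapT => ny; apply: nex; exists y.
have sA n : A (s n) by case: (sP n).
have sp : s n @[n --> \oo] --> p.
  apply: (@cvg_norm_le _ _ _ _ _ _ _ (fun n => n.+1%:R^-1)).
    by near=> n; rewrite distrC ltW//; case: (sP n).
  exact: cvg_harmonic.
have /cvgrPdist_le/(_ _ e0)[N _ /(_ N (leqnn N))] := H s sA sp.
by have [_ _] := sP N.
Unshelve. all: by end_near. Qed.

Lemma cvg_sqr0 (a : nat -> R) : (a n ^+ 2)%:E @[n --> \oo] --> (0 : \bar R) ->
  `|a n| @[n --> \oo] --> 0.
Proof.
move=> /fine_cvgP[_ a2].
rewrite (_ : (fun n => `|a n|) = fun n => Num.sqrt (a n ^+ 2)); last first.
  by apply/funext => n; rewrite sqrtr_sqr.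
rewrite -[X in _ --> X]sqrtr0.
by apply: cvg_comp a2 _; exact: sqrt_continuous.
Qed.

(** The squares of a n - f are dominated by 4 g^2, since the limit f inherits the bound by g. *)
Lemma L2_dct (a : nat -> R -> R) f g : (forall n, measurable_fun setT (a n)) ->
  measurable_fun setT f -> inL2 g ->
  {ae leb, forall x, forall n, `|a n x| <= `|g x|} ->
  {ae leb, forall x, a n x @[n --> \oo] --> f x} ->
  [/\ forall n, inL2 (a n), inL2 f & toL2 (a n) @[n --> \oo] --> toL2 f].
Proof.
move=> ma mf gL ag af.
have aL n : inL2 (a n).
  by apply: (inL2_le (ma n) gL); apply: filterS ag => x /(_ n).
have fg : {ae leb, forall x, `|f x| <= `|g x|}.
  apply: filterS2 ag af => x agx afx.
  have naf : `|a n x| @[n --> \oo] --> `|f x| by exact: cvg_norm.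
  by apply: (cvgr_to_le naf); exact: nearW.
have fL : inL2 f by exact: inL2_le fg.
split => //; apply/cvg_normP.
have mg := inL2_measurable gL.
pose F n x := ((a n x - f x) ^+ 2)%:E.
have mF n : measurable_fun setT (F n) by apply: measurable_sqr; exact: measurable_funB.
have F0 : {ae leb, forall x, setT x -> F n x @[n --> \oo] --> 0%E}.
  apply: filterS af => x afx _; rewrite /F.
  apply: cvg_EFin; first exact: nearW.
  rewrite -[X in _ --> X](mulr0 (f x - f x)) -[X in _ * X](subrr (f x)).
  under eq_fun do rewrite /= expr2.
  by apply: cvgM; apply: cvgB => //; exact: cvg_cst.
have ig : leb.-integrable setT (fun x => (4 * g x ^+ 2)%:E).
  have := Lfun2_integrable_sqr gL.
  by move=> /(integrableZl measurableT 4); apply: eq_integrable.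
have Fg : {ae leb, forall x, forall n, setT x -> (`|F n x| <= (4 * g x ^+ 2)%:E)%E}.
  apply: filterS2 ag fg => x agx fgx n _; rewrite /F.
  rewrite abse_EFin lee_fin ger0_norm ?sqr_ge0//.
  rewrite (_ : 4 * g x ^+ 2 = (`|g x| + `|g x|) ^+ 2); last first.
    by rewrite -[in LHS](real_normK (num_real _)); ring.
  rewrite -(real_normK (num_real (a n x - f x))) ler_sqr ?nnegrE ?addr_ge0//.
  by rewrite (le_trans (ler_normB _ _))// lerD.
have m0 : measurable_fun setT (fun _ : R => 0%E : \bar R) by exact: measurable_cst.
have [_ + _] := @dominated_convergence _ (measurableTypeR R) R leb setT measurableT F (cst 0%E) _ mF m0 F0 ig Fg.
under eq_fun do under eq_integral do rewrite sube0 gee0_abs ?lee_fin ?sqr_ge0//.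
move=> Fcvg.
suff : `| `|toL2 (a n) - toL2 f| | @[n --> \oo] --> (0 : R).
  by under eq_fun do rewrite normr_id.
apply: cvg_sqr0.
move: Fcvg; apply: cvg_trans; apply: near_eq_cvg; near=> n.
rewrite normL2_sq; apply: ae_eq_integral => //; [exact: mF|exact: measurable_sqr|].
rewrite -toL2B//.
by apply: filterS (toL2_ae (inL2B (aL n) fL)) => x -> _.
Unshelve. all: by end_near. Qed.

Definition ae_bdd u (B : R) := {ae leb, forall x, `|u x| <= B}.

(** The excess of |u| over B is at most |u - a n| almost everywhere, for every n, so its norm is 0.
    This avoids extracting a subsequence that converges almost everywhere. *)
Lemma ae_bdd_lim (a : nat -> L2 R) u (B : R) : (forall n, ae_bdd (a n) B) ->
  a n @[n --> \oo] --> u -> ae_bdd u B.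
Proof.
move=> aB au.
pose v (x : R) : R := Num.max (`|u x| - B) 0.
have mv : measurable_fun setT v.
  apply: measurable_maxr => //; apply: measurable_funB => //.
  by apply: measurableT_comp => //; exact: measurable_L2.
have vle n : {ae leb, forall x, `|v x| <= 1 * `|(u - a n) x|}.
  apply: filterS2 (L2B_ae u (a n)) (aB n) => x -> aBx.
  rewrite mul1r ger0_norm /v; last by rewrite le_max lexx orbT.
  rewrite ge_max normr_ge0 andbT lerBlDr -(subrK (a n x) (u x)).
  by rewrite (le_trans (ler_normD _ _))// addrNK lerD2l.
have vL : inL2 v by have [] := norm_toL2 mv ler01 (vle 0%N).
have v0 : toL2 v = 0.
  apply/eqP; rewrite -normr_le0.
  have : `|u - a n| @[n --> \oo] --> (0 : R).
    by move/cvg_normP: au; under eq_fun do rewrite distrC.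
  move=> H; apply: (cvgr_to_ge H); apply: nearW => n.
  by have [_] := norm_toL2 mv ler01 (vle n); rewrite mul1r.
have := toL2_ae vL; rewrite v0; apply: filterS2 L20_ae => x -> /esym /eqP.
by rewrite /v eq_le ge_max => /andP[/andP[]]; rewrite subr_le0.
Qed.

End L2_limits.

(** * Smooth functions and a flat exponential *)

Section test_functions.
Context {R : realType}.
Local Notation leb := (@lebesgue_measure R).
Implicit Types (f g h : R -> R) (u v w : L2 R).

(** [test_function] is stated with iterated derivatives; this recursive form, which asks nothing at
    order 0, lets sums, products and affine changes of variable be handled by induction on k. *)
Fixpoint Ck (k : nat) f : Prop :=
  if k is k'.+1 then (forall x, derivable f x 1) /\ Ck k' (derive1 f) else True.

Lemma is_derive_derive1 f (x a : R) : is_derive x 1 f a -> derive1 f x = a.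
Proof. by move=> fa; rewrite derive1E derive_val. Qed.

Lemma derivable_is_derive f (x : R) : derivable f x 1 -> is_derive x 1 f (derive1 f x).
Proof. by move/derivableP; rewrite derive1E. Qed.

Lemma CkS k f : Ck k.+1 f -> Ck k f.
Proof. by elim: k f => [//|k IH f [df dk]]; split => //; exact: IH. Qed.

Lemma Ck_smoothP f : (forall k, Ck k f) <-> (forall k x, derivable (derive1n k f) x 1).
Proof.
split=> [fC k|].
  elim: k f fC => [f fC|k IH f fC]; first by have [] := fC 1%N.
  by rewrite derive1Sn; apply: IH => j; have [] := fC j.+1.
move=> H k; elim: k f H => [//|k IH f H]; split; first exact: (H 0%N).
by apply: IH => j x; have := H j.+1 x; rewrite derive1Sn.
Qed.

Lemma Ck_derive k f (f' : R -> R) : (forall x : R, is_derive x 1 f (f' x)) -> Ck k f' -> Ck k.+1 f.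
Proof.
move=> ff' Cf'; split; first by move=> x; have [] := ff' x.
by rewrite (_ : derive1 f = f')//; apply/funext => x; exact: is_derive_derive1.
Qed.

Lemma CkD k f g : Ck k f -> Ck k g -> Ck k (fun x => f x + g x).
Proof.
elim: k f g => [//|k IH f g [df Cf] [dg Cg]].
apply: (@Ck_derive _ _ (fun x => derive1 f x + derive1 g x)); last exact: IH.
by move=> x; apply: is_deriveD; exact: derivable_is_derive.
Qed.

Lemma CkZ k (a : R) f : Ck k f -> Ck k (fun x => a * f x).
Proof.
elim: k f => [//|k IH f [df Cf]].
apply: (@Ck_derive _ _ (fun x => a * derive1 f x)); last exact: IH.
by move=> x; apply: is_deriveZ; exact: derivable_is_derive.
Qed.

Lemma CkM k f g : Ck k f -> Ck k g -> Ck k (fun x => f x * g x).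
Proof.
elim: k f g => [//|k IH f g Cf Cg]; have [df Cf'] := Cf; have [dg Cg'] := Cg.
apply: (@Ck_derive _ _ (fun x => f x * derive1 g x + g x * derive1 f x)).
  by move=> x; apply: is_deriveM; exact: derivable_is_derive.
by apply: CkD; apply: IH => //; exact: CkS.
Qed.

Lemma Ck_affine k f (a b : R) : Ck k f -> Ck k (fun x => f (a + b * x)).
Proof.
elim: k f => [//|k IH f [df Cf]].
apply: (@Ck_derive _ _ (fun x => b * derive1 f (a + b * x))); last exact/CkZ/IH.
move=> x; rewrite mulrC.
apply: (@is_derive1_comp _ f (fun x => a + b * x)); first exact: derivable_is_derive.
rewrite -[b in is_derive _ _ _ b]add0r -[in X in is_derive _ _ _ (_ + X)](mulr1 b).
apply: is_deriveD; apply: is_deriveZ.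
Qed.

(* x ^- p * exp (- c / x) on the half line x > 0; with all powers p this family
   is stable under differentiation *)
Definition flat (c : R) (p : nat) (x : R) : R :=
  if 0 < x then x ^- p * expR (- c / x) else 0.

(** exp (c / x) is at least the term of order p + 2 of its series. The resulting O(x^2) bound makes
    the function differentiable at 0, with derivative 0. *)
Lemma flat_le (c : R) p x : 0 < c ->
  `|flat c p x| <= (p.+2)`!%:R / c ^+ p.+2 * x ^+ 2.
Proof.
move=> c0; rewrite /flat; case: ifPn => [x0|_]; last first.
  rewrite normr0 mulr_ge0 ?sqr_ge0//.
  by rewrite mulr_ge0// invr_ge0 exprn_ge0// ltW.
rewrite ger0_norm; last by rewrite mulr_ge0 ?expR_ge0// invr_ge0 exprn_ge0 ?ltW.
have H := @expR_ge1Dxn R (c / x) p.+1 (ltW (divr_gt0 c0 x0)).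
have {}H : (c / x) ^+ p.+2 / (p.+2)`!%:R <= expR (c / x).
  by apply: le_trans H; rewrite lerDr.
rewrite mulNr expRN.
have F0 : 0 < (p.+2)`!%:R :> R by rewrite ltr0n fact_gt0.
rewrite ler_pdivrMr ?expR_gt0//.
have -> : x ^- p = (p.+2)`!%:R / c ^+ p.+2 * x ^+ 2 * ((c / x) ^+ p.+2 / (p.+2)`!%:R).
  rewrite expr_div_n !exprS; field.
  by rewrite !gt_eqF// ?exprn_gt0//.
rewrite ler_pM2l// !mulr_gt0// ?invr_gt0 ?exprn_gt0//.
Qed.

Lemma flat_derive (c : R) p (x : R) : 0 < c ->
  is_derive x 1 (flat c p) (- p%:R * flat c p.+1 x + c * flat c p.+2 x).
Proof.
move=> c0; have [x0|x0|->] := ltgtP x 0.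
- rewrite /flat ltNge (ltW x0)/= !mulr0 addr0.
  apply: (@near_eq_is_derive _ _ _ (cst 0)).
    by near=> y; rewrite ltNge ltW//=; near: y; exact: lt_nbhsl.
- rewrite /flat x0.
  apply: (@near_eq_is_derive _ _ _ (fun x : R => x ^- p * expR (- c / x))).
    by near=> y; rewrite ifT//; near: y; exact: lt_nbhsr.
  have x0' : x != 0 by rewrite gt_eqF.
  have dinv : is_derive x 1 (fun y : R => y^-1) (- x ^- 2).
    have := @is_deriveV R (fun y : R => y) x 1 1 x0' (is_derive_id x 1).
    by rewrite /GRing.scale/= mulr1.
  have d1 : is_derive x 1 (fun y : R => y ^- p) (- p%:R * x ^- p.+1).
    have := @is_deriveX _ _ (fun y : R => y^-1) p x 1 _ dinv.
    rewrite (_ : (fun y : R => y^-1) ^+ p = (fun y => y ^- p)); last first.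
      by apply/funext => y; rewrite fctE exprVn.
    congr is_derive; rewrite /GRing.scale/=.
    case: (p) => [|q]; first by rewrite mulr0n oppr0 !mul0r.
    by rewrite /= exprVn !exprS; field; rewrite x0' expf_neq0.
  have d2 : is_derive x 1 (fun y : R => expR (- c / y)) (expR (- c / x) * (- c * - x ^- 2)).
    exact: (@is_derive1_comp _ expR (fun y => - c / y)).
  have := is_deriveM d1 d2; congr is_derive; rewrite /GRing.scale/=.
  by rewrite -!exprVn !exprS; ring.
rewrite {2 3}/flat ltxx !mulr0 addr0.
set C := (p.+2)`!%:R / c ^+ p.+2.
have lim0 : h^-1 *: ((flat c p \o shift 0) (h *: 1) - flat c p 0) @[h --> 0^'] --> (0 : R).
  apply: (@cvg_norm_le _ _ _ _ _ _ _ (fun h : R => C * `|h|)).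
    near=> h; rewrite subr0 /= addr0 [flat c p 0]/flat ltxx subr0 /GRing.scale/= mulr1.
    have h0 : 0 < `|h| by rewrite normr_gt0; near: h; exact: nbhs_dnbhs_neq.
    rewrite normrM normfV mulrC ler_pdivrMr// -mulrA -expr2 real_normK ?num_real//.
    exact: flat_le.
  rewrite -[X in _ --> X](mulr0 C); apply: cvgMl_tmp.
  rewrite -[X in _ --> X](@normr0 _ R); apply: cvg_norm.
  exact: nbhs_dnbhs.
split; first by apply/cvg_ex; exists 0.
exact: cvg_lim lim0.
Unshelve. all: by end_near. Qed.

Lemma flat_Ck (c : R) p k : 0 < c -> Ck k (flat c p).
Proof.
move=> c0; elim: k p => [//|k IH p].
apply: Ck_derive; first by move=> x; exact: flat_derive.
by apply: CkD; apply: CkZ.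
Qed.

End test_functions.

(** * Density of test functions *)

Section density.
Context {R : realType}.
Local Notation leb := (@lebesgue_measure R).
Implicit Types (f g h phi : R -> R) (u v w : L2 R).

Lemma test_functionP phi : test_function phi <->
  (forall k, Ck k phi) /\ exists M : R, forall x, M < `|x| -> phi x = 0.
Proof. by split=> -[H K]; split => //; exact/Ck_smoothP. Qed.

Lemma test_derivable phi x : test_function phi -> derivable phi x 1.
Proof. by case=> /(_ 0%N). Qed.

Lemma test_function_derive1 phi : test_function phi -> test_function (derive1 phi).
Proof.
move=> [sphi [M Mphi]]; split; first by move=> k x; rewrite -derive1Sn.
exists M => x Mx; apply: is_derive_derive1.
apply: (@near_eq_is_derive _ _ _ (cst 0)).
near=> y; rewrite Mphi//; near: y.
have : (fun y : R => `|y|) @ x --> `|x| by exact: cvg_norm.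
by move/cvgr_gt; apply.
Unshelve. all: by end_near. Qed.

Lemma test_continuous phi : test_function phi -> continuous phi.
Proof.
by move=> tphi x; apply: differentiable_continuous; exact/derivable1_diffP/test_derivable.
Qed.

Lemma test_bounded phi : test_function phi ->
  exists K M : R, [/\ 0 <= K, 0 <= M & forall x, `|phi x| <= K * \1_(`[- M, M]%classic) x].
Proof.
move=> tphi; have [_ [M0 M0phi]] := tphi; pose M := Num.max M0 0.
have M_ge0 : 0 <= M by rewrite le_max lexx orbT.
have Mphi x : M < `|x| -> phi x = 0.
  by move=> Mx; apply: M0phi; rewrite (le_lt_trans _ Mx)// le_max lexx.
have := @EVT_max R (fun x => `|phi x|) (- M) M.
case; first by rewrite ge0_cp.
  apply: continuous_subspaceT => x.
  by apply: cvg_norm; exact: test_continuous.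
move=> c _ cM; exists `|phi c|, M; split => // x; rewrite indicE.
have [xM|xM] := leP `|x| M.
  have xin : x \in `[- M, M] by rewrite in_itv/= -ler_norml.
  by rewrite mem_set//= mulr1 cM.
by rewrite Mphi// normr0 mulr_ge0.
Qed.

Lemma inL2_indic (A : set R) : measurable A -> (leb A < +oo)%E -> inL2 (\1_A : R -> R).
Proof.
move=> mA Aoo; apply/inL2P; split; first exact: measurable_indic.
rewrite (_ : (fun x => _) = (fun x => (\1_A x)%:E)); last first.
  by apply/funext => x; rewrite indicE; case: (_ \in _); rewrite ?expr1n ?expr0n.
by rewrite integral_indic// setIT.
Qed.

Lemma inL2_itv (a b : R) : inL2 (\1_(`[a, b]%classic) : R -> R).
Proof.
apply: inL2_indic; first exact: measurable_itv.
by rewrite lebesgue_measure_itv/=; case: ifP => // _; rewrite -EFinB ltry.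
Qed.

Lemma inL2_bdd_supp f (K a b : R) : measurable_fun setT f ->
  (forall x, `|f x| <= K * \1_(`[a, b]%classic) x) -> inL2 f.
Proof.
move=> mf fK; apply: (inL2_le mf (inL2Z K (inL2_itv a b))).
by apply: aeW => x; rewrite (le_trans (fK x))// ler_norm.
Qed.

Lemma test_inL2 phi : test_function phi -> inL2 phi.
Proof.
move=> tphi; have [K [M [_ _]]] := test_bounded tphi.
apply: inL2_bdd_supp; apply: continuous_measurable_fun; exact: test_continuous.
Qed.

(** As c tends to 0 these test functions tend to the indicator of ]a, b[, which starts the density
    argument. *)
Definition bump (a b c x : R) : R := flat c 0 (x - a) * flat c 0 (b - x).

Lemma bump_test a b c : 0 < c -> test_function (bump a b c).
Proof.
move=> c0; apply/test_functionP; split.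
  move=> k; apply: CkM.
    have := @Ck_affine _ k _ (- a) 1 (flat_Ck 0 k c0).
    by congr Ck; apply/funext => x; rewrite mul1r addrC.
  have := @Ck_affine _ k _ b (- 1) (flat_Ck 0 k c0).
  by congr Ck; apply/funext => x; rewrite mulN1r.
exists (`|a| + `|b|) => x abx; rewrite /bump /flat !subr_gt0.
case: ifPn => [ax|]; last by rewrite mul0r.
case: ifPn => [xb|]; last by rewrite mulr0.
move: abx; rewrite ltNge => /negP; case.
have [x0|x0] := leP 0 x.
  by rewrite ger0_norm// (le_trans (ltW xb))// (le_trans (ler_norm b))// lerDr.
rewrite ltr0_norm// (@le_trans _ _ (- a)) ?lerN2 ?(ltW ax)//.
by rewrite (@le_trans _ _ `|a|)// ?lerDl// -normrN ler_norm.
Qed.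

Lemma bump_le (a b c x : R) : 0 < c -> `|bump a b c x| <= 1 * \1_(`[a, b]%classic) x.
Proof.
move=> c0; rewrite mul1r indicE /bump /flat !subr_gt0 !expr0 !invr1 !mul1r.
case: ifPn => [ax|_]; last by rewrite mul0r normr0 ler0n.
case: ifPn => [xb|_]; last by rewrite mulr0 normr0 ler0n.
rewrite mem_set/=; last by rewrite in_itv/= !ltW.
rewrite normrM -[leRHS]mulr1 ler_pM// ger0_norm ?expR_ge0// -expR0 ler_expR mulNr
  oppr_le0 divr_ge0 ?subr_ge0 ?ltW//.
Qed.

Lemma bump_cvg (a b x : R) :
  bump a b n.+1%:R^-1 x @[n --> \oo] --> (\1_(`]a, b[%classic) x : R).
Proof.
have key (y : R) : 0 < y -> expR (- n.+1%:R^-1 / y) @[n --> \oo] --> (1 : R).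
  move=> y0; rewrite -[X in _ --> X]expR0; apply: continuous_cvg; first exact: continuous_expR.
  rewrite -(mul0r y^-1); apply: cvgMr_tmp; rewrite -oppr0; apply: cvgN; exact: cvg_harmonic.
rewrite indicE; have [xab|xab] := boolP (x \in `]a, b[%classic).
  move: xab; rewrite inE/= in_itv/= => /andP[ax xb].
  under eq_fun do rewrite /bump /flat !subr_gt0 ax xb !expr0 !invr1 !mul1r.
  have xa0 : 0 < x - a by rewrite subr_gt0.
  have bx0 : 0 < b - x by rewrite subr_gt0.
  have := cvgM (key _ xa0) (key _ bx0).
  by rewrite mulr1; apply.
rewrite (_ : (fun n => _) = cst 0); first exact: cvg_cst.
apply/funext => n; rewrite /bump /flat !subr_gt0.
case: ifPn => [ax|]; last by rewrite mul0r.
case: ifPn => [xb|]; last by rewrite mulr0.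
by move: xab; rewrite notin_setE/= in_itv/= ax xb.
Qed.

Definition test_dense u := forall e, 0 < e ->
  exists2 phi, test_function phi & `|u - toL2 phi| <= e.

Lemma test_dense_lim (a : nat -> L2 R) u : (forall n, test_dense (a n)) ->
  a n @[n --> \oo] --> u -> test_dense u.
Proof.
move=> da au e e0; have e20 : 0 < e / 2 by rewrite divr_gt0.
move/cvgrPdist_le : au => /(_ _ e20)[N _ /(_ N (leqnn N)) uN].
have [phi tphi aphi] := da N _ e20; exists phi => //.
by rewrite (le_trans (ler_distD (a N) _ _))// [leRHS](splitr e) lerD.
Qed.

Lemma testD phi h : test_function phi -> test_function h -> test_function (phi \+ h).
Proof.
move=> /test_functionP[Cp [Mp Hp]] /test_functionP[Ch [Mh Hh]].
apply/test_functionP; split; first by move=> k; exact: CkD.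
by exists (Num.max Mp Mh) => x; rewrite gt_max => /andP[xp xh]; rewrite /= Hp// Hh// addr0.
Qed.

Lemma testZ (a : R) phi : test_function phi -> test_function (fun x => a * phi x).
Proof.
move=> /test_functionP[Cp [Mp Hp]].
apply/test_functionP; split; first by move=> k; exact: CkZ.
by exists Mp => x xp; rewrite Hp// mulr0.
Qed.

Lemma toL2Z (a : R) f : inL2 f -> toL2 (fun x => a * f x) = a *: toL2 f.
Proof.
move=> fL; apply: L2_eq.
by apply: filterS3 (L2Z_ae a (toL2 f)) (toL2_ae fL) (toL2_ae (inL2Z a fL)) => x -> -> ->.
Qed.

Definition dens f := inL2 f /\ test_dense (toL2 f).

Lemma densD f g : dens f -> dens g -> dens (f \+ g).
Proof.
move=> [fL fd] [gL gd]; split; first exact: inL2D.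
move=> e e0; have e20 : 0 < e / 2 by rewrite divr_gt0.
have [p tp fp] := fd _ e20; have [q tq gq] := gd _ e20.
exists (p \+ q); first exact: testD.
rewrite !toL2D//; [|exact: test_inL2|exact: test_inL2].
by rewrite opprD addrACA (le_trans (ler_normD _ _))// [leRHS](splitr e) lerD.
Qed.

Lemma densZ (a : R) f : dens f -> dens (fun x => a * f x).
Proof.
move=> [fL fd]; split; first exact: inL2Z.
move=> e e0; have a0 : 0 < `|a| + 1 by rewrite ltr_wpDl.
have [p tp fp] := fd _ (divr_gt0 e0 a0).
exists (fun x => a * p x); first exact: testZ.
rewrite !toL2Z//; last exact: test_inL2.
rewrite -scalerBr normrZ (le_trans (ler_wpM2l _ fp))// mulrCA ler_piMr ?ltW//.
by rewrite ltr_pdivrMr// mul1r ltrDl.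
Qed.

Lemma dens_sum (I : Type) (r : seq I) (F : I -> R -> R) : (forall i, dens (F i)) ->
  dens (fun x => \sum_(i <- r) F i x).
Proof.
move=> dF; elim: r => [|i r IH].
  have := bump_test 0 0 (@ltr01 R) => tb.
  have := densZ 0 (conj (test_inL2 tb) _); rewrite (_ : (fun x => 0 * _) = (fun x => \sum_(i <- [::]) F i x)).
    apply => e e0; exists (bump 0 0 1) => //; by rewrite subrr normr0 ltW.
  by apply/funext => x; rewrite big_nil mul0r.
have := densD (dF i) IH; congr dens.
by apply/funext => x; rewrite big_cons.
Qed.

Lemma dens_dct (a : nat -> R -> R) f g : (forall n, dens (a n)) ->
  measurable_fun setT f -> inL2 g ->
  {ae leb, forall x, forall n, `|a n x| <= `|g x|} ->
  {ae leb, forall x, a n x @[n --> \oo] --> f x} -> dens f.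
Proof.
move=> da mf gL ag af.
have [|_ fL afL] := @L2_dct _ a f g _ mf gL ag af.
  by move=> n; apply: inL2_measurable; case: (da n).
by split => //; apply: test_dense_lim afL => n; case: (da n).
Qed.

Lemma ae_neq (b : R) : {ae leb, forall x, x != b}.
Proof.
exists [set b]; split => //; first by rewrite lebesgue_measure_set1.
by move=> x /=; apply: contra_notP => /eqP.
Qed.

Lemma dens_itv (a b : R) : dens (\1_(`]a, b]%classic) : R -> R).
Proof.
apply: (@dens_dct (fun n => bump a b n.+1%:R^-1) _ (\1_(`[a, b]%classic))).
- move=> n; have tb := @bump_test a b n.+1%:R^-1 (ltac:(by rewrite invr_gt0)).
  split; first exact: test_inL2.
  by move=> e e0; exists (bump a b n.+1%:R^-1) => //; rewrite subrr normr0 ltW.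
- by apply: measurable_indic; exact: measurable_itv.
- exact: inL2_itv.
- apply: aeW => x n; rewrite (le_trans (bump_le _ _ _ _)) ?invr_gt0//.
  by rewrite mul1r ler_norm.
(* The indicators of ]a, b] and ]a, b[ differ only at b. *)
apply: filterS (ae_neq b) => x xb.
rewrite (_ : \1__ x = \1_(`]a, b[%classic) x); first exact: bump_cvg.
by rewrite !indicE !mem_setE !in_itv/= [x <= b]le_eqVlt (negbTE xb).
Qed.

Definition box (m : nat) : set R := `]- m%:R, m%:R]%classic.

Lemma measurable_box m : measurable (box m).
Proof. exact: measurable_itv. Qed.

(** Dynkin's theorem: the sets with this property contain the half-open intervals, which generate
    the Borel sets and are stable under intersection, and are closed under complements and disjoint
    unions. Cutting by [box m] keeps all measures finite. *)
Lemma dens_box (A : set R) : measurable A -> forall m, dens (\1_(A `&` box m) : R -> R).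
Proof.
have boxL m : inL2 (\1_(box m) : R -> R) by have [] := dens_itv (- m%:R) m%:R.
move=> mA; apply: (@dynkin_induction _ (measurableTypeR R) (@ocitv R)
  (fun A => forall m, dens (\1_(A `&` box m) : R -> R))) => //.
- move=> _ _ [[a b] _ <-] [[c d] _ <-]; exists (Num.max a c, Num.min b d) => //.
  apply/seteqP; split => x /=; rewrite !in_itv/= gt_max le_min.
    by move=> /andP[/andP[-> ->] /andP[-> ->]].
  by move=> [/andP[-> ->] /andP[-> ->]].
- by move=> m; rewrite setTI; exact: dens_itv.
- move=> _ [[a b] _ <-] m.
  have -> : `]a, b]%classic `&` box m = `]Num.max a (- m%:R), Num.min b m%:R]%classic.
    apply/seteqP; split => x /=; rewrite /box/= !in_itv/= gt_max le_min.
      by move=> [/andP[-> ->] /andP[-> ->]].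
    by move=> /andP[/andP[-> ->] /andP[-> ->]].
  exact: dens_itv.
- move=> S _ dS m.
  have := densD (dens_itv (- m%:R) m%:R) (densZ (-1) (dS m)); congr dens.
  apply/funext => x; rewrite /= !indicE !in_setI in_setC -/(box m).
  by case: (x \in S); case: (x \in box m); rewrite /= ?mulr1 ?mulr0 ?addr0 ?subrr ?addrN.
- move=> F mF tF dF m.
  apply: (@dens_dct (fun n x => \sum_(k < n) \1_(F k `&` box m) x) _ (\1_(box m))) => //.
  + by move=> n; exact: dens_sum.
  + apply: measurable_indic; apply: measurableI; last exact: measurable_box.
    exact: (@bigcupT_measurable _ (measurableTypeR R)).
  + apply: aeW => x n.
    rewrite !indicE; have [xm|xm] := boolP (x \in box m); last first.
      rewrite big1 ?normr0// => k _.
      by rewrite indicE in_setI (negbTE xm) andbF.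
    rewrite normr1; have [[k Fk]|nF] := pselect (exists k, F k x); last first.
      rewrite big1 ?normr0// => k _.
      rewrite indicE in_setI memNset//= => Fk.
      by apply: nF; exists k.
    (* By disjointness the partial sum at x counts the indices equal to k, of which there is at most
       one. *)
    rewrite (eq_bigr (fun j : 'I_n => ((j : nat) == k)%:R)); last first.
      move=> j _; rewrite indicE in_setI xm andbT; congr ((_ : bool)%:R).
      apply/idP/eqP => [|->]; last by rewrite inE.
      by rewrite inE => Fj; apply: (tF j k) => //; exists x.
    rewrite -natr_sum normr_nat lern1.
    have -> : (\sum_(i < n) ((i : nat) == k) = #|[pred j : 'I_n | (j : nat) == k]|)%N.
      by rewrite -sum1_card [RHS]big_mkcond; apply: eq_bigr => j _; rewrite inE; case: eqP.
    by apply/card_le1P => i /eqP ik j; rewrite !inE -val_eqE/= ik eq_sym.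
  apply: aeW => x.
  rewrite indicE in_setI; have [xm|xm] := boolP (x \in box m); last first.
    rewrite andbF (_ : (fun n => _) = cst 0); first exact: cvg_cst.
    by apply/funext => n; rewrite big1//= => k _; rewrite indicE in_setI (negbTE xm) andbF.
  rewrite andbT; have [[k Fk]|nF] := pselect (exists k, F k x); last first.
    rewrite memNset; last by move=> [k _ Fk]; apply: nF; exists k.
    rewrite (_ : (fun n => _) = cst 0); first exact: cvg_cst.
    apply/funext => n; rewrite big1//= => k _; rewrite indicE in_setI memNset//= => Fk.
    by apply: nF; exists k.
  rewrite mem_set; last by exists k.
  apply: cvg_near_cst; near=> n.
  have kn : (k < n)%N by near: n; exact: nbhs_infty_gt.
  rewrite (bigD1 (Ordinal kn))//= big1 ?addr0.
    by rewrite indicE in_setI xm andbT mem_set.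
  move=> j jk; rewrite indicE in_setI xm andbT memNset//= => Fj.
  move/eqP: jk; apply; apply: val_inj => /=.
  by apply: (tF j k) => //; exists x.
Unshelve. all: by end_near. Qed.

Import HBNNSimple.

(** Approximation from below by simple functions; the factor [\1_(box n)] makes their level sets
    have finite measure. *)
Lemma dens_ge0 f : inL2 f -> (forall x, 0 <= f x) -> dens f.
Proof.
move=> fL f0; have mf := inL2_measurable fL.
have mEf : measurable_fun setT (EFin \o f) by exact/measurable_EFinP.
pose s n := nnsfun_approx measurableT mEf n.
have s_cvg x : s n x @[n --> \oo] --> f x.
  have := @cvg_nnsfun_approx _ _ R setT measurableT (EFin \o f) mEf (fun x _ => f0 x) x I.
  by move=> /fine_cvgP[].
have s_le n x : s n x <= f x.
  have nd : nondecreasing_seq (fun n => s n x).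
    by move=> i j ij; have /lefP := nd_nnsfun_approx measurableT mEf ij; exact.
  have := nondecreasing_cvgn_le nd (cvgP _ (s_cvg x)) n.
  by rewrite (cvg_lim _ (s_cvg x)).
apply: (@dens_dct (fun n x => s n x * \1_(box n) x) _ f) => //.
- move=> n.
  have := @dens_sum _ (finmap.enum_fset (fset_set (range (s n))))
    (fun y x => y * \1_((s n) @^-1` [set y] `&` box n) x) _.
  rewrite (_ : (fun x => \sum_(i <- _) _) = (fun x => s n x * \1_(box n) x)).
    apply => y; apply: densZ; apply: dens_box.
    exact: measurable_funPTI.
  apply/funext => x; rewrite [in RHS]fimfunE fsbig_finite//= mulr_suml; apply: eq_bigr => y _.
  by rewrite -mulrA indicI.
- apply: aeW => x n; rewrite !ger0_norm ?mulr_ge0// ?indicE ?ler0n//.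
  by rewrite (le_trans _ (s_le n x))// ler_piMr//; case: (_ \in _).
apply: aeW => x; rewrite -[X in _ --> X]mulr1; apply: cvgM => //.
apply: cvg_near_cst; near=> n; rewrite indicE mem_set// /box/= in_itv/=.
have : `|x| < n%:R by near: n; exact: nbhs_infty_gtr.
by rewrite ltr_norml => /andP[-> /ltW ->].
Unshelve. all: by end_near. Qed.

Lemma test_dense_L2 u : test_dense u.
Proof.
have mu := measurable_L2 u.
have L0 g : measurable_fun setT g -> (forall x, `|g x| <= `|u x|) -> inL2 g.
  by move=> mg gu; apply: (inL2_le mg (inL2_L2 u)); exact: aeW.
pose up (x : R) : R := Num.max (u x) 0; pose un (x : R) : R := Num.max (- u x) 0.
have dp : dens up.
  apply: dens_ge0; last by move=> x; rewrite le_max lexx orbT.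
  apply: L0; first by apply: measurable_maxr => //; exact: mu.
  by move=> x; rewrite /up; case: (leP (u x) 0) => _; rewrite ?normr0.
have dn : dens un.
  apply: dens_ge0; last by move=> x; rewrite le_max lexx orbT.
  apply: L0; first by apply: measurable_maxr => //; apply: measurableT_comp => //; exact: mu.
  by move=> x; rewrite /un; case: (leP (- u x) 0) => _; rewrite ?normr0 ?normrN.
have [_] := densD dp (densZ (-1) dn).
rewrite (_ : _ \+ _ = u) ?toL2_id//; apply/funext => x /=; rewrite mulN1r /up /un.
move: (u x : R) => t; case: (leP t 0) => h1; case: (leP (- t) 0) => h2; lra.
Qed.

End density.

(** * Weak derivatives and the resolvent of d/dx *)

Section translation.
Context {R : realType}.
Local Notation leb := (@lebesgue_measure R).
Implicit Types (f g phi : R -> R) (u v w : L2 R).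

Lemma measurable_shift (h : R) : measurable_fun setT (fun x : R => x + h).
Proof. exact: (measurable_funD (@measurable_id _ _ _) (@measurable_cst _ _ _ _ _ _)). Qed.

(** The translated measure takes the same values on half-open intervals, which determine Lebesgue
    measure. *)
Lemma lebesgue_measure_shift (h : R) (A : set R) : measurable A ->
  leb ((fun x => x + h) @^-1` A) = leb A.
Proof.
move=> mA; apply/esym.
unshelve apply: (@lebesgue_measure_unique R
  (pushforward leb (fun x : measurableTypeR R => (x + h : measurableTypeR R)))) mA.
  exact: measurable_shift.
move=> _ _ [[a b] _ <-] /=; rewrite /pushforward.
have -> : (fun x : R => x + h) @^-1` `]a, b]%classic = `]a - h, b - h]%classic.
  by apply/seteqP; split => x /=; rewrite !in_itv/= ltrBlDr lerBrDr.
rewrite !lebesgue_measure_itv/= !lte_fin ltrD2r; case: ifP => // _.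
by rewrite -!EFinB; congr (_%:E); ring.
Qed.

Lemma integral_shift (h : R) (F : R -> \bar R) : measurable_fun setT F ->
  (forall x, 0 <= F x)%E -> (\int[leb]_x F (x + h)%R = \int[leb]_x F x)%E.
Proof.
move=> mF F0.
pose s (x : measurableTypeR R) : measurableTypeR R := x + h.
have ms : measurable_fun setT s by exact: measurable_shift.
have := @ge0_integral_pushforward _ _ (measurableTypeR R) (measurableTypeR R) R s ms leb setT F
  measurableT mF (fun x _ => F0 x).
rewrite preimage_setT => <-; apply: eq_measure_integral => A mA _.
exact: lebesgue_measure_shift.
Qed.

Lemma ae_shift (h : R) (P : R -> Prop) :
  {ae leb, forall x, P x} -> {ae leb, forall x, P (x + h)}.
Proof.
move=> [N [mN N0 PN]]; exists ((fun x => x + h) @^-1` N); split.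
- by rewrite -[X in measurable X]setTI; apply: measurable_shift.
- by rewrite lebesgue_measure_shift.
- by move=> x /= nP; exact: PN.
Qed.

Lemma measurable_fun_shift (h : R) f : measurable_fun setT f ->
  measurable_fun setT (fun x : R => f (x + h)).
Proof.
by move=> mf; exact: (measurableT_comp mf (measurable_shift h)).
Qed.

Lemma inL2_shift (h : R) f : inL2 f -> inL2 (fun x => f (x + h)).
Proof.
move=> /inL2P[mf fi]; apply/inL2P; split; first exact: measurable_fun_shift.
rewrite (@integral_shift h (fun x => (f x ^+ 2)%:E))//; first exact: measurable_sqr.
by move=> x; rewrite lee_fin sqr_ge0.
Qed.

Definition tau (h : R) u : L2 R := toL2 (fun x => u (x + h)).

Lemma tau_ae h u : {ae leb, forall x, tau h u x = u (x + h)}.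
Proof. by apply: toL2_ae; exact: inL2_shift. Qed.

Lemma tau_toL2 h f : inL2 f -> tau h (toL2 f) = toL2 (fun x => f (x + h)).
Proof.
move=> fL; apply: L2_eq.
apply: filterS3 (tau_ae h (toL2 f)) (toL2_ae (inL2_shift h fL)) (ae_shift h (toL2_ae fL)).
by move=> x -> -> ->.
Qed.

Lemma tauD h u v : tau h (u + v) = tau h u + tau h v.
Proof.
apply: L2_eq; near=> x.
rewrite (near (tau_ae h (u + v)) x)// (near (L2D_ae (tau h u) (tau h v)) x)//.
rewrite (near (tau_ae h u) x)// (near (tau_ae h v) x)//.
by near: x; exact: ae_shift (L2D_ae u v).
Unshelve. all: by end_near. Qed.

Lemma tauZ h (a : R) u : tau h (a *: u) = a *: tau h u.
Proof.
apply: L2_eq; near=> x.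
rewrite (near (tau_ae h (a *: u)) x)// (near (L2Z_ae a (tau h u)) x)//.
rewrite (near (tau_ae h u) x)//.
by near: x; exact: ae_shift (L2Z_ae a u).
Unshelve. all: by end_near. Qed.

Lemma tauB h u v : tau h (u - v) = tau h u - tau h v.
Proof. by rewrite tauD -scaleN1r tauZ scaleN1r. Qed.

Lemma norm_tau h u : `|tau h u| = `|u|.
Proof.
apply/eqP; rewrite -(@eqrXn2 _ 2)//; apply/eqP/EFin_inj; rewrite !normL2_sq.
rewrite -(@integral_shift h (fun x => (u x ^+ 2)%:E)); last 2 first.
- exact: measurable_sqr.
- by move=> x; rewrite lee_fin sqr_ge0.
apply: ae_eq_integral => //.
- exact: measurable_sqr.
- by apply: measurable_sqr; exact: measurable_fun_shift.
- by apply: filterS (tau_ae h u) => x -> _.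
Qed.

Lemma tauK h u : tau (- h) (tau h u) = u.
Proof.
apply: L2_eq; near=> x.
rewrite (near (tau_ae (- h) (tau h u)) x)//.
rewrite -[in RHS](subrK h x) [x - h + h]addrC [h + _]addrC.
by near: x; exact: ae_shift (tau_ae h u).
Unshelve. all: by end_near. Qed.

(** Polarization transfers the translation invariance of the norm to the inner product. *)
Lemma dot_polar u v : dot u v = 4^-1 * (`|u + v| ^+ 2 - `|u - v| ^+ 2).
Proof. by rewrite -!dot_normE !(dotDl, dotDr, dotNl, dotNr) (dotC v u); field. Qed.

Lemma dot_tau h u v : dot (tau h u) v = dot u (tau (- h) v).
Proof.
rewrite -{1}(tauK (- h) v) opprK.
by rewrite !dot_polar -tauD -tauB !norm_tau.
Qed.

End translation.

(** * Weak derivatives as limits of difference quotients in L2 *)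

Section strong_derivative.
Context {R : realType}.
Local Notation leb := (@lebesgue_measure R).
Implicit Types (f g phi : R -> R) (u v w : L2 R).

Lemma near0_norm_lt (d : R) : 0 < d -> \forall k \near (0 : R)^', `|k| < d.
Proof.
move=> d0; apply: nbhs_dnbhs; have := nbhsx_ballx (0 : R) d d0.
by apply: filterS => y; rewrite /ball/= sub0r normrN.
Qed.

Lemma derive_lipschitz f (K : R) : (forall x, derivable f x 1) ->
  (forall x, `|derive1 f x| <= K) -> forall x y, `|f y - f x| <= K * `|y - x|.
Proof.
move=> df fK; have key x y : x < y -> `|f y - f x| <= K * `|y - x|.
  move=> xy; have [] := @MVT R f (derive1 f) x y xy.
  - by move=> t _; exact: derivable_is_derive.
  - by apply: derivable_within_continuous => t _; exact: df.
  by move=> c _ ->; rewrite normrM ler_wpM2r.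
move=> x y; have [xy|yx|->] := ltgtP x y; first exact: key.
- by rewrite distrC (distrC y); exact: key.
- by rewrite !subrr normr0 mulr0.
Qed.

Lemma test_support phi : test_function phi ->
  exists K M : R, [/\ 0 <= K, 0 <= M, forall x, `|phi x| <= K &
    forall x, M < `|x| -> phi x = 0].
Proof.
move=> /test_bounded[K [M [K0 M0 KM]]]; exists K, M; split => // x.
  by rewrite (le_trans (KM x))// ler_piMr// indicE; case: (_ \in _).
move=> Mx; apply/eqP; rewrite -normr_le0 (le_trans (KM x))// indicE memNset ?mulr0//=.
by rewrite in_itv/= -ler_norml leNgt Mx.
Qed.

Lemma test_taylor phi : test_function phi -> exists2 C : R, 0 <= C &
  forall h : R, `|h| <= 1 ->
   `|tau h (toL2 phi) - toL2 phi - h *: toL2 (derive1 phi)| <= C * h ^+ 2 /\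
   `|tau h (toL2 phi) - toL2 phi| <= C * `|h|.
Proof.
move=> tphi; have tphi1 := test_function_derive1 tphi.
have tphi2 := test_function_derive1 tphi1.
have [_ [M0 [_ _ _ sM0]]] := test_support tphi.
have [K1 [M1 [K10 _ bK1 sM1]]] := test_support tphi1.
have [K2 [_ [K20 _ bK2 _]]] := test_support tphi2.
(* The margin 1 makes [-M, M] contain the support of every translate by |h| <= 1. *)
pose M := Num.max M0 M1 + 1.
have iL := @inL2_itv R (- M) M; pose I := toL2 (\1_(`[- M, M]%classic) : R -> R).
pose C := (K1 + K2) * `|I|.
have lip1 := derive_lipschitz (fun x => @test_derivable _ _ x tphi) bK1.
have lip2 := derive_lipschitz (fun x => @test_derivable _ _ x tphi1) bK2.
have out x h : `|h| <= 1 -> x \notin `[- M, M]%classic ->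
    [/\ phi (x + h) = 0, phi x = 0 & derive1 phi x = 0].
  move=> h1; rewrite notin_setE/= in_itv/= -ler_norml => /negP; rewrite -ltNge => Mx.
  have x1 : Num.max M0 M1 < `|x| by rewrite (lt_trans _ Mx)// ltrDl.
  have xh : Num.max M0 M1 < `|x + h|.
    rewrite -(ltrD2r 1) (lt_le_trans Mx)// -[x in leLHS](addrK h).
    by rewrite (le_trans (ler_normB _ _))// lerD2l.
  move: x1 xh; rewrite !gt_max => /andP[x1 x2] /andP[x3 x4].
  by split; [exact: sM0|exact: sM0|exact: sM1].
have bnd (F : R -> R) (K h : R) : measurable_fun setT F -> 0 <= K -> `|h| <= 1 ->
    (forall x, x \notin `[- M, M]%classic -> F x = 0) -> (forall x, `|F x| <= K) ->
    `|toL2 F| <= K * `|I|.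
  move=> mF K0 h1 F0 FK; have [] := @norm_toL2 _ F I K mF K0; last by [].
  apply: filterS (toL2_ae iL) => x ->; rewrite indicE.
  have [_|xM] := boolP (x \in _); first by rewrite normr1 mulr1.
  by rewrite F0// normr0 mulr0.
have pL := test_inL2 tphi; have p1L := test_inL2 tphi1.
have mp := inL2_measurable pL; have mp1 := inL2_measurable p1L.
exists C; first by rewrite mulr_ge0// addr_ge0.
move=> h h1; have psL := inL2_shift h pL; have mps := inL2_measurable psL.
rewrite tau_toL2// -toL2Z// -!toL2B//; last 2 first.
- exact: inL2B.
- exact: inL2Z.
split.
  apply: (@le_trans _ _ (K2 * h ^+ 2 * `|I|)).
    apply: (bnd _ _ h) => //.
    - by apply: measurable_funB; [exact: measurable_funB|exact: measurable_funM].
    - by rewrite mulr_ge0// sqr_ge0.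
    - by move=> x /(out _ _ h1)[/= -> -> ->]; rewrite mulr0 !subrr.
    move=> x /=.
    have key (a b : R) : a < b -> (x = a /\ x + h = b) \/ (x = b /\ x + h = a) ->
      exists2 c, `|c - x| <= `|h| & phi (x + h) - phi x = derive1 phi c * h.
      move=> ab xab; have [] := @MVT R phi (derive1 phi) a b ab.
      - by move=> t _; exact/derivable_is_derive/test_derivable.
      - by apply: continuous_subspaceT; exact: test_continuous.
      move=> c; rewrite in_itv/= => /andP[ac cb] E; exists c.
        case: xab => -[xa xb]; rewrite ler_norml; have := ler_norm h; have := ler_norm (- h);
        by rewrite normrN; lra.
      case: xab => -[xa xb]; first by rewrite xb xa E -xb -xa; congr (_ * _); ring.
      rewrite xb xa -opprB E -mulrN; congr (_ * _); rewrite -xb -xa; ring.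
    have [c ch ->] : exists2 c, `|c - x| <= `|h| & phi (x + h) - phi x = derive1 phi c * h.
      have [h0|h0|->] := ltgtP h 0.
      - by apply: (key (x + h) x); [rewrite gtrDl|right].
      - by apply: (key x (x + h)); [rewrite ltrDl|left].
      - by exists x; rewrite ?subrr ?normr0// addr0 subrr mulr0.
    rewrite mulrC -mulrBr normrM.
    rewrite (le_trans (ler_wpM2l _ (lip2 _ _)))// mulrCA -[h ^+ 2](real_normK (num_real _)) expr2.
    by rewrite ler_wpM2l// ler_wpM2l.
  by rewrite /C mulrAC ler_wpM2r ?sqr_ge0// ler_wpM2r// lerDr.
apply: (@le_trans _ _ (K1 * `|h| * `|I|)).
  apply: (bnd _ _ h) => //.
  - exact: measurable_funB.
  - by rewrite mulr_ge0.
  - by move=> x /(out _ _ h1)[/= -> ->]; rewrite subrr.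
  by move=> x /=; rewrite (le_trans (lip1 _ _))// addrAC subrr add0r.
by rewrite /C mulrAC ler_wpM2r// ler_wpM2r// lerDl.
Qed.

(** Differentiability of translations at u, equivalent to [weak_derivative] by [sderiv_weak] and
    [weak_sderiv]. In this form integration by parts and the product rule hold for arbitrary L2
    functions, without mollification. *)
Definition sderiv u v := forall e : R, 0 < e -> exists2 d : R, 0 < d &
  forall h, `|h| < d -> `|tau h u - u - h *: v| <= e * `|h|.

Lemma sderiv_test phi : test_function phi -> sderiv (toL2 phi) (toL2 (derive1 phi)).
Proof.
move=> /test_taylor[C C0 CP] e e0.
have C1 : 0 < C + 1 by rewrite ltr_wpDl.
exists (Num.min 1 (e / (C + 1))); first by rewrite lt_min ltr01 divr_gt0.
move=> h; rewrite lt_min => /andP[h1 hC].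
have [H _] := CP h (ltW h1); apply: le_trans H _.
rewrite -(real_normK (num_real h)) expr2 mulrA ler_wpM2r//.
move: hC; rewrite ltr_pdivlMr// => hC.
have := normr_ge0 h; nra.
Qed.

Lemma tau_continuous u (e : R) : 0 < e -> exists2 d : R, 0 < d &
  forall h, `|h| < d -> `|tau h u - u| <= e.
Proof.
move=> e0; have e30 : 0 < e / 3 by rewrite divr_gt0.
have [phi tphi up] := test_dense_L2 u e30.
have [C C0 CP] := test_taylor tphi.
have C1 : 0 < C + 1 by rewrite ltr_wpDl.
exists (Num.min 1 (e / 3 / (C + 1))); first by rewrite lt_min ltr01 divr_gt0.
move=> h; rewrite lt_min => /andP[h1 hC].
have [_ H] := CP h (ltW h1).
have -> : tau h u - u = tau h (u - toL2 phi) + (tau h (toL2 phi) - toL2 phi) - (u - toL2 phi).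
  by rewrite tauB addrA subrK opprB addrA subrK.
have {}H : `|tau h (toL2 phi) - toL2 phi| <= e / 3.
  apply: le_trans H _; move: hC; rewrite ltr_pdivlMr// => hC.
  have := normr_ge0 h; nra.
rewrite (le_trans (ler_normB _ _))// (le_trans (lerD (ler_normD _ _) (lexx _)))//.
by rewrite norm_tau; lra.
Qed.

(** The square of |w| is dot w phi + dot w (w - phi), with a test function phi close to w. *)
Lemma dual_norm_le w (C : R) : 0 <= C ->
  (forall phi, test_function phi -> `|dot w (toL2 phi)| <= C * `|toL2 phi|) -> `|w| <= C.
Proof.
move=> C0 H.
have [w0|w0] := eqVneq `|w| 0; first by rewrite w0.
have {}w0 : 0 < `|w| by rewrite lt_neqAle eq_sym w0 normr_ge0.
rewrite -(ler_pM2l w0) -expr2 -dot_normE.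
apply/ler_addgt0Pr => e e0.
have Cw : 0 < C + `|w| by rewrite ltr_wpDl.
have [phi tphi wp] := test_dense_L2 w (divr_gt0 e0 Cw).
have -> : dot w w = dot w (toL2 phi) + dot w (w - toL2 phi) by rewrite dotBr; ring.
have h1 := H _ tphi; have h2 := dot_le w (w - toL2 phi).
have h3 : `|toL2 phi| <= `|w| + `|w - toL2 phi|.
  by rewrite -lerBlDl -[leRHS]normrN opprB lerB_dist.
have h4 := ler_norm (dot w (toL2 phi)); have h5 := ler_norm (dot w (w - toL2 phi)).
move: wp; rewrite ler_pdivlMr// => wp.
have := normr_ge0 (w - toL2 phi); nra.
Qed.

Lemma test_shift phi (s : R) : test_function phi -> test_function (fun x => phi (x + s)).
Proof.
move=> /test_functionP[Cp [M Mp]]; apply/test_functionP; split.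
  move=> k; have := @Ck_affine _ k _ s 1 (Cp k).
  by congr Ck; apply/funext => x; rewrite mul1r addrC.
exists (M + `|s|) => x xM; apply: Mp.
rewrite -(ltrD2r `|s|) (lt_le_trans xM)// -[x in leLHS](addrK s).
exact: ler_normB.
Qed.

Lemma weak_derivativeP u v : weak_derivative u v <->
  forall phi, test_function phi -> dot u (toL2 (derive1 phi)) = - dot v (toL2 phi).
Proof.
have E phi : test_function phi -> dot u (toL2 (derive1 phi)) = \int[leb]_x (u x * derive1 phi x).
  by move=> tphi; rewrite dot_toL2//; apply: test_inL2; exact: test_function_derive1.
have E' phi : test_function phi -> dot v (toL2 phi) = \int[leb]_x (v x * phi x).
  by move=> tphi; rewrite dot_toL2//; exact: test_inL2.
by split=> H phi tphi; have := H phi tphi; rewrite E// E'.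
Qed.

(** The adjoint of [tau h] is [tau (- h)]; expanding both to first order in h, the terms of order 0
    cancel and those of order 1 give the identity. *)
Lemma sderiv_ibp u v p p' : sderiv u v -> sderiv p p' -> dot u p' = - dot v p.
Proof.
move=> uv sp.
apply/eqP; rewrite -subr_eq0 opprK -normr_le0; apply/ler_addgt0Pr => e e0; rewrite add0r.
have k0 : 0 < `|u| + `|p| + 1 by rewrite ltr_wpDl// addr_ge0.
have e'0 := divr_gt0 e0 k0.
have [d1 d10 H1] := uv _ e'0; have [d2 d20 H2] := sp _ e'0.
pose h := Num.min d1 d2 / 2.
have d0 : 0 < Num.min d1 d2 by rewrite lt_min d10.
have h0 : 0 < h by rewrite divr_gt0.
have hd : h < Num.min d1 d2 by rewrite /h; lra.
move: (hd); rewrite lt_min => /andP[hd1 hd2].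
have {}H1 := H1 h; have {}H2 := H2 (- h).
rewrite normrN gtr0_norm// in H2; rewrite gtr0_norm// in H1.
have {}H1 := H1 hd1; have {}H2 := H2 hd2.
set X := tau h u - u - h *: v in H1; set Y := tau (- h) p - p - - h *: p' in H2.
have E : h * (dot u p' + dot v p) = dot u Y - dot X p.
  rewrite /X /Y !(dotBl, dotBr, dotZl, dotZr) dot_tau; ring.
have {}E : h * `|dot u p' + dot v p| = `|dot u Y - dot X p|.
  by rewrite -E normrM gtr0_norm.
have le1 := dot_le u Y; have le2 := dot_le X p.
have le3 := ler_normB (dot u Y) (dot X p); rewrite -E in le3.
rewrite -(ler_pM2l h0).
have q (t : R) : t <= e / (`|u| + `|p| + 1) * h -> t * (`|u| + `|p| + 1) <= e * h.
  by rewrite mulrAC ler_pdivlMr.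
have {}H1 := q _ H1; have {}H2 := q _ H2.
rewrite -(ler_pM2r k0).
apply: (@le_trans _ _ ((`|u| * `|Y| + `|X| * `|p|) * (`|u| + `|p| + 1))).
  by rewrite ler_wpM2r ?(ltW k0)//; lra.
have := ler_wpM2l (normr_ge0 u) H2; have := ler_wpM2l (normr_ge0 p) H1.
have := normr_ge0 u; have := normr_ge0 p; have := mulr_gt0 e0 h0.
set a := `|u|; set b := `|p|; set c := e * h => c0 b0 a0 q1 q2.
rewrite (_ : h * e = c); last by rewrite mulrC.
have -> : (a * `|Y| + `|X| * b) * (a + b + 1) = a * (`|Y| * (a + b + 1)) + b * (`|X| * (a + b + 1)) by ring.
nra.
Qed.

Lemma sderiv_weak u v : sderiv u v -> weak_derivative u v.
Proof.
by move=> uv; apply/weak_derivativeP => phi tphi; exact: sderiv_ibp uv (sderiv_test tphi).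
Qed.

(** Against a test function p, the map s |-> dot u (tau (- s) p) has derivative dot v (tau (- s) p).
    By the mean value theorem the remainder tested against p is h (dot (tau c v - v) p) for some |c|
    <= |h|, and translations are continuous in L2. *)
Lemma weak_sderiv u v : weak_derivative u v -> sderiv u v.
Proof.
move=> /weak_derivativeP uv e e0.
have [d d0 dP] := tau_continuous v e0.
exists d => // h hd; apply: dual_norm_le; first by rewrite mulr_ge0// ltW.
move=> phi tphi; set p := toL2 phi.
pose a (s : R) := dot u (tau (- s) p).
have da (s : R) : is_derive s 1 a (dot v (tau (- s) p)).
  have tps := test_shift (- s) tphi.
  have Es : tau (- s) p = toL2 (fun x => phi (x - s)) by rewrite tau_toL2//; exact: test_inL2.
  have Es' : forall h : R, tau (- (h + s)) p = tau (- h) (tau (- s) p).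
    move=> k; rewrite Es tau_toL2; last exact: test_inL2.
    rewrite tau_toL2; last exact: test_inL2.
    by congr toL2; apply/funext => x; congr phi; ring.
  have sp := sderiv_test tps; have uvs := uv _ tps; rewrite -Es in sp uvs.
  have lim : h^-1 *: ((a \o shift s) (h *: 1) - a s) @[h --> 0^'] --> dot v (tau (- s) p).
    apply/cvgrPdist_le => e' e'0.
    have k0 : 0 < `|u| + 1 by rewrite ltr_wpDl.
    have [d' d'0 d'P] := sp _ (divr_gt0 e'0 k0).
    near=> k.
    have k1 : 0 < `|k| by rewrite normr_gt0; near: k; exact: nbhs_dnbhs_neq.
    have kd : `|- k| < d'.
      by rewrite normrN; near: k; exact: near0_norm_lt.
    rewrite /= /GRing.scale/= mulr1 /a Es'.
    have := d'P _ kd; set Y := _ - _ - _ => Yle.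
    have -> : dot v (tau (- s) p) - k^-1 * (dot u (tau (- k) (tau (- s) p)) - dot u (tau (- s) p))
        = - k^-1 * dot u Y.
      have kn0 : k != 0 by rewrite -normr_gt0.
      rewrite /Y !(dotBr, dotZr) uvs; field.
      exact: kn0.
    rewrite normrM normrN normfV mulrC ler_pdivrMr//.
    rewrite (le_trans (dot_le _ _))// (le_trans (ler_wpM2l _ Yle))//.
    rewrite normrN mulrA ler_wpM2r// mulrCA ler_piMr ?ltW// ltr_pdivrMr// mul1r ltrDl//.
  split; first by apply/cvg_ex; exists (dot v (tau (- s) p)).
  exact: cvg_lim lim.
have Ea : dot (tau h u - u - h *: v) p = a h - a 0 - h * dot v p.
  rewrite !(dotBl, dotZl) dot_tau /a oppr0.
  have -> // : tau 0 p = p.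
  by rewrite tau_toL2; [congr toL2; apply/funext => x; rewrite addr0|exact: test_inL2].
have [c ch Ec] : exists2 c, `|c| <= `|h| & a h - a 0 = dot v (tau (- c) p) * h.
  have ca (x y : R) : {within `[x, y], continuous a}.
    by apply: derivable_within_continuous => t _; have [] := da t.
  have [h0|h0|->] := ltgtP h 0; last by exists 0; rewrite ?subrr ?mulr0.
  - have [c] := MVT h0 (fun s _ => da s) (ca h 0); rewrite in_itv/= => /andP[hc c0] E.
    exists c; first by rewrite !ltr0_norm// lerN2 ltW.
    by rewrite -opprB E sub0r mulrN opprK.
  have [c] := MVT h0 (fun s _ => da s) (ca 0 h); rewrite in_itv/= => /andP[hc c0] E.
  exists c; first by rewrite !gtr0_norm// ltW.
  by rewrite E subr0.
rewrite Ea Ec mulrC -mulrBr -dot_tau -dotBl normrM mulrAC [leRHS]mulrC ler_wpM2l//.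
rewrite (le_trans (dot_le _ _))// ler_wpM2r// dP//.
exact: le_lt_trans hd.
Unshelve. all: by end_near. Qed.

End strong_derivative.

(** * Calculus of weak derivatives *)

Section weak_derivatives.
Context {R : realType}.
Local Notation leb := (@lebesgue_measure R).
Local Notation wd := (@weak_derivative R).
Implicit Types (f g phi : R -> R) (u v w : L2 R).

Lemma dot_cvg (a : nat -> L2 R) u w : a n @[n --> \oo] --> u ->
  dot (a n) w @[n --> \oo] --> dot u w.
Proof.
move=> au; apply: (@cvg_norm_le _ _ _ _ _ _ _ (fun n => `|a n - u| * `|w|)).
  by near=> n; rewrite -dotBl; exact: dot_le.
rewrite -(mul0r `|w|); apply: cvgMr_tmp; by have /cvg_normP := au.
Unshelve. all: by end_near. Qed.

Lemma dot_test_eq0 w : (forall phi, test_function phi -> dot w (toL2 phi) = 0) -> w = 0.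
Proof.
move=> H; apply/eqP; rewrite -normr_le0; apply: dual_norm_le => // phi tphi.
by rewrite H// normr0 mul0r.
Qed.

Lemma wd_uniq u v w : wd u v -> wd u w -> v = w.
Proof.
move=> /weak_derivativeP uv /weak_derivativeP uw; apply/eqP; rewrite -subr_eq0; apply/eqP.
apply: dot_test_eq0 => phi tphi; rewrite dotBl.
by rewrite -[dot v _]opprK -(uv _ tphi) -[dot w _]opprK -(uw _ tphi) subrr.
Qed.

Lemma wderivE u v : wd u v -> wderiv u = v.
Proof.
move=> uv; rewrite /wderiv; case: xgetP => [w _ /= uw|/(_ v)]; first exact: wd_uniq uw uv.
by [].
Qed.

Lemma wdD u u' v v' : wd u u' -> wd v v' -> wd (u + v) (u' + v').
Proof.
move=> /weak_derivativeP uu' /weak_derivativeP vv'; apply/weak_derivativeP => phi tphi.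
by rewrite !dotDl uu'// vv'// opprD.
Qed.

Lemma wdZ (a : R) u u' : wd u u' -> wd (a *: u) (a *: u').
Proof.
move=> /weak_derivativeP uu'; apply/weak_derivativeP => phi tphi.
by rewrite !dotZl uu'// mulrN.
Qed.

Lemma wdN u u' : wd u u' -> wd (- u) (- u').
Proof. by move=> uu'; rewrite -scaleN1r -(scaleN1r u'); exact: wdZ. Qed.

Lemma wdB u u' v v' : wd u u' -> wd v v' -> wd (u - v) (u' - v').
Proof. by move=> uu' vv'; apply: wdD => //; exact: wdN. Qed.

Lemma wd_test phi : test_function phi -> wd (toL2 phi) (toL2 (derive1 phi)).
Proof. by move=> tphi; apply: sderiv_weak; exact: sderiv_test. Qed.

Lemma wd_lim (a b : nat -> L2 R) u v : (forall n, wd (a n) (b n)) ->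
  a n @[n --> \oo] --> u -> b n @[n --> \oo] --> v -> wd u v.
Proof.
move=> ab au bv; apply/weak_derivativeP => phi tphi.
have h1 := @dot_cvg _ _ (toL2 (derive1 phi)) au.
have h2 : - dot (b n) (toL2 phi) @[n --> \oo] --> - dot v (toL2 phi).
  by apply: cvgN; exact: dot_cvg.
have E : (fun n => dot (a n) (toL2 (derive1 phi))) = (fun n => - dot (b n) (toL2 phi)).
  by apply/funext => n; have /weak_derivativeP -> := ab n.
rewrite E in h1; exact: (cvg_unique (@norm_hausdorff _ _) h1 h2).
Qed.

Lemma wd_ibp u u' v v' : wd u u' -> wd v v' -> dot u' v = - dot u v'.
Proof.
by move=> /weak_sderiv uu' /weak_sderiv vv'; rewrite (sderiv_ibp uu' vv') opprK.
Qed.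

Lemma wd_skew u u' : wd u u' -> dot u u' = 0.
Proof. by move=> uu'; have := wd_ibp uu' uu'; rewrite (dotC u'); lra. Qed.

(** The derivative need not be continuous, as is the case for the first derivatives of twice
    differentiable coefficients. It is still measurable, as a limit of difference quotients. *)
Definition nice g (K : R) := [/\ forall x, derivable g x 1, forall x, `|g x| <= K
  & forall x, `|derive1 g x| <= K].

Lemma derivable_continuous g : (forall x, derivable g x 1) -> continuous g.
Proof. by move=> dg x; apply: differentiable_continuous; exact/derivable1_diffP. Qed.

Lemma measurable_derivable g : (forall x, derivable g x 1) -> measurable_fun setT g.
Proof. by move=> dg; apply: continuous_measurable_fun; exact: derivable_continuous. Qed.

Lemma derive1_seq g x (s : nat -> R) : derivable g x 1 -> (forall n, s n != 0) ->
  s n @[n --> \oo] --> 0 ->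
  (s n)^-1 * (g (x + s n) - g x) @[n --> \oo] --> derive1 g x.
Proof.
move=> dg s0 sc.
have /cvg_ex[l gl] := dg.
have -> : derive1 g x = l by rewrite derive1E; exact: cvg_lim gl.
have s0' : s n @[n --> \oo] --> 0^'.
  move=> A A0; have {}A0 : \forall y \near (0 : R), y != 0 -> A y by exact: A0.
  have H1 : \forall n \near \oo, s n != 0 -> A (s n) by exact: (sc _ A0).
  have : \forall n \near \oo, A (s n) by apply: filterS H1 => n Hn; exact: (Hn (s0 n)).
  by [].
have := @cvg_comp _ _ _ s _ _ _ _ s0' gl; apply: cvg_trans; apply: near_eq_cvg; near=> n.
by rewrite /= /GRing.scale/= mulr1 [s n + x]addrC.
Unshelve. all: by end_near. Qed.

Lemma measurable_derive1 g : (forall x, derivable g x 1) -> measurable_fun setT (derive1 g).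
Proof.
move=> dg; have mg := measurable_derivable dg.
apply: (@measurable_fun_cvg _ _ _ _
  (fun (n : nat) (x : R) => (n.+1%:R^-1)^-1 * (g (x + n.+1%:R^-1) - g x))).
  move=> n; apply: measurable_funM => //; apply: measurable_funB => //.
  exact: measurable_fun_shift.
move=> x _; apply: derive1_seq => //; exact: cvg_harmonic.
Qed.

Lemma nice_bdd g K : nice g K -> bddfun g K.
Proof. by move=> [dg gK _]; split => //; exact: measurable_derivable. Qed.

Lemma nice_bdd' g K : nice g K -> bddfun (derive1 g) K.
Proof. by move=> [dg _ gK]; split => //; exact: measurable_derive1. Qed.

(** The difference quotients of g converge only pointwise, not uniformly, but they are bounded by K:
    dominated convergence, with majorant 2 K |u|, gives the estimate after multiplication by a fixed
    u. *)
Lemma mul_taylor g K u (e : R) : nice g K -> 0 < e -> exists2 d : R, 0 < d &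
  forall h, `|h| < d -> `|mulL2 (fun x => g (x + h) - g x - h * derive1 g x) u| <= e * `|h|.
Proof.
move=> ng e0; have [dg gK g'K] := ng.
have [mg _] := nice_bdd ng; have [mg' _] := nice_bdd' ng.
pose F (h x : R) := (h^-1 * (g (x + h) - g x) - derive1 g x) * u x.
have mF h : measurable_fun setT (F h).
  have m1 : measurable_fun setT (fun x : R => g (x + h) - g x).
    by apply: measurable_funB => //; exact: measurable_fun_shift.
  have m2 : measurable_fun setT (fun x : R => h^-1 * (g (x + h) - g x) - derive1 g x).
    by apply: measurable_funB => //; exact: measurable_funM.
  exact: (measurable_funM m2 (measurable_L2 u)).
have K0 : 0 <= K by exact: le_trans (gK 0).
have Fb h x : h != 0 -> `|F h x| <= `|2 * K * u x|.
  move=> h0; rewrite normrM [leRHS]normrM ler_wpM2r// (le_trans (ler_normB _ _))//.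
  rewrite [leRHS]ger0_norm ?mulr_ge0// (_ : 2 * K = K + K); last by ring.
  rewrite lerD//.
  rewrite normrM normfV mulrC ler_pdivrMr ?normr_gt0//.
  by have := derive_lipschitz dg g'K x (x + h); rewrite addrAC subrr add0r.
have cF : toL2 (F h) @[h --> 0^'] --> (0 : L2 R).
  apply: cvg_within_seq => s s0 sc.
  have Fdom : {ae leb, forall x, forall n, `|F (s n) x| <= `|2 * K * u x|}.
    by apply: aeW => x n; exact: Fb (s0 n).
  have Flim : {ae leb, forall x, F (s n) x @[n --> \oo] --> (cst 0 x : R)}.
    apply: aeW => x; rewrite /F -[X in _ --> X](mul0r (u x)); apply: cvgMr_tmp.
    rewrite -[X in _ --> X](subrr (derive1 g x)); apply: cvgB; last exact: cvg_cst.
    exact: derive1_seq.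
  have [_ _] := L2_dct (fun n => mF (s n)) (measurable_cst _) (inL2Z _ (inL2_L2 u)) Fdom Flim.
  rewrite (_ : toL2 (cst 0) = 0)//; apply: L2_eq.
  have c0 : inL2 (cst 0 : R -> R).
    by have := inL2Z 0 (inL2_L2 u); congr inL2; apply/funext => x; rewrite mul0r.
  by apply: filterS2 L20_ae (toL2_ae c0) => x -> ->.
move/cvgrPdist_le : cF => /(_ _ e0); rewrite near_withinE => -[d /= d0 dP].
exists d => // h hd; have [->|h0] := eqVneq h 0.
  rewrite normr0 mulr0 normr_le0; apply/eqP/L2_eq.
  have b0 : bddfun (fun x => g (x + 0) - g x - 0 * derive1 g x) 0.
    split; last by move=> x; rewrite addr0 subrr mul0r subrr normr0.
    rewrite (_ : (fun x => _) = cst 0); first exact: measurable_cst.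
    by apply/funext => x; rewrite addr0 subrr mul0r subrr.
  by apply: filterS2 L20_ae (mulL2_ae u b0) => x -> ->; rewrite addr0 subrr mul0r subrr mul0r.
have := dP h; rewrite /= sub0r normrN => /(_ hd h0); rewrite sub0r normrN => Fe.
have FL : inL2 (F h).
  by apply: (inL2_le (mF h) (inL2Z (2 * K) (inL2_L2 u))); apply: aeW => x; exact: Fb.
have -> : mulL2 (fun x => g (x + h) - g x - h * derive1 g x) u = h *: toL2 (F h).
  rewrite -toL2Z// /mulL2; congr toL2; apply/funext => x.
  by rewrite /F mulrA mulrBr mulrA divff// mul1r.
by rewrite normrZ mulrC ler_wpM2r.
Qed.

(** The first order error of the product splits into an error on u, an increment of g times u',
    controlled by the Lipschitz bound, and the error of [mul_taylor]. *)
Lemma wd_mul g K u u' : nice g K -> wd u u' ->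
  wd (mulL2 g u) (mulL2 (derive1 g) u + mulL2 g u').
Proof.
move=> ng /weak_sderiv uu'; apply: sderiv_weak => e e0.
have [dg gK g'K] := ng; have bg := nice_bdd ng; have bg' := nice_bdd' ng.
have K0 : 0 <= K by exact: le_trans (gK 0).
have k0 : 0 < 2 * K + 2 by lra.
(* The three errors are at most [K * e1], [K * e1] and [e1] times |h|. *)
pose e1 := e / (2 * K + 2); have e10 : 0 < e1 by exact: divr_gt0.
have [d1 d10 H1] := uu' _ e10.
have [d2 d20 H2] := mul_taylor u ng e10.
have k1 : 0 < `|u'| + 1 by rewrite ltr_wpDl.
exists (Num.min (Num.min d1 d2) (e1 / (`|u'| + 1))).
  by rewrite !lt_min d10 d20 divr_gt0.
move=> h; rewrite !lt_min => /andP[/andP[hd1 hd2] hd3].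
have bs : bddfun (fun x => g (x + h)) K.
  by split => [|x]; [apply: measurable_fun_shift; case: bg|exact: gK].
have bd : bddfun (fun x => g (x + h) - g x) (K * `|h|).
  split => [|x]; first by apply: measurable_funB; [case: bs|case: bg].
  by have := derive_lipschitz dg g'K x (x + h); rewrite addrAC subrr add0r.
have br : bddfun (fun x => g (x + h) - g x - h * derive1 g x) (K * `|h| + `|h| * K).
  split => [|x].
    by apply: measurable_funB; [case: bd|apply: measurable_funM => //; case: bg'].
  by rewrite (le_trans (ler_normB _ _))// lerD//; [case: bd|rewrite normrM ler_wpM2l].
have -> : tau h (mulL2 g u) - mulL2 g u - h *: (mulL2 (derive1 g) u + mulL2 g u') =
    mulL2 (fun x => g (x + h)) (tau h u - u - h *: u') +
    h *: mulL2 (fun x => g (x + h) - g x) u' +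
    mulL2 (fun x => g (x + h) - g x - h * derive1 g x) u.
  apply: L2_eq.
  have A1 := ae_shift h (mulL2_ae u bg).
  near=> x.
  rewrite (near (L2D_ae (_ + _) (mulL2 (fun x => g (x + h) - g x - h * derive1 g x) u)) x)//.
  rewrite (near (L2D_ae (mulL2 (fun x => g (x + h)) _) _) x)//.
  rewrite (near (L2B_ae (_ - mulL2 g u) _) x)// (near (L2B_ae _ (mulL2 g u)) x)//.
  rewrite (near (tau_ae h (mulL2 g u)) x)// (near (mulL2_ae u bg) x)//.
  rewrite (near A1 x)//.
  rewrite (near (L2Z_ae h (mulL2 (derive1 g) u + mulL2 g u')) x)//.
  rewrite (near (L2D_ae (mulL2 (derive1 g) u) (mulL2 g u')) x)//.
  rewrite (near (mulL2_ae u bg') x)// (near (mulL2_ae u' bg) x)//.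
  rewrite (near (mulL2_ae _ bs) x)// (near (L2B_ae (tau h u - u) _) x)//.
  rewrite (near (L2B_ae (tau h u) u) x)// (near (tau_ae h u) x)//.
  rewrite (near (L2Z_ae h u') x)// (near (L2Z_ae h (mulL2 _ u')) x)//.
  rewrite (near (mulL2_ae u' bd) x)// (near (mulL2_ae u br) x)//.
  ring.
have h1 := norm_mulL2 (tau h u - u - h *: u') bs.
have h2 := norm_mulL2 u' bd; have h3 := H2 h hd2; have h4 := H1 h hd1.
rewrite (le_trans (ler_normD _ _))//.
rewrite (le_trans (lerD (ler_normD _ _) (lexx _)))// normrZ.
apply: (@le_trans _ _ (K * (e1 * `|h|) + `|h| * (K * e1) + e1 * `|h|)).
  rewrite lerD// lerD//; first by rewrite (le_trans h1)// ler_wpM2l.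
  rewrite ler_wpM2l// (le_trans h2)// -mulrA ler_wpM2l//.
  move: hd3; rewrite ltr_pdivlMr// => hd3.
  by rewrite (le_trans _ (ltW hd3))// ler_wpM2l// lerDl.
have -> : e = e1 * (2 * K + 2) by rewrite /e1 divfK// gt_eqF.
have := normr_ge0 h; have := mulr_ge0 (ltW e10) (normr_ge0 h); nra.
Unshelve. all: by end_near. Qed.

End weak_derivatives.

(** * Inverting 1 + d/dx, and a sup bound for H1 functions *)

Section resolvent.
Context {R : realType}.
Local Notation leb := (@lebesgue_measure R).
Local Notation wd := (@weak_derivative R).
Implicit Types (f g phi : R -> R) (u v w : L2 R).

Lemma normL2D u v : `|u + v| ^+ 2 = `|u| ^+ 2 + 2 * dot u v + `|v| ^+ 2.
Proof. by rewrite -!dot_normE !(dotDl, dotDr) (dotC v u); ring. Qed.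

(** Projection onto the closure of S: a minimizing sequence for the distance to u is Cauchy by the
    parallelogram identity, and u minus its limit is orthogonal to S. *)
Lemma ortho_dense (S : L2 R -> Prop) : (exists m, S m) ->
  (forall m m' (t : R), S m -> S m' -> S (m + t *: m')) ->
  (forall w, (forall m, S m -> dot w m = 0) -> w = 0) ->
  forall u (e : R), 0 < e -> exists2 m, S m & `|u - m| <= e.
Proof.
move=> [m0 Sm0] SD Sw u e e0.
pose E := [set `|u - m| | m in S].
pose D := inf E.
have infE : has_inf E.
  by split; [exists `|u - m0|, m0|exists 0 => _ [m _ <-]].
have D_le m : S m -> D <= `|u - m| by move=> Sm; apply: ge_inf; [case: infE|exists m].
have D0 : 0 <= D by apply: lb_le_inf; [exists `|u - m0|, m0|move=> _ [m _ <-]].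
have /choice[m mP] : forall k : nat, exists m, S m /\ `|u - m| < D + k.+1%:R^-1.
  move=> k; have k0 : 0 < k.+1%:R^-1 :> R by rewrite invr_gt0.
  by have [_ [m Sm <-] lt] := inf_adherent k0 infE; exists m.
have half : S 0.
  by have := SD m0 m0 (-1) Sm0 Sm0; rewrite scaleN1r subrr.
have para a b : S a -> S b ->
    `|a - b| ^+ 2 <= 2 * (`|u - a| ^+ 2 - D ^+ 2) + 2 * (`|u - b| ^+ 2 - D ^+ 2).
  move=> Sa Sb; pose c := a + 2^-1 *: (b + (-1) *: a).
  have Sc : S c by apply: (SD) => //; exact: SD.
  have Ec : (u - a) + (u - b) = 2 *: (u - c).
    rewrite /c scaleN1r scalerBr scalerDr scalerA divff// scale1r.
    rewrite !scaler_nat !mulr2n.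
    have -> : a + a + (b - a) = a + b by rewrite addrACA subrr addr0.
    by rewrite addrACA -opprD.
  have D2 : D ^+ 2 <= `|u - c| ^+ 2 by rewrite ler_sqr ?nnegrE//; exact: D_le.
  have := normL2D (u - a) (u - b); rewrite Ec normrZ exprMn.
  rewrite ger0_norm//; have := normL2D (u - a) (- (u - b)).
  have -> : u - a - (u - b) = b - a by rewrite opprB addrC addrA subrK.
  rewrite normrN dotNr distrC.
  lra.
have small k : `|u - m k| ^+ 2 - D ^+ 2 <= (2 * D + 1) * k.+1%:R^-1.
  have [_ lt] := mP k; have k0 : 0 < k.+1%:R^-1 :> R by rewrite invr_gt0.
  have k1 : k.+1%:R^-1 <= 1 :> R by rewrite invf_le1// ler1n.
  have := normr_ge0 (u - m k); move: (ltW lt); set t := k.+1%:R^-1 in k0 k1 *.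
  set s := `|u - m k| => *; nra.
have [l ml] : exists l : L2 R, m k @[k --> \oo] --> l.
  apply: L2_complete => e' e'0.
  have k0 : 0 < e' ^+ 2 / (4 * (2 * D + 1)).
    by rewrite divr_gt0 ?exprn_gt0//; lra.
  have /cvgrPdist_lt/(_ _ k0)[N _ NP] := @cvg_harmonic R.
  have sm j : (N <= j)%N -> `|u - m j| ^+ 2 - D ^+ 2 <= e' ^+ 2 / 4.
    move=> Nj; apply: le_trans (small j) _.
    have := NP j Nj; rewrite sub0r normrN ger0_norm ?invr_ge0//= ltr_pdivlMr; last lra.
    by set t := _^-1; lra.
  exists N => j k Nj Nk.
  rewrite -ler_sqr ?nnegrE//; last exact: ltW.
  have [Sj _] := mP j; have [Sk _] := mP k.
  by apply: le_trans (para _ _ Sj Sk) _; have := sm j Nj; have := sm k Nk; lra.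
have w0 : u - l = 0.
  apply: Sw => n Sn.
  have wD : `|u - l| <= D.
    apply: (@ler_cvg_to _ \oo _ _ (fun k => `|u - m k|) (fun k => D + k.+1%:R^-1)).
    - by apply: cvg_norm; apply: cvgB => //; exact: cvg_cst.
    - by rewrite -[X in _ --> X]addr0; apply: cvgD; [exact: cvg_cst|exact: cvg_harmonic].
    - by near=> k; apply/ltW; case: (mP k).
  have wt t : `|u - l| ^+ 2 <= `|u - l - t *: n| ^+ 2.
    rewrite ler_sqr ?nnegrE//; apply: le_trans wD _.
    have H : `|u - (m k + t *: n)| @[k --> \oo] --> `|u - l - t *: n|.
      rewrite -addrA -opprD; apply: cvg_norm; apply: cvgB; first exact: cvg_cst.
      by apply: cvgD => //; exact: cvg_cst.
    apply: (cvgr_to_ge H); near=> k; apply: D_le; apply: SD => //.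
    by case: (mP k).
  pose M := `|n| ^+ 2; have M0 : 0 <= M by exact: sqr_ge0.
  have key t : 2 * t * dot (u - l) n <= t ^+ 2 * M.
    have := wt t; rewrite [leRHS]normL2D dotNr dotZr normrN normrZ exprMn real_normK ?num_real//.
    by rewrite -/M; lra.
  set d := dot (u - l) n in key *.
  have M1 : 0 < M + 1 by lra.
  (* The optimal t would be d / M; M + 1 avoids a division by 0. *)
  have := key (d / (M + 1)).
  have -> : 2 * (d / (M + 1)) * d = d ^+ 2 * (2 * (M + 1)) / (M + 1) ^+ 2 by field; lra.
  have -> : (d / (M + 1)) ^+ 2 * M = d ^+ 2 * M / (M + 1) ^+ 2 by field; lra.
  rewrite ler_pM2r ?invr_gt0 ?exprn_gt0// => H.
  have : d ^+ 2 <= 0 by have := sqr_ge0 d; nra.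
  by move=> H2; apply/eqP; rewrite -sqrf_eq0 eq_le H2 sqr_ge0.
move/eqP: w0; rewrite subr_eq0 => /eqP ul.
move/cvgrPdist_le: ml => /(_ _ e0)[N _ /(_ N (leqnn N)) mN].
by exists (m N); [case: (mP N)|rewrite ul].
Unshelve. all: by end_near. Qed.

(** The cross term vanishes because d/dx is skew. Thus 1 + s d/dx controls both z and z', which
    makes preimages of Cauchy sequences Cauchy. *)
Lemma wd_norm (s : R) z z' : s ^+ 2 = 1 -> wd z z' ->
  `|z + s *: z'| ^+ 2 = `|z| ^+ 2 + `|z'| ^+ 2.
Proof.
move=> s1 zz'; rewrite normL2D dotZr (wd_skew zz') !mulr0 addr0 normrZ exprMn.
by rewrite real_normK ?num_real// s1 mul1r.
Qed.

(** The image of the test functions under 1 + s d/dx is dense: a function w orthogonal to it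
    satisfies w' = s w, and skewness forces w = 0. Preimages of a sequence tending to u then
    converge together with their derivatives. The approximating test functions are part of the
    conclusion so that pointwise inequalities can be transferred to z. *)
Lemma resolvent_approx (s : R) u : s ^+ 2 = 1 -> exists (z : L2 R) (th : nat -> R -> R),
  [/\ wd z (s *: (u - z)), forall n, test_function (th n),
      toL2 (th n) @[n --> \oo] --> z &
      toL2 (derive1 (th n)) @[n --> \oo] --> s *: (u - z)].
Proof.
move=> s1.
pose S m := exists2 th, test_function th & m = toL2 th + s *: toL2 (derive1 th).
have t0 := bump_test 0 0 (@ltr01 R).
have Sdense : forall u (e : R), 0 < e -> exists2 m, S m & `|u - m| <= e.
  apply: ortho_dense.
  - by exists (toL2 (bump 0 0 1) + s *: toL2 (derive1 (bump 0 0 1))), (bump 0 0 1).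
  - move=> _ _ t [p tp ->] [q tq ->].
    exists (p \+ (fun x => t * q x)); first by apply: testD => //; exact: testZ.
    have -> : derive1 (p \+ (fun x => t * q x)) = derive1 p \+ (fun x => t * derive1 q x).
      apply/funext => x; apply: is_derive_derive1; apply: is_deriveD.
        exact/derivable_is_derive/test_derivable.
      by apply: is_deriveZ; exact/derivable_is_derive/test_derivable.
    have tp' := test_function_derive1 tp; have tq' := test_function_derive1 tq.
    rewrite !toL2D ?toL2Z//; try exact: test_inL2; try (by apply: inL2Z; exact: test_inL2).
    by rewrite !scalerDr addrACA !scalerA (mulrC s).
  - move=> w wS; have ww : wd w (s *: w).
      apply/weak_derivativeP => phi tphi.
      have := wS _ (ex_intro2 _ _ phi tphi erefl); rewrite dotDr dotZr dotZl => /eqP.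
      rewrite addr_eq0 => /eqP ->; rewrite mulrN opprK mulrA -expr2 s1 mul1r.
      by [].
    have := wd_skew ww; rewrite dotZr dot_normE => /eqP; rewrite mulf_eq0 sqrf_eq0 normr_eq0.
    by case/orP => [/eqP s0|/eqP//]; move: s1; rewrite s0 expr0n/= => /eqP; rewrite eq_sym oner_eq0.
have /choice[th thP] : forall k : nat, exists th, test_function th /\
    `|u - (toL2 th + s *: toL2 (derive1 th))| <= k.+1%:R^-1.
  move=> k; have k0 : 0 < k.+1%:R^-1 :> R by rewrite invr_gt0.
  by have [_ [th tth ->] H] := Sdense u _ k0; exists th.
pose m k := toL2 (th k) + s *: toL2 (derive1 (th k)).
have mu : m k @[k --> \oo] --> u.
  apply: (@cvg_norm_le _ _ _ _ _ _ _ (fun k => k.+1%:R^-1)); last exact: cvg_harmonic.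
  by near=> k; rewrite distrC; case: (thP k).
have thwd k : wd (toL2 (th k)) (toL2 (derive1 (th k))) by apply: wd_test; case: (thP k).
have dist j k : `|toL2 (th j) - toL2 (th k)| <= `|m j - m k|.
  rewrite -ler_sqr ?nnegrE//.
  have -> : m j - m k = toL2 (th j) - toL2 (th k) +
      s *: (toL2 (derive1 (th j)) - toL2 (derive1 (th k))).
    by rewrite /m opprD addrACA scalerBr.
  by rewrite (wd_norm s1 (wdB (thwd j) (thwd k))) lerDl sqr_ge0.
have [z thz] : exists z : L2 R, toL2 (th k) @[k --> \oo] --> z.
  apply: L2_complete => e e0; have e20 : 0 < e / 2 by rewrite divr_gt0.
  move/cvgrPdist_le: mu => /(_ _ e20)[N _ NP]; exists N => j k Nj Nk.
  rewrite (le_trans (dist j k))// (le_trans (ler_distD u _ _))// [leRHS](splitr e) lerD//.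
    by rewrite distrC; exact: NP.
  exact: NP.
have thz' : toL2 (derive1 (th k)) @[k --> \oo] --> s *: (u - z).
  have -> : (fun k => toL2 (derive1 (th k))) = (fun k => s *: (m k - toL2 (th k))).
    by apply/funext => k; rewrite /m addrAC subrr add0r scalerA -expr2 s1 scale1r.
  by apply: cvgZl_tmp; exact: cvgB.
exists z, th; split => //; first exact: wd_lim thz thz'.
by move=> k; case: (thP k).
Unshelve. all: by end_near. Qed.

Lemma wd_eq0 (s : R) w : s ^+ 2 = 1 -> wd w (- (s *: w)) -> w = 0.
Proof.
move=> s1 ww; have := wd_skew ww; rewrite dotNr dotZr dot_normE => /eqP.
rewrite oppr_eq0 mulf_eq0 sqrf_eq0 normr_eq0.
by case/orP => [/eqP s0|/eqP//]; move: s1; rewrite s0 expr0n/= => /eqP; rewrite eq_sym oner_eq0.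
Qed.

(** phi(x)^2 is the integral of 2 phi phi' from a point to the left of the support; Cauchy-Schwarz
    bounds it. *)
Lemma test_sup phi x : test_function phi ->
  phi x ^+ 2 <= 2 * `|toL2 phi| * `|toL2 (derive1 phi)|.
Proof.
move=> tphi; have tphi1 := test_function_derive1 tphi.
have [_ [M [_ M0 _ sM]]] := test_support tphi.
pose a := Num.min (x - 1) (- M - 1).
have ax : a < x by rewrite gt_min; apply/orP; left; lra.
have pa : phi a = 0.
  apply: sM; rewrite -normrN (lt_le_trans _ (ler_norm _))// ltrNr gt_min.
  by apply/orP; right; lra.
pose F (y : R) := phi y ^+ 2; pose f (y : R) := 2 * (phi y * derive1 phi y).
have dF (y : R) : is_derive y 1 F (f y).
  have dp : is_derive y 1 phi (derive1 phi y) by exact/derivable_is_derive/test_derivable.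
  have := is_deriveM dp dp; rewrite (_ : phi * phi = F); last by apply/funext => t; rewrite /F expr2.
  by congr is_derive; rewrite /f /GRing.scale/=; ring.
have cF : continuous F by apply: derivable_continuous => y; case: (dF y).
have cf : continuous f.
  move=> y; apply: cvgMl_tmp; apply: cvgM; [exact: (test_continuous tphi)|exact: (test_continuous tphi1)].
have c1 : {within `[a, x], continuous f} by exact: continuous_subspaceT.
have c2 : derivable_oo_LRcontinuous F a x.
  split; first by move=> y _; case: (dF y).
  + by apply: cvg_at_right_filter; exact: cF.
  + by apply: cvg_at_left_filter; exact: cF.
have c3 : {in `]a, x[, derive1 F =1 f} by move=> y _; exact: is_derive_derive1.
have := continuous_FTC2 ax c1 c2 c3.
rewrite {2}/F pa expr0n/= sube0 => E.
have mf : measurable_fun setT f by exact: continuous_measurable_fun.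
have aL : inL2 (fun y => `|phi y|).
  apply: (inL2_le _ (test_inL2 tphi)); last by apply: aeW => y; rewrite normr_id.
  by apply: measurableT_comp => //; exact: inL2_measurable (test_inL2 tphi).
have aL1 : inL2 (fun y => `|derive1 phi y|).
  apply: (inL2_le _ (test_inL2 tphi1)); last by apply: aeW => y; rewrite normr_id.
  by apply: measurableT_comp => //; exact: inL2_measurable (test_inL2 tphi1).
have n1 : `|toL2 (fun y => `|phi y|)| <= `|toL2 phi|.
  apply: normL2_le; apply: filterS2 (toL2_ae aL) (toL2_ae (test_inL2 tphi)) => y -> ->.
  by rewrite normr_id.
have n2 : `|toL2 (fun y => `|derive1 phi y|)| <= `|toL2 (derive1 phi)|.
  apply: normL2_le; apply: filterS2 (toL2_ae aL1) (toL2_ae (test_inL2 tphi1)) => y -> ->.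
  by rewrite normr_id.
apply: (@le_trans _ _ (2 * dot (toL2 (fun y => `|phi y|)) (toL2 (fun y => `|derive1 phi y|)))); last first.
  rewrite -mulrA ler_wpM2l// (le_trans (ler_norm _))// (le_trans (dot_le _ _))//.
  by rewrite ler_pM.
rewrite (@dotE _ _ _ (fun y => `|phi y|) (fun y => `|derive1 phi y|)); last 4 first.
- exact: inL2_measurable.
- exact: inL2_measurable.
- exact: toL2_ae.
- exact: toL2_ae.
rewrite -lee_fin -/(F x) -E EFinM /Rintegral fineK; last first.
  exact: integrable_fin_num (integrable_mul aL aL1).
rewrite -ge0_integralZl//; last first.
  by apply/measurable_EFinP; apply: measurable_funM; exact: inL2_measurable.
apply: le_trans (lee_abs _) _; apply: le_trans (le_abse_integral _ _ _) _ => //.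
  by apply/measurable_EFinP; exact: measurable_funTS.
apply: (@le_trans _ _ (\int[leb]_(y in `[a, x]) (2%:E * (`|phi y| * `|derive1 phi y|)%:E))%E).
  apply: ge0_le_integral => //.
  - by apply/measurable_EFinP; apply: measurableT_comp => //; exact: measurable_funTS.
  - apply/measurable_EFinP; apply: measurable_funM => //.
    by apply: measurable_funTS; apply: measurable_funM; exact: inL2_measurable.
  - by move=> y _; rewrite abse_EFin -EFinM lee_fin /f !normrM (ger0_norm (ler0n _ _)).
apply: ge0_subset_integral => //.
apply/measurable_EFinP; apply: measurable_funM => //.
by apply: measurable_funM; exact: inL2_measurable.
Qed.

(** f solves z + z' = f + f', so [resolvent_approx] yields test functions converging to f together
    with their derivatives. As the inequality is strict, it eventually holds for them, and
    [test_sup] applies. *)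
Lemma wd_sup (f f' : L2 R) (B : R) : wd f f' -> 0 <= B -> 2 * `|f| * `|f'| < B ^+ 2 -> ae_bdd f B.
Proof.
move=> ff' B0 fB; have s1 : 1 ^+ 2 = 1 :> R by rewrite expr1n.
have [z [th [zz' tth thz thz']]] := resolvent_approx (f + f') s1.
rewrite scale1r in zz' thz'.
have zf : z = f.
  apply/eqP; rewrite -subr_eq0; apply/eqP; apply: (wd_eq0 s1); rewrite scale1r.
  have := wdB zz' ff'; congr weak_derivative.
  by rewrite opprB addrAC addrK.
subst z; move: thz'; rewrite addrAC subrr add0r => thz'.
have : 2 * `|toL2 (th n)| * `|toL2 (derive1 (th n))| @[n --> \oo] --> 2 * `|f| * `|f'|.
  by apply: cvgM; [apply: cvgMl_tmp|]; exact: cvg_norm.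
move/cvgr_lt => /(_ _ fB)[N _ NP].
apply: (@ae_bdd_lim _ (fun n => toL2 (th (n + N)%N))).
  move=> n; apply: filterS (toL2_ae (test_inL2 (tth (n + N)%N))) => x ->.
  rewrite -ler_sqr ?nnegrE// real_normK ?num_real//.
  by rewrite (le_trans (test_sup _ (tth _)))// ltW// NP//= leq_addl.
by rewrite (cvg_shiftn N (fun n => toL2 (th n))).
Qed.

(* [Aop] is the inverse of [1 + d/dx]. *)
Definition Aop u : L2 R := xget 0 [set z | wd z (u - z)].

Lemma AopP u : wd (Aop u) (u - Aop u).
Proof.
rewrite /Aop; case: xgetP => [z _ //|/= H].
have s1 : 1 ^+ 2 = 1 :> R by rewrite expr1n.
have [z [th [zz' _ _ _]]] := resolvent_approx u s1; rewrite scale1r in zz'.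
by have := H z zz'.
Qed.

Lemma Aop_uniq u z : wd z (u - z) -> Aop u = z.
Proof.
move=> uz; have s1 : 1 ^+ 2 = 1 :> R by rewrite expr1n.
apply/eqP; rewrite -subr_eq0; apply/eqP; apply: (wd_eq0 s1); rewrite scale1r.
have := wdB (AopP u) uz; congr weak_derivative.
by rewrite !opprB addrC addrA subrK.
Qed.

Lemma AopD u v : Aop (u + v) = Aop u + Aop v.
Proof.
apply: Aop_uniq; have := wdD (AopP u) (AopP v); congr weak_derivative.
by rewrite addrACA opprD.
Qed.

Lemma AopZ (a : R) u : Aop (a *: u) = a *: Aop u.
Proof.
by apply: Aop_uniq; have := wdZ a (AopP u); congr weak_derivative; rewrite scalerBr.
Qed.

Lemma AopN u : Aop (- u) = - Aop u.
Proof. by rewrite -scaleN1r AopZ scaleN1r. Qed.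

Lemma AopB u v : Aop (u - v) = Aop u - Aop v.
Proof. by rewrite AopD AopN. Qed.

Lemma norm_Aop u : `|Aop u| <= `|u|.
Proof.
have s1 : 1 ^+ 2 = 1 :> R by rewrite expr1n.
have := wd_norm s1 (AopP u); rewrite scale1r addrC subrK => E.
by rewrite -ler_sqr ?nnegrE// E lerDl sqr_ge0.
Qed.

(** Trades a derivative under [Aop] for terms of order 0. *)
Lemma Aop_wd (g g' : L2 R) : wd g g' -> Aop g' = g - Aop g.
Proof.
move=> gg'; apply: Aop_uniq; have := wdB gg' (AopP g); congr weak_derivative.
Qed.

(* The adjoint of [Aop] maps L2 into H1, so [Aop u] is controlled by the action of u on H1. *)
Lemma Aop_dual u (C : R) : 0 <= C ->
  (forall v v' (N : R), wd v v' -> `|v| <= N -> `|v'| <= N -> `|dot u v| <= C * N) ->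
  `|Aop u| <= C.
Proof.
move=> C0 H; set z := Aop u.
have s1 : (-1) ^+ 2 = 1 :> R by rewrite sqrrN expr1n.
have [v [_ [vv' _ _ _]]] := resolvent_approx z s1; rewrite scaleN1r opprB in vv'.
have := wd_norm s1 vv'; rewrite scaleN1r opprB addrC subrK => E.
have vz : `|v| <= `|z| by rewrite -ler_sqr ?nnegrE// E lerDl sqr_ge0.
have v'z : `|v - z| <= `|z| by rewrite -ler_sqr ?nnegrE// E lerDr sqr_ge0.
have := H v (v - z) _ vv' vz v'z.
have -> : dot u v = `|z| ^+ 2.
  rewrite -dot_normE -[u in LHS](subrK z) dotDl (wd_ibp (AopP u) vv') -/z dotBr.
  by rewrite opprB subrK.
rewrite ger0_norm ?sqr_ge0// expr2; have [->//|z0] := eqVneq `|z| 0.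
by rewrite ler_pM2r// lt_neqAle eq_sym z0 normr_ge0.
Qed.

End resolvent.

(** * Energy estimates and smoothing *)

Section energy.
Context {R : realType}.
Local Notation leb := (@lebesgue_measure R).
Local Notation wd := (@weak_derivative R).
Implicit Types (f g phi : R -> R) (u v w : L2 R).

Lemma dot_mulL2_ge g (k K : R) u : bddfun g K -> (forall x, k <= g x) ->
  k * `|u| ^+ 2 <= dot (mulL2 g u) u.
Proof.
move=> bg kg; have mg : measurable_fun setT g by case: bg.
rewrite -dot_normE -dotZl -subr_ge0 -dotBl.
rewrite (@dotE _ _ _ (fun x => (g x - k) * u x) u)//; last 3 first.
- exact: (measurable_funM (measurable_funB mg (measurable_cst k)) (measurable_L2 u)).
- near=> x; rewrite (near (L2B_ae _ _) x)// (near (mulL2_ae u bg) x)//.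
  by rewrite (near (L2Z_ae k u) x)// mulrBl.
- exact: aeW.
apply: Rintegral_ge0 => x _ /=.
by rewrite -mulrA mulr_ge0 ?subr_ge0// -expr2 sqr_ge0.
Unshelve. all: by end_near. Qed.

(** Here a and b are the two squared norms, d and e bounds for their time derivatives, and kt = k (t
    - s) the weight of b. Differentiating the weight produces k b, which the dissipation of a
    absorbs. *)
Lemma energy_combine (a b k kt C d e : R) : 0 <= kt -> d + k * b <= C * a -> e <= C * b ->
  d + (kt * e + b * (k * 1)) <= C * (a + kt * b).
Proof.
move=> kt0 h1 h2; have h3 := ler_wpM2l kt0 h2.
have -> : C * (a + kt * b) = C * a + kt * (C * b) by ring.
by rewrite mulr1 addrCA addrC (mulrC b) lerD.
Qed.

(** The arithmetic of [energy_Hm1], with x = |u| and y = |Aop u|. Each name stands for the inner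
    product of a vector with [Aop u]: [a1u] for a' u, [Aa1u] for its image under [Aop], and so on;
    only [auu] pairs a u with u itself. Eliminating the unknowns, AX - AY is - auu plus nine terms
    of size at most K x y. Doubled, they make 18 K x y, and completing the square (9 K y - k x)^2
    gives 81. *)
Lemma energy_scalar (k K x y Aau a1u Aa1u Aa2u bu Abu Ab1u auu au au1 Aau1 Aa1u1 AX AY : R) :
  0 < k -> `|Aau| <= K * (x * y) -> `|a1u| <= K * (x * y) -> `|Aa1u| <= K * (x * y) ->
  `|Aa2u| <= K * (x * y) -> `|bu| <= K * (x * y) -> `|Abu| <= K * (x * y) ->
  `|Ab1u| <= K * (x * y) -> k * x ^+ 2 <= auu ->
  a1u + au1 = - (auu - au) -> Aa1u + Aau1 = au - Aau -> Aa1u1 + AX = au1 - Aau1 ->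
  Aa2u + Aa1u1 = a1u - Aa1u -> Ab1u + AY = bu - Abu ->
  (2 * (AX - AY) + k * x ^+ 2) * k <= 81 * K ^+ 2 * y ^+ 2.
Proof.
move=> k0 /ler_normlP[? ?] /ler_normlP[? ?] /ler_normlP[? ?] /ler_normlP[? ?].
move=> /ler_normlP[? ?] /ler_normlP[? ?] /ler_normlP[? ?] ? ? ? ? ? ?.
have sq : 0 <= (9 * K * y - k * x) ^+ 2 by exact: sqr_ge0.
have H : 2 * (AX - AY) + k * x ^+ 2 <= 18 * (K * (x * y)) - k * x ^+ 2 by lra.
have {}H := ler_wpM2r (ltW k0) H; apply: (le_trans H).
have -> : (18 * (K * (x * y)) - k * x ^+ 2) * k =
  81 * K ^+ 2 * y ^+ 2 - (9 * K * y - k * x) ^+ 2 by ring.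
by rewrite lerBlDr lerDl.
Qed.

Section fixed_time.
Variables (k K : R) (a b : R -> R).
Hypotheses (k0 : 0 < k) (na : nice a K) (na' : nice (derive1 a) K) (nb : nice b K)
  (ka : forall x, k <= a x).
Variables (u u' u'' : L2 R).
Hypotheses (uu' : wd u u') (u'u'' : wd u' u'').

Let g := mulL2 a u'' - mulL2 b u'.

Let K0 : 0 <= K.
Proof. by case: na => _ /(_ 0) H _; exact: le_trans H. Qed.

Let dmul f v w : bddfun f K -> `|dot (mulL2 f v) w| <= K * (`|v| * `|w|).
Proof.
move=> bf; rewrite (le_trans (dot_le _ _))// mulrA ler_wpM2r//.
exact: norm_mulL2.
Qed.

Let dA f v w : bddfun f K -> `|dot (Aop (mulL2 f v)) w| <= K * (`|v| * `|w|).
Proof.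
move=> bf; rewrite (le_trans (dot_le _ _))// mulrA ler_wpM2r//.
by rewrite (le_trans (norm_Aop _))//; exact: norm_mulL2.
Qed.

(** Integration by parts turns the leading term into - dot (a u') u' plus a term with a';
    ellipticity and the square (2 K |u| - k |u'|)^2 absorb the rest. *)
Lemma energy_L2 : 2 * dot g u + k * `|u'| ^+ 2 <= 4 * K ^+ 2 / k * `|u| ^+ 2.
Proof.
have E : dot g u = - dot (mulL2 (derive1 a) u) u' - dot (mulL2 a u') u' - dot (mulL2 b u') u.
  rewrite /g dotBl (dot_mulL2 _ _ (nice_bdd na)) (wd_ibp u'u'' (wd_mul na uu')) dotDr.
  by rewrite !(dotC u') opprD.
have h1 := dmul u u' (nice_bdd' na); have h2 := dmul u' u (nice_bdd nb).
have h3 := dot_mulL2_ge u' (nice_bdd na) ka.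
rewrite E mulrAC ler_pdivlMr//.
move: h1 h2; rewrite !ler_norml => /andP[h1 _] /andP[h2 _].
have x0 := normr_ge0 u; have y0 := normr_ge0 u'.
have sq : 0 <= (2 * K * `|u| - k * `|u'|) ^+ 2 by exact: sqr_ge0.
set x := `|u| in h1 h2 h3 x0 sq *; set y := `|u'| in h1 h2 h3 y0 sq *.
set d1 := dot _ _ in h1 *; set d2 := dot (mulL2 b _) _ in h2 *; set d3 := dot (mulL2 a _) _ in h3 *.
have : (2 * (- d1 - d3 - d2) + k * y ^+ 2) <= 4 * (K * (x * y)) - k * y ^+ 2 by lra.
move=> /(ler_wpM2r (ltW k0)); nra.
Qed.

(** After integration by parts, -2 dot g u'' is the time derivative of |u'|^2 when u' = g in time.
    The constant 4 is the one of [energy_L2], for uniformity. *)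
Lemma energy_H1 : - 2 * dot g u'' <= 4 * K ^+ 2 / k * `|u'| ^+ 2.
Proof.
have h2 := dmul u' u'' (nice_bdd nb).
have h3 := dot_mulL2_ge u'' (nice_bdd na) ka.
rewrite /g dotBl mulrAC ler_pdivlMr//.
move: h2; rewrite !ler_norml => /andP[_ h2].
have sq : 0 <= (K * `|u'| - k * `|u''|) ^+ 2 by exact: sqr_ge0.
have s2 : 0 <= (k * `|u''|) ^+ 2 by exact: sqr_ge0.
have s3 : 0 <= (K * `|u'|) ^+ 2 by exact: sqr_ge0.
set x := `|u'| in h2 h3 sq s3 *; set y := `|u''| in h2 h3 sq s2 *.
set d2 := dot (mulL2 b _) _ in h2 *; set d3 := dot (mulL2 a _) _ in h3 *.
have : -2 * (d3 - d2) <= -2 * (k * y ^+ 2) + 2 * (K * (x * y)) by lra.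
move=> /(ler_wpM2r (ltW k0)); nra.
Qed.

(** By the Leibniz rule a u'' and b u' are derivatives of products up to terms with fewer
    derivatives of u, and [Aop_wd] removes the outer derivatives. This costs a', a'' and b', and
    leaves - dot (a u) u as the dissipative term. *)
Lemma energy_Hm1 : 2 * dot (Aop g) (Aop u) + k * `|u| ^+ 2 <= 81 * K ^+ 2 / k * `|Aop u| ^+ 2.
Proof.
set z := Aop u.
have wau := wd_mul na uu'; have wau' := wd_mul na u'u''.
have wa'u := wd_mul na' uu'; have wbu := wd_mul nb uu'.
have E1 := Aop_wd wau; have E2 := Aop_wd wau'; have E3 := Aop_wd wa'u; have E4 := Aop_wd wbu.
rewrite AopD in E1; rewrite AopD in E2; rewrite AopD in E3; rewrite AopD in E4.
have P : dot (mulL2 (derive1 a) u + mulL2 a u') z = - dot (mulL2 a u) (u - z).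
  by rewrite (wd_ibp wau (AopP u)).
rewrite dotDl in P.
set au := mulL2 a u in E1 P *; set au1 := mulL2 a u' in E1 E2 P *.
set a1u := mulL2 (derive1 a) u in E1 E3 P *; set a1u1 := mulL2 (derive1 a) u' in E2 E3 *.
set a2u := mulL2 (derive1 (derive1 a)) u in E3 *; set bu := mulL2 b u in E4 *.
set b1u := mulL2 (derive1 b) u in E4 *.
have h1 := dA u z (nice_bdd na); have h2 := dmul u z (nice_bdd' na).
have h3 := dA u z (nice_bdd' na); have h4 := dA u z (nice_bdd' na').
have h5 := dmul u z (nice_bdd nb); have h6 := dA u z (nice_bdd nb).
have h7 := dA u z (nice_bdd' nb).
have h8 := dot_mulL2_ge u (nice_bdd na) ka.
rewrite -/au -/a1u -/a2u -/bu -/b1u in h1 h2 h3 h4 h5 h6 h7 h8.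
rewrite /g AopB; set X := mulL2 a u'' in E2 *; set Y := mulL2 b u' in E4 *.
clearbody z au au1 a1u a1u1 a2u bu b1u X Y; clear wau wau' wa'u wbu g dmul dA.
have D (p q r t : L2 R) : p + q = r - t -> dot p z + dot q z = dot r z - dot t z.
  by move=> e; rewrite -dotDl e dotBl.
have D1 := D _ _ _ _ E1; have D2 := D _ _ _ _ E2; have D3 := D _ _ _ _ E3; have D4 := D _ _ _ _ E4.
rewrite (dotBr au) in P.
rewrite dotBl mulrAC ler_pdivlMr//.
exact: (energy_scalar k0 h1 h2 h3 h4 h5 h6 h7 h8 P D1 D2 D3 D4).
Qed.

End fixed_time.

Definition tderiv (f : R -> L2 R) (t : R) (l : L2 R) :=
  h^-1 *: (f (t + h) - f t) @[h --> 0^'] --> l.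

Lemma dot_cvg2 (T : Type) (F : set_system T) {FF : Filter F} (a b : T -> L2 R) u v :
  a t @[t --> F] --> u -> b t @[t --> F] --> v -> dot (a t) (b t) @[t --> F] --> dot u v.
Proof.
move=> /cvg_normP au /cvg_normP bv.
apply: (@cvg_norm_le _ _ _ _ _ _ _
  (fun t => `|a t - u| * `|b t - v| + (`|a t - u| * `|v| + `|u| * `|b t - v|))).
  near=> t.
  have -> : dot (a t) (b t) - dot u v =
      dot (a t - u) (b t - v) + (dot (a t - u) v + dot u (b t - v)).
    by rewrite !(dotBl, dotBr); ring.
  rewrite (le_trans (ler_normD _ _))// lerD ?dot_le//.
  by rewrite (le_trans (ler_normD _ _))// lerD ?dot_le.
have -> : (0 : R) = 0 * 0 + (0 * `|v| + `|u| * 0) by rewrite !(mul0r, mulr0) !addr0.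
by apply: cvgD; [exact: cvgM|apply: cvgD; [exact: cvgMr_tmp|exact: cvgMl_tmp]].
Unshelve. all: by end_near. Qed.

Lemma tderiv_cvg (f : R -> L2 R) t l : tderiv f t l -> f (t + h) @[h --> 0^'] --> f t.
Proof.
move=> ft; rewrite -[X in _ --> X]addr0 -(scale0r l).
have : f t + h *: (h^-1 *: (f (t + h) - f t)) @[h --> 0^'] --> f t + 0 *: l.
  by apply: cvgD; [exact: cvg_cst|apply: cvgZ => //; exact: nbhs_dnbhs].
apply: cvg_trans; apply: near_eq_cvg; near=> h.
have h0 : h != 0 by near: h; exact: nbhs_dnbhs_neq.
by rewrite scalerA divff// scale1r addrC subrK.
Unshelve. all: by end_near. Qed.

Lemma is_derive_shift (f : R -> R) (t l : R) :
  h^-1 * (f (t + h) - f t) @[h --> 0^'] --> l -> is_derive t 1 f l.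
Proof.
move=> fl; have lim : h^-1 *: ((f \o shift t) (h *: 1) - f t) @[h --> 0^'] --> l.
  apply: cvg_trans fl; apply: near_eq_cvg; near=> h.
  by rewrite /= /GRing.scale/= mulr1 [h + t]addrC.
split; first by apply/cvg_ex; exists l.
exact: cvg_lim lim.
Unshelve. all: by end_near. Qed.

Lemma derive_normL2_sq (f : R -> L2 R) (t : R) l : tderiv f t l ->
  is_derive t 1 (fun t => `|f t| ^+ 2) (2 * dot l (f t)).
Proof.
move=> ft; apply: is_derive_shift.
have H := dot_cvg2 ft (cvgD (tderiv_cvg ft) (cvg_cst (f t))).
have {}H : dot (h^-1 *: (f (t + h) - f t)) (f (t + h) + f t) @[h --> 0^'] --> dot l (f t + f t).
  exact: H.
rewrite dotDr -mulr2n -mulr_natl in H.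
apply: cvg_trans H; apply: near_eq_cvg; near=> h.
rewrite dotZl -!dot_normE !(dotBl, dotDr) (dotC (f t) (f (t + h))); ring.
Unshelve. all: by end_near. Qed.

(** f1 need not be differentiable in time. Integrating by parts, |f1 (t + h)|^2 - |f1 t|^2 is minus
    the inner product of f (t + h) - f t with f2 (t + h) + f2 t, where only f is differentiated and
    f2 need only be continuous. *)
Lemma derive_norm_wd_sq (f f1 f2 : R -> L2 R) (t : R) l :
  (forall s, wd (f s) (f1 s)) -> (forall s, wd (f1 s) (f2 s)) ->
  tderiv f t l -> f2 (t + h) @[h --> 0^'] --> f2 t ->
  is_derive t 1 (fun t => `|f1 t| ^+ 2) (- 2 * dot l (f2 t)).
Proof.
move=> w1 w2 ft ct; apply: is_derive_shift.
have H : dot (h^-1 *: (f (t + h) - f t)) (f2 (t + h) + f2 t) @[h --> 0^'] --> dot l (f2 t + f2 t).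
  apply: (dot_cvg2 ft); apply: cvgD => //; exact: cvg_cst.
rewrite dotDr -mulr2n -mulr_natl in H.
have {}H : - dot (h^-1 *: (f (t + h) - f t)) (f2 (t + h) + f2 t) @[h --> 0^'] --> - (2 * dot l (f2 t)).
  exact: cvgN.
rewrite mulNr; apply: cvg_trans H; apply: near_eq_cvg; near=> h.
have sw r s : dot (f r) (f2 s) = - dot (f1 r) (f1 s).
  by rewrite (wd_ibp (w1 r) (w2 s)) opprK.
rewrite /= dotZl -!dot_normE !(dotBl, dotDr) !sw (dotC (f1 t) (f1 (t + h))); ring.
Unshelve. all: by end_near. Qed.

Lemma gronwall_diff (L L' : R -> R) (s T C : R) : s < T ->
  (forall t, t \in `]s, T[ -> is_derive t 1 L (L' t)) ->
  (forall t, t \in `]s, T[ -> L' t <= C * L t) ->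
  {within `[s, T], continuous L} -> L T <= expR (C * (T - s)) * L s.
Proof.
move=> sT dL LC cL.
pose M t := expR (- C * t) * L t.
have dM t : t \in `]s, T[ -> is_derive t 1 M (expR (- C * t) * L' t + L t * (expR (- C * t) * - C)).
  move=> ts; have d1 : is_derive t 1 (fun t => expR (- C * t)) (expR (- C * t) * - C).
    have dlin : is_derive t 1 (fun t : R => - C * t) (- C).
      by rewrite -[X in is_derive _ _ _ X]mulr1; exact: is_deriveZ.
    exact: (@is_derive1_comp _ expR (fun t => - C * t)).
  exact: (is_deriveM d1 (dL t ts)).
have cM : {within `[s, T], continuous M}.
  have ce : {within `[s, T], continuous (fun t => expR (- C * t))}.
    apply: continuous_subspaceT => t; apply: continuous_comp; last exact: continuous_expR.
    exact: mulrl_continuous.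
  by move=> t; apply: cvgM; [exact: ce|exact: cL].
have [c cin] := MVT sT dM cM.
have e0 := expR_gt0 (- C * c); have LCc := LC c cin => E.
have : M T <= M s.
  rewrite -subr_le0 E pmulr_lle0 ?subr_gt0//; nra.
rewrite /M -(ler_pM2l (expR_gt0 (C * T))) !mulrA -!expRD.
by rewrite mulNr subrr expR0 mul1r mulrBr mulNr.
Qed.

(** * Smoothing by the evolution operators *)

Section evolution_estimates.
Variables (k K : R) (al be : R -> R -> R) (G : R -> L2 R -> L2 R) (U : R -> R -> L2 R -> L2 R).
Hypotheses (k0 : 0 < k)
  (na : forall t, 0 <= t -> nice (al^~ t) K)
  (na' : forall t, 0 <= t -> nice (derive1 (al^~ t)) K)
  (nb : forall t, 0 <= t -> nice (be^~ t) K)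
  (ka : forall t x, 0 <= t -> k <= al x t)
  (GE : forall t u u' u'', 0 <= t -> wd u u' -> wd u' u'' ->
     - G t u = mulL2 (al^~ t) u'' - mulL2 (be^~ t) u')
  (evol : evolution_operator G U).

(** The largest constant of the three energy inequalities, so that one exponential rate serves both
    functionals. *)
Let C := 81 * K ^+ 2 / k.
Let C0 : 0 <= C. Proof. by apply: divr_ge0; [apply: mulr_ge0; [|exact: sqr_ge0]|exact: ltW]. Qed.
Let C4 : 4 * K ^+ 2 / k <= C.
Proof. rewrite /C ler_pM2r ?invr_gt0//; have := sqr_ge0 K; lra. Qed.

Lemma inH2_wd u : inH2 u -> wd u (wderiv u) /\ wd (wderiv u) (wderiv (wderiv u)).
Proof. by move=> [u' [u'' [w1 w2]]]; rewrite (wderivE w1) (wderivE w2). Qed.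

Section orbit.
Variables (s : R) (psi : L2 R).
Hypotheses (s0 : 0 <= s) (psi2 : inH2 psi).

(* constant for t <= s, so as to be continuous on the whole line *)
Let u t := U (Num.max s t) s psi.
Let u1 t := wderiv (u t).
Let u2 t := wderiv (u1 t).

Let uH2 t : inH2 (u t).
Proof. by apply: (evol_H2 evol) => //; rewrite s0 le_max lexx. Qed.

Let w1 t : wd (u t) (u1 t). Proof. exact: (inH2_wd (uH2 t)).1. Qed.
Let w2 t : wd (u1 t) (u2 t). Proof. exact: (inH2_wd (uH2 t)).2. Qed.

Let cH2 t : s <= t -> H2norm (u r - u t) @[r --> t] --> 0.
Proof.
move=> st; have st' : time_triangle (t, s) by rewrite /time_triangle/= s0.
have := evol_H2_continuous evol psi2 st'.
have cmax : Num.max s r @[r --> t] --> t.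
  apply: (@cvg_norm_le _ _ _ _ _ _ _ (fun r => `|r - t|)); last first.
    have H0 : r @[r --> t] --> t by exact: cvg_id.
    by have /cvg_normP := H0.
  near=> r; case: (leP s r) => // rs.
  by rewrite (ler0_norm (_ : s - t <= 0)) ?subr_le0// ler0_norm ?opprB ?lerD2l ?lerN2 ?(ltW rs)// subr_le0 (le_trans (ltW rs)).
move=> H.
have cp : (Num.max s r, s) @[r --> t] --> ((t, s) : R * R).
  exact: (cvg_pair cmax (@cvg_cst _ s _ (nbhs t) _)).
move=> A /H HA.
have {}HA : \forall x \near ((t, s) : R * R), time_triangle x ->
    A (H2norm (U x.1 x.2 psi - U t s psi)) by exact: HA.
have : \forall r \near t, A (H2norm (u r - u t)).
  have H1 : \forall r \near t, time_triangle (Num.max s r, s) ->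
    A (H2norm (U (Num.max s r) s psi - U t s psi)) by exact: (cp _ HA).
  apply: filterS H1 => r; rewrite /u (max_r st); apply.
  by rewrite /time_triangle/= s0 le_max lexx.
by [].
Unshelve. all: by end_near. Qed.

Let sqrt3 (x y z : R) : 0 <= x -> 0 <= y -> 0 <= z ->
  [/\ x <= Num.sqrt (x ^+ 2 + y ^+ 2 + z ^+ 2), y <= Num.sqrt (x ^+ 2 + y ^+ 2 + z ^+ 2)
    & z <= Num.sqrt (x ^+ 2 + y ^+ 2 + z ^+ 2)].
Proof.
move=> x0 y0 z0.
have sq (a b : R) : 0 <= a -> a ^+ 2 <= b -> a <= Num.sqrt b.
  by move=> a0 ab; rewrite -(ger0_norm a0) -sqrtr_sqr ler_wsqrtr.
have s1 := sqr_ge0 x; have s2 := sqr_ge0 y; have s3 := sqr_ge0 z.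
by split; apply: sq => //; lra.
Qed.

Let dnorms r t : [/\ `|u r - u t| <= H2norm (u r - u t), `|u1 r - u1 t| <= H2norm (u r - u t)
  & `|u2 r - u2 t| <= H2norm (u r - u t)].
Proof.
have wr := wdB (w1 r) (w1 t); have wr2 := wdB (w2 r) (w2 t).
rewrite /H2norm (wderivE wr) (wderivE wr2).
exact: sqrt3.
Qed.

Let cu t : s <= t -> [/\ u r @[r --> t] --> u t, u1 r @[r --> t] --> u1 t
  & u2 r @[r --> t] --> u2 t].
Proof.
move=> st; have H := cH2 st.
by split; apply: (cvg_norm_le _ H); near=> r; have [] := dnorms r t.
Unshelve. all: by end_near. Qed.

Let cvg_shift0 (V : normedModType R) (f : R -> V) t : f r @[r --> t] --> f t ->
  f (t + h) @[h --> 0^'] --> f t.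
Proof.
move=> ft; have : t + h @[h --> 0^'] --> t.
  rewrite -[X in _ --> X]addr0; apply: cvgD; first exact: cvg_cst.
  exact: nbhs_dnbhs.
by move/cvg_comp; apply.
Qed.

Let g t := - G t (u t).

Let du t : s < t -> tderiv u t (g t).
Proof.
move=> st; have st' : 0 <= s <= t by rewrite s0 ltW.
have := evol_derive_t evol st' psi2; rewrite /is_derive_in /diff_quotient_in => H.
rewrite /tderiv /g /u (max_r (ltW st)).
have near_st : \forall h \near (0 : R)^', s <= t + h.
  have ts0 : 0 < t - s by rewrite subr_gt0.
  apply: filterS (near0_norm_lt ts0) => h; rewrite ltr_norml => /andP[h1 _]; lra.
move=> A /H HA.
have {}HA : \forall h \near (0 : R)^', s <= t + h -> A (h^-1 *: (U (t + h) s psi - U t s psi)).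
  have {}HA : \forall h \near (0 : R)^', `[s, +oo[%classic (t + h) ->
      A (h^-1 *: (U (t + h) s psi - U t s psi)) by exact: HA.
  by apply: filterS HA => h H1 sth; apply: H1; rewrite /= in_itv/= sth.
have : \forall h \near (0 : R)^', A (h^-1 *: (U (Num.max s (t + h)) s psi - U t s psi)).
  by apply: filterS2 near_st HA => h sth; rewrite (max_r sth); apply.
by [].
Qed.

Let gE t : s <= t -> g t = mulL2 (al^~ t) (u2 t) - mulL2 (be^~ t) (u1 t).
Proof. by move=> st; apply: GE => //; exact: le_trans st. Qed.

Let itv_st T t : t \in `]s, T[ -> s < t.
Proof. by rewrite in_itv/= => /andP[]. Qed.

(** The weight of |u'|^2 vanishes at time s, so the initial energy involves |psi| alone. *)
Lemma smoothing_H1 T : s < T ->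
  `|U T s psi| ^+ 2 + k * (T - s) * `|wderiv (U T s psi)| ^+ 2 <= expR (C * (T - s)) * `|psi| ^+ 2.
Proof.
move=> sT; have uT : u T = U T s psi by rewrite /u (max_r (ltW sT)).
have us : u s = psi by rewrite /u maxxx (evol_id evol).
pose L t := `|u t| ^+ 2 + k * (t - s) * `|u1 t| ^+ 2.
pose L' t := 2 * dot (g t) (u t) + (k * (t - s) * (- 2 * dot (g t) (u2 t)) + `|u1 t| ^+ 2 * (k * 1)).
have Ls : L s = `|psi| ^+ 2 by rewrite /L us subrr mulr0 mul0r addr0.
have LT : L T = `|U T s psi| ^+ 2 + k * (T - s) * `|wderiv (U T s psi)| ^+ 2 by rewrite /L /u1 uT.
rewrite -Ls -LT; apply: (@gronwall_diff L L' s T C sT).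
- move=> t /itv_st st; apply: is_deriveD; first exact: derive_normL2_sq (du st).
  have [_ _ c2] := cu (ltW st).
  apply: is_deriveM; last first.
    exact: derive_norm_wd_sq w1 w2 (du st) (cvg_shift0 c2).
  apply: is_deriveZ; rewrite -[X in is_derive _ _ _ X]subr0.
  exact: is_deriveB.
- move=> t /itv_st st; have t0 : 0 <= t by rewrite (le_trans s0)// ltW.
  have e1 := energy_L2 k0 (na t0) (nb t0) (fun x => ka x t0) (w1 t) (w2 t).
  have e2 := energy_H1 k0 (na t0) (nb t0) (fun x => ka x t0) (u1 t) (u2 t).
  rewrite -(gE (ltW st)) in e1 e2.
  have p0 : 0 <= k * (t - s) by apply: mulr_ge0; [exact: ltW|rewrite subr_ge0 ltW].
  have q0 (z : L2 R) : 4 * K ^+ 2 / k * `|z| ^+ 2 <= C * `|z| ^+ 2.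
    by apply: ler_wpM2r C4; exact: sqr_ge0.
  apply: energy_combine p0 (le_trans e1 (q0 _)) (le_trans e2 (q0 _)).
apply/subspace_continuousP => t; rewrite /= in_itv/= => /andP[st _].
have [c0 c1 _] := cu st.
apply: cvg_within_filter; apply: cvgD.
  by under eq_fun do rewrite -dot_normE; rewrite -dot_normE; exact: dot_cvg2.
apply: cvgM.
  by apply: cvgMl_tmp; apply: cvgB; [exact: cvg_id|exact: cvg_cst].
by under eq_fun do rewrite -dot_normE; rewrite -dot_normE; exact: dot_cvg2.
Qed.

(** The same argument one derivative lower: the initial energy is the square of |Aop psi|, the
    negative norm. *)
Lemma smoothing_L2 T : s < T ->
  k * (T - s) * `|U T s psi| ^+ 2 <= expR (C * (T - s)) * `|Aop psi| ^+ 2.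
Proof.
move=> sT; have uT : u T = U T s psi by rewrite /u (max_r (ltW sT)).
have us : u s = psi by rewrite /u maxxx (evol_id evol).
pose L t := `|Aop (u t)| ^+ 2 + k * (t - s) * `|u t| ^+ 2.
pose L' t := 2 * dot (Aop (g t)) (Aop (u t)) +
  (k * (t - s) * (2 * dot (g t) (u t)) + `|u t| ^+ 2 * (k * 1)).
have cA (T0 : Type) (F : set_system T0) (FF : Filter F) (a : T0 -> L2 R) l :
    a x @[x --> F] --> l -> Aop (a x) @[x --> F] --> Aop l.
  move=> /cvg_normP aL; apply: (cvg_norm_le _ aL).
  by near=> x; rewrite -AopB norm_Aop.
apply: (@le_trans _ _ (L T)); first by rewrite /L uT lerDr sqr_ge0.
have Ls : L s = `|Aop psi| ^+ 2 by rewrite /L us subrr mulr0 mul0r addr0.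
rewrite -Ls; apply: (@gronwall_diff L L' s T C sT).
- move=> t /itv_st st; apply: is_deriveD.
    apply: derive_normL2_sq; have H : Aop (h^-1 *: (u (t + h) - u t)) @[h --> 0^'] --> Aop (g t).
      by apply: cA; exact: du.
    have E : (fun h => Aop (h^-1 *: (u (t + h) - u t))) =
      (fun h => h^-1 *: (Aop (u (t + h)) - Aop (u t))).
      by apply/funext => h; rewrite AopZ AopB.
    by rewrite E in H.
  apply: is_deriveM; last exact: derive_normL2_sq (du st).
  apply: is_deriveZ; rewrite -[X in is_derive _ _ _ X]subr0.
  exact: is_deriveB.
- move=> t /itv_st st; have t0 : 0 <= t by rewrite (le_trans s0)// ltW.
  have e1 := energy_L2 k0 (na t0) (nb t0) (fun x => ka x t0) (w1 t) (w2 t).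
  have e2 := energy_Hm1 k0 (na t0) (na' t0) (nb t0) (fun x => ka x t0) (w1 t) (w2 t).
  rewrite -(gE (ltW st)) in e1 e2.
  have p0 : 0 <= k * (t - s) by apply: mulr_ge0; [exact: ltW|rewrite subr_ge0 ltW].
  have q0 : 4 * K ^+ 2 / k * `|u t| ^+ 2 <= C * `|u t| ^+ 2.
    by apply: ler_wpM2r C4; exact: sqr_ge0.
  have r0 : 0 <= k * `|u1 t| ^+ 2 by apply: mulr_ge0; [exact: ltW|exact: sqr_ge0].
  apply: energy_combine p0 e2 _; apply: le_trans q0; apply: le_trans e1.
  by rewrite lerDl.
apply/subspace_continuousP => t; rewrite /= in_itv/= => /andP[st _].
have [c0 c1 _] := cu st.
apply: cvg_within_filter; apply: cvgD.
  by under eq_fun do rewrite -dot_normE; rewrite -dot_normE; apply: dot_cvg2; exact: cA.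
apply: cvgM.
  by apply: cvgMl_tmp; apply: cvgB; [exact: cvg_id|exact: cvg_cst].
by under eq_fun do rewrite -dot_normE; rewrite -dot_normE; exact: dot_cvg2.
Unshelve. all: by end_near. Qed.

End orbit.

Lemma inH2_dense (psi : L2 R) : exists2 a : nat -> L2 R, (forall n, inH2 (a n)) & a n @[n --> \oo] --> psi.
Proof.
have H (n : nat) : exists v, inH2 v /\ `|v - psi| <= n.+1%:R^-1.
  have n0 : 0 < n.+1%:R^-1 :> R by rewrite invr_gt0.
  have [phi tphi up] := test_dense_L2 psi n0.
  exists (toL2 phi); split; last by rewrite distrC.
  exists (toL2 (derive1 phi)), (toL2 (derive1 (derive1 phi))).
  by split; apply: wd_test => //; exact: test_function_derive1.
have [a Ha] := choice H; exists a => [n|]; first by have [] := Ha n.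
apply: (@cvg_norm_le _ _ _ _ _ _ _ (fun n => n.+1%:R^-1)).
  by near=> n; have [] := Ha n.
exact: cvg_harmonic.
Unshelve. all: by end_near. Qed.

Let Ucvg (t s : R) (a : nat -> L2 R) psi : 0 <= s <= t -> a n @[n --> \oo] --> psi ->
  U t s (a n) @[n --> \oo] --> U t s psi.
Proof. by move=> st ap; apply: (cvg_comp _ _ ap); exact: (evol_bounded evol st). Qed.

Let sqcvg (a : nat -> L2 R) psi : a n @[n --> \oo] --> psi ->
  `|a n| ^+ 2 @[n --> \oo] --> `|psi| ^+ 2.
Proof.
by move=> ap; under eq_fun do rewrite -dot_normE; rewrite -dot_normE; exact: dot_cvg2.
Qed.

Lemma evol_norm (t s : R) psi : 0 <= s -> s < t -> `|U t s psi| ^+ 2 <= expR (C * (t - s)) * `|psi| ^+ 2.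
Proof.
move=> s0 st; have st' : 0 <= s <= t by rewrite s0 ltW.
have [a a2 ap] := inH2_dense psi.
have H1 := sqcvg (Ucvg st' ap).
have H2 : expR (C * (t - s)) * `|a n| ^+ 2 @[n --> \oo] --> expR (C * (t - s)) * `|psi| ^+ 2.
  by apply: cvgMl_tmp; exact: sqcvg.
apply: (ler_cvg_to H1 H2).
near=> n; apply: le_trans (smoothing_H1 s0 (a2 n) st); rewrite lerDl.
by apply: mulr_ge0; [apply: mulr_ge0; [exact: ltW|rewrite subr_ge0 ltW]|exact: sqr_ge0].
Unshelve. all: by end_near. Qed.

Lemma evol_dual (t s : R) psi : 0 <= s -> s < t ->
  k * (t - s) * `|U t s psi| ^+ 2 <= expR (C * (t - s)) * `|Aop psi| ^+ 2.
Proof.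
move=> s0 st; have st' : 0 <= s <= t by rewrite s0 ltW.
have [a a2 ap] := inH2_dense psi.
have Aap : Aop (a n) @[n --> \oo] --> Aop psi.
  have /cvg_normP H := ap.
  by apply: (cvg_norm_le _ H); near=> n; rewrite -AopB norm_Aop.
have H1 : k * (t - s) * `|U t s (a n)| ^+ 2 @[n --> \oo] --> k * (t - s) * `|U t s psi| ^+ 2.
  by apply: cvgMl_tmp; exact: (sqcvg (Ucvg st' ap)).
have H2 : expR (C * (t - s)) * `|Aop (a n)| ^+ 2 @[n --> \oo] --> expR (C * (t - s)) * `|Aop psi| ^+ 2.
  by apply: cvgMl_tmp; exact: sqcvg.
apply: (ler_cvg_to H1 H2).
by near=> n; exact: smoothing_L2.
Unshelve. all: by end_near. Qed.

(** On H2, the arithmetic-geometric inequality bounds 2 sqrt(k (t - s)) |u| |u'| by the energy of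
    [smoothing_H1], and [wd_sup] turns the product |u| |u'| into a sup bound. Almost everywhere
    bounds pass to L2 limits. *)
Lemma evol_sup (t s : R) psi (B : R) : 0 <= s -> s < t -> 0 <= B ->
  2 * expR (C * (t - s)) * `|psi| ^+ 2 < B ^+ 2 * Num.sqrt (k * (t - s)) ->
  ae_bdd (U t s psi) B.
Proof.
move=> s0 st B0 H; have st' : 0 <= s <= t by rewrite s0 ltW.
set E := expR _ in H; have E0 : 0 <= E by exact: expR_ge0.
have kt0 : 0 < k * (t - s) by rewrite mulr_gt0// subr_gt0.
have sk : 0 < Num.sqrt (k * (t - s)) by rewrite sqrtr_gt0.
have [a a2 ap] := inH2_dense psi.
have sm v : inH2 v -> 2 * E * `|v| ^+ 2 < B ^+ 2 * Num.sqrt (k * (t - s)) -> ae_bdd (U t s v) B.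
  move=> v2 vB; have [w1 _] := inH2_wd (evol_H2 evol st' v2).
  apply: (wd_sup w1 B0); rewrite -(ltr_pM2r sk); apply: le_lt_trans vB.
  have := smoothing_H1 s0 v2 st; rewrite -/E.
  rewrite -[X in X * `|wderiv _| ^+ 2](sqr_sqrtr (ltW kt0)).
  rewrite -[2 * E * _]mulrA.
  move: (Num.sqrt _) (`|U t s v|) (`|wderiv _|) (E * _) => x y z e.
  have := sqr_ge0 (y - x * z) => s1 s2.
  have -> : 2 * y * z * x = y ^+ 2 + x ^+ 2 * z ^+ 2 - (y - x * z) ^+ 2 by ring.
  have := sqr_ge0 y; have := mulr_ge0 (sqr_ge0 x) (sqr_ge0 z); lra.
have : \forall n \near \oo, 2 * E * `|a n| ^+ 2 < B ^+ 2 * Num.sqrt (k * (t - s)).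
  have H2 : 2 * E * `|a n| ^+ 2 @[n --> \oo] --> 2 * E * `|psi| ^+ 2.
    by apply: cvgMl_tmp; exact: sqcvg.
  exact: (cvgr_lt _ H2 _ H).
move=> [N _ HN]; apply: (@ae_bdd_lim _ (fun n => U t s (a (n + N)%N))).
  by move=> n; apply: sm => //; apply: HN; exact: leq_addl.
by apply: (Ucvg st'); rewrite -(cvg_shiftn N) in ap.
Qed.

Lemma evolution_smoothing (T : R) : exists2 M : R, 0 <= M & forall (s t : R) psi, 0 <= s -> s < t -> t <= T ->
  [/\ `|U t s psi| <= M * `|psi|,
      `|U t s psi| <= M * (t - s) `^ (- (1 / 2)) * `|Aop psi|
    & ae_bdd (U t s psi) (M * (t - s) `^ (- (1 / 4)) * `|psi|)].
Proof.
pose E := expR (C * T).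
have E0 : 0 < E by exact: expR_gt0.
pose M1 := Num.sqrt E; pose M2 := Num.sqrt (E / k).
(* The added 1 yields the strict inequality that [evol_sup] requires. *)
pose M3 := Num.sqrt ((2 * E + 1) / Num.sqrt k).
have M10 : 0 <= M1 by exact: sqrtr_ge0.
have M20 : 0 <= M2 by exact: sqrtr_ge0.
have M30 : 0 <= M3 by exact: sqrtr_ge0.
exists (M1 + M2 + M3); first by rewrite !addr_ge0.
move=> s t psi s0 st tT.
have ts0 : 0 < t - s by rewrite subr_gt0.
have ET : expR (C * (t - s)) <= E by rewrite ler_expR ler_wpM2l//; lra.
have n1 : `|U t s psi| <= M1 * `|psi|.
  rewrite -(@ler_pXn2r _ 2)// ?nnegrE ?mulr_ge0// exprMn sqr_sqrtr ?(ltW E0)//.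
  by apply: (le_trans (evol_norm psi s0 st)); rewrite ler_wpM2r// sqr_ge0.
have n2 : `|U t s psi| <= M2 * (t - s) `^ (- (1 / 2)) * `|Aop psi|.
  rewrite powRN div1r powR12_sqrt ?(ltW ts0)//.
  rewrite -(@ler_pXn2r _ 2)// ?nnegrE ?mulr_ge0 ?invr_ge0 ?sqrtr_ge0//.
  rewrite !exprMn exprVn !sqr_sqrtr ?(ltW ts0) ?divr_ge0 ?(ltW E0) ?(ltW k0)//.
  have -> : E / k / (t - s) * `|Aop psi| ^+ 2 = (k * (t - s))^-1 * (E * `|Aop psi| ^+ 2).
    by field; rewrite !gt_eqF.
  rewrite ler_pdivlMl ?mulr_gt0//; apply: (le_trans (evol_dual psi s0 st)).
  by rewrite ler_wpM2r ?sqr_ge0.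
have p12 : 0 <= (t - s) `^ (- (1 / 2)) by exact: powR_ge0.
have p14 : 0 <= (t - s) `^ (- (1 / 4)) by exact: powR_ge0.
split.
- apply: (le_trans n1); apply: ler_wpM2r => //; lra.
- apply: (le_trans n2); apply: ler_wpM2r => //; apply: ler_wpM2r => //; lra.
(* For psi = 0 the strict inequality of [evol_sup] would fail, the bound being 0. *)
have [p0|psi0] := eqVneq psi 0.
  move: n1; rewrite p0 normr0 !mulr0 normr_le0 => /eqP ->.
  by apply: filterS (@L20_ae R) => x ->; rewrite normr0.
apply: evol_sup => //; first by rewrite !mulr_ge0 ?addr_ge0.
have psi2 : 0 < `|psi| ^+ 2 by rewrite exprn_gt0// normr_gt0.
rewrite !exprMn [ltRHS]mulrAC ltr_pM2r//.
have -> : ((t - s) `^ (- (1 / 4))) ^+ 2 = (Num.sqrt (t - s))^-1.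
  have h : - (1 / 2) = - (1 / 4) + - (1 / 4) :> R by field.
  have <- : (t - s) `^ (- (1 / 4) + - (1 / 4)) = (t - s) `^ (- (1 / 4)) ^+ 2.
    by rewrite powRD//; apply/implyP => _; rewrite gt_eqF.
  by rewrite -h powRN div1r powR12_sqrt ?(ltW ts0).
rewrite sqrtrM ?(ltW k0)//.
rewrite [ltRHS](_ : _ = (M1 + M2 + M3) ^+ 2 * Num.sqrt k); last first.
  by field; rewrite gt_eqF ?sqrtr_gt0.
apply: (@lt_le_trans _ _ (M3 ^+ 2 * Num.sqrt k)).
  rewrite sqr_sqrtr ?divr_ge0 ?addr_ge0 ?mulr_ge0 ?sqrtr_ge0 ?(ltW E0)//.
  rewrite divfK ?gt_eqF ?sqrtr_gt0//; lra.
rewrite ler_wpM2r ?sqrtr_ge0// ler_pXn2r ?nnegrE ?addr_ge0// lerDr addr_ge0//.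
Qed.
End evolution_estimates.
End energy.

(** * Regularity of the coefficients *)

Section goldowsky.
Context {R : realType}.
Local Notation leb := (@lebesgue_measure R).
Implicit Types f g : R -> R.

(** A property of intervals that is additive and holds for all short intervals containing a given
    point holds globally: take the supremum of the points reached from a, and a short interval that
    straddles it. *)
Lemma straddle (P : R -> R -> Prop) (a b : R) : a <= b ->
  (forall p q r, P p q -> P q r -> P p r) ->
  (forall x, exists2 d, 0 < d & forall p q, p <= x <= q -> q - p < d -> P p q) -> P a b.
Proof.
move=> ab Ptr Ploc.
pose S := [set x | a <= x <= b /\ P a x].
have Sa : S a.
  split; first by rewrite lexx.
  by have [d d0] := Ploc a; apply; rewrite ?lexx ?subrr.
have Sb : ubound S b by move=> x [/andP[]].
have hS : has_sup S by split; [exists a|exists b].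
have as_ : a <= sup S by apply: ub_le_sup => //; exists b.
have d20 (d : R) : 0 < d -> 0 < d / 2 by move=> d0; rewrite divr_gt0.
have sb : sup S <= b by apply: ge_sup => //; exists a.
have [d d0 Pd] := Ploc (sup S).
have [x [/andP[ax xb] Pax] xs] := sup_adherent (d20 _ d0) hS.
have xs' : x <= sup S by apply: ub_le_sup; [exists b|split=> //; rewrite ax].
(* x is within d / 2 of the supremum and q at most d / 3 beyond it, so [x, q] is shorter than d. *)
pose q := Num.min b (sup S + d / 3).
have d30 : 0 < d / 3 by rewrite divr_gt0.
have sq : sup S <= q by rewrite le_min sb lerDl ltW.
have Paq : P a q.
  apply: (Ptr _ _ _ Pax); apply: Pd; first by rewrite xs'.
  have : q <= sup S + d / 3 by rewrite ge_min lexx orbT.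
  lra.
have qS : q <= sup S.
  by apply: ub_le_sup; [exists b|split=> //; rewrite (le_trans as_ sq) ge_min lexx].
suff : q = b by move=> <-.
by move: qS; rewrite /q; case: (leP b (sup S + d / 3)) => // _; rewrite gerDl leNgt d30.
Qed.

Lemma derivable_slope f x e : derivable f x 1 -> 0 < e -> exists2 d, 0 < d &
  forall h, `|h| < d -> `|f (x + h) - f x - h * derive1 f x| <= e * `|h|.
Proof.
move=> df e0.
have H : h^-1 *: (f (h *: 1 + x) - f x) @[h --> 0^'] --> derive1 f x by rewrite derive1E; exact: df.
move/cvgrPdist_le : H => /(_ e e0) H.
have [d /= d0 Hd] : nbhs (0 : R)^' [set h : R | `|derive1 f x - h^-1 *: (f (h *: 1 + x) - f x)| <= e].
  by move: H; apply: filterS => h.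
exists d => // h hd; have [->|h0] := eqVneq h 0.
  by rewrite addr0 subrr mul0r subrr normr0 mulr0.
have := Hd h; rewrite /= sub0r normrN => /(_ hd h0).
rewrite /GRing.scale/= mulr1 => H1.
have -> : f (x + h) - f x - h * derive1 f x = - (h * (derive1 f x - h^-1 * (f (h + x) - f x))).
  by rewrite mulrBr mulrA divff// mul1r opprB [h + x]addrC.
by rewrite normrN normrM mulrC ler_wpM2r.
Qed.

Let leb_itvI (U : set R) (p q x d : R) : p <= x <= q -> q - p < d ->
  (forall y, `|x - y| < d -> U y) -> leb (`]p, q] `&` U) = (q - p)%:E.
Proof.
move=> /andP[px xq] qp Ud; rewrite setIidl; last first.
  move=> y /=; rewrite in_itv/= => /andP[py yq]; apply: Ud.
  by rewrite ltr_norml; apply/andP; split; lra.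
rewrite lebesgue_measure_itv/= lte_fin; case: ltP => // qp'.
have -> : q = p by apply/le_anti; rewrite qp' (le_trans px xq).
by rewrite subrr.
Qed.

Lemma derive_le_ae f M a b : (forall x, derivable f x 1) ->
  {ae leb, forall x, derive1 f x <= M} -> a <= b -> f b - f a <= M * (b - a).
Proof.
(* A is covered by open sets U n of small total measure; the measure nu, of
   density \sum_n \1_(U n), is small but has infinite density at the points of A,
   so that it absorbs the increments of f there. *)
move=> df [A [mA A0 AM]] ab.
apply/ler_addgt0Pr => e e0.
have e20 : 0 < e / 2 by rewrite divr_gt0.
have ex_U (n : nat) : exists U : set R,
    [/\ open U, A `<=` U & (leb U <= (e / 2 / (2 ^ n.+1)%:R)%:E)%E].
  have en0 : 0 < e / 2 / (2 ^ n.+1)%:R by rewrite divr_gt0// ltr0n expn_gt0.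
  have [U [oU AU Ue]] := lebesgue_regularity_outer mA (eq_ind_r (fun z => z < +oo)%E (ltry 0) A0) en0.
  exists U; split=> //; apply: (@le_trans _ _ (leb (U `\` A) + leb A)%E).
    apply: (le_trans _ (measureU2 _ _ _)) => //.
      rewrite setUC setDUK//.
    by apply: measurableD => //; exact: open_measurable.
  by rewrite A0 adde0 ltW.
have [U HU] := choice ex_U.
have mU n : measurable (U n) by have [oU _ _] := HU n; exact: open_measurable.
pose nu := mseries (fun n => mrestr leb (mU n)) 0.
have nuE p q : nu `]p, q]%classic = (\sum_(n <oo) leb (`]p, q]%classic `&` U n))%E by [].
pose e1 := e / 2 / (b - a + 1).
have ba0 : 0 < b - a + 1 by lra.
have e10 : 0 < e1 by rewrite divr_gt0.
pose P p q := p <= q /\ ((f q - f p)%:E <= ((M + e1) * (q - p))%:E + nu `]p, q]%classic)%E.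
have : P a b.
  apply: straddle => //.
    move=> p q r [pq H1] [qr H2]; split; first exact: le_trans qr.
    have -> : nu `]p, r]%classic = (nu `]p, q]%classic + nu `]q, r]%classic)%E.
      rewrite -measureU//.
        by rewrite (@itv_bndbnd_setU _ _ (BRight p) (BRight q) (BRight r)).
      rewrite -subset0 => y [] /=; rewrite !in_itv/= => /andP[_ yq] /andP[qy _].
      by move: (lt_le_trans qy yq); rewrite ltxx.
    have -> : f r - f p = (f q - f p) + (f r - f q) by ring.
    have -> : (M + e1) * (r - p) = (M + e1) * (q - p) + (M + e1) * (r - q) by ring.
    by rewrite (EFinD (f q - f p)) (EFinD ((M + e1) * (q - p))) addeACA; exact: leeD.
  move=> x; have [d d0 fd] := derivable_slope (df x) e10.
  have slope p q : p <= x <= q -> q - p < d -> f q - f p <= (derive1 f x + e1) * (q - p).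
    move=> /andP[px xq] qpd.
    have h1 : `|p - x| < d by rewrite ler0_norm; lra.
    have h2 : `|q - x| < d by rewrite ger0_norm; lra.
    have := fd _ h1; have := fd _ h2; rewrite !subrKC.
    rewrite (ler0_norm (_ : p - x <= 0)) ?subr_le0// (ger0_norm (_ : 0 <= q - x)) ?subr_ge0//.
    move=> /ler_normlP[_ g1] /ler_normlP[g2 _]; lra.
  have [fM|fM] := leP (derive1 f x) M.
    exists d => // p q pxq qpd; have /andP[px xq] := pxq.
    split; first exact: le_trans xq.
    apply: (@le_trans _ _ ((M + e1) * (q - p))%:E); last by rewrite leeDl.
    rewrite lee_fin (le_trans (slope _ _ pxq qpd))// ler_wpM2r ?lerD2r// subr_ge0.
    exact: le_trans xq.
  have Ax : A x by apply: AM => /=; apply/negP; rewrite -ltNge.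
  (* Close to x the interval lies in the first N open sets, so [nu] gives it at least N times its
     length, which covers the excess slope. *)
  have [N fN] : exists N : nat, derive1 f x - M <= N%:R.
    by exists (Num.truncn (derive1 f x - M)).+1; exact/ltW/truncnS_gt.
  have [d' d'0 Ud'] : exists2 d', 0 < d' & forall n, (n < N)%N -> forall y, `|x - y| < d' -> U n y.
    elim: N {fN} => [|N [r r0 IH]]; first by exists 1.
    have [oU AU _] := HU N.
    have [r' /= r'0 Ur'] := oU x (AU x Ax).
    exists (Num.min r r') => [|n]; first by rewrite lt_min r0.
    rewrite ltnS leq_eqVlt => /orP[/eqP ->|nN] y; rewrite lt_min => /andP[yr yr'].
      exact: Ur'.
    exact: IH yr.
  exists (Num.min d d') => [|p q pxq]; first by rewrite lt_min d0.
  rewrite lt_min => /andP[qpd qpd']; have /andP[px xq] := pxq.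
  have pq : p <= q by exact: le_trans xq.
  split=> //; apply: (@le_trans _ _ ((derive1 f x + e1) * (q - p))%:E).
    by rewrite lee_fin; exact: slope.
  have -> : (derive1 f x + e1) * (q - p) = (M + e1) * (q - p) + (derive1 f x - M) * (q - p) by ring.
  rewrite EFinD leeD2l// nuE.
  apply: (le_trans _ (nneseries_lim_ge N _)); last by [].
  rewrite (eq_big_nat _ _ (F2 := fun=> (q - p)%:E)); last first.
    by move=> n /andP[_ nN]; apply: (leb_itvI pxq qpd'); exact: Ud'.
  rewrite sumEFin sumr_const_nat subn0 lee_fin -[leRHS]mulr_natl.
  by rewrite ler_wpM2r// subr_ge0.
move=> [_ H].
have nue : (nu `]a, b]%classic <= (e / 2)%:E)%E.
  rewrite nuE; apply: le_trans (epsilon_trick0 _ (ltW e20)).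
  apply: lee_nneseries => // n _; have [oU _ Ue] := HU n.
  exact: (le_trans (@measureIr _ _ _ leb _ _ (measurable_itv _) (mU n)) Ue).
have : ((f b - f a)%:E <= ((M + e1) * (b - a))%:E + (e / 2)%:E)%E.
  by apply: (le_trans H); rewrite leeD2l.
rewrite -EFinD lee_fin => /le_trans; apply.
have : e1 * (b - a) <= e / 2.
  rewrite /e1 mulrAC ler_pdivrMr// ler_wpM2l ?(ltW e20)//; lra.
lra.
Qed.

Lemma derive_norm_ae f M x y : (forall x, derivable f x 1) ->
  {ae leb, forall x, `|derive1 f x| <= M} -> `|f y - f x| <= M * `|y - x|.
Proof.
move=> df fM.
have key a b : a <= b -> `|f b - f a| <= M * (b - a).
  move=> ab; rewrite ler_norml; apply/andP; split; last first.
    by apply: derive_le_ae => //; apply: filterS fM => z /ler_normlP[].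
  have dN z : derivable (- f) z 1 by exact: derivableN.
  rewrite lerNl (_ : - (f b - f a) = (- f) b - (- f) a); last by rewrite /= opprB opprK addrC.
  apply: derive_le_ae => //; apply: filterS fM => z.
  by rewrite [derive1 (- f) z]derive1E deriveN// -derive1E => /ler_normlP[].
have [xy|/ltW yx] := leP x y.
  by rewrite [`|y - x|]ger0_norm ?subr_ge0//; exact: key.
by rewrite distrC [`|y - x|]distrC [`|x - y|]ger0_norm ?subr_ge0//; exact: key.
Qed.

Lemma lipschitz_derive f M x : derivable f x 1 ->
  (forall h, `|f (x + h) - f x| <= M * `|h|) -> `|derive1 f x| <= M.
Proof.
move=> df fM; apply/ler_addgt0Pr => e e0.
have [d d0 fd] := derivable_slope df e0.
have d20 : 0 < d / 2 by rewrite divr_gt0.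
have := fd (d / 2); rewrite (gtr0_norm d20) => /(_ _).
have d2 : d / 2 < d by rewrite ltr_pdivrMr// ltr_pMr// ltr1n.
move=> /(_ d2); have := fM (d / 2); rewrite (gtr0_norm d20) => h1 h2.
rewrite -(ler_pM2l d20) -{1}(gtr0_norm d20) -normrM mulrDr.
rewrite -[d / 2 * derive1 f x](subKr (f (x + d / 2) - f x)).
by rewrite (le_trans (ler_normB _ _))// lerD// [leRHS]mulrC.
Qed.

Lemma ae_dense (P : R -> Prop) x e : {ae leb, forall y, P y} -> 0 < e ->
  exists y, [/\ x < y, y < x + e & P y].
Proof.
move=> [A [mA A0 AP]] e0; apply: contrapT => H.
have sub : `]x, x + e[ `<=` A.
  move=> y /=; rewrite in_itv/= => /andP[xy yx]; apply: AP => /= Py.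
  by apply: H; exists y.
have : (leb `]x, (x + e)%R[%classic <= 0)%E.
  by rewrite -A0; apply: le_measure => //; apply/mem_set => //; exact: measurable_itv.
rewrite lebesgue_measure_itv/= lte_fin ltrDl e0 -EFinD lee_fin addrAC subrr add0r.
by rewrite leNgt e0.
Qed.

(** Tonelli's theorem for the indicator of the exceptional set. *)
Lemma prod_ae (P : R * R -> Prop) : {ae (leb \x leb)%E, forall z, P z} ->
  {ae leb, forall t, {ae leb, forall x, P (x, t)}}.
Proof.
move=> [A [mA A0 AP]].
have E : (\int[leb]_t leb (ysection A t) = 0)%E.
  have := indic_fubini_tonelli leb leb mA.
  by rewrite (indic_fubini_tonelli_FE leb mA) (indic_fubini_tonelli_GE leb mA) => <-; exact: A0.
have : {ae leb, forall t, (leb (ysection A t) = 0)%E}.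
  have /(ae_eq_integral_abs leb measurableT (measurable_fun_ysection leb mA)) :
      (\int[leb]_t `|(leb \o ysection A) t| = 0)%E.
    rewrite -[RHS]E; apply: eq_integral => t _; rewrite gee0_abs//.
  by apply: filterS => t /=; apply.
apply: filterS => t At; exists (ysection A t); split=> //.
  exact: measurable_ysection.
by move=> x /AP; rewrite /ysection/= inE.
Qed.

End goldowsky.

Section Linfty.
Context d (T : measurableType d) (R : realType) (mu : {measure set T -> \bar R}).
Implicit Types f : T -> R.

Lemma Lnorm_oo_ae f (k : R) : ('N[mu]_+oo[EFin \o f] <= k%:E)%E ->
  {ae mu, forall x, `|f x| <= k}.
Proof.
rewrite unlock /=; case: ifPn => [mu0 /ess_supP|].
  by apply: filterS => x /=; rewrite lee_fin.
(* If the whole space is null the norm carries no information, and every property holds almost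
   everywhere. *)
rewrite -leNgt => mu0 _; exists setT; split=> //.
by apply/le_anti; rewrite mu0 measure_ge0.
Qed.

Lemma Lfun_oo_ae f : f \in Lfun mu +oo%E -> exists2 M : R, 0 <= M & {ae mu, forall x, `|f x| <= M}.
Proof.
move=> /sub_Lfun_finLfun; rewrite inE /finite_norm /= => foo.
exists (fine 'N[mu]_+oo[EFin \o f]%E); first by rewrite fine_ge0// Lnorm_ge0.
by apply: Lnorm_oo_ae; rewrite fineK// ge0_fin_numE// Lnorm_ge0.
Qed.

End Linfty.

(** * Time-dependent coefficients: bounds valid at every time *)

Section time_dependent.
Context {R : realType}.
Local Notation leb := (@lebesgue_measure R).
Implicit Types (w : R -> R) (v : R -> R -> R).

Lemma is_derive_increment w (k x : R) : (forall x, derivable w x 1) ->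
  is_derive x 1 (fun z => w (z + k) - w z) (derive1 w (x + k) - derive1 w x).
Proof.
move=> dw; apply: is_deriveB; last exact: derivable_is_derive.
rewrite -[X in is_derive _ _ _ X]mulr1.
have d1 : is_derive x 1 (fun z : R => z + k) 1.
  by rewrite -[X in is_derive _ _ _ X]addr0; exact: is_deriveD.
apply: (@is_derive1_comp _ w (fun z => z + k)).
exact: derivable_is_derive.
Qed.

(** The double difference involves values of w only, so a bound on it survives pointwise limits,
    after which [lipschitz_of_mixed_difference] recovers the Lipschitz bound on the derivative. *)
Lemma mixed_difference w M : (forall x, derivable w x 1) ->
  (forall x y, `|derive1 w y - derive1 w x| <= M * `|y - x|) ->
  forall x k h, `|(w (x + h + k) - w (x + h)) - (w (x + k) - w x)| <= M * `|k| * `|h|.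
Proof.
move=> dw wM x k h.
have dz z := is_derive_increment k z dw.
have H := @derive_lipschitz _ (fun z => w (z + k) - w z) (M * `|k|) _ _ x (x + h).
rewrite (_ : x + h - x = h) in H; last by ring.
apply: H => z; first exact: ex_derive.
rewrite (is_derive_derive1 (dz z)); apply: (le_trans (wM _ _)).
by rewrite addrAC subrr add0r.
Qed.

Lemma lipschitz_of_mixed_difference w M : (forall x, derivable w x 1) ->
  (forall x k h, `|(w (x + h + k) - w (x + h)) - (w (x + k) - w x)| <= M * `|k| * `|h|) ->
  forall x y, `|derive1 w y - derive1 w x| <= M * `|y - x|.
Proof.
move=> dw wM x y.
have dz := is_derive_increment (y - x) x dw.
rewrite -[X in derive1 w X](subrKC x y) -(is_derive_derive1 dz).
apply: lipschitz_derive; first exact: ex_derive.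
by move=> h; exact: wM.
Qed.

Lemma derivable_in_near (f : R -> R) (t e : R) : derivable_in `[0, +oo[ f t -> 0 < e ->
  exists2 d, 0 < d & forall s, 0 <= s -> `|s - t| < d -> `|f s - f t| <= e.
Proof.
rewrite /derivable_in /diff_quotient_in => /cvg_ex[l Hl] e0.
move/cvgrPdist_le : Hl => /(_ 1 ltr01) Hl.
have [d /= d0 Hd] : nbhs (0 : R)^' [set h : R | `[0, +oo[%classic (t + h) ->
    `|l - h^-1 *: (f (t + h) - f t)| <= 1] by exact: Hl.
have l0 : 0 < `|l| + 1 by rewrite ltr_pwDr.
exists (Num.min d (e / (`|l| + 1))) => [|s s0]; first by rewrite lt_min d0 divr_gt0.
rewrite lt_min => /andP[sd se].
have [->|st] := eqVneq s t; first by rewrite subrr normr0 ltW.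
have st0 : s - t != 0 by rewrite subr_eq0.
have := Hd (s - t); rewrite /= sub0r normrN => /(_ sd st0).
rewrite subrKC in_itv/= s0 => /(_ isT).
rewrite /GRing.scale/= => H.
have -> : f s - f t = (s - t) * (l - (l - (s - t)^-1 * (f s - f t))).
  by rewrite subKr mulrA divff// mul1r.
rewrite normrM; move: se; rewrite ltr_pdivlMr// => /ltW; apply: le_trans.
by rewrite ler_wpM2l// (le_trans (ler_normB _ _))// lerD2l.
Qed.

Lemma derivable_in_right (f : R -> R) t e : 0 <= t -> derivable_in `[0, +oo[ f t -> 0 < e ->
  exists2 d, 0 < d & forall s, t < s -> s < t + d -> `|f s - f t| <= e.
Proof.
move=> t0 df e0; have [d d0 H] := derivable_in_near df e0; exists d => // s ts sd.
by apply: H; [exact: le_trans (ltW ts)|rewrite gtr0_norm ?subr_gt0// ltrBlDl].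
Qed.

(* Fubini gives the bounds for almost every t only, and continuity in t extends
   them to every t. Mixed differences are used because the x-derivatives of v are
   not assumed to be continuous in t. *)
Lemma time_dependent_nice v (k3 : R) :
  (forall t : R, 0 <= t -> twice_differentiable (v ^~ t)) ->
  (forall x t : R, 0 <= t -> derivable_in `[0, +oo[ (v x) t) ->
  inLoo_Omega (dx v) -> inLoo_Omega (dx (dx v)) ->
  ('N[leb \x leb]_+oo[EFin \o on_Omega v] <= k3%:E)%E ->
  exists M, forall t : R, 0 <= t ->
    [/\ forall x, `|v x t| <= k3, nice (v ^~ t) M & nice (derive1 (v ^~ t)) M].
Proof.
move=> v2 vt /Lfun_oo_ae[M1 M10 h1] /Lfun_oo_ae[M2 M20 h2] /Lnorm_oo_ae h0.
have onE (z : R -> R -> R) x t : 0 <= t -> on_Omega z (x, t) = z x t.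
  by move=> t0; rewrite /on_Omega patchE mem_set// /Omega /= in_itv/= t0.
have {h0 h1 h2} good : {ae leb, forall t, 0 <= t -> {ae leb, forall x,
    [/\ `|v x t| <= k3, `|derive1 (v ^~ t) x| <= M1 & `|derive1 (derive1 (v ^~ t)) x| <= M2]}}.
  have := prod_ae h0; have := prod_ae h1; have := prod_ae h2.
  apply: filterS3 => t g2 g1 g0 t0; apply: filterS3 g2 g1 g0 => x.
  by rewrite !onE.
pose Q t := [/\ forall x, `|v x t| <= k3, forall x y, `|v y t - v x t| <= M1 * `|y - x|
  & forall x k h, `|(v (x + h + k) t - v (x + h) t) - (v (x + k) t - v x t)| <= M2 * `|k| * `|h|].
have {}good : {ae leb, forall t, 0 <= t -> Q t}.
  apply: filterS good => t + t0 => /(_ t0) H.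
  have d1 x : derivable (v ^~ t) x 1 by exact: (v2 t t0 x).1.
  have d2 x : derivable (derive1 (v ^~ t)) x 1 by exact: (v2 t t0 x).2.
  have L1 x y : `|v y t - v x t| <= M1 * `|y - x|.
    by apply: (@derive_norm_ae _ (v ^~ t)) => //; apply: filterS H => z [].
  split=> //; last first.
    apply: (@mixed_difference (v ^~ t)) => // x y.
    by apply: derive_norm_ae => //; apply: filterS H => z [].
  (* The sup bound holds at almost every point and extends to every x by the Lipschitz bound just
     obtained. *)
  move=> x; apply/ler_addgt0Pr => e e0.
  have M1p : 0 < M1 + 1 by rewrite ltr_pwDr.
  have e1 : 0 < e / (M1 + 1) by rewrite divr_gt0.
  have [y [xy yx [vk _ _]]] := ae_dense x H e1.
  rewrite -(subKr (v y t) (v x t)) (le_trans (ler_normB _ _))// lerD//.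
  rewrite (le_trans (L1 _ _))// gtr0_norm ?subr_gt0//.
  move: yx; rewrite -ltrBlDl ltr_pdivlMr// => /ltW; apply: le_trans.
  by rewrite mulrC ler_wpM2l ?subr_ge0 ?(ltW xy)// lerDl.
have vr x t e : 0 <= t -> 0 < e -> exists2 d, 0 < d & forall s, t < s -> s < t + d -> `|v x s - v x t| <= e.
  by move=> t0; apply: derivable_in_right => //; exact: vt.
have allQ t : 0 <= t -> Q t.
  move=> t0; split.
  - move=> x; apply/ler_addgt0Pr => e e0; have [d d0 H] := vr x _ _ t0 e0.
    have [s [ts sd /(_ (le_trans t0 (ltW ts)))[Qs _ _]]] := ae_dense t good d0.
    by rewrite -(subKr (v x s) (v x t)) (le_trans (ler_normB _ _))// lerD// H.
  - move=> x y; apply/ler_addgt0Pr => e e0; have e20 : 0 < e / 2 by rewrite divr_gt0.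
    have [d d0 H] := vr x _ _ t0 e20; have [d' d'0 H'] := vr y _ _ t0 e20.
    have dd : 0 < Num.min d d' by rewrite lt_min d0.
    have [s [ts sd /(_ (le_trans t0 (ltW ts)))[_ Qs _]]] := ae_dense t good dd.
    move: sd; rewrite -ltrBlDl lt_min !ltrBlDl => /andP[/(H _ ts) Hs /(H' _ ts) H's].
    have -> : v y t - v x t = (v y s - v x s) + ((v x s - v x t) - (v y s - v y t)) by ring.
    rewrite (le_trans (ler_normD _ _))// lerD//.
    by rewrite (le_trans (ler_normB _ _))// [leRHS]splitr lerD.
  move=> x k h; apply/ler_addgt0Pr => e e0; have e40 : 0 < e / 4 by rewrite divr_gt0.
  have [d1 d10 H1] := vr (x + h + k) _ _ t0 e40; have [d2 d20 H2] := vr (x + h) _ _ t0 e40.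
  have [d3 d30 H3] := vr (x + k) _ _ t0 e40; have [d4 d40 H4] := vr x _ _ t0 e40.
  have dd : 0 < Num.min (Num.min d1 d2) (Num.min d3 d4) by rewrite !lt_min d10 d20 d30.
  have [s [ts sd /(_ (le_trans t0 (ltW ts)))[_ _ Qs]]] := ae_dense t good dd.
  move: sd; rewrite -ltrBlDl !lt_min !ltrBlDl => /andP[/andP[/(H1 _ ts) H1s /(H2 _ ts) H2s] /andP[/(H3 _ ts) H3s /(H4 _ ts) H4s]].
  have := Qs x k h.
  move: (v (x + h + k) s) (v (x + h) s) (v (x + k) s) (v x s) H1s H2s H3s H4s => a b c f.
  move=> /ler_normlP[? ?] /ler_normlP[? ?] /ler_normlP[? ?] /ler_normlP[? ?] /ler_normlP[? ?].
  by apply/ler_normlP; split; lra.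
exists (k3 + M1 + M2) => t t0; have [q0 q1 q2] := allQ t t0.
have d1 x : derivable (v ^~ t) x 1 by exact: (v2 t t0 x).1.
have d2 x : derivable (derive1 (v ^~ t)) x 1 by exact: (v2 t t0 x).2.
have k30 : 0 <= k3 by exact: le_trans (q0 0).
have b1 x : `|derive1 (v ^~ t) x| <= M1.
  by apply: lipschitz_derive => // h; rewrite (le_trans (q1 _ _))// addrAC subrr add0r.
have b2 x : `|derive1 (derive1 (v ^~ t)) x| <= M2.
  apply: lipschitz_derive => // h.
  have := @lipschitz_of_mixed_difference (v ^~ t) M2 d1 q2 x (x + h).
  by rewrite (_ : x + h - x = h)//; ring.
split; [exact: q0|split; [exact: d1|move=> x|move=> x]|split; [exact: d2|move=> x|move=> x]].
- by apply: (le_trans (q0 x)); rewrite -addrA lerDl addr_ge0.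
- by apply: (le_trans (b1 x)); rewrite addrAC lerDr addr_ge0.
- by apply: (le_trans (b1 x)); rewrite addrAC lerDr addr_ge0.
- by apply: (le_trans (b2 x)); rewrite lerDr addr_ge0.
Qed.

End time_dependent.

(** * Uniform bounds for alpha and beta *)

Section coefficients.
Context {R : realType}.
Local Notation leb := (@lebesgue_measure R).
Implicit Types (f g : R -> R) (v z : R -> R -> R) (K L : R).

Lemma nice_le f K L : nice f K -> K <= L -> nice f L.
Proof. by move=> [df fK f'K] KL; split=> // x; exact: le_trans KL. Qed.

Lemma nice_ge0 f K : nice f K -> 0 <= K.
Proof. by move=> [_ fK _]; exact: le_trans (fK 0). Qed.

Lemma nice_derivable f K : nice f K -> forall x, derivable f x 1.
Proof. by case. Qed.

Lemma derive1D f g : (forall x, derivable f x 1) -> (forall x, derivable g x 1) ->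
  derive1 (fun x => f x + g x) = (fun x => derive1 f x + derive1 g x).
Proof.
move=> df dg; apply/funext => x; apply: is_derive_derive1.
by apply: is_deriveD; exact: derivable_is_derive.
Qed.

Lemma derive1M f g : (forall x, derivable f x 1) -> (forall x, derivable g x 1) ->
  derive1 (fun x => f x * g x) = (fun x => f x * derive1 g x + g x * derive1 f x).
Proof.
move=> df dg; apply/funext => x; apply: is_derive_derive1.
by apply: is_deriveM; exact: derivable_is_derive.
Qed.

Lemma derive1V f : (forall x, derivable f x 1) -> (forall x, f x != 0) ->
  derive1 (fun x => (f x)^-1) = (fun x => -1 * ((f x)^-1 * (f x)^-1 * derive1 f x)).
Proof.
move=> df f0; apply/funext => x; apply: is_derive_derive1.
have := is_deriveV (f0 x) (derivable_is_derive (df x)).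
by rewrite /GRing.scale/= expr2 invfM mulN1r mulNr.
Qed.

Lemma niceD f g K L : nice f K -> nice g L -> nice (fun x => f x + g x) (K + L).
Proof.
move=> [df fK f'K] [dg gL g'L]; split=> [x|x|x].
- exact: derivableD.
- by rewrite (le_trans (ler_normD _ _))// lerD.
- by rewrite (derive1D df dg) (le_trans (ler_normD _ _))// lerD.
Qed.

Lemma niceM f g K L : nice f K -> nice g L -> nice (fun x => f x * g x) (2 * (K * L)).
Proof.
move=> fn gn; have K0 := nice_ge0 fn; have L0 := nice_ge0 gn.
case: fn => df fK f'K; case: gn => dg gL g'L.
have KL0 : 0 <= K * L by exact: mulr_ge0.
split=> [x|x|x].
- exact: derivableM.
- by rewrite normrM (le_trans (ler_pM _ _ (fK x) (gL x)))//; lra.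
- have -> : 2 * (K * L) = K * L + L * K by ring.
  rewrite (derive1M df dg) (le_trans (ler_normD _ _))//.
  by apply: lerD; rewrite normrM; exact: ler_pM.
Qed.

Lemma niceV f K k : nice f K -> 0 < k -> (forall x, k <= f x) ->
  nice (fun x => (f x)^-1) (k^-1 + k^-1 * k^-1 * K).
Proof.
move=> fn k0 kf; have K0 := nice_ge0 fn; case: fn => df fK f'K.
have k'0 : 0 <= k^-1 by rewrite invr_ge0 ltW.
have f0 x : f x != 0 by rewrite gt_eqF// (lt_le_trans k0).
have fV x : `|(f x)^-1| <= k^-1.
  by rewrite normfV lef_pV2 ?posrE ?normr_gt0// (le_trans (kf x))// ler_norm.
split=> [x|x|x].
- exact: derivableV.
- by rewrite (le_trans (fV x))// lerDl mulr_ge0// mulr_ge0.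
- rewrite (derive1V df f0) mulN1r normrN !normrM (@le_trans _ _ (k^-1 * k^-1 * K))//.
    by rewrite !ler_pM// mulr_ge0.
  by rewrite lerDr.
Qed.

Lemma nice_cst (c : R) : nice (cst c) `|c|.
Proof.
split=> [x|x|x] /=; [exact: derivable_cst|by []|].
by rewrite derive1_cst normr0.
Qed.

(** Stable under sums, products and inverses of functions bounded below, hence inherited by alpha
    and beta, for which it contains the bounds that the energy estimates use. *)
Definition uniformly_nice z := exists K, forall t : R, 0 <= t ->
  nice (z ^~ t) K /\ nice (derive1 (z ^~ t)) K.

Lemma uniformly_niceP z K L : (forall t : R, 0 <= t -> nice (z ^~ t) K /\ nice (derive1 (z ^~ t)) L) ->
  uniformly_nice z.
Proof.
move=> zn; exists (K + L) => t t0; have [n1 n2] := zn t t0.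
have K0 := nice_ge0 n1; have L0 := nice_ge0 n2.
by split; [apply: (nice_le n1); rewrite lerDl|apply: (nice_le n2); rewrite lerDr].
Qed.

Lemma uniformly_niceD z v : uniformly_nice z -> uniformly_nice v ->
  uniformly_nice (fun x t => z x t + v x t).
Proof.
move=> [K zK] [L vL]; exists (K + L) => t t0; have [n1 n2] := zK t t0; have [m1 m2] := vL t t0.
split; first exact: niceD.
by rewrite (derive1D (nice_derivable n1) (nice_derivable m1)); exact: (niceD n2 m2).
Qed.

Lemma uniformly_niceM z v : uniformly_nice z -> uniformly_nice v ->
  uniformly_nice (fun x t => z x t * v x t).
Proof.
move=> [K zK] [L vL].
apply: (@uniformly_niceP _ (2 * (K * L)) (2 * (K * L) + 2 * (L * K))) => t t0.
have [n1 n2] := zK t t0; have [m1 m2] := vL t t0.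
split; first exact: niceM.
rewrite (derive1M (nice_derivable n1) (nice_derivable m1)).
exact: (niceD (niceM n1 m2) (niceM m1 n2)).
Qed.

Lemma uniformly_niceV z k : uniformly_nice z -> 0 < k -> (forall x t, 0 <= t -> k <= z x t) ->
  uniformly_nice (fun x t => (z x t)^-1).
Proof.
move=> [K zK] k0 kz; set B := k^-1 + k^-1 * k^-1 * K.
apply: (@uniformly_niceP _ B (2 * (`|-1| * (2 * (2 * (B * B) * K))))) => t t0.
have [n1 n2] := zK t t0; have nV := niceV n1 k0 (fun x => kz x t t0).
split; first exact: nV.
rewrite (derive1V (nice_derivable n1)); last first.
  by move=> x; rewrite gt_eqF// (lt_le_trans k0)// kz.
exact: (niceM (nice_cst (-1)) (niceM (niceM nV nV) n2)).
Qed.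

(** (H1) bounds the derivatives almost everywhere only; passing through Lipschitz bounds gives them
    at every point. *)
Lemma uniformly_nice_cst f K : twice_differentiable f ->
  (forall k, (k <= 2)%N -> inLoo (derive1n k f)) -> (forall x, `|f x| <= K) ->
  uniformly_nice (fun x _ => f x).
Proof.
move=> f2 foo fK.
have d1 x : derivable f x 1 by exact: (f2 x).1.
have d2 x : derivable (derive1 f) x 1 by exact: (f2 x).2.
have [M1 M10 h1] := Lfun_oo_ae (foo 1%N isT); have [M2 M20 h2] := Lfun_oo_ae (foo 2%N isT).
have b1 x : `|derive1 f x| <= M1.
  apply: lipschitz_derive => // h.
  by rewrite (le_trans (@derive_norm_ae _ f M1 _ _ _ _))// addrAC subrr add0r.
have b2 x : `|derive1 (derive1 f) x| <= M2.
  apply: lipschitz_derive => // h.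
  by rewrite (le_trans (@derive_norm_ae _ (derive1 f) M2 _ _ _ _))// addrAC subrr add0r.
apply: (@uniformly_niceP _ (K + M1) (M1 + M2)) => t t0.
have K0 : 0 <= K by exact: le_trans (fK 0).
split; [split; [exact: d1|move=> x|move=> x]|split; [exact: d2|move=> x|move=> x]].
- by rewrite (le_trans (fK x))// lerDl.
- by rewrite (le_trans (b1 x))// lerDr.
- by rewrite (le_trans (b1 x))// lerDl.
- by rewrite (le_trans (b2 x))// lerDr.
Qed.

Variables (n : nat) (P : coefficients R n).
Hypotheses (P0 : nonneg_coefficients P) (h1 : hypH1 P) (h2 : hypH2 P).

Lemma coeff_nice i : [/\ uniformly_nice (fun x _ => ca P i x), uniformly_nice (fun x _ => cb P i x),
  uniformly_nice (fun x _ => cc P i x), uniformly_nice (fun x _ => clambda P i x)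
  & uniformly_nice (cy P i)].
Proof.
have [H [k1 [k2 [k10 k12 Hk]]]] := h1.
have nn (k x : R) : 0 <= x -> x <= k -> `|x| <= k by move=> x0; rewrite ger0_norm.
have k1x x : k1 <= x -> 0 <= x by apply: le_trans; exact: ltW.
have cst f : [\/ f = ca P i, f = cb P i, f = cc P i | f = clambda P i] ->
    (forall x, `|f x| <= k2) -> uniformly_nice (fun x _ => f x).
  by move=> /H[f2 foo] fk; exact: uniformly_nice_cst fk.
split.
- by apply: cst => [|x]; [constructor 1|have [/andP[/k1x a b] _ _ _] := Hk i x; exact: nn].
- by apply: cst => [|x]; [constructor 2|have [_ _ /andP[a b] _] := Hk i x; exact: nn].
- by apply: cst => [|x]; [constructor 3|have [_ _ _ /andP[a b]] := Hk i x; exact: nn].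
- by apply: cst => [|x]; [constructor 4|have [_ /andP[/k1x a b] _ _] := Hk i x; exact: nn].
have [k3 k30 /(_ i)[_ [y2 yt [_ y1 y11 _] yk] _ _]] := h2.
have [M HM] := time_dependent_nice y2 yt y1 y11 yk.
by exists M => t t0; have [_ ? ?] := HM t t0.
Qed.

Lemma y_bound : exists2 k3, 0 < k3 & forall i x t, 0 <= t -> 0 <= cy P i x t <= k3.
Proof.
have [k3 k30 Hy] := h2; exists k3 => // i x t t0.
have [y0 [y2 yt [_ y1 y11 _] yk] _ _] := Hy i.
have [M HM] := time_dependent_nice y2 yt y1 y11 yk.
have [/(_ x) yk3 _ _] := HM t t0.
by rewrite y0//=; exact: le_trans (ler_norm _) yk3.
Qed.

Lemma denom_ge : exists k1 k2 : R, [/\ 0 < k1, 0 < k2 &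
  forall i x t, 0 <= t -> k1 <= denom P i x t <= k2].
Proof.
have [_ [k1 [k2 [k10 k12 Hk]]]] := h1; have [k3 k30 Hy] := y_bound.
exists k1, (k2 + k2 * k3); have k20 : 0 < k2 by exact: lt_trans k12.
split=> //; first by rewrite ltr_pwDl// mulr_ge0 ?ltW.
move=> i x t t0; have [/andP[a1 a2] _ /andP[b1 b2] _] := Hk i x.
have /andP[y1 y2] := Hy i x t t0; rewrite /denom; apply/andP; split.
  by rewrite (le_trans a1)// lerDl mulr_ge0.
by rewrite lerD// ler_pM.
Qed.

Lemma denom_nice i : uniformly_nice (fun x t => (denom P i x t)^-1).
Proof.
have [k1 [k2 [k10 k20 kd]]] := denom_ge; have [na nb _ _ ny] := coeff_nice i.
apply: (@uniformly_niceV (denom P i) k1 _ k10); last first.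
  by move=> x t t0; have /andP[] := kd i x t t0.
exact: (uniformly_niceD na (uniformly_niceM nb ny)).
Qed.

Lemma alpha_nice i : uniformly_nice (alpha P i).
Proof.
by have [_ _ _ nl _] := coeff_nice i; apply: (uniformly_niceM nl); exact: denom_nice.
Qed.

Lemma beta_nice i : uniformly_nice (beta P i).
Proof.
by have [_ _ nc _ _] := coeff_nice i; apply: (uniformly_niceM nc); exact: denom_nice.
Qed.

Lemma alpha_ge : exists2 k, 0 < k & forall i x t, 0 <= t -> k <= alpha P i x t.
Proof.
have [_ [k1 [k2 [k10 k12 Hk]]]] := h1; have [l1 [l2 [l10 l20 Hl]]] := denom_ge.
exists (k1 / l2) => [|i x t t0]; first by rewrite divr_gt0.
have [_ /andP[a1 a2] _ _] := Hk i x; have /andP[b1 b2] := Hl i x t t0.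
have d0 : 0 < denom P i x t by exact: lt_le_trans b1.
by rewrite /alpha ler_pM// ?(ltW k10) ?invr_ge0 ?(ltW l20)// lef_pV2.
Qed.

Lemma Gop_weak i t u u' u'' : 0 <= t -> weak_derivative u u' -> weak_derivative u' u'' ->
  - Gop P i t u = mulL2 (alpha P i ^~ t) u'' - mulL2 (beta P i ^~ t) u'.
Proof.
move=> t0 w1 w2; rewrite /Gop (wderivE w1) (wderivE w2).
have [K HK] := alpha_nice i; have [L HL] := beta_nice i.
have ba := nice_bdd (HK t t0).1; have bb := nice_bdd (HL t t0).1.
have ia := inL2M ba.1 ba.2 (inL2_L2 u''); have ib := inL2M bb.1 bb.2 (inL2_L2 u').
rewrite -[mulL2 (alpha P i ^~ t) u'' - _]opprB; congr (- _).
rewrite -[RHS](toL2B ib ia); congr toL2; apply/funext => x /=; ring.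
Qed.

(** The three bounds on which everything below rests: in L2, from the negative norm to L2, and from
    L2 to Loo. *)
Lemma smoothing i T : forall U, evolution_operator (Gop P i) U ->
  exists2 M : R, 0 <= M & forall s t psi, 0 <= s -> s < t -> t <= T ->
  [/\ `|U t s psi| <= M * `|psi|, `|U t s psi| <= M * (t - s) `^ (- (1 / 2)) * `|Aop psi|
    & ae_bdd (U t s psi) (M * (t - s) `^ (- (1 / 4)) * `|psi|)].
Proof.
move=> U evol; have [k k0 kal] := alpha_ge.
have [K HK] := alpha_nice i; have [L HL] := beta_nice i.
have K0 := nice_ge0 (HK 0 (lexx 0)).1; have L0 := nice_ge0 (HL 0 (lexx 0)).1.
have KL : K <= K + L by rewrite lerDl.
have LK : L <= K + L by rewrite lerDr.
apply: (@evolution_smoothing _ k (K + L) (alpha P i) (beta P i) (Gop P i)) => //.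
- by move=> t t0; exact: nice_le (HK t t0).1 KL.
- by move=> t t0; exact: nice_le (HK t t0).2 KL.
- by move=> t t0; exact: nice_le (HL t t0).1 LK.
- by move=> t x t0; exact: kal.
- by move=> t u u' u''; exact: Gop_weak.
Qed.

End coefficients.

(** * Bochner integrals *)

Section nonmeasurable_integrals.
Context d (T : measurableType d) (R : realType) (mu : {measure set T -> \bar R}).
Implicit Types (D E : set T) (f g : T -> \bar R).
Local Open Scope ereal_scope.
Import HBNNSimple.

(** The integral of a nonnegative function is a supremum over the simple functions below it, so
    monotonicity holds without measurability. This matters because the norms of Bochner integrands
    are not known to be measurable. *)
Lemma le_integral_patch D E f g : (forall x, D x -> 0 <= f x) -> (forall x, E x -> 0 <= g x) ->
  (forall x, (f \_ D) x <= (g \_ E) x) -> \int[mu]_(x in D) f x <= \int[mu]_(x in E) g x.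
Proof.
move=> f0 g0 fg; rewrite !ge0_integralE//; apply: ereal_sup_le => _ [h /= hf <-].
by exists h => // x; exact: le_trans (fg x).
Qed.

Lemma le_integral_ge0 D f g : (forall x, D x -> 0 <= f x) ->
  (forall x, D x -> f x <= g x) -> \int[mu]_(x in D) f x <= \int[mu]_(x in D) g x.
Proof.
move=> f0 fg; apply: le_integral_patch => // x.
  by move=> Dx; apply: le_trans (fg x Dx); exact: f0.
by rewrite !patchE; case: ifPn => // /set_mem; exact: fg.
Qed.

(** Multiplying a simple function below f by the indicator of the complement of A does not change
    its integral. *)
Lemma integral_setD_null D A f : (forall x, D x -> 0 <= f x) -> measurable A -> mu A = 0 ->
  \int[mu]_(x in D) f x <= \int[mu]_(x in D `\` A) f x.
Proof.
move=> f0 mA A0; rewrite !ge0_integralE//; last by move=> x [/f0].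
apply: ge_ereal_sup => _ [h /= hf <-].
have mAC : measurable (~` A) by exact: measurableC.
apply: ereal_sup_ubound; exists (proj_nnsfun h mAC) => /=.
  move=> x; rewrite mindicE !patchE; have := hf x; rewrite patchE.
  have [xA|xA] := boolP (x \in ~` A); rewrite ?mulr1 ?mulr0; last first.
    move=> _; case: ifPn => [/set_mem[_ nA]|//].
    by move/negP : xA; case; exact/mem_set.
  have [xD|xD] := boolP (x \in D).
    by rewrite ifT//; apply/mem_set; split; exact: set_mem.
  by rewrite ifF//; apply/negbTE; apply: contra xD => /set_mem[/mem_set].
rewrite -!integralT_nnsfun; apply: ae_eq_integral => //.
- exact/measurable_EFinP.
- exact/measurable_EFinP.
exists A; split=> // x /= H; apply: contrapT => nA; apply: H => _.
by rewrite mindicE mem_set// mulr1.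
Qed.

Lemma le_integral_ae D f g : (forall x, D x -> 0 <= f x) -> (forall x, D x -> 0 <= g x) ->
  {ae mu, forall x, D x -> f x <= g x} -> \int[mu]_(x in D) f x <= \int[mu]_(x in D) g x.
Proof.
move=> f0 g0 [A [mA A0 AP]]; apply: (le_trans (integral_setD_null f0 mA A0)).
apply: le_integral_patch => //; first by move=> x [/f0].
move=> x; rewrite !patchE; case: ifPn => [/set_mem[Dx nA]|_].
  by rewrite mem_set//; apply: contrapT => H; apply: nA; apply: AP => /= H'; exact: H (H' Dx).
by case: ifPn => // /set_mem/g0.
Qed.

End nonmeasurable_integrals.

(** * Bochner integrals through linear functionals *)

Section bochner_theory.
Context d (T : measurableType d) (R : realType) (V : normedModType R).
Variables (mu : {measure set T -> \bar R}) (D : set T) (mD : measurable D).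
Implicit Types (f g s : T -> V) (l : V -> R).

Definition functional l := linear l /\ forall v, `|l v| <= `|v|.

(** Takes the place of the Hahn-Banach theorem; in the space at hand the functionals are explicit
    inner products. *)
Definition norming := forall v, exists2 l, functional l & l v = `|v|.

Definition weakly_measurable f := forall l, functional l -> measurable_fun D (l \o f).

Lemma functionalB l u v : functional l -> l (u - v) = l u - l v.
Proof. by case=> ll _; have e := ll (-1) v u; rewrite !scaleN1r in e; rewrite addrC e addrC. Qed.

Lemma functionalD l u v : functional l -> l (u + v) = l u + l v.
Proof. by case=> ll _; have := ll 1 u v; rewrite !scale1r. Qed.

Lemma functionalZ l a v : functional l -> l (a *: v) = a * l v.
Proof.
move=> [ll lb]; have l0 : l 0 = 0 by apply/normr0_eq0/le_anti; rewrite normr_ge0 (le_trans (lb _)) ?normr0.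
by have := ll a v 0; rewrite !addr0 l0 addr0.
Qed.

Lemma functional0 l : functional l -> l 0 = 0.
Proof. by move=> fl; rewrite -(scale0r (0 : V)) functionalZ// mul0r. Qed.

Lemma functional_cvg l (F : set_system nat) {FF : Filter F} (a : nat -> V) v :
  functional l -> a @ F --> v -> l (a n) @[n --> F] --> l v.
Proof.
move=> fl /cvg_normP av; apply: (cvg_norm_le _ av).
by near=> n; rewrite -functionalB//; exact: fl.2.
Unshelve. all: by end_near. Qed.

Lemma integrable_indic_sub (A : set T) : measurable A -> A `<=` D -> (mu A < +oo)%E ->
  mu.-integrable D (fun x => (\1_A x : R)%:E).
Proof.
move=> mA AD Aoo; apply/integrableP; split.
  by apply/measurable_EFinP; exact: measurable_indic.
under eq_integral do rewrite abse_EFin ger0_norm//.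
by rewrite integral_indic// setIidl.
Qed.

(** Reduces integrals of simple vector-valued functions to scalar ones. *)
Lemma simple_functional l s : functional l -> simple_on mu D s ->
  mu.-integrable D (EFin \o (l \o s)) /\ \int[mu]_(x in D) l (s x) = l (simple_integral mu D s).
Proof.
move=> fl [fs sm].
pose r := finmap.enum_fset (fset_set (s @` D)); pose A v := D `&` s @^-1` [set v].
have mA v : measurable (A v) by case: (sm v).
have lsE x : D x -> l (s x) = \sum_(v <- r) l v * \1_(A v) x.
    move=> Dx; have sr : s x \in r.
    have := in_fset_set fs (s x); rewrite [RHS]mem_set; last by exists x.
    exact.
  rewrite (bigD1_seq (s x) sr (finmap.fset_uniq _))/=.
  rewrite indicE mem_set// mulr1 big1 ?addr0// => v vs.
  rewrite indicE memNset ?mulr0//; move=> [_ /= e].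
  by rewrite e eqxx in vs.
have iA v : mu.-integrable D (fun x => (l v * \1_(A v) x)%:E).
  (* The set where s vanishes may have infinite measure, but its coefficient l 0 is 0. *)
  have [->|v0] := eqVneq v 0.
    by rewrite functional0//; under eq_fun do rewrite mul0r; exact: integrable0.
  have Aoo : (mu (A v) < +oo)%E by case: (sm v) => _; exact.
  under eq_fun do rewrite EFinM; apply: integrableZl => //.
  by apply: integrable_indic_sub => // x [].
have isum : mu.-integrable D (fun x => (\sum_(v <- r) l v * \1_(A v) x)%:E).
  under eq_fun do rewrite -sumEFin; exact: integrable_sum.
split.
  by apply: eq_integrable isum => // x /set_mem Dx /=; rewrite lsE.
rewrite /simple_integral fsbig_finite//= -/r.
transitivity (\int[mu]_(x in D) \sum_(v <- r) l v * \1_(A v) x).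
  by apply: eq_Rintegral => x /set_mem; exact: lsE.
have lsum (q : seq V) (F : V -> V) : l (\sum_(v <- q) F v) = \sum_(v <- q) l (F v).
  elim: q => [|v q IH]; first by rewrite !big_nil functional0.
  by rewrite !big_cons functionalD// IH.
rewrite lsum.
transitivity (\sum_(v <- r) \int[mu]_(x in D) (l v * \1_(A v) x)).
  elim: {isum lsE} (r : seq V) => [|v q IH].
    by under eq_Rintegral do rewrite big_nil; rewrite big_nil Rintegral_cst// mul0r.
  under eq_Rintegral do rewrite big_cons; rewrite big_cons RintegralD; [by rewrite IH|by []|exact: iA|].
  have : mu.-integrable D (fun x => (\sum_(v <- q) (l v * \1_(A v) x)%:E)%E).
    exact: integrable_sum.
  by congr (_.-integrable _ _); apply/funext => x /=; rewrite sumEFin.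
apply: eq_bigr => v _; rewrite functionalZ//.
have [->|v0] := eqVneq v 0.
  rewrite functional0// mulr0; under eq_Rintegral do rewrite mul0r.
  by rewrite Rintegral_cst// mul0r.
have Aoo : (mu (A v) < +oo)%E by case: (sm v) => _; exact.
rewrite RintegralZl//; last first.
  by apply: integrable_indic_sub => // x [].
by rewrite mulrC /Rintegral integral_indic// setIidl// => x [].
Qed.

Lemma simple_integralB s s' : norming -> simple_on mu D s -> simple_on mu D s' ->
  (`|simple_integral mu D s - simple_integral mu D s'|%:E <= \int[mu]_(x in D) `|s x - s' x|%:E)%E.
Proof.
move=> nV ss ss'; have [l fl <-] := nV (simple_integral mu D s - simple_integral mu D s').
have [is_ E] := simple_functional fl ss; have [is' E'] := simple_functional fl ss'.
rewrite functionalB// -E -E' -RintegralB//.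
have iB : mu.-integrable D (EFin \o (fun x => l (s x) - l (s' x))).
  by apply: eq_integrable (integrableB mD is_ is') => // x _ /=; rewrite EFinB.
apply: (@le_trans _ _ `|\int[mu]_(x in D) (l (s x) - l (s' x))|%:E); first by rewrite lee_fin ler_norm.
apply: (@le_trans _ _ (\int[mu]_(x in D) `|l (s x) - l (s' x)|)%:E).
  by rewrite lee_fin le_normr_Rintegral.
rewrite /Rintegral fineK; last exact: (integrable_fin_num mD (integrable_norm iB)).
apply: le_integral_ge0 => x Dx; first by rewrite lee_fin.
by rewrite lee_fin -functionalB//; exact: fl.2.
Qed.

(** Weak measurability makes l o f measurable. The integrals of the l o s k tend to l I by
    continuity, and to the integral of l o f because the L1 distances tend to 0. *)
Lemma bochner_functional f I l : functional l -> weakly_measurable f ->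
  is_bochner_integral mu D f I ->
  mu.-integrable D (EFin \o (l \o f)) /\ \int[mu]_(x in D) l (f x) = l I.
Proof.
move=> fl mf [s [ss _ s0 sI]].
have mlf := mf l fl.
have ils k := (simple_functional fl (ss k)).1.
have mls k : measurable_fun D (l \o s k).
  by apply/measurable_EFinP; exact: measurable_int (ils k).
have dle k : (\int[mu]_(x in D) `|l (f x) - l (s k x)|%:E <= \int[mu]_(x in D) `|f x - s k x|%:E)%E.
  apply: le_integral_ge0 => x Dx; first by rewrite lee_fin.
  by rewrite lee_fin -functionalB//; exact: fl.2.
have mB k : measurable_fun D (fun x => l (f x) - l (s k x)) by exact: (measurable_funB mlf (mls k)).
have /fine_cvgP[[N _ HN] fin0] := s0.
have iBN k : (N <= k)%N -> mu.-integrable D (EFin \o (fun x => l (f x) - l (s k x))).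
  move=> Nk; apply/integrableP; split; first exact/measurable_EFinP.
  under eq_integral do rewrite abse_EFin.
  by apply: (le_lt_trans (dle k)); rewrite ltey_eq HN.
have ilf : mu.-integrable D (EFin \o (l \o f)).
  apply: eq_integrable (integrableD mD (iBN N (leqnn N)) (ils N)) => // x _ /=.
  by rewrite -EFinD subrK.
split=> //.
have c1 : l (simple_integral mu D (s k)) @[k --> \oo] --> l I by exact: functional_cvg.
apply: (cvg_unique _ _ c1) => //.
apply: (cvg_norm_le _ fin0); exists N => // k /= Nk.
rewrite -(simple_functional fl (ss k)).2 distrC -(RintegralB mD ilf (ils k)).
have iN := integrable_norm (iBN k Nk).
apply: (le_trans (le_normr_Rintegral mD (iBN k Nk))); apply: fine_le => //; last exact: HN.
exact: (integrable_fin_num mD iN).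
Qed.

Lemma bochner_functional_le f I l : functional l -> weakly_measurable f ->
  is_bochner_integral mu D f I ->
  (`|l I|%:E <= \int[mu]_(x in D) `|l (f x)|%:E)%E.
Proof.
move=> fl mf fI; have [il <-] := bochner_functional fl mf fI.
apply: (@le_trans _ _ (\int[mu]_(x in D) `|l (f x)|)%:E).
  by rewrite lee_fin (le_normr_Rintegral mD il).
by rewrite /Rintegral fineK//; exact: (integrable_fin_num mD (integrable_norm il)).
Qed.

(** A functional attaining the norm of I - J reduces the inequality to real integrals. *)
Lemma bochner_distance f g I J : norming -> weakly_measurable f -> weakly_measurable g ->
  is_bochner_integral mu D f I -> is_bochner_integral mu D g J ->
  (`|I - J|%:E <= \int[mu]_(x in D) `|f x - g x|%:E)%E.
Proof.
move=> nV mf mg fI gJ; have [l fl <-] := nV (I - J).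
have [if_ E] := bochner_functional fl mf fI; have [ig E'] := bochner_functional fl mg gJ.
rewrite functionalB// -E -E' -RintegralB//.
have iB : mu.-integrable D (EFin \o (fun x => l (f x) - l (g x))).
  by apply: eq_integrable (integrableB mD if_ ig) => // x _ /=; rewrite EFinB.
apply: (@le_trans _ _ (\int[mu]_(x in D) `|l (f x) - l (g x)|)%:E).
  by rewrite lee_fin (le_trans (ler_norm _))// le_normr_Rintegral.
rewrite /Rintegral fineK; last exact: (integrable_fin_num mD (integrable_norm iB)).
apply: le_integral_ge0 => x Dx; first by rewrite lee_fin.
by rewrite lee_fin -functionalB//; exact: fl.2.
Qed.

Lemma bochner_uniq f I J : norming -> weakly_measurable f ->
  is_bochner_integral mu D f I -> is_bochner_integral mu D f J -> I = J.
Proof.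
move=> nV mf fI fJ; have := bochner_distance nV mf mf fI fJ.
under eq_integral do rewrite subrr normr0.
by rewrite integral0 lee_fin normr_le0 subr_eq0 => /eqP.
Qed.

Lemma bochner_ae_eq f g I : {ae mu, forall x, D x -> f x = g x} ->
  is_bochner_integral mu D f I -> is_bochner_integral mu D g I.
Proof.
move=> fg [s [ss sf s0 sI]]; exists s; split=> //.
  by apply: filterS2 fg sf => x fg sf Dx; rewrite -fg//; exact: sf.
have -> // : (fun k => \int[mu]_(x in D) `|g x - s k x|%:E)%E =
  (fun k => \int[mu]_(x in D) `|f x - s k x|%:E)%E.
apply/funext => k; apply/le_anti/andP; split; apply: le_integral_ae => [x _|x _|]; rewrite ?lee_fin//;
  by apply: filterS fg => x + Dx => /(_ Dx) ->.
Qed.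

Lemma bochner_null f : mu D = 0%E -> is_bochner_integral mu D f 0.
Proof.
move=> D0; apply: (@bochner_ae_eq (cst 0)).
  by exists D; split=> // x /= H; apply: contrapT => nD; apply: H => /nD.
have s0 : simple_on mu D (cst (0 : V)).
  split; first by apply: (@sub_finite_set _ _ [set (0 : V)]) => // _ [x _ <-].
  move=> v; rewrite /preimage /=; split.
    have [->|v0] := eqVneq v 0.
      by rewrite (_ : [set _ | _] = setT) ?setIT//; apply/seteqP; split.
    rewrite (_ : [set _ | _] = set0) ?setI0//; apply/seteqP; split=> // x /= e.
    by rewrite -e eqxx in v0.
  by move=> v0; rewrite (_ : [set _ | _] = set0) ?setI0 ?measure0//; apply/seteqP; split=> // x /= e; rewrite -e eqxx in v0.
exists (fun=> cst 0); split=> //.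
- by apply: aeW => x _; exact: cvg_cst.
- rewrite (_ : (fun=> _) = cst 0%E); first exact: cvg_cst.
  apply/funext => k; under eq_integral do rewrite subrr normr0; exact: integral0.
rewrite /simple_integral fsbig1; first exact: cvg_cst.
by move=> v [x _ <-]; rewrite scaler0.
Qed.

End bochner_theory.

(** * Weakly singular Volterra equations *)

Section kernel.
Context {R : realType}.
Local Notation leb := (@lebesgue_measure R).
Implicit Types (s t e C : R).

(** Evaluated at x = s - t, this is (t - s)^(-3/4). It is nondecreasing on the negative half-line,
    so it does not grow when s is replaced by an earlier sampling time. *)
Definition kernel (x : R) : R := if x < 0 then (- x) `^ (- (3 / 4)) else 0.

Lemma kernel_ge0 x : 0 <= kernel x.
Proof. by rewrite /kernel; case: ifP => // _; exact: powR_ge0. Qed.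

Lemma kernel_le x y : x <= y -> y < 0 -> kernel x <= kernel y.
Proof.
move=> xy y0; rewrite /kernel y0 (le_lt_trans xy y0) !powRN lef_pV2 ?posrE ?powR_gt0 ?oppr_gt0//; last exact: le_lt_trans y0.
by rewrite ge0_ler_powR ?nnegrE ?oppr_ge0 ?lerN2 ?(ltW y0)//; exact: le_trans xy (ltW y0).
Qed.

Lemma kernel_continuous x : x < 0 -> {for x, continuous kernel}.
Proof.
move=> x0; have x0' : 0 < - x by rewrite oppr_gt0.
have dx := @is_derive1_comp _ _ _ x _ _ (is_derive1_powR (- (3 / 4)) x0') (is_deriveNid x 1).
have dk : is_derive x 1 kernel (- (3 / 4) * (- x) `^ (- (3 / 4) - 1) * - 1).
  apply: near_eq_is_derive dx => //.
  have : \forall y \near x, y < 0 by exact: lt_nbhsl.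
  by apply: filterS => y y0; rewrite /kernel y0.
apply: differentiable_continuous; apply/derivable1_diffP; by have [d _] := dk; exact: d.
Qed.

Lemma measurable_kernel : measurable_fun setT kernel.
Proof.
apply: measurable_fun_ifT => //=.
  exact: measurable_fun_ltr.
by apply: (measurableT_comp (measurable_powR _)); exact: measurable_funN.
Qed.

Lemma kernel_primitive t x : x < t ->
  is_derive x 1 (fun x : R => - 4 * (t - x) `^ (1 / 4)) (kernel (x - t)).
Proof.
move=> xt; have tx : 0 < t - x by rewrite subr_gt0.
have d1 : is_derive x 1 (fun x => t - x) (-1).
  by rewrite -[X in is_derive _ _ _ X]add0r; exact: is_deriveB.
have d2 : is_derive (t - x) 1 (fun y : R => y `^ (1 / 4)) (1 / 4 * (t - x) `^ (1 / 4 - 1)).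
  exact: is_derive1_powR.
have := is_deriveZ (-4) (@is_derive1_comp _ (fun y : R => y `^ (1 / 4)) (fun x => t - x) x _ _ d2 d1).
have -> : kernel (x - t) = -4 *: (1 / 4 * (t - x) `^ (1 / 4 - 1) * -1).
  rewrite /kernel subr_lt0 xt opprB /GRing.scale/= (_ : 1 / 4 - 1 = - (3 / 4)); last by field.
  by field.
exact.
Qed.

(** The primitive is singular at the endpoint t, so the fundamental theorem of calculus is applied
    on [s, t - c n], and these intervals exhaust [s, t[. *)
Lemma kernel_integral s t : s <= t ->
  (\int[leb]_(x in `[s, t]) (kernel (x - t))%:E <= (4 * (t - s) `^ (1 / 4))%:E)%E.
Proof.
move=> st; have mk : measurable_fun setT (fun x : R => (kernel (x - t))%:E).
  apply/measurable_EFinP; apply: (measurableT_comp measurable_kernel).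
  exact: measurable_funB.
have mkS D : measurable_fun D (fun x : R => (kernel (x - t))%:E) by exact: measurable_funTS.
rewrite -integral_itv_bndo_bndc//.
have [ts|st'] := leP t s.
  rewrite set_itv_ge ?integral_set0 ?lee_fin ?mulr_ge0 ?powR_ge0//.
  by rewrite bnd_simp -leNgt.
(* Dividing by n + 2 keeps [c n] strictly below t - s. *)
pose c (n : nat) := (t - s) / n.+2%:R.
have c0 n : 0 < c n by rewrite divr_gt0 ?subr_gt0.
have cts n : c n < t - s by rewrite ltr_pdivrMr// ltr_pMr ?subr_gt0// ltr1n.
pose F n := `[s, t - c n]%classic.
have cle n m : (n <= m)%N -> c m <= c n.
  by move=> nm; rewrite ler_wpM2l ?subr_ge0// lef_pV2 ?posrE// ler_nat.
have -> : `[s, t[%classic = \bigcup_n F n.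
  apply/seteqP; split=> [x|x [n _]]; rewrite /F /= !in_itv/=; last first.
    by move=> /andP[-> xt]; rewrite (le_lt_trans xt)// ltrBlDr ltrDl.
  move=> /andP[sx xt]; pose n := Num.truncn ((t - s) / (t - x)).
  exists n => //; rewrite /= in_itv/= sx/= lerBrDr -lerBrDl.
  rewrite /c ler_pdivrMr// mulrC -ler_pdivrMr ?subr_gt0//.
  by rewrite (le_trans (ltW (truncnS_gt _)))// ler_nat.
have bnd n : (\int[leb]_(x in F n) (kernel (x - t))%:E <= (4 * (t - s) `^ (1 / 4))%:E)%E.
  have sn : s < t - c n by have := cts n; lra.
  have nt (x : R) : x <= t - c n -> x < t by move=> /le_lt_trans; apply; rewrite ltrBlDr ltrDl.
  have cP (x : R) : x < t -> {for x, continuous (fun x : R => - 4 * (t - x) `^ (1 / 4))}.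
    move=> xt; apply: differentiable_continuous; apply/derivable1_diffP.
    by have [d _] := kernel_primitive xt; exact: d.
  rewrite (@continuous_FTC2 _ _ (fun x : R => - 4 * (t - x) `^ (1 / 4)))//.
  - rewrite -EFinB lee_fin subKr.
    have := powR_ge0 (c n) (1 / 4); lra.
  - apply/continuous_in_subspaceT => x /set_mem; rewrite /= in_itv/= => /andP[_ /nt xt].
    apply: (@continuous_comp _ _ _ (fun x => x - t) kernel).
      by apply: cvgB; [exact: cvg_id|exact: cvg_cst].
    by apply: kernel_continuous; rewrite subr_lt0.
  - split.
    + by move=> x; rewrite in_itv/= => /andP[_ /ltW/nt xt]; by have [d _] := kernel_primitive xt; exact: d.
    + by apply: cvg_at_right_filter; apply: cP; exact: nt (ltW sn).
    + by apply: cvg_at_left_filter; apply: cP; exact: nt (lexx _).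
  move=> x; rewrite in_itv/= => /andP[_ /ltW/nt xt].
  by rewrite (is_derive_derive1 (kernel_primitive xt)).
apply: (@cvge_le _ \oo eventually_filter _ (fun i => \int[leb]_(x in F i) (kernel (x - t))%:E)%E); last first.
  apply: ge0_nondecreasing_set_cvg_integral.
  - by move=> n m nm; apply/subsetPset => x; rewrite /F /= !in_itv/= => /andP[-> /le_trans]; apply; rewrite lerB// cle.
  - by move=> n; exact: measurable_itv.
  - by move=> n; exact: mkS.
  - by move=> n x _; rewrite lee_fin kernel_ge0.
by near=> n; exact: bnd.
Unshelve. all: by end_near. Qed.

Lemma integrable_kernel s t : s <= t -> leb.-integrable `[s, t] (fun x : R => (kernel (x - t))%:E).
Proof.
move=> st; apply/integrableP; split.
  apply: measurable_funTS; apply/measurable_EFinP; apply: (measurableT_comp measurable_kernel).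
  exact: measurable_funB.
under eq_integral do rewrite abse_EFin ger0_norm ?kernel_ge0//.
by apply: (le_lt_trans (kernel_integral st)); rewrite ltry.
Qed.

(** Bielecki's weight: in the norm weighted by exp (- a t), for a large, the singular Volterra
    operator is a contraction on the whole of [0, T], so no patching of short intervals is
    needed. *)
Lemma kernel_exp C T : 0 <= C -> exists2 a : R, 0 <= a & forall t, 0 <= t -> t <= T ->
  (\int[leb]_(x in `[0%R, t]) (C * (kernel (x - t) * expR (a * x)))%:E <= (expR (a * t) / 2)%:E)%E.
Proof.
(* The part of the integral within d of t contributes at most 4 C r exp(a t), since d^(1/4) = r.
   Elsewhere the kernel is at most b, which contributes at most (C b / a) exp(a t). [r] and [a] make
   each part at most exp(a t) / 4. *)
move=> C0; pose r := (16 * C + 16)^-1; pose d := r `^ 4.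
have r0 : 0 < r by rewrite invr_gt0; lra.
have d0 : 0 < d by exact: powR_gt0.
have dr : d `^ (1 / 4) = r.
  by rewrite /d -powRrM (_ : 4 * (1 / 4) = 1) ?powRr1 ?(ltW r0)//; field.
pose b := kernel (- d); have b0 : 0 <= b by exact: kernel_ge0.
pose a := 4 * C * b + 1; have a0 : 0 < a by rewrite ltr_wpDl// !mulr_ge0.
exists a => [|t t0 tT]; first exact: ltW.
have mk : measurable_fun setT (fun x : R => kernel (x - t)).
  by apply: (measurableT_comp measurable_kernel); exact: measurable_funB.
have me : measurable_fun setT (fun x : R => expR (a * x)).
  by apply: (measurableT_comp (@measurable_expR R)); exact: measurable_funM.
have [t_gt0|t_le0] := ltP 0 t; last first.
  have -> : t = 0 by apply/le_anti; rewrite t_le0.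
  rewrite (_ : (\int[_]_(x in _) _)%E = 0%E) ?lee_fin ?divr_ge0 ?expR_ge0//.
  apply: integral0_eq => x; rewrite /= in_itv/= => /le_anti <-.
  by rewrite subrr /kernel ltxx mul0r mulr0.
pose A x := C * expR (a * t) * (kernel (x - t) * \1_(`[t - d, t]%classic) x).
pose B x := C * b * expR (a * x).
have A0 x : 0 <= A x by rewrite !mulr_ge0// ?expR_ge0 ?kernel_ge0.
have B0 x : 0 <= B x by rewrite !mulr_ge0// ?expR_ge0.
have mA : measurable_fun setT A.
  by apply: measurable_funM => //; apply: measurable_funM => //; exact: measurable_indic.
have mB : measurable_fun setT B by exact: measurable_funM.
apply: (@le_trans _ _ (\int[leb]_(x in `[0%R, t]) ((A x)%:E + (B x)%:E))%E).
  apply: le_integral_ge0 => x; rewrite /= in_itv/= => /andP[x0 xt]; rewrite -?EFinD lee_fin.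
    by rewrite !mulr_ge0// ?expR_ge0 ?kernel_ge0.
  have [xd|xd] := leP (t - d) x.
    rewrite ler_wpDr// /A indicE mem_set ?mulr1; last by rewrite /= in_itv/= xd.
    rewrite -mulrA ler_wpM2l// mulrC ler_wpM2r ?kernel_ge0// ler_expR ler_wpM2l// ltW//.
  rewrite ler_wpDl// /B -mulrA ler_wpM2l// ler_wpM2r ?expR_ge0//.
  by apply: kernel_le; lra.
rewrite ge0_integralD//; last 4 first.
- by move=> x _; rewrite lee_fin.
- by apply/measurable_EFinP; exact: measurable_funTS.
- by move=> x _; rewrite lee_fin.
- by apply/measurable_EFinP; exact: measurable_funTS.
have -> : expR (a * t) / 2 = expR (a * t) / 4 + expR (a * t) / 4 by field.
rewrite EFinD; apply: leeD.
  apply: (@le_trans _ _ (\int[leb]_(x in `[(t - d)%R, t]) ((C * expR (a * t))%:E * (kernel (x - t))%:E))%E).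
    apply: le_integral_patch => [x _|x _|x]; rewrite -?EFinM ?lee_fin//.
      by rewrite !mulr_ge0// ?expR_ge0 ?kernel_ge0.
    rewrite !patchE; case: ifPn => _.
      case: ifPn => xd; rewrite /A indicE; first by rewrite xd mulr1.
      by rewrite (negbTE xd) !mulr0.
    by case: ifPn => // _; rewrite lee_fin !mulr_ge0// ?expR_ge0 ?kernel_ge0.
  rewrite ge0_integralZl_EFin//; last 3 first.
  - by move=> x _; rewrite lee_fin kernel_ge0.
  - by apply/measurable_EFinP; exact: measurable_funTS.
  - by rewrite mulr_ge0// expR_ge0.
  have td : t - d <= t by rewrite gerBl ltW.
  apply: (@le_trans _ _ ((C * expR (a * t))%:E * (4 * (t - (t - d)) `^ (1 / 4))%:E)%E).
    by apply: lee_wpmul2l; [rewrite lee_fin mulr_ge0// expR_ge0|exact: kernel_integral].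
  rewrite subKr dr -EFinM lee_fin [C * _]mulrC -!mulrA ler_wpM2l ?expR_ge0//.
  rewrite /r mulrA ler_pdivrMr; last by lra.
  lra.
have dB (x : R) : is_derive x 1 (fun x : R => C * b / a * expR (a * x)) (B x).
  have dl : is_derive x 1 (fun x : R => a * x) a.
    by rewrite -[X in is_derive _ _ _ X]mulr1; exact: is_deriveZ.
  have := is_deriveZ (C * b / a) (@is_derive1_comp _ expR (fun x => a * x) x _ _ (is_derive_expR _) dl).
  have -> // : C * b / a *: (expR (a * x) * a) = B x.
  by rewrite /B /GRing.scale/=; field; rewrite gt_eqF.
have cB x : {for x, continuous (fun x : R => C * b / a * expR (a * x))}.
  by apply: differentiable_continuous; apply/derivable1_diffP; have [] := dB x.
have cB' : continuous B.
  move=> x; have [db _] := is_deriveZ a (dB x).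
  have -> : B = (fun x => a *: (C * b / a * expR (a * x))).
    by apply/funext => z; rewrite /B /GRing.scale/=; field; rewrite gt_eqF.
  by apply: differentiable_continuous; apply/derivable1_diffP.
rewrite (@continuous_FTC2 _ B (fun x : R => C * b / a * expR (a * x)))//; last 3 first.
- exact: continuous_subspaceT.
- split; [by move=> x _; have [] := dB x|exact: cvg_at_right_filter (cB _)|exact: cvg_at_left_filter (cB _)].
- by move=> x _; exact: is_derive_derive1.
rewrite -EFinB lee_fin mulr0 expR0 mulr1.
have Ca : C * b / a <= 1 / 4.
  rewrite ler_pdivrMr// /a; lra.
apply: (@le_trans _ _ (C * b / a * expR (a * t))); first by rewrite gerBl !mulr_ge0// invr_ge0 ltW.
rewrite div1r in Ca; by rewrite [leLHS]mulrC ler_wpM2l ?expR_ge0.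
Qed.

End kernel.

(** * Bochner integrability of continuous functions with a weak singularity *)

Section bochner_existence.
Context {R : realType} (V : normedModType R).
Local Notation leb := (@lebesgue_measure R).
Implicit Types (g : R -> V) (t : R).

Definition norm_complete := forall a : nat -> V,
  (forall e, 0 < e -> exists N, forall m n, (N <= m)%N -> (N <= n)%N -> `|a m - a n| <= e) ->
  exists l : V, a n @[n --> \oo] --> l.

Lemma functional_continuous (l : V -> R) : functional l -> continuous l.
Proof.
move=> fl v; have H : w @[w --> v] --> v by exact: cvg_id.
move/cvg_normP : H => H; apply: (cvg_norm_le _ H).
by near=> w; rewrite -functionalB//; exact: fl.2.
Unshelve. all: by end_near. Qed.

Lemma within_measurable g t (h : V -> R) : {within `[0, t[, continuous g} -> continuous h ->
  measurable_fun `[0, t] (h \o g).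
Proof.
move=> cg ch; apply/measurable_fun_itv_bndo_bndcP.
apply: subspace_continuous_measurable_fun => // x.
exact: (@continuous_comp (subspace `[0, t[) V R g h x (cg x) (ch _)).
Qed.

Lemma within_weakly_measurable g t : {within `[0, t[, continuous g} -> weakly_measurable `[0, t] g.
Proof. by move=> cg l fl; apply: within_measurable => //; exact: functional_continuous. Qed.

Section sampling.
Variables (t : R) (t0 : 0 < t) (k : nat).
Let N := k.+1.
Let node (j : nat) : R := t * j%:R / N%:R.
Let E (j : nat) := [set x : R | node j <= x < node j.+1].

(** The left end of the cell of width t / (k + 1) containing x; sampling on the left moves away from
    the singularity at t. *)
Definition sample (x : R) := node (Num.truncn (x * N%:R / t)).

Let nodeE j x : (node j <= x) = (j%:R <= x * N%:R / t).
Proof. by rewrite /node ler_pdivrMr// ler_pdivlMr// mulrC. Qed.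

Lemma sample_le x : 0 <= x -> sample x <= x.
Proof. by move=> x0; rewrite /sample nodeE truncn_le ?divr_ge0 ?mulr_ge0 ?(ltW t0). Qed.

Lemma sample_ge0 x : 0 <= sample x.
Proof. by rewrite /sample /node divr_ge0// mulr_ge0// ltW. Qed.

Lemma sample_dist x : 0 <= x -> `|sample x - x| <= t / N%:R.
Proof.
move=> x0; rewrite ler0_norm ?subr_le0 ?sample_le// opprB lerBlDr.
have := truncnS_gt (x * N%:R / t); rewrite ltNge -nodeE -ltNge => /ltW /le_trans; apply.
rewrite /sample /node -addn1 natrD mulrDr mulrDl mulr1 addrC; exact: lexx.
Qed.

Let EP j x : 0 <= x -> E j x <-> Num.truncn (x * N%:R / t) = j.
Proof.
move=> x0; have y0 : 0 <= x * N%:R / t by rewrite divr_ge0 ?mulr_ge0// ltW.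
rewrite /E /=; split=> [/andP[]|<-].
  by rewrite ltNge !nodeE -ltNge => a b; apply/truncn_def; rewrite a b.
apply/andP; split; first by rewrite nodeE truncn_le.
by rewrite ltNge nodeE -ltNge truncnS_gt.
Qed.

Let mE j : measurable (E j).
Proof.
rewrite (_ : E j = `[node j, node j.+1[%classic); first exact: measurable_itv.
by apply/seteqP; split=> x; rewrite /E /= in_itv.
Qed.

Let D := `[0, t]%classic.

Lemma simple_on_sample g : simple_on leb D (g \o sample).
Proof.
split.
  apply: (@sub_finite_set _ _ ((g \o node) @` `I_N.+1)); last exact/finite_image/finite_II.
  move=> _ [x + <-]; rewrite /D /= in_itv/= => /andP[x0 xt].
  exists (Num.truncn (x * N%:R / t)) => //=; rewrite ltnS.
  rewrite -(@ler_nat R) (@le_trans _ _ (x * N%:R / t))//.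
    by rewrite truncn_le divr_ge0// ?mulr_ge0// ltW.
  by rewrite ler_pdivrMr// mulrC ler_wpM2l.
move=> v; have mv : measurable (D `&` (g \o sample) @^-1` [set v]).
  rewrite (_ : _ `&` _ = D `&` \bigcup_(j in [set j | g (node j) = v]) E j).
    exact: (measurableI _ _ (measurable_itv _) (@bigcup_measurable _ _ E _ (fun j _ => mE j))).
  apply/seteqP; split=> x [] Dx; have x0 : 0 <= x by move: Dx; rewrite /D /= in_itv/= => /andP[].
    by move=> /= gv; split=> //; exists (Num.truncn (x * N%:R / t)) => //; exact/EP.
  by move=> [j /= gj /(EP _ x0) jx]; split=> //=; rewrite /sample jx.
split=> // _; apply: (@le_lt_trans _ _ (leb D)); first last.
  by rewrite lebesgue_measure_itv/=; case: ifP => _; rewrite ?ltry// -EFinB ltry.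
apply: le_measure; last by move=> x [].
  exact: mem_set.
by apply: mem_set; exact: measurable_itv.
Qed.

Lemma measurable_dist_sample g : {within `[0, t[, continuous g} ->
  measurable_fun D (fun x => `|g x - g (sample x)|).
Proof.
move=> cg; have -> : D = \bigcup_j (D `&` E j).
  apply/seteqP; split=> [x Dx|x [j _ []]//].
  exists (Num.truncn (x * N%:R / t)) => //; split=> //; apply/EP => //.
  by move: Dx; rewrite /D /= in_itv/= => /andP[].
apply/measurable_fun_bigcup => [j|j]; first exact: (measurableI _ _ (measurable_itv _) (mE j)).
apply: (@eq_measurable_fun _ _ _ _ _ (fun x => `|g x - g (node j)|)).
  move=> x /set_mem[Dx]; have x0 : 0 <= x by move: Dx; rewrite /D /= in_itv/= => /andP[].
  by move=> /(EP _ x0) jx; rewrite /sample jx.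
apply: (@measurable_funS _ _ _ _ D); [exact: measurable_itv|by move=> x []|].
apply: (@within_measurable g t (fun v => `|v - g (node j)|) cg).
move=> v; apply: (@continuous_comp _ _ _ (fun v => v - g (node j)) Num.norm).
  by apply: cvgB; [exact: cvg_id|exact: cvg_cst].
exact: norm_continuous.
Qed.

End sampling.

(** The sampled step functions converge to g by continuity, and by monotonicity of the kernel both
    are dominated by the same integrable function. Their integrals are then Cauchy by
    [simple_integralB]. *)
Lemma bochner_exists g t (M : R) : norm_complete -> norming V -> 0 <= t ->
  {within `[0, t[, continuous g} ->
  (forall x, 0 <= x -> x < t -> `|g x| <= M * kernel (x - t)) ->
  exists I, is_bochner_integral leb `[0, t] g I.
Proof.
move=> cV nV t_ge0 cg gM.
have [t_gt0|t_le0] := ltP 0 t; last first.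
  exists 0; apply: bochner_null => //.
  have : leb `[0%R, t]%classic = 0%E by rewrite lebesgue_measure_itv/= lte_fin ltNge t_le0.
  exact.
have D0 x : `[0, t]%classic x -> 0 <= x by rewrite /= in_itv/= => /andP[].
have ss k := simple_on_sample t_gt0 k g.
pose s k := g \o sample t k.
have sc x : 0 <= x -> x < t -> s k x @[k --> \oo] --> g x.
  move=> x0 xt; have Ax : `[0, t[%classic x by rewrite /= in_itv/= x0.
  have /subspace_continuousP/(_ x Ax) cx := cg.
  have c1 : sample t k x @[k --> \oo] --> x.
    apply: (@cvg_norm_le _ _ _ _ _ _ _ (fun k => t * k.+1%:R^-1)).
      by near=> k; exact: sample_dist.
    rewrite -[X in _ --> X](mulr0 t); apply: cvgMl_tmp; exact: cvg_harmonic.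
  move=> B /cx HB.
  have {}HB : \forall y \near x, `[0, t[%classic y -> B (g y) by exact: HB.
  have : \forall k \near \oo, `[0, t[%classic (sample t k x) -> B (s k x) by exact: (c1 _ HB).
  apply: filterS => k; apply; rewrite /= in_itv/= sample_ge0//=.
  by apply: le_lt_trans xt; exact: sample_le.
have aex : {ae leb, forall x, x != t} by exact: ae_neq.
have sb k x : 0 <= x -> x < t -> `|g x - s k x| <= 2 * M * kernel (x - t).
  move=> x0 xt; rewrite (le_trans (ler_normB _ _))// mulr2n -mulrA mulrDl mul1r lerD ?gM//.
  have sx := sample_le t_gt0 k x0.
  have s0 := sample_ge0 t_gt0 k x.
  apply: (le_trans (gM _ s0 (le_lt_trans sx xt))).
  have M0 : 0 <= M.
    have t2 : t / 2 < t by rewrite ltr_pdivrMr// ltr_pMr// ltr1n.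
    have t20 : 0 <= t / 2 by rewrite divr_ge0.
    have := le_trans (normr_ge0 _) (gM _ t20 t2).
    by rewrite pmulr_lge0// /kernel subr_lt0 t2 powR_gt0// oppr_gt0 subr_lt0.
  by rewrite ler_wpM2l// kernel_le ?lerB// subr_lt0.
have i0 : (\int[leb]_(x in `[0%R, t]) `|g x - s k x|%:E)%E @[k --> \oo] --> 0%E.
  have mk : measurable_fun `[0%R, t]%classic (fun x : R => (2 * M * kernel (x - t))%:E).
    apply/measurable_EFinP; apply: measurable_funTS; apply: measurable_funM => //.
    by apply: (measurableT_comp measurable_kernel); exact: measurable_funB.
  have H := @dominated_convergence _ _ R leb `[0%R, t]%classic (measurable_itv _)
    (fun k x => `|g x - s k x|%:E) (cst 0%E) (fun x => (2 * M * kernel (x - t))%:E).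
  have [||||| _ _] := H.
  - by move=> k; apply/measurable_EFinP; exact: measurable_dist_sample.
  - exact: measurable_cst.
  - apply: filterS aex => x xt; rewrite /= in_itv/= => /andP[x0 xt'].
    have {}xt : x < t by rewrite lt_neqAle xt.
    apply: cvg_EFin; first by near=> k.
    by have /cvg_normP := sc x x0 xt; apply: cvg_trans; apply: near_eq_cvg; near=> k; rewrite /= distrC.
  - have ik := integrable_kernel t_ge0.
    have := @integrableZl _ _ R leb _ (measurable_itv `[0%R, t]) (2 * M) _ ik.
    by apply: eq_integrable => // x _; rewrite EFinM.
  - apply: filterS aex => x xt k; rewrite /= in_itv/= => /andP[x0 xt'].
    have {}xt : x < t by rewrite lt_neqAle xt.
    by rewrite lee_fin normr_id; exact: sb.
  by rewrite integral0.
have inn k : (0 <= \int[leb]_(x in `[0%R, t]) `|g x - s k x|%:E)%E.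
  by apply: integral_ge0 => x _; rewrite lee_fin.
have /fine_cvgP[[K0 _ HK0] i0'] := i0.
have [I HI] : exists I : V, simple_integral leb `[0%R, t] (s k) @[k --> \oo] --> I.
  apply: cV => e e0; have e20 : 0 < e / 2 by rewrite divr_gt0.
  have /cvgrPdist_le/(_ _ e20)[K1 _ HK1] := i0'.
  exists (maxn K0 K1) => m n; rewrite !geq_max => /andP[m0 m1] /andP[n0 n1].
  rewrite -lee_fin; apply: (le_trans (@simple_integralB _ _ R V leb _ (measurable_itv `[0%R, t]) (s m) (s n) nV (ss m) (ss n))).
  apply: (@le_trans _ _ (\int[leb]_(x in `[0%R, t]) (`|g x - s m x|%:E + `|g x - s n x|%:E))%E).
    apply: le_integral_ge0 => x _; first by rewrite lee_fin.
    rewrite -EFinD lee_fin (_ : _ - _ = (g x - s n x) - (g x - s m x)).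
      by apply: (le_trans (ler_normB _ _)); rewrite addrC.
    by rewrite opprB [RHS]addrC addrA subrK.
  have md j : measurable_fun `[0%R, t]%classic (fun x => `|g x - s j x|%:E).
    by apply/measurable_EFinP; exact: measurable_dist_sample.
  rewrite ge0_integralD; [|exact: measurable_itv|by move=> x _; rewrite lee_fin|exact: md|by move=> x _; rewrite lee_fin|exact: md].
  have bd j : (K0 <= j)%N -> (K1 <= j)%N -> (\int[leb]_(x in `[0%R, t]) `|g x - s j x|%:E <= (e / 2)%:E)%E.
    move=> j0 j1; rewrite -(fineK (HK0 j j0)) lee_fin.
    by have := HK1 j j1; rewrite /= sub0r normrN ger0_norm// fine_ge0.
  by rewrite [e]splitr EFinD leeD// bd.
exists I, s; split=> //.
apply: filterS aex => x xt; rewrite /= in_itv/= => /andP[x0 xt'].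
by apply: sc => //; rewrite lt_neqAle xt.
Unshelve. all: by end_near. Qed.

End bochner_existence.

(** * Picard iteration for a Volterra equation with singular kernel *)

Section volterra.
Context {R : realType} (V : normedModType R).
Local Notation leb := (@lebesgue_measure R).
Variables (U : R -> R -> V -> V) (Phi : R -> R -> V -> V) (x0 : V).
Implicit Types (u v : R -> V) (s t r T m : R).
Hypotheses (cV : norm_complete V) (nV : norming V)
  (Ulin : forall t s, 0 <= s -> s <= t -> linear (U t s))
  (Ubd : forall T, exists2 M, 0 <= M & forall s t (w : V), 0 <= s -> s <= t -> t <= T ->
    `|U t s w| <= M * `|w|)
  (Ucoc : forall t s w, 0 <= s -> s <= t -> U t 0 w = U t s (U s 0 w))
  (Ucont : forall s w, 0 <= s -> {within `[s, +oo[, continuous (fun t => U t s w)})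
  (Phib : forall T, exists2 C, 0 <= C & forall s t (w z : V), 0 <= s -> s < t -> t <= T ->
    `|Phi t s w| <= C * kernel (s - t) * (1 + `|w|) /\
    `|Phi t s w - Phi t s z| <= C * kernel (s - t) * `|w - z|)
  (Phicoc : forall r s t w, 0 <= r -> r < s -> s <= t -> Phi t r w = U t s (Phi s r w))
  (Phicont : forall u t, {within `[0, +oo[, continuous u} -> 0 < t ->
    {within `[0, t[, continuous (fun s => Phi t s (u s))}).

Local Notation cont u := {within `[0%R, +oo[, continuous u}.

Let bfun t (f : R -> V) I (l : V -> R) := @bochner_functional _ _ R V leb _ (measurable_itv `[0, t]) f I l.

Let bdist t (f g : R -> V) I J := @bochner_distance _ _ R V leb _ (measurable_itv `[0, t]) f g I J nV.

Let integ u t := is_bochner_integral leb `[0, t] (fun s => Phi t s (u s)).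

Let Phic u t : cont u -> 0 <= t -> {within `[0, t[, continuous (fun s => Phi t s (u s))}.
Proof.
move=> cu; rewrite le_eqVlt => /orP[/eqP <-|]; last exact: Phicont.
by apply/subspace_continuousP => x; rewrite /= in_itv/= => /andP[/le_lt_trans h /h]; rewrite ltxx.
Qed.

Lemma cont_bounded u T : cont u -> exists2 B, 0 <= B & forall t, 0 <= t -> t <= T -> `|u t| <= B.
Proof.
move=> cu; have [T0|T0] := leP 0 T; last first.
  by exists 0 => // t t0 tT; move: (lt_le_trans T0 (le_trans t0 tT)); rewrite ltxx.
have cn : {within `[0, T], continuous (fun t => `|u t|)}.
  have cu' : {within `[0, T], continuous u}.
    by apply: continuous_subspaceW cu => x /=; rewrite !in_itv/= => /andP[->].
  have nc : continuous (Num.norm : V -> R) by exact: norm_continuous.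
  by move=> x; exact: (@continuous_comp (subspace `[0, T]) V R u Num.norm x (cu' x) (nc _)).
have [c _ cmax] := EVT_max T0 cn.
by exists `|u c| => // t t0 tT; apply: cmax; rewrite in_itv/= t0.
Qed.

Let integ_ex u t : cont u -> 0 <= t -> exists I, integ u t I.
Proof.
move=> cu t0; have [B B0 uB] := cont_bounded t cu; have [C C0 PC] := Phib t.
apply: (@bochner_exists _ _ _ _ (C * (1 + B))) => //; first exact: Phic.
move=> s s0 st; have [H _] := PC s t (u s) 0 s0 st (lexx t).
apply: (le_trans H); rewrite mulrAC ler_wpM2r ?kernel_ge0// ler_wpM2l// lerD2l.
exact: uB (ltW st).
Qed.

Let J u t := xget 0 [set I | integ u t I].

Let JP u t : cont u -> 0 <= t -> integ u t (J u t).
Proof.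
move=> cu t0; have [I HI] := integ_ex cu t0.
exact: (@xgetPex _ 0 [set I | integ u t I]) (ex_intro _ I HI).
Qed.

Definition picard u t := U t 0 x0 + J u t.

Let wm u t : cont u -> 0 <= t -> weakly_measurable `[0, t] (fun s => Phi t s (u s)).
Proof. by move=> cu t0; apply: within_weakly_measurable; exact: Phic. Qed.

(** The form l o U t s becomes a contractive functional after division by M + 1, so it commutes with
    the integral; the cocycle property of [Phi] then absorbs U t s into the integrand. *)
Let J_evolve u s t (l : V -> R) : cont u -> 0 <= s -> s <= t -> functional l ->
  l (U t s (J u s)) = \int[leb]_(r in `[0, s]) l (Phi t r (u r)).
Proof.
move=> cu s0 st fl; have t0 := le_trans s0 st.
have [M M0 UM] := Ubd t.
have M1 : 0 < M + 1 by rewrite ltr_wpDl.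
pose l' (w : V) := (M + 1)^-1 * l (U t s w).
have fl' : functional l'.
  split=> [a v w|v].
    rewrite /l' (@Ulin t s s0 st).
    have lD : l (a *: U t s v + U t s w) = a * l (U t s v) + l (U t s w).
      by rewrite functionalD// functionalZ.
    transitivity ((M + 1)^-1 * (a * l (U t s v) + l (U t s w))); first by congr (_ * _).
    by rewrite mulrDr mulrCA.
  rewrite /l' normrM gtr0_norm ?invr_gt0// ler_pdivrMl//.
  rewrite (le_trans (fl.2 _))// (le_trans (UM _ _ _ s0 st (lexx t)))//.
  by rewrite ler_wpM2r// lerDl.
have [i1 E1] := bfun fl' (wm cu s0) (JP cu s0).
have i2 := (bfun fl (wm cu t0) (JP cu t0)).1.
have i3 : leb.-integrable `[0, s]%classic (EFin \o (fun r => l (Phi t r (u r)))).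
  apply: integrableS i2 => // r; rewrite /= !in_itv/= => /andP[-> rs]; exact: le_trans st.
apply: (@mulfI _ (M + 1)^-1); first by rewrite invr_eq0 gt_eqF.
rewrite -[LHS]E1 -RintegralZl//; congr fine; apply: ae_eq_integral => //.
- exact: measurable_int i1.
- apply/measurable_EFinP; apply: measurable_funM => //.
  by apply/measurable_EFinP; exact: measurable_int i3.
apply: filterS (ae_neq s) => r rs; rewrite /= in_itv/= => /andP[r0 rs'].
by rewrite /l' (@Phicoc r s t _ r0 _ st)// lt_neqAle rs.
Qed.

(** [picard u t] is compared with the evolution of [picard u s]: by the cocycle property the
    contributions up to time s cancel, and the integral over ]s, t] is bounded by that of the
    kernel. *)
Lemma picard_increment u T : cont u -> exists2 c, 0 <= c & forall s t, 0 <= s -> s <= t -> t <= T ->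
  `|picard u t - U t s (picard u s)| <= c * (t - s) `^ (1 / 4).
Proof.
move=> cu; have [B B0 uB] := cont_bounded T cu; have [C C0 PC] := Phib T.
exists (C * (1 + B) * 4) => [|s t s0 st tT]; first by rewrite !mulr_ge0// addr_ge0.
have t0 := le_trans s0 st.
have -> : picard u t - U t s (picard u s) = J u t - U t s (J u s).
  rewrite /picard (@Ucoc t s _ s0 st).
  have := @Ulin t s s0 st 1 (U s 0 x0) (J u s); rewrite !scale1r => ->.
  by rewrite opprD addrACA subrr add0r.
have [l fl E] := nV (J u t - U t s (J u s)); rewrite -E functionalB// (J_evolve cu s0 st fl).
have [i2 <-] := bfun fl (wm cu t0) (JP cu t0).
rewrite Rintegral_itvB ?bnd_simp//.
have i4 : leb.-integrable `]s, t]%classic (EFin \o (fun r => l (Phi t r (u r)))).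
  apply: integrableS i2 => // r; rewrite /= !in_itv/= => /andP[sr ->]; rewrite andbT.
  exact: le_trans s0 (ltW sr).
apply: (le_trans (ler_norm _)); apply: (le_trans (@le_normr_Rintegral _ _ R leb _ _ (measurable_itv `]s, t]) i4)).
rewrite -lee_fin fineK; last first.
  apply: (@integrable_fin_num _ _ R leb _ (measurable_itv `]s, t]) (fun r => (`|l (Phi t r (u r))|)%:E)).
  exact: integrable_norm i4.
have k0 r : 0 <= C * (1 + B) * kernel (r - t) by rewrite !mulr_ge0// ?addr_ge0// kernel_ge0.
apply: (@le_trans _ _ (\int[leb]_(r in `]s, t]) (C * (1 + B) * kernel (r - t))%:E)%E).
  apply: le_integral_ae => [r _|r _|]; rewrite ?lee_fin//.
  apply: filterS (ae_neq t) => r rt; rewrite /= in_itv/= => /andP[sr rt'].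
  have r0 : 0 <= r by exact: le_trans (ltW sr).
  have {}rt : r < t by rewrite lt_neqAle rt.
  have [H _] := PC r t (u r) 0 r0 rt tT.
  rewrite lee_fin (le_trans (fl.2 _))// (le_trans H)// mulrAC ler_wpM2r ?kernel_ge0//.
  by rewrite ler_wpM2l// lerD2l uB// (le_trans (ltW rt)).
apply: (@le_trans _ _ (\int[leb]_(r in `[s, t]) ((C * (1 + B))%:E * (kernel (r - t))%:E))%E).
  apply: le_integral_patch => [r _|r _|r]; rewrite -?EFinM ?lee_fin//.
  rewrite !patchE; case: ifPn => [/set_mem|_].
    rewrite /= in_itv/= => /andP[sr rt]; rewrite ifT// inE/= in_itv/= (ltW sr)//.
  by case: ifPn => // _; rewrite lee_fin.
rewrite ge0_integralZl_EFin//; last 3 first.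
- by move=> r _; rewrite lee_fin kernel_ge0.
- exact: measurable_int (integrable_kernel st).
- by rewrite mulr_ge0// addr_ge0.
rewrite -[in leRHS]mulrA [leRHS]EFinM; apply: lee_wpmul2l; last exact: kernel_integral.
by rewrite lee_fin mulr_ge0// addr_ge0.
Qed.

(** For t' near t, both values are compared with the evolution of the single vector [picard u s],
    for a fixed s slightly before t; strong continuity of U on that vector suffices. *)
Lemma picard_continuous u : cont u -> cont (picard u).
Proof.
move=> cu; apply/subspace_continuousP => t; rewrite /= in_itv/= andbT => t0.
have [c c0 cP] := picard_increment (t + 1) cu.
apply/cvgrPdist_le => e e0.
(* t and t' lie within 2 d of s, and (2 d)^(1/4) <= h, so both increments are at most c h <= e /
   3. *)
pose h := e / 3 / (c + 1); have c1 : 0 < c + 1 by rewrite ltr_wpDl.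
have h0 : 0 < h by rewrite !divr_gt0.
pose d := Num.min 1 (h `^ 4) / 2.
have d0 : 0 < d by rewrite divr_gt0// lt_min ltr01 powR_gt0.
have d1 : d < 1.
  have : Num.min 1 (h `^ 4) <= 1 by rewrite ge_min lexx.
  rewrite /d; lra.
have dh : 2 * d <= h `^ 4.
  by rewrite /d mulrC divfK// ge_min lexx orbT.
pose s := Num.max 0 (t - d).
have s0 : 0 <= s by rewrite le_max lexx.
have st : s <= t by rewrite ge_max t0/= gerBl ltW.
have key t' : s <= t' -> t' < t + d -> `|picard u t' - U t' s (picard u s)| <= e / 3.
  move=> st' t'd; have t'1 : t' <= t + 1 by rewrite ltW// (lt_trans t'd)// ltrD2l.
  apply: (le_trans (cP s t' s0 st' t'1)).
  have : (t' - s) `^ (1 / 4) <= h.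
    have -> : h = (h `^ 4) `^ (1 / 4).
      by rewrite -powRrM (_ : 4 * (1 / 4) = 1) ?powRr1 ?(ltW h0)//; field.
    apply: ge0_ler_powR; rewrite ?nnegrE ?subr_ge0 ?powR_ge0//.
    apply: le_trans dh; have : t - d <= s by rewrite le_max lexx orbT.
    lra.
  move=> /(ler_wpM2l c0) /le_trans; apply.
  rewrite /h mulrCA ger_pMr ?divr_gt0// ler_pdivrMr// mul1r lerDl//.
have Uc : \forall t' \near within `[0, +oo[ (nbhs t), s <= t' ->
    `|U t s (picard u s) - U t' s (picard u s)| <= e / 3.
  have /subspace_continuousP/(_ t) := @Ucont s (picard u s) s0.
  rewrite /= in_itv/= andbT => /(_ st)/cvgrPdist_le/(_ (e / 3)).
  rewrite divr_gt0// => /(_ isT) H.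
  have H' : \forall t' \near t, s <= t' -> `|U t s (picard u s) - U t' s (picard u s)| <= e / 3.
    have {}H : \forall t' \near t, `[s, +oo[%classic t' -> `|U t s (picard u s) - U t' s (picard u s)| <= e / 3 by exact: H.
    by apply: filterS H => t' H st'; apply: H; rewrite /= in_itv/= st'.
  by apply: filterS H' => t' Ht' _.
have near_t : \forall t' \near within `[0, +oo[ (nbhs t), 0 <= t' /\ `|t - t'| < d.
  have : \forall t' \near t, `|t - t'| < d by exact: (nbhsx_ballx t d d0).
  by apply: filterS => t' td; rewrite /= in_itv/= andbT.
apply: filterS2 near_t Uc => t' [t'0]; rewrite ltr_norml => /andP[td td'] Uc.
have st' : s <= t' by rewrite ge_max t'0/=; lra.
have H1 := key t st; have H2 := key t' st'.
have -> : picard u t - picard u t' = (picard u t - U t s (picard u s)) +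
    ((U t s (picard u s) - U t' s (picard u s)) - (picard u t' - U t' s (picard u s))).
  by rewrite opprB !subrKA.
have -> : e = e / 3 + (e / 3 + e / 3) by field.
rewrite (le_trans (ler_normD _ _))// lerD ?H1 ?ltrDl//.
rewrite (le_trans (ler_normB _ _))// lerD ?Uc// H2//; lra.
Qed.

Lemma picard_contraction T : exists2 a, 0 <= a & forall u v m, cont u -> cont v -> 0 <= m ->
  (forall t, 0 <= t -> t <= T -> `|u t - v t| <= m * expR (a * t)) ->
  forall t, 0 <= t -> t <= T -> `|picard u t - picard v t| <= m / 2 * expR (a * t).
Proof.
have [C C0 PC] := Phib T; have [a a0 aP] := kernel_exp T C0; exists a => // u v m cu cv m0 uv t t0 tT.
have -> : picard u t - picard v t = J u t - J v t by rewrite /picard opprD addrACA subrr add0r.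
rewrite -lee_fin; apply: (le_trans (bdist (wm cu t0) (wm cv t0) (JP cu t0) (JP cv t0))).
have mk : measurable_fun `[0, t]%classic (fun x : R => (C * (kernel (x - t) * expR (a * x)))%:E).
  apply/measurable_EFinP; apply: measurable_funTS; apply: measurable_funM => //; apply: measurable_funM.
    by apply: (measurableT_comp measurable_kernel); exact: measurable_funB.
  by apply: (measurableT_comp (@measurable_expR R)); exact: measurable_funM.
have kk x : 0 <= C * (kernel (x - t) * expR (a * x)) by rewrite !mulr_ge0 ?expR_ge0 ?kernel_ge0.
apply: (@le_trans _ _ (\int[leb]_(x in `[0%R, t]) (m%:E * (C * (kernel (x - t) * expR (a * x)))%:E))%E).
  apply: le_integral_ae => [r _|r _|]; [by rewrite lee_fin|by rewrite -EFinM lee_fin mulr_ge0|].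
  apply: filterS (ae_neq t) => r rt; rewrite /= in_itv/= => /andP[r0 rt'].
  have {}rt : r < t by rewrite lt_neqAle rt.
  have [_ H] := PC r t (u r) (v r) r0 rt tT.
  rewrite -EFinM lee_fin (le_trans H)// mulrCA -mulrA ler_wpM2l// mulrCA ler_wpM2l ?kernel_ge0//.
  by apply: uv => //; exact: le_trans (ltW rt) tT.
rewrite ge0_integralZl_EFin//; last by move=> x _; rewrite lee_fin.
rewrite -mulrA (mulrC 2^-1) EFinM; apply: lee_wpmul2l; first by rewrite lee_fin.
exact: aP.
Qed.

Let zero_of_geometric (x c : R) : (forall k, x <= c * (2^-1) ^+ k) -> x <= 0.
Proof.
move=> xc; have H : c * (2^-1) ^+ k @[k --> \oo] --> c * 0.
  by apply: cvgMl_tmp; apply: cvg_expr; rewrite gtr0_norm ?invr_gt0// invf_lt1// ltr1n.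
rewrite mulr0 in H; apply: (ler_cvg_to (cvg_cst x) H).
by near=> k; exact: xc.
Unshelve. all: by end_near. Qed.

(** The weight a depends on T, so geometric convergence of the iterates is obtained separately on
    each [0, T]; the pointwise limit does not depend on T. *)
Lemma picard_fixpoint : exists2 u : R -> V, cont u & forall t, 0 <= t -> picard u t = u t.
Proof.
pose p k := iter k picard (cst 0).
have cp k : cont (p k).
  elim: k => [|k IH]; last exact: picard_continuous.
  by apply: continuous_subspaceT => x; exact: cvg_cst.
have geo T : exists a m, [/\ 0 <= a, 0 <= m & forall k n t, 0 <= t -> t <= T -> (k <= n)%N ->
    `|p n t - p k t| <= 2 * m * (2^-1) ^+ k * expR (a * t)].
  have [a a0 aP] := picard_contraction T.
  have c1 : cont (fun t => p 1%N t - p 0%N t).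
    by move=> x; apply: cvgB; exact: cp.
  have [m m0 mP] := cont_bounded T c1.
  have step k t : 0 <= t -> t <= T -> `|p k.+1 t - p k t| <= m * (2^-1) ^+ k * expR (a * t).
    elim: k t => [|k IH] t t0 tT.
      rewrite expr0 mulr1 (le_trans (mP t t0 tT))// ler_peMr// -expR0 ler_expR mulr_ge0//.
    have mk : 0 <= m * 2^-1 ^+ k by rewrite mulr_ge0// exprn_ge0.
    have := aP _ _ _ (cp k.+1) (cp k) mk IH t t0 tT.
    by rewrite exprSr mulrA.
  exists a, m; split=> // k n t t0 tT kn; rewrite -(subnKC kn).
  have E0 : 0 <= expR (a * t) by exact: expR_ge0.
  have -> : 2 * m * 2^-1 ^+ k * expR (a * t) = (m * 2^-1 ^+ k * expR (a * t)) * 2 by ring.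
  (* The defect 2 * 2^-(n - k) is what lets the induction on n - k close. *)
  suff : `|p (k + (n - k))%N t - p k t| <= (m * 2^-1 ^+ k * expR (a * t)) * (2 - 2 * 2^-1 ^+ (n - k)).
    move=> /le_trans; apply; rewrite ler_wpM2l ?mulr_ge0 ?exprn_ge0// gerBl mulr_ge0// exprn_ge0//.
  elim: (n - k)%N => [|j IH]; first by rewrite addn0 subrr normr0 expr0 mulr1 subrr mulr0.
  rewrite addnS -(subrKA (p (k + j)%N t)) (le_trans (ler_normD _ _))//.
  have := lerD (step (k + j)%N t t0 tT) IH => /le_trans; apply.
  rewrite exprD exprS.
  have -> : m * (2^-1 ^+ k * 2^-1 ^+ j) * expR (a * t) + m * 2^-1 ^+ k * expR (a * t) * (2 - 2 * 2^-1 ^+ j)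
    = m * 2^-1 ^+ k * expR (a * t) * (2 - 2^-1 ^+ j) by ring.
  by rewrite mulrA divff// mul1r.
have small (e c : R) : 0 < e -> exists k, c * 2^-1 ^+ k <= e.
  move=> e0; apply: contrapT => H; have : e <= 0.
    apply: (@zero_of_geometric _ c) => k; apply: ltW; rewrite ltNge; apply/negP => Hk.
    by apply: H; exists k.
  by rewrite leNgt e0.
have lim_ex t : exists l : V, 0 <= t -> p k t @[k --> \oo] --> l.
  have [t0|t0] := leP 0 t; last by exists 0.
  have [a [m [a0 m0 H]]] := geo t.
  have [|l Hl] := cV (a := fun k => p k t); last by exists l.
  move=> e e0; have e20 : 0 < e / 2 by rewrite divr_gt0.
  have [k kP] := small _ (2 * m * expR (a * t)) e20.
  have kP' n : (k <= n)%N -> `|p n t - p k t| <= e / 2.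
    by move=> kn; rewrite (le_trans (H k n t t0 (lexx t) kn))// mulrAC.
  exists k => i j ki kj; rewrite -(subrKA (p k t)) (le_trans (ler_normD _ _))// [e]splitr.
  by rewrite lerD ?kP'// distrC kP'.
have [u uP] := choice lim_ex.
have ugeo T : exists a m, [/\ 0 <= a, 0 <= m & forall k t, 0 <= t -> t <= T ->
    `|u t - p k t| <= m * (2^-1) ^+ k * expR (a * t)].
  have [a [m [a0 m0 H]]] := geo T.
  exists a, (2 * m); split=> //; first by rewrite mulr_ge0.
  move=> k t t0 tT; have c1 : `|p n t - p k t| @[n --> \oo] --> `|u t - p k t|.
    by apply: cvg_norm; apply: cvgB; [exact: uP|exact: cvg_cst].
  apply: (ler_cvg_to c1 (cvg_cst _)); exists k => // n /= kn; exact: H.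
have cu : cont u.
  apply/subspace_continuousP => t; rewrite /= in_itv/= andbT => t0.
  have [a [m [a0 m0 H]]] := ugeo (t + 1).
  apply/cvgrPdist_le => e e0; have e30 : 0 < e / 3 by rewrite divr_gt0.
  have [k kP] := small _ (m * expR (a * (t + 1))) e30.
  have kP' t' : 0 <= t' -> t' <= t + 1 -> `|u t' - p k t'| <= e / 3.
    move=> t'0 t'1; rewrite (le_trans (H k t' t'0 t'1))//; apply: le_trans kP.
    rewrite mulrAC ler_wpM2r ?exprn_ge0// ler_wpM2l// ler_expR ler_wpM2l//.
  have near_t : \forall t' \near within `[0, +oo[ (nbhs t), 0 <= t' /\ `|t - t'| < 1.
    have : \forall t' \near t, `|t - t'| < 1 by exact: (nbhsx_ballx t 1 ltr01).
    by apply: filterS => t' td; rewrite /= in_itv/= andbT.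
  have ck : \forall t' \near within `[0, +oo[ (nbhs t), `|p k t - p k t'| <= e / 3.
    have /subspace_continuousP/(_ t) := cp k.
    by rewrite /= in_itv/= andbT => /(_ t0)/cvgrPdist_le/(_ (e / 3) e30).
  apply: filterS2 near_t ck => t' [t'0]; rewrite ltr_norml => /andP[td _] ck.
  have H1 : `|u t - p k t| <= e / 3 by apply: kP' => //; rewrite lerDl.
  have H2 : `|u t' - p k t'| <= e / 3 by apply: kP' => //; lra.
  have -> : u t - u t' = (u t - p k t) + ((p k t - p k t') - (u t' - p k t')) by rewrite opprB !subrKA.
  have -> : e = e / 3 + (e / 3 + e / 3) by field.
  rewrite (le_trans (ler_normD _ _))// lerD//.
  by rewrite (le_trans (ler_normB _ _))// lerD.
exists u => // t t0; apply/eqP; rewrite -subr_eq0 -normr_le0.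
have [a1 [m1 [a10 m10 H1]]] := ugeo t; have [a a0 aP] := picard_contraction t.
pose c := m1 * expR (a1 * t).
have c0 : 0 <= c by rewrite mulr_ge0// expR_ge0.
(* [picard u t] and [u t] are both compared with the iterate of order k + 1, the image under
   [picard] of the iterate of order k. *)
apply: (@zero_of_geometric _ (c * expR (a * t) + c)) => k.
have k0 : 0 <= 2^-1 ^+ k :> R by rewrite exprn_ge0.
have uk r : 0 <= r -> r <= t -> `|u r - p k r| <= c * 2^-1 ^+ k * expR (a * r).
  move=> r0 rt; rewrite (le_trans (H1 k r r0 rt))// /c mulrAC -[leRHS]mulrA [_ * expR (a * r)]mulrC mulrA.
  rewrite ler_wpM2r// (@le_trans _ _ (m1 * expR (a1 * t)))//.
    by rewrite ler_wpM2l// ler_expR ler_wpM2l.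
  by rewrite ler_peMr// -expR0 ler_expR mulr_ge0.
have ck0 : 0 <= c * 2^-1 ^+ k by rewrite mulr_ge0.
have h1 := aP u (p k) _ cu (cp k) ck0 uk t t0 (lexx t).
have h2 := H1 k.+1 t t0 (lexx t).
rewrite distrC in h2.
rewrite -(subrKA (p k.+1 t)) (le_trans (ler_normD _ _))//; apply: (le_trans (lerD h1 h2)).
have E0 := expR_ge0 (a * t); rewrite exprS.
have -> : m1 * (2^-1 * 2^-1 ^+ k) * expR (a1 * t) = c * 2^-1 ^+ k / 2 by rewrite /c; ring.
have -> : (c * expR (a * t) + c) * 2^-1 ^+ k = c * 2^-1 ^+ k * expR (a * t) + c * 2^-1 ^+ k by ring.
rewrite lerD//; last by rewrite ler_pdivrMr// ler_peMr// ler1n.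
by rewrite ler_wpM2r// ler_pdivrMr// ler_peMr// ler1n.
Qed.

(** For uniqueness, the contraction is iterated from any bound of the difference of two solutions on
    [0, T]. *)
Theorem volterra_solution : exists u : R -> V, [/\ cont u,
  forall t, 0 <= t -> is_bochner_integral leb `[0, t] (fun s => Phi t s (u s)) (u t - U t 0 x0) &
  forall v, cont v ->
    (forall t, 0 <= t -> is_bochner_integral leb `[0, t] (fun s => Phi t s (v s)) (v t - U t 0 x0)) ->
    forall t, 0 <= t -> v t = u t].
Proof.
have [u cu uE] := picard_fixpoint; exists u; split=> //.
  move=> t t0; rewrite -(uE t t0) /picard addrAC subrr add0r; exact: JP.
move=> v cv vP T T0.
have vE t : 0 <= t -> v t = picard v t.
  move=> t0; rewrite /picard; apply/eqP; rewrite addrC -subr_eq; apply/eqP.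
  exact: (@bochner_uniq _ _ R V leb _ (measurable_itv `[0, t]) _ _ _ nV (wm cv t0) (vP t t0) (JP cv t0)).
have [a a0 aP] := picard_contraction T.
have cuv : cont (fun t => v t - u t) by move=> x; apply: cvgB; [exact: cv|exact: cu].
have [m m0 mP] := cont_bounded T cuv.
have H k t : 0 <= t -> t <= T -> `|v t - u t| <= m * 2^-1 ^+ k * expR (a * t).
  elim: k t => [|k IH] t t0 tT.
    by rewrite expr0 mulr1 (le_trans (mP t t0 tT))// ler_peMr// -expR0 ler_expR mulr_ge0.
  have mk : 0 <= m * 2^-1 ^+ k by rewrite mulr_ge0// exprn_ge0.
  by rewrite (vE t t0) -(uE t t0) exprSr mulrA; exact: aP.
apply/eqP; rewrite -subr_eq0 -normr_le0.
apply: (@zero_of_geometric _ (m * expR (a * T))) => k.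
by rewrite mulrAC; exact: H.
Qed.

End volterra.

(** * The source term *)

Section arrhenius.
Context {R : realType}.
Implicit Types (f : R -> R) (x y a b : R).

Lemma half_line_lipschitz f (L : R) : (forall x, x <= 0 -> f x = 0) ->
  (forall x, 0 < x -> exists2 l, is_derive x 1 f l & `|l| <= L) ->
  (forall x, 0 < x -> `|f x| <= L * x) -> forall x y, `|f y - f x| <= L * `|y - x|.
Proof.
move=> f0 df fL.
have [l _ lL] := df 1 ltr01; have L0 : 0 <= L by exact: le_trans lL.
have key a b : a < b -> `|f b - f a| <= L * (b - a).
  move=> ab; have [a0|a0] := leP a 0.
    rewrite (f0 a a0) subr0; have [b0|b0] := leP b 0.
      by rewrite (f0 b b0) normr0 mulr_ge0// subr_ge0 ltW.
    by rewrite (le_trans (fL b b0))// ler_wpM2l// lerDl oppr_ge0.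
  have dfx x : 0 < x -> is_derive x 1 f (derive1 f x) /\ `|derive1 f x| <= L.
    move=> x0; have [l' dl lL'] := df x x0.
    by rewrite (is_derive_derive1 dl).
  have pos x : x \in `[a, b] -> 0 < x.
    by rewrite in_itv/= => /andP[ax _]; exact: lt_le_trans ax.
  have [||c cab ->] := @MVT R f (derive1 f) a b ab.
  - move=> x; rewrite in_itv/= => /andP[ax _].
    by have [] := dfx x (lt_trans a0 ax).
  - apply: derivable_within_continuous => x xab.
    by have [[d _] _] := dfx x (pos x xab).
  rewrite normrM (gtr0_norm (_ : 0 < b - a)) ?subr_gt0// ler_wpM2r ?subr_ge0 ?(ltW ab)//.
  by move: cab; rewrite in_itv/= => /andP[ac _]; have [] := dfx c (lt_trans a0 ac).
move=> x y; have [xy|yx|->] := ltgtP x y.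
- by rewrite [`|y - x|]gtr0_norm ?subr_gt0//; exact: key.
- by rewrite distrC [`|y - x|]distrC [`|x - y|]gtr0_norm ?subr_gt0//; exact: key.
- by rewrite !subrr normr0 mulr0.
Qed.

Lemma lipschitz_continuous f (L : R) : (forall x y, `|f y - f x| <= L * `|y - x|) -> continuous f.
Proof.
move=> fL x; apply: (@cvg_norm_le _ _ _ _ _ _ _ (fun y => L * `|y - x|)); first by near=> y.
rewrite -[X in _ --> X](mulr0 L); apply: cvgMl_tmp.
have H : y @[y --> x] --> x by exact: cvg_id.
by have /cvg_normP := H.
Unshelve. all: by end_near. Qed.

Variables (E : R) (E0 : 0 < E).

(** Used at s = E / x: the derivative of exp(- E / x) is s^2 exp(- s) / E, and that of x exp(- E /
    x) is exp(- s) + s exp(- s). *)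
Let expR_bound (s : R) : 0 <= s -> s * expR (- s) <= 1 /\ s ^+ 2 * expR (- s) <= 4.
Proof.
move=> s0; rewrite expRN; have e0 := expR_gt0 s; split; rewrite ler_pdivrMr// ?mul1r.
  by apply: le_trans (expR_ge1Dx s); rewrite lerDr.
have h : (s / 2) ^+ 2 <= expR (s / 2) ^+ 2.
  rewrite ler_pXn2r// ?nnegrE ?divr_ge0 ?expR_ge0//.
  by apply: le_trans (expR_ge1Dx _); rewrite lerDr.
rewrite [in leRHS]expr2 -expRD -splitr exprMn in h; lra.
Qed.

Let darr x : 0 < x -> is_derive x 1 (arrhenius E) (expR (- (E / x)) * (E / x ^+ 2)).
Proof.
move=> x0; have xn0 : x != 0 by rewrite gt_eqF.
have dV := is_deriveV xn0 (is_derive_id x 1).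
have dE := is_deriveZ (- E) dV.
have dc := @is_derive1_comp _ expR _ x _ _ (is_derive_expR _) dE.
have pos : \forall y \near x, 0 < y by exact: lt_nbhsr.
apply: (@near_eq_is_derive _ _ _ (expR \o (fun y => - E *: y^-1))).
  by apply: filterS pos => y y0; rewrite /arrhenius y0 /=.
have -> : expR (- (E / x)) * (E / x ^+ 2) = expR (- E *: x^-1) * (- E *: (- x ^- 2 *: 1)).
  by rewrite /GRing.scale/= mulNr; field.
exact: dc.
Qed.

Lemma arrhenius_lipschitz x y : `|arrhenius E y - arrhenius E x| <= 4 / E * `|y - x|.
Proof.
apply: half_line_lipschitz => {x y} [x|x x0|x x0].
- by rewrite /arrhenius leNgt => /negbTE ->.
- eexists; first exact: darr.
  have s0 : 0 <= E / x by rewrite divr_ge0 ?ltW.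
  have [_ h] := expR_bound s0.
  rewrite ger0_norm ?mulr_ge0 ?expR_ge0 ?divr_ge0 ?invr_ge0 ?sqr_ge0 ?(ltW E0)//.
  rewrite ler_pdivlMr//; apply: le_trans h; rewrite le_eqVlt; apply/orP; left; apply/eqP.
  by field; rewrite gt_eqF.
rewrite /arrhenius x0 ger0_norm ?expR_ge0// mulNr.
have s0 : 0 <= E / x by rewrite divr_ge0 ?ltW.
have [h _] := expR_bound s0.
have : expR (- (E / x)) <= x / E.
  by rewrite ler_pdivlMr// mulrC -[X in _ <= X]mul1r -ler_pdivrMr// mulrAC.
move=> /le_trans; apply; rewrite mulrAC ler_pM2r ?invr_gt0//; lra.
Qed.

(** This is what makes the term K b w g(w) globally Lipschitz in spite of the unbounded factor w:
    the slope of g decays fast enough at infinity. *)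
Lemma arrhenius_mul_lipschitz x y : `|y * arrhenius E y - x * arrhenius E x| <= 2 * `|y - x|.
Proof.
apply: (@half_line_lipschitz (fun x => x * arrhenius E x)) => {x y} [x|x x0|x x0].
- by rewrite /arrhenius leNgt => /negbTE ->; rewrite mulr0.
- have s0 : 0 <= E / x by rewrite divr_ge0 ?ltW.
  have [h _] := expR_bound s0.
  eexists; first exact: (is_deriveM (is_derive_id x 1) (darr x0)).
  rewrite /GRing.scale/= mulr1 /arrhenius x0 mulNr.
  have -> : x * (expR (- (E / x)) * (E / x ^+ 2)) = E / x * expR (- (E / x)).
    by field; rewrite gt_eqF.
  have e1 : expR (- (E / x)) <= 1 by rewrite -expR0 ler_expR oppr_le0.
  have p2 := expR_ge0 (- (E / x)); have p1 := mulr_ge0 s0 p2.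
  rewrite ger0_norm; last exact: addr_ge0.
  lra.
have e1 : arrhenius E x <= 1.
  by rewrite /arrhenius x0 -expR0 ler_expR mulNr oppr_le0 divr_ge0 ?ltW.
have e0 : 0 <= arrhenius E x by rewrite /arrhenius x0 expR_ge0.
rewrite ger0_norm ?mulr_ge0 ?(ltW x0)// mulrC ler_wpM2r ?(ltW x0)//; lra.
Qed.

Lemma arrhenius0 : arrhenius E 0 = 0.
Proof. by rewrite /arrhenius ltxx. Qed.

Lemma measurable_arrhenius : measurable_fun setT (arrhenius E).
Proof. by apply: continuous_measurable_fun; apply: lipschitz_continuous; exact: arrhenius_lipschitz. Qed.

End arrhenius.

(** * The source as a Lipschitz part plus multiplication by qhat *)

Section source_terms.
Context {R : realType} (n : nat) (P : coefficients R n).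
Local Notation leb := (@lebesgue_measure R).
Hypotheses (E_gt0 : 0 < cE P) (P_ge0 : nonneg_coefficients P) (h1 : hypH1 P)
  (h2 : hypH2 P) (h3 : hypH3 P).
Implicit Types (i : 'I_n) (x t a b e : R) (w : L2vec R n).

Definition qhat i x : R :=
  (if i == 0 :> nat then cqhat1 P x else 0) + (if i.+1 == n then cqhat2 P x else 0).

Definition qprev i x : R := if i == 0 :> nat then 0 else cq P i.-1 x.

Definition qnext i x : R := if i.+1 == n then 0 else cq P i x.

(* the source term without the contribution of qhat that is linear in w *)
Definition reg i t x (a b e : R) : R :=
  (denom P i x t)^-1 * (- derive1 (cc P i) x * a
   + (cK P i x * cb P i x * a + cd P i x) * cy P i x t * arrhenius (cE P) a
   + qprev i x * (b - a) + qnext i x * (e - a) + qhat i x * cue P).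

Lemma source_reg i t w x : source_at P t w i x =
  reg i t x (w i x) (w (ord_pred i) x) (w (ordS i) x) - (denom P i x t)^-1 * (qhat i x * w i x).
Proof.
rewrite /source_at /source_fun /reg /exchange_prev /exchange_next /qhat /qprev /qnext.
by case: ifP => _; case: ifP => _; ring.
Qed.

Lemma qhat_inL2 i : inL2 (qhat i).
Proof.
have [_ _ q1 q2] := h3.
have q0 (b : bool) f : inL2 f -> inL2 (fun x => if b then f x else 0).
  by case: b => // /(inL2Z 0); congr inL2; apply/funext => x; rewrite mul0r.
by have := inL2D (q0 (i == 0 :> nat) _ q1) (q0 (i.+1 == n) _ q2).
Qed.

Lemma qhat_ge0 i x : 0 <= qhat i x.
Proof.
have [_ _ _ q1 q2] := P_ge0; rewrite /qhat addr_ge0//; by case: ifP.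
Qed.

Lemma denom_gt0 i x t : 0 <= t -> 0 < denom P i x t.
Proof.
have [k1 [k2 [k10 _ H]]] := denom_ge h1 h2.
by move=> t0; have /andP[a _] := H i x t t0; exact: lt_le_trans a.
Qed.

Lemma denomV_bound : exists2 k : R, 0 < k & forall i x t, 0 <= t -> 0 <= (denom P i x t)^-1 <= k.
Proof.
have [k1 [k2 [k10 _ H]]] := denom_ge h1 h2.
exists k1^-1 => [|i x t t0]; first by rewrite invr_gt0.
have d0 := denom_gt0 i x t0; have /andP[a _] := H i x t t0.
by rewrite invr_ge0 ltW//= lef_pV2.
Qed.

Lemma measurable_y i t : 0 <= t -> measurable_fun setT (cy P i ^~ t).
Proof.
have [_ _ _ _ [K HK]] := coeff_nice h1 h2 i.
by move=> t0; apply: measurable_derivable; exact: nice_derivable (HK t t0).1.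
Qed.

Lemma measurable_denomV i t : 0 <= t -> measurable_fun setT (fun x => (denom P i x t)^-1).
Proof.
have [K HK] := denom_nice h1 h2 i.
by move=> t0; apply: measurable_derivable; exact: nice_derivable (HK t t0).1.
Qed.

Let qprevE i : i != 0 :> nat -> (i.-1.+1 < n)%N.
Proof. by rewrite -lt0n => /prednK ->. Qed.

Let qnextE i : i.+1 != n -> (i.+1 < n)%N.
Proof. by move=> i1; rewrite ltn_neqAle i1 ltn_ord. Qed.

Lemma measurable_inLoo (f : R -> R) : inLoo f -> measurable_fun setT f.
Proof. by rewrite /inLoo inE => /andP[/set_mem]. Qed.

Lemma measurable_qcoef i : [/\ measurable_fun setT (cd P i), measurable_fun setT (cK P i),
  measurable_fun setT (cb P i), measurable_fun setT (derive1 (cc P i))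
  & measurable_fun setT (qprev i) /\ measurable_fun setT (qnext i)].
Proof.
have [/(_ i)[/measurable_inLoo md /measurable_inLoo mK] qoo _ _] := h3.
have [_ [B HB] [C HC] _ _] := coeff_nice h1 h2 i.
split=> //; first by apply: measurable_derivable; exact: nice_derivable (HB 0 (lexx 0)).1.
  by apply: measurable_derivable; exact: nice_derivable (HC 0 (lexx 0)).2.
rewrite /qprev /qnext; split.
  have [_|h] := boolP (i == 0 :> nat); first exact: measurable_cst.
  exact: measurable_inLoo (qoo _ (qprevE h)).
have [_|h] := boolP (i.+1 == n); first exact: measurable_cst.
exact: measurable_inLoo (qoo _ (qnextE h)).
Qed.

Lemma coef_ae : exists2 M : R, 0 < M & {ae leb, forall x i,
  [/\ `|derive1 (cc P i) x| <= M, `|cK P i x * cb P i x| <= M, `|cd P i x| <= M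
    & `|qprev i x| <= M /\ `|qnext i x| <= M]}.
Proof.
have [doo qoo _ _] := h3.
have Q (b : bool) k : (~~ b -> (k.+1 < n)%N) -> exists2 M : R, 0 <= M &
    {ae leb, forall x, `|if b then 0 else cq P k x| <= M}.
  by case: b => [_|/(_ isT)/qoo/Lfun_oo_ae//]; exists 0 => //; apply: aeW => x; rewrite normr0.
have H i : exists2 M : R, 0 <= M & {ae leb, forall x,
  [/\ `|derive1 (cc P i) x| <= M, `|cK P i x * cb P i x| <= M, `|cd P i x| <= M
    & `|qprev i x| <= M /\ `|qnext i x| <= M]}.
  have [_ [B HB] [C HC] _ _] := coeff_nice h1 h2 i.
  have [/Lfun_oo_ae[D D0 HD] /Lfun_oo_ae[K K0 HK]] := doo i.
  have [Q1 Q10 H1] := Q (i == 0 :> nat) i.-1 (@qprevE i).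
  have [Q2 Q20 H2] := Q (i.+1 == n) i (@qnextE i).
  have [[nB _] [_ nC]] := (HB 0 (lexx 0), HC 0 (lexx 0)).
  have B0 := nice_ge0 nB; have C0 := nice_ge0 nC; have KB0 := mulr_ge0 K0 B0.
  exists (C + K * B + D + Q1 + Q2); first by rewrite !addr_ge0.
  near=> x; have E1 : `|cd P i x| <= D by near: x.
  have E2 : `|cK P i x| <= K by near: x.
  have E3 : `|qprev i x| <= Q1 by near: x.
  have E4 : `|qnext i x| <= Q2 by near: x.
  have E5 : `|derive1 (cc P i) x| <= C by case: nC.
  have E6 : `|cb P i x| <= B by case: nB.
  have E7 : `|cK P i x * cb P i x| <= K * B by rewrite normrM ler_pM.
  have [S1 S2] : C <= C + K * B + D + Q1 + Q2 /\ K * B <= C + K * B + D + Q1 + Q2.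
    by clear -C0 KB0 D0 Q10 Q20; lra.
  have [S3 S4 S5] : [/\ D <= C + K * B + D + Q1 + Q2, Q1 <= C + K * B + D + Q1 + Q2
      & Q2 <= C + K * B + D + Q1 + Q2] by clear -C0 KB0 D0 Q10 Q20; split; lra.
  split; [exact: le_trans E5 S1|exact: le_trans E7 S2|exact: le_trans E1 S3|].
  by split; [exact: le_trans E3 S4|exact: le_trans E4 S5].
have [M M0 HM] := fin_all_exists2 H.
have Mi i : M i <= \sum_j M j + 1.
  by rewrite (bigD1 i)//= -addrA lerDl addr_ge0// sumr_ge0.
exists (\sum_j M j + 1); first by rewrite ltr_wpDl// sumr_ge0.
have : {ae leb, forall x, forall i, [/\ `|derive1 (cc P i) x| <= M i, `|cK P i x * cb P i x| <= M i,
    `|cd P i x| <= M i & `|qprev i x| <= M i /\ `|qnext i x| <= M i]} by exact: filter_forall.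
apply: filterS => x Hx i; have [m1 m2 m3 [m4 m5]] := Hx i.
by split; [exact: le_trans m1 (Mi i)|exact: le_trans m2 (Mi i)|exact: le_trans m3 (Mi i)
  |split; [exact: le_trans m4 (Mi i)|exact: le_trans m5 (Mi i)]].
Unshelve. all: by end_near.
Qed.

Lemma measurable_reg i t (a b e : R -> R) : 0 <= t -> measurable_fun setT a ->
  measurable_fun setT b -> measurable_fun setT e ->
  measurable_fun setT (fun x => reg i t x (a x) (b x) (e x)).
Proof.
move=> t0 ma mb me; have [md mK mcb mc [mp mn]] := measurable_qcoef i.
have my := measurable_y i t0; have mD := measurable_denomV i t0.
have mg : measurable_fun setT (fun x => arrhenius (cE P) (a x)).
  exact: (measurableT_comp (measurable_arrhenius E_gt0)).
have mq := inL2_measurable (qhat_inL2 i).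
rewrite /reg; apply: measurable_funM => //; apply: measurable_funD; last exact: measurable_funM.
apply: measurable_funD; last by apply: measurable_funM => //; exact: measurable_funB.
apply: measurable_funD; last by apply: measurable_funM => //; exact: measurable_funB.
apply: measurable_funD.
  by apply: measurable_funM => //; exact: measurable_funN.
apply: measurable_funM => //; apply: measurable_funM => //; apply: measurable_funD => //.
by apply: measurable_funM => //; exact: measurable_funM.
Qed.

Lemma reg_lipschitz : exists2 C : R, 0 < C & {ae leb, forall x i t a b e a' b' e', 0 <= t ->
  `|reg i t x a b e - reg i t x a' b' e'| <= C * (`|a - a'| + `|b - b'| + `|e - e'|)}.
Proof.
have [k k0 kd] := denomV_bound; have [M M0 HM] := coef_ae; have [k3 k30 ky] := y_bound h2.
pose L := 4 / cE P; have L0 : 0 < L by rewrite divr_gt0.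
exists (k * (M + (M * 2 + M * L) * k3 + M + M)).
  by rewrite mulr_gt0// !addr_gt0// ?mulr_gt0// addr_gt0// mulr_gt0.
apply: filterS HM => x HM i t a b e a' b' e' t0.
have [m1 m2 m3 [m4 m5]] := HM i.
have /andP[D0 Dk] := kd i x t t0; have /andP[y0 yk] := ky i x t t0.
have l1 := arrhenius_lipschitz E_gt0 a' a; have l2 := arrhenius_mul_lipschitz E_gt0 a' a.
rewrite /reg -mulrBr normrM (ger0_norm D0) -[leRHS]mulrA.
apply: ler_pM => //.
set y := cy P i x t in y0 yk *; set g := arrhenius (cE P) a in l1 l2 *.
set g' := arrhenius (cE P) a' in l1 l2 *.
move: (derive1 (cc P i) x) (cK P i x * cb P i x) (cd P i x) (qprev i x) (qnext i x) (qhat i x * cue P) m1 m2 m3 m4 m5.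
move=> c1 kb d1 p q r m1 m2 m3 m4 m5.
(* The nonlinearity enters only through the increments of a g(a) and of g(a), both of them
   Lipschitz. *)
have -> : - c1 * a + (kb * a + d1) * y * g + p * (b - a) + q * (e - a) + r -
    (- c1 * a' + (kb * a' + d1) * y * g' + p * (b' - a') + q * (e' - a') + r) =
    - c1 * (a - a') + (kb * (a * g - a' * g') + d1 * (g - g')) * y +
    p * ((b - b') - (a - a')) + q * ((e - e') - (a - a')) by ring.
have A0 := normr_ge0 (a - a'); have B0 := normr_ge0 (b - b'); have C0 := normr_ge0 (e - e').
have t1 : `|- c1 * (a - a')| <= M * `|a - a'| by rewrite normrM normrN ler_wpM2r.
have t2 : `|(kb * (a * g - a' * g') + d1 * (g - g')) * y| <= (M * 2 + M * L) * k3 * `|a - a'|.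
  rewrite normrM (ger0_norm y0) mulrAC ler_pM// mulrDl (le_trans (ler_normD _ _))//.
  by rewrite lerD// normrM -mulrA ler_pM.
have t3 : `|p * ((b - b') - (a - a'))| <= M * (`|b - b'| + `|a - a'|).
  by rewrite normrM ler_pM// ler_normB.
have t4 : `|q * ((e - e') - (a - a'))| <= M * (`|e - e'| + `|a - a'|).
  by rewrite normrM ler_pM// ler_normB.
have kk : 0 <= (M * 2 + M * L) * k3.
  by apply: mulr_ge0; [apply: addr_ge0; apply: mulr_ge0; rewrite ?ltW|exact: ltW].
apply: (le_trans (ler_normD _ _)); apply: (le_trans (lerD (ler_normD _ _) t4)).
apply: (le_trans (lerD (lerD (ler_normD _ _) t3) (lexx _))).
apply: (le_trans (lerD (lerD (lerD t1 t2) (lexx _)) (lexx _))).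
move: ((M * 2 + M * L) * k3) (`|a - a'|) (`|b - b'|) (`|e - e'|) kk A0 B0 C0 => N A B C kk A0 B0 C0.
have := mulr_ge0 (ltW M0) B0; have := mulr_ge0 (ltW M0) C0.
have := mulr_ge0 kk B0; have := mulr_ge0 kk C0; lra.
Qed.

Lemma reg0 i t x : reg i t x 0 0 0 = (denom P i x t)^-1 * (qhat i x * cue P).
Proof. by rewrite /reg arrhenius0 !mulr0 !subrr !mulr0 !add0r. Qed.

Lemma y_continuous i x t (s : nat -> R) : 0 <= t -> (forall k, 0 <= s k) -> s k @[k --> \oo] --> t ->
  cy P i x (s k) @[k --> \oo] --> cy P i x t.
Proof.
move=> t0 s0 st; have [k3 _ /(_ i)[_ [_ dy _ _] _ _]] := h2.
apply/cvgrPdist_le => e e0; have [d d0 Hd] := derivable_in_near (dy x t t0) e0.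
move/cvgrPdist_lt : st => /(_ d d0); apply: filterS => k kd.
by rewrite distrC; apply: Hd => //; rewrite distrC.
Qed.

Lemma denomV_continuous i x t (s : nat -> R) : 0 <= t -> (forall k, 0 <= s k) ->
  s k @[k --> \oo] --> t -> (denom P i x (s k))^-1 @[k --> \oo] --> (denom P i x t)^-1.
Proof.
move=> t0 s0 st; apply: cvgV; first by rewrite gt_eqF// denom_gt0.
by apply: cvgD; [exact: cvg_cst|apply: cvgM; [exact: cvg_cst|exact: y_continuous]].
Qed.

Lemma reg_continuous i x t a b e (s : nat -> R) : 0 <= t -> (forall k, 0 <= s k) ->
  s k @[k --> \oo] --> t -> reg i (s k) x a b e @[k --> \oo] --> reg i t x a b e.
Proof.
move=> t0 s0 st; apply: cvgM; first exact: denomV_continuous.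
do 3 (apply: cvgD; last exact: cvg_cst); apply: cvgD; first exact: cvg_cst.
apply: cvgM; last exact: cvg_cst.
by apply: cvgM; [exact: cvg_cst|exact: y_continuous].
Qed.

(** At w = 0 only the term with [qhat * cue] remains, so linear growth follows from the Lipschitz
    bound. *)
Lemma reg_bound : exists2 C : R, 0 < C & {ae leb, forall x i t a b e, 0 <= t ->
  `|reg i t x a b e| <= C * (`|a| + `|b| + `|e| + qhat i x)}.
Proof.
have [C C0 HC] := reg_lipschitz; have [k k0 kd] := denomV_bound.
have M0 : 0 <= k * `|cue P| by rewrite mulr_ge0// ltW.
exists (C + k * `|cue P|); first by rewrite ltr_pwDl.
apply: filterS HC => x HC i t a b e t0; have q0 := qhat_ge0 i x.
have := HC i t a b e 0 0 0 t0; rewrite !subr0 reg0.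
set r := reg _ _ _ _ _ _; set c := (denom P i x t)^-1 * _ => rc.
have cM : `|c| <= k * `|cue P| * qhat i x.
  have /andP[D0 Dk] := kd i x t t0.
  by rewrite /c !normrM (ger0_norm D0) (ger0_norm q0) -[leRHS]mulrA (mulrC `|cue P|) ler_pM// mulr_ge0.
have := ler_normD (r - c) c; rewrite subrK => H; apply: (le_trans H).
apply: (le_trans (lerD rc cM)); rewrite mulrDl [leRHS]addrC mulrDr [leRHS]addrC.
have Cq : 0 <= C * qhat i x by rewrite mulr_ge0// ltW.
have ka : 0 <= k * `|cue P| * (`|a| + `|b| + `|e|) by rewrite mulr_ge0// !addr_ge0.
by move: Cq ka; rewrite !mulrDr; lra.
Qed.

End source_terms.

(** * Multiplication by L2 functions in the negative norm *)

Section L2_products.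
Context {R : realType}.
Local Notation leb := (@lebesgue_measure R).
Implicit Types (f g : R -> R) (u v z : L2 R) (K c x : R).

Definition absL2 u : L2 R := toL2 (fun x => `|u x|).

Lemma absL2_norm u : {ae leb, forall x, absL2 u x = `|u x|} /\ `|absL2 u| <= `|u|.
Proof.
have [H1 H2] : inL2 (fun x => `|u x|) /\ `|absL2 u| <= 1 * `|u|.
  apply: norm_toL2 => //; first by apply: measurableT_comp => //; exact: measurable_L2.
  by apply: aeW => x; rewrite normr_id mul1r.
by rewrite mul1r in H2; split=> //; exact: toL2_ae.
Qed.

Lemma mulL2Bl f g K c u : bddfun f K -> bddfun g c ->
  mulL2 f u - mulL2 g u = mulL2 (fun x => f x - g x) u.
Proof.
move=> fK gc; have fg : bddfun (fun x => f x - g x) (K + c).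
  split=> [|x]; first by case: fK gc => mf _ [mg _]; exact: measurable_funB.
  by case: fK gc => _ fK [_ gc]; rewrite (le_trans (ler_normB _ _))// lerD.
apply: L2_eq; near=> x; rewrite (near (L2B_ae _ _) x)// (near (mulL2_ae u fK) x)//.
by rewrite (near (mulL2_ae u gc) x)// (near (mulL2_ae u fg) x)// mulrBl.
Unshelve. all: by end_near. Qed.

(** By duality: if v and v' have norm at most N, then |v| <= 2 N almost everywhere, so f v is
    bounded in L2 through the majorant g. The estimate is independent of the sup bound K, which
    allows bounded truncations to tend to an unbounded multiplier. *)
Lemma norm_Aop_mulL2 f K c (g : L2 R) z : bddfun f K -> 0 <= c ->
  {ae leb, forall x, `|f x| <= c * `|g x|} -> `|Aop (mulL2 f z)| <= 2 * c * `|g| * `|z|.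
Proof.
move=> fK c0 fg; have C0 : 0 <= 2 * c * `|g| * `|z| by rewrite !mulr_ge0.
apply: Aop_dual => // v v' N vv' vN v'N.
have : 0 <= N by exact: le_trans vN.
(* N = 0 is treated apart, [wd_sup] asking for a strict inequality. *)
rewrite le_eqVlt => /orP[/eqP N0|N0].
  have /eqP -> : v == 0 by rewrite -normr_le0 N0.
  by rewrite dot0r normr0 mulr_ge0// -N0.
have vB : ae_bdd v (2 * N).
  apply: (wd_sup vv'); first by rewrite mulr_ge0// ltW.
  rewrite (@le_lt_trans _ _ (2 * N * N))// ?ler_pM// ?mulr_ge0// ?ler_pM//.
  by have := mulr_gt0 N0 N0; rewrite expr2; lra.
have mf : measurable_fun setT (fun x => f x * v x).
  by apply: measurable_funM; [case: fK|exact: measurable_L2].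
have [_ H] : inL2 (fun x => f x * v x) /\ `|mulL2 f v| <= c * (2 * N) * `|g|.
  apply: norm_toL2 => //; first by rewrite !mulr_ge0// ltW.
  by apply: filterS2 fg vB => x a b; rewrite normrM mulrAC ler_pM.
rewrite (dot_mulL2 _ _ fK) (le_trans (dot_le _ _))//.
apply: (le_trans (ler_wpM2l (normr_ge0 z) H)); rewrite le_eqVlt; apply/orP; left; apply/eqP; ring.
Qed.

Lemma cvg_mulL2 (f : nat -> R -> R) (z : nat -> L2 R) f0 z0 K : (forall k, bddfun (f k) K) ->
  bddfun f0 K -> (forall x, f k x @[k --> \oo] --> f0 x) -> z k @[k --> \oo] --> z0 ->
  mulL2 (f k) (z k) @[k --> \oo] --> mulL2 f0 z0.
Proof.
move=> fK f0K fx /cvg_normP zz; have K0 : 0 <= K by case: f0K => _ /(_ 0); exact: le_trans.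
have H : mulL2 (f k) z0 @[k --> \oo] --> mulL2 f0 z0.
  have [|||||_ _ //] := @L2_dct _ (fun k x => f k x * z0 x) (fun x => f0 x * z0 x) (fun x => K * z0 x).
  - by move=> k; apply: measurable_funM; [case: (fK k)|exact: measurable_L2].
  - by apply: measurable_funM; [case: f0K|exact: measurable_L2].
  - exact: inL2Z.
  - apply: aeW => x k; rewrite !normrM ler_wpM2r//.
    by rewrite (ger0_norm K0); case: (fK k).
  - by apply: aeW => x; apply: cvgM => //; exact: cvg_cst.
rewrite (_ : (fun k => _) = (fun k => mulL2 (f k) (z k - z0) + mulL2 (f k) z0)); last first.
  by apply/funext => k; rewrite (mulL2B _ _ (fK k)) subrK.
rewrite -[X in _ --> X]add0r; apply: cvgD => //.
apply: (@cvg_norm_le _ _ _ _ _ _ _ (fun k => K * `|z k - z0|)).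
  by apply: nearW => k; rewrite subr0; exact: norm_mulL2.
by rewrite -[X in _ --> X](mulr0 K); apply: cvgM => //; exact: cvg_cst.
Qed.

Lemma cvg_approx (V : normedModType R) (a : nat -> V) (l : V) :
  (forall e, 0 < e -> exists (b : nat -> V) (l' : V), [/\ \forall k \near \oo, `|a k - b k| <= e,
     `|l - l'| <= e & b k @[k --> \oo] --> l']) -> a k @[k --> \oo] --> l.
Proof.
move=> H; apply/cvgrPdist_le => e e0.
have e30 : 0 < e / 3 by rewrite divr_gt0.
have [b [l' [ab ll' /cvgrPdist_le/(_ _ e30) bl]]] := H _ e30.
near=> k; have h1 : `|a k - b k| <= e / 3 by near: k.
have h2 : `|l' - b k| <= e / 3 by near: k.
have -> : l - a k = (l - l') + (l' - b k) - (a k - b k) by rewrite addrA subrK opprB addrA subrK.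
apply: (le_trans (ler_normB _ _)); apply: (le_trans (lerD (ler_normD _ _) (lexx _))); lra.
Unshelve. all: by end_near. Qed.

(** Weakens a power singularity to a stronger one on a bounded interval, at the price of a factor 1
    + T. *)
Lemma powRN_le (T x a b : R) : 0 < x -> x <= T -> a <= b -> b <= a + 1 ->
  x `^ (- a) <= (1 + T) * x `^ (- b).
Proof.
move=> x0 xT ab b1; have -> : - a = (b - a) + (- b) by ring.
rewrite powRD ?(gt_eqF x0) ?implybT// ler_wpM2r ?powR_ge0//.
have T1 : 1 <= 1 + T by rewrite lerDl (le_trans _ xT)// ltW.
rewrite (@le_trans _ _ ((1 + T) `^ (b - a)))//.
  by apply: ge0_ler_powR; rewrite ?nnegrE; lra.
rewrite -[leRHS]powRr1 ?(le_trans _ T1)//.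
by rewrite ler_powR//; lra.
Qed.

End L2_products.

(** * The operators z |-> - U(t,s) (qhat z / denom) on L2 *)

Section singular_part.
Context {R : realType} (n : nat) (P : coefficients R n).
Local Notation leb := (@lebesgue_measure R).
Hypotheses (P_ge0 : nonneg_coefficients P) (h1 : hypH1 P)
  (h2 : hypH2 P) (h3 : hypH3 P).
Variables (i : 'I_n) (U : R -> R -> L2 R -> L2 R) (Uev : evolution_operator (Gop P i) U).
Implicit Types (x t s r T : R) (m N k : nat) (z w : L2 R).

Definition trunc i m x : R := Num.min (qhat P i x) m%:R.

(** Bounded approximations of the multiplier - qhat / denom, under which the source acts on the
    unknown. *)
Definition damp i m s x : R := - ((denom P i x s)^-1 * trunc i m x).

Let qhat0 := qhat_ge0 P_ge0 i.
Let qhatL : inL2 (qhat P i). Proof. exact: qhat_inL2. Qed.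

Lemma trunc_ge0 m x : 0 <= trunc i m x.
Proof. by rewrite /trunc le_min qhat0 ler0n. Qed.

Lemma trunc_bdd m : bddfun (trunc i m) m%:R.
Proof.
split=> [|x]; last by rewrite ger0_norm ?trunc_ge0// /trunc ge_min lexx orbT.
by apply: measurable_minr; [exact: inL2_measurable|exact: measurable_cst].
Qed.

Lemma trunc_le m N x : (N <= m)%N -> trunc i N x <= trunc i m x <= qhat P i x.
Proof.
by move=> Nm; rewrite /trunc le_min !ge_min !lexx/= orbC/= ler_nat Nm.
Qed.

Lemma trunc_cvg x : trunc i m x @[m --> \oo] --> qhat P i x.
Proof.
apply: (@cvg_near_cst _ _ _ _ _ _).
near=> m; apply/min_idPl; near: m; exact: nbhs_infty_ger.
Unshelve. all: by end_near. Qed.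

Definition tail N : R := `|toL2 (fun x => qhat P i x - trunc i N x)|.

Lemma tail_inL2 N : inL2 (fun x => qhat P i x - trunc i N x).
Proof.
apply: (inL2_le _ qhatL).
  by apply: measurable_funB; [exact: inL2_measurable|case: (trunc_bdd N)].
apply: aeW => x; have /andP[_ b] := trunc_le x (leqnn N); have a := trunc_ge0 N x.
by rewrite !ger0_norm ?subr_ge0// lerBlDr lerDl.
Qed.

Lemma tail_cvg : tail N @[N --> \oo] --> 0.
Proof.
have L0 : toL2 (fun _ => 0) = 0 :> L2 R.
  apply: L2_eq; have i0 : inL2 (fun _ : R => 0 : R) by have := inL2Z 0 qhatL; congr inL2; apply/funext => x; rewrite mul0r.
  by apply: filterS2 (toL2_ae i0) L20_ae => x -> ->.
have [|||||_ _] := @L2_dct _ (fun N x => qhat P i x - trunc i N x) (fun _ => 0) (qhat P i).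
- by move=> N; exact: inL2_measurable (tail_inL2 N).
- exact: measurable_cst.
- exact: qhatL.
- apply: aeW => x N; have /andP[_ b] := trunc_le x (leqnn N); have a := trunc_ge0 N x.
  by rewrite !ger0_norm ?subr_ge0// lerBlDr lerDl.
- by apply: aeW => x; rewrite -(subrr (qhat P i x)); apply: cvgB; [exact: cvg_cst|exact: trunc_cvg].
by rewrite L0 => /cvg_normP; under eq_fun do rewrite subr0.
Qed.

Lemma damp_bdd : exists2 k : R, 0 <= k & forall s, 0 <= s ->
  [/\ forall m, bddfun (damp i m s) (k * m%:R), (forall x, `|(denom P i x s)^-1| <= k) &
  forall N m m' x, (N <= m)%N -> (N <= m')%N ->
    `|damp i m s x - damp i m' s x| <= k * (qhat P i x - trunc i N x)].
Proof.
have [k k0 Hk] := denomV_bound h1 h2; exists k; first exact: ltW.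
move=> s s0; have D x : `|(denom P i x s)^-1| <= k.
  by have /andP[a b] := Hk i x s s0; rewrite ger0_norm.
split=> // [m|N m m' x Nm Nm'].
  split=> [|x]; last by rewrite normrN normrM ler_pM//; case: (trunc_bdd m).
  apply: measurable_funN; apply: measurable_funM; first exact: measurable_denomV.
  by case: (trunc_bdd m).
rewrite /damp opprK addrC -mulrBr normrM ler_pM//.
have /andP[a b] := trunc_le x Nm; have /andP[a' b'] := trunc_le x Nm'.
rewrite ler_norml; apply/andP; split; lra.
Qed.

Definition Useq m t s z := U t s (mulL2 (damp i m s) z).

(* U t s applied to - qhat z / denom, which need not be in L2 *)
Definition Vop t s z : L2 R := lim (Useq m t s z @[m --> \oo]).

Let Ulin t s : 0 <= s -> s < t -> linear (U t s).
Proof. by move=> s0 st; apply: (evol_linear Uev); rewrite s0 ltW. Qed.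

Lemma linear_sub (f : L2 R -> L2 R) u v : linear f -> f (u - v) = f u - f v.
Proof. by move=> lf; rewrite addrC -scaleN1r lf scaleN1r addrC. Qed.

Lemma linear_zero (f : L2 R -> L2 R) : linear f -> f 0 = 0.
Proof. by move=> /(linear_sub 0 0); rewrite !subrr. Qed.

Lemma L2_cvg_unique (a : nat -> L2 R) (l l' : L2 R) : a m @[m --> \oo] --> l -> a m @[m --> \oo] --> l' -> l = l'.
Proof. by move=> al al'; apply: (cvg_unique _ al al'); exact: norm_hausdorff. Qed.

Lemma evol_cvg t s (a : nat -> L2 R) l : 0 <= s -> s <= t -> a m @[m --> \oo] --> l ->
  U t s (a m) @[m --> \oo] --> U t s l.
Proof.
move=> s0 st al; have := @evol_bounded _ _ _ Uev t s; rewrite s0 st => /(_ isT l).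
exact: cvg_comp al.
Qed.

(** Two truncations differ by at most a multiple of qhat - trunc N, which is small in L2 though not
    uniformly. [norm_Aop_mulL2] makes the difference small in the negative norm, and the smoothing
    of U pays (t - s)^(-1/2) to return to L2. *)
Lemma Useq_cauchy T : exists2 B : R, 0 <= B & forall s t z N m m', 0 <= s -> s < t -> t <= T ->
  (N <= m)%N -> (N <= m')%N ->
  `|Useq m t s z - Useq m' t s z| <= B * (t - s) `^ (- (1 / 2)) * tail N * `|z|.
Proof.
have [M M0 HM] := smoothing h1 h2 T Uev; have [k k0 Hk] := damp_bdd.
exists (2 * M * k) => [|s t z N m m' s0 st tT Nm Nm']; first by rewrite !mulr_ge0.
have [db _ dd] := Hk s s0; have [_ H _] := HM s t (mulL2 (fun x => damp i m s x - damp i m' s x) z) s0 st tT.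
rewrite /Useq -linear_sub; last exact: Ulin.
rewrite (mulL2Bl _ (db m) (db m')); apply: (le_trans H).
set p := (t - s) `^ _; have p0 : 0 <= p by exact: powR_ge0.
have -> : 2 * M * k * p * tail N * `|z| = M * p * (2 * k * tail N * `|z|) by ring.
rewrite ler_wpM2l ?mulr_ge0//.
apply: (@norm_Aop_mulL2 _ _ (k * m%:R + k * m'%:R)) => //.
  split=> [|x]; first by case: (db m) (db m') => a _ [b _]; exact: measurable_funB.
  by case: (db m) (db m') => _ a [_ b]; rewrite (le_trans (ler_normB _ _))// lerD.
apply: filterS (toL2_ae (tail_inL2 N)) => x E.
by rewrite E (le_trans (dd N m m' x Nm Nm'))// ler_wpM2l// ler_norm.
Qed.

Lemma Useq_cvg t s z : 0 <= s -> s < t -> Useq m t s z @[m --> \oo] --> Vop t s z.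
Proof.
move=> s0 st; have [B B0 HB] := Useq_cauchy t.
suff [l Hl] : exists l : L2 R, Useq m t s z @[m --> \oo] --> l.
  suff -> : Vop t s z = l by [].
  by apply: cvg_lim => //; exact: norm_hausdorff.
apply: L2_complete => e e0; set c := B * (t - s) `^ (- (1 / 2)).
have c0 : 0 <= c by rewrite mulr_ge0// powR_ge0.
have H : c * tail N * `|z| @[N --> \oo] --> 0.
  rewrite -(mul0r `|z|) -[X in X * _](mulr0 c); apply: cvgM; last exact: cvg_cst.
  by apply: cvgM; [exact: cvg_cst|exact: tail_cvg].
move/cvgrPdist_le : H => /(_ e e0)[N _ HN]; exists N => m m' Nm Nm'.
have := HN N (leqnn N); rewrite /= sub0r normrN ger0_norm ?mulr_ge0 ?powR_ge0 ?normr_ge0//.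
by apply: le_trans; exact: HB.
Qed.

Lemma Vop_approx T : exists2 B : R, 0 <= B & forall s t z N, 0 <= s -> s < t -> t <= T ->
  `|Vop t s z - Useq N t s z| <= B * (t - s) `^ (- (1 / 2)) * tail N * `|z|.
Proof.
have [B B0 HB] := Useq_cauchy T; exists B => // s t z N s0 st tT.
have H : Useq m t s z - Useq N t s z @[m --> \oo] --> Vop t s z - Useq N t s z.
  by apply: cvgB; [exact: Useq_cvg|exact: cvg_cst].
apply: (cvgr_to_le (cvg_norm H)); exists N => // m Nm /=; exact: HB.
Qed.

Lemma Vop_bound T : exists2 B : R, 0 <= B & forall s t z, 0 <= s -> s < t -> t <= T ->
  `|Vop t s z| <= B * (t - s) `^ (- (1 / 2)) * `|z|.
Proof.
have [B B0 HB] := Vop_approx T.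
exists (B * tail 0) => [|s t z s0 st tT]; first by rewrite mulr_ge0// normr_ge0.
(* The truncation at level 0 is identically 0, so the approximation estimate becomes a bound. *)
have := HB s t z 0%N s0 st tT; have -> : Useq 0 t s z = 0.
  rewrite /Useq (_ : mulL2 _ _ = 0); first by rewrite linear_zero//; exact: Ulin.
  have [k k0 Hk] := damp_bdd; have [db _ _] := Hk s s0.
  apply: L2_eq; apply: filterS2 (mulL2_ae z (db 0%N)) L20_ae => x -> ->.
  by rewrite /damp /trunc min_r// mulr0 oppr0 mul0r.
by rewrite subr0; congr (_ <= _); ring.
Qed.

Lemma VopB t s z w : 0 <= s -> s < t -> Vop t s (z - w) = Vop t s z - Vop t s w.
Proof.
move=> s0 st; have [k k0 Hk] := damp_bdd; have [db _ _] := Hk s s0.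
have H : Useq m t s (z - w) @[m --> \oo] --> Vop t s z - Vop t s w.
  rewrite (_ : (fun m => _) = (fun m => Useq m t s z - Useq m t s w)).
    by apply: cvgB; exact: Useq_cvg.
  by apply/funext => m; rewrite /Useq (mulL2B _ _ (db m)) linear_sub//; exact: Ulin.
exact: L2_cvg_unique (Useq_cvg s0 st) H.
Qed.

Lemma Vop_comp t s r z : 0 <= r -> r < s -> s <= t -> Vop t r z = U t s (Vop s r z).
Proof.
move=> r0 rs st; have s0 : 0 <= s by rewrite (le_trans r0)// ltW.
have H : Useq m t r z @[m --> \oo] --> U t s (Vop s r z).
  rewrite (_ : (fun m => _) = (fun m => U t s (Useq m s r z))).
    by apply: evol_cvg => //; exact: Useq_cvg.
  by apply/funext => m; rewrite /Useq (@evol_comp _ _ _ Uev t s r)// ltW.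
exact: L2_cvg_unique (Useq_cvg r0 (lt_le_trans rs st)) H.
Qed.

Lemma evol_seq t s (sk : nat -> R) zk z : 0 <= s -> s <= t -> (forall k, 0 <= sk k <= t) ->
  sk k @[k --> \oo] --> s -> zk k @[k --> \oo] --> z -> (forall k, sk k < t) ->
  U t (sk k) (zk k) @[k --> \oo] --> U t s z.
Proof.
move=> s0 st skt sks /cvg_normP zkz skt'.
have [M M0 HM] := smoothing h1 h2 t Uev.
have sk0 k : 0 <= sk k by have /andP[] := skt k.
have -> : (fun k => U t (sk k) (zk k)) = (fun k => U t (sk k) (zk k - z) + U t (sk k) z).
  by apply/funext => k; rewrite linear_sub ?subrK//; exact: Ulin.
rewrite -[X in _ --> X]add0r; apply: cvgD.
  apply: (@cvg_norm_le _ _ _ _ _ _ _ (fun k => M * `|zk k - z|)).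
    by apply: nearW => k; rewrite subr0; have [] := HM (sk k) t (zk k - z) (sk0 k) (skt' k) (lexx t).
  by rewrite -[X in _ --> X](mulr0 M); apply: cvgM => //; exact: cvg_cst.
have /subspace_continuousP/(_ (t, s)) := @evol_continuous _ _ _ Uev z; rewrite /time_triangle/= s0 st => /(_ isT) H.
have K : (t, sk k) @[k --> \oo] --> within (@time_triangle R) (nbhs (t, s)).
  have C : (t, sk k) @[k --> \oo] --> (t, s) by exact: cvg_pair (cvg_cst t) sks.
  move=> A AT; have H' : \forall k \near \oo, time_triangle (t, sk k) -> A (t, sk k) by exact: C AT.
  by apply: filterS H' => k; apply; exact: skt.
exact: (cvg_comp _ _ K H).
Qed.

(** As long as s stays away from t, [Useq N] approximates [Vop] uniformly on bounded sets, and
    [Useq N] is continuous because its multiplier is bounded. *)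
Lemma Vop_seq t s (sk : nat -> R) zk z : 0 <= s -> s < t -> (forall k, 0 <= sk k < t) ->
  sk k @[k --> \oo] --> s -> zk k @[k --> \oo] --> z ->
  Vop t (sk k) (zk k) @[k --> \oo] --> Vop t s z.
Proof.
move=> s0 st skt sks zkz; have sk0 k : 0 <= sk k by have /andP[] := skt k.
have skt' k : sk k < t by have /andP[] := skt k.
have [B B0 HB] := Vop_approx t; have [k k0 Hk] := damp_bdd.
(* Value of the singular factor at half the distance to t; it bounds this factor at all [sk] close
   enough to s. *)
set c := ((t - s) / 2) `^ (- (1 / 2)); have c0 : 0 <= c by exact: powR_ge0.
have ts0 : 0 < (t - s) / 2 by rewrite divr_gt0// subr_gt0.
have pc r : (t - s) / 2 <= t - r -> (t - r) `^ (- (1 / 2)) <= c.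
  move=> h; rewrite /c !powRN lef_pV2 ?posrE ?powR_gt0//; last exact: lt_le_trans h.
  by apply: ge0_ler_powR; rewrite ?nnegrE ?(ltW ts0)// ?(le_trans (ltW ts0) h)//; lra.
apply: cvg_approx => e e0.
have H : B * c * tail N * (`|z| + 1) @[N --> \oo] --> 0.
  have -> : (0 : R) = B * c * 0 * (`|z| + 1) by rewrite mulr0 mul0r.
  apply: cvgM; last exact: cvg_cst.
  by apply: cvgM; [exact: cvg_cst|exact: tail_cvg].
move/cvgrPdist_le : H => /(_ e e0)[N _ HN].
have := HN N (leqnn N); rewrite /= sub0r normrN => HN'.
have {}HN' y r : 0 <= r -> r < t -> (t - s) / 2 <= t - r -> `|y| <= `|z| + 1 ->
    `|Vop t r y - Useq N t r y| <= e.
  move=> r0 rt rs yz; apply: (le_trans (HB r t y N r0 rt (lexx t))).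
  apply: (le_trans _ (le_trans (ler_norm _) HN')); rewrite !ler_pM ?mulr_ge0 ?powR_ge0 ?normr_ge0//.
  exact: pc.
exists (fun k => Useq N t (sk k) (zk k)), (Useq N t s z); split.
- near=> j; apply: HN' => //.
    have : `|s - sk j| <= (t - s) / 2.
      by near: j; move/cvgrPdist_le : sks => /(_ _ ts0).
    by rewrite ler_norml => /andP[a b]; lra.
  have : `|z - zk j| <= 1 by near: j; move/cvgrPdist_le : zkz => /(_ _ ltr01).
  by move=> h; have := ler_normB z (z - zk j); rewrite subKr; lra.
- by apply: HN' => //; [lra|rewrite lerDl].
- apply: evol_seq => //; first exact: ltW.
    by move=> j; rewrite sk0 ltW.
  apply: (@cvg_mulL2 _ _ _ _ _ (k * N%:R)) => //.
  + by move=> j; have [/(_ N)] := Hk _ (sk0 j).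
  + by have [/(_ N)] := Hk _ s0.
  + by move=> x; apply: cvgN; apply: cvgM; [exact: denomV_continuous|exact: cvg_cst].
Unshelve. all: by end_near. Qed.

(** When qhat z / denom is square integrable, the truncated products converge to its opposite in L2
    by dominated convergence, and U is continuous on L2. *)
Lemma Vop_defined t s z : 0 <= s -> s < t -> inL2 (fun x => (denom P i x s)^-1 * (qhat P i x * z x)) ->
  Vop t s z = - U t s (toL2 (fun x => (denom P i x s)^-1 * (qhat P i x * z x))).
Proof.
move=> s0 st qz; have [k k0 Hk] := damp_bdd; have [db _ _] := Hk s s0.
set g := fun x => _ in qz *; have mg := inL2_measurable qz.
have H : mulL2 (damp i m s) z @[m --> \oo] --> toL2 (\- g).
  have [|||||_ _ //] := @L2_dct _ (fun m x => damp i m s x * z x) (\- g) g.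
  - by move=> m; apply: measurable_funM; [case: (db m)|exact: measurable_L2].
  - exact: measurable_funN.
  - by [].
  - apply: aeW => x m; rewrite /damp /g mulNr normrN -mulrA !normrM !ler_wpM2l//.
    have /andP[_ b] := trunc_le x (leqnn m).
    by rewrite ler_wpM2r// !ger0_norm ?trunc_ge0.
  - apply: aeW => x; rewrite /damp /g; under eq_fun do rewrite mulNr -mulrA.
    apply: cvgN; apply: cvgM; first exact: cvg_cst.
    by apply: cvgM; [exact: trunc_cvg|exact: cvg_cst].
rewrite toL2N// in H.
rewrite (L2_cvg_unique (Useq_cvg s0 st) (evol_cvg s0 (ltW st) H)).
by rewrite -[- toL2 g]sub0r linear_sub ?linear_zero ?sub0r//; exact: Ulin.
Qed.

End singular_part.

(** * Convergence, completeness and functionals in the product space *)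

Section vector_facts.
Context {R : realType} (n : nat).
Local Notation leb := (@lebesgue_measure R).
Implicit Types (w z : L2vec R n) (i : 'I_n).

Lemma norm_coord w i : `|w i| <= `|w|.
Proof. by rewrite norm_vecfunE; exact: le_bigmax. Qed.

Lemma norm_vec_le w (c : R) : 0 <= c -> (forall i, `|w i| <= c) -> `|w| <= c.
Proof. by move=> c0 H; rewrite norm_vecfunE; apply/bigmax_leP. Qed.

Lemma vecB w z i : (w - z) i = w i - z i.
Proof. by rewrite !ffunE. Qed.

Lemma cvg_coord (a : nat -> L2vec R n) w i : a k @[k --> \oo] --> w -> a k i @[k --> \oo] --> w i.
Proof.
move/cvg_normP; apply: cvg_norm_le; apply: nearW => k.
by rewrite -vecB; exact: norm_coord.
Qed.

Lemma cvg_vec (a : nat -> L2vec R n) w : (forall i, a k i @[k --> \oo] --> w i) -> a k @[k --> \oo] --> w.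
Proof.
move=> H; apply/cvgrPdist_le => e e0.
have : \forall k \near \oo, forall i, `|w i - a k i| <= e.
  by apply: filter_forall => i; move/cvgrPdist_le : (H i); exact.
by apply: filterS => k Hk; apply: norm_vec_le => [|i]; [exact: ltW|rewrite vecB].
Qed.

Lemma within_seq (V : normedModType R) (A : set R) (f : R -> V) x (s : nat -> R) :
  {within A, continuous f} -> A x -> (forall k, A (s k)) -> s k @[k --> \oo] --> x ->
  f (s k) @[k --> \oo] --> f x.
Proof.
move=> /subspace_continuousP cf Ax As sx.
have K : s k @[k --> \oo] --> within A (nbhs x).
  move=> B BA; have H : \forall k \near \oo, A (s k) -> B (s k) by exact: sx BA.
  by apply: filterS H => k; apply; exact: As.
exact: (cvg_comp _ _ K (cf x Ax)).
Qed.

Lemma within_seqP (V : normedModType R) (A : set R) (f : R -> V) :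
  (forall x (s : nat -> R), A x -> (forall k, A (s k)) -> s k @[k --> \oo] --> x ->
    f (s k) @[k --> \oo] --> f x) -> {within A, continuous f}.
Proof.
by move=> H; apply/subspace_continuousP => x Ax; apply: cvg_within_seq => s As sx; exact: H.
Qed.

Lemma fin_bound (Q : 'I_n -> R -> Prop) : (forall i, exists2 M, 0 <= M & Q i M) ->
  (forall i M M', M <= M' -> Q i M -> Q i M') -> exists2 M, 0 <= M & forall i, Q i M.
Proof.
move=> H Hle; have [M M0 HM] := fin_all_exists2 H.
exists (\sum_j M j); first by rewrite sumr_ge0.
move=> i; apply: Hle (HM i).
by rewrite (bigD1 i)//= lerDl sumr_ge0.
Qed.

Lemma vec_complete : norm_complete (L2vec R n).
Proof.
move=> a ca; have H i : exists l : L2 R, a k i @[k --> \oo] --> l.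
  apply: L2_complete => e /ca[N HN]; exists N => p q Np Nq.
  by rewrite -vecB (le_trans (norm_coord _ _))//; exact: HN.
have [l Hl] := fin_all_exists H.
by exists [ffun i => l i]; apply: cvg_vec => i; rewrite ffunE.
Qed.

(** The functional is the inner product with the normalized component of largest norm. *)
Lemma vec_norming : norming (L2vec R n).
Proof.
move=> w; have [w0|w0] := eqVneq w 0.
  exists (fun _ => 0); last by rewrite w0 normr0.
  by split=> [a u v|u]; [rewrite /GRing.scale/= mulr0 addr0|rewrite normr0].
have [i wi] : exists i, `|w| = `|w i|.
  have [i0|noi] := pselect (exists i : 'I_n, True).
    have [i _] := i0; have [j _ jE] := @eq_bigmax _ _ _ (0 : R) i xpredT (fun i => `|w i|) isT (fun i _ => normr_ge0 _).
    by exists j; rewrite norm_vecfunE.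
  move/eqP: w0; case; apply/ffunP => i; case: noi; by exists i.
have wi0 : 0 < `|w i| by rewrite -wi normr_gt0.
exists (fun v : L2vec R n => `|w i|^-1 * dot (w i) (v i)); last first.
  by rewrite dot_normE expr2 mulKf// gt_eqF.
split=> [a u v|v].
  by rewrite !ffunE dotDr dotZr /GRing.scale/= mulrDr mulrCA.
rewrite normrM gtr0_norm ?invr_gt0// ler_pdivrMl// (le_trans (dot_le _ _))//.
by rewrite ler_wpM2l//; exact: norm_coord.
Qed.

End vector_facts.

(** * The Volterra kernel of the mild formulation *)

Section mild_kernel.
Context {R : realType} (n : nat) (P : coefficients R n).
Local Notation leb := (@lebesgue_measure R).
Hypotheses (E_gt0 : 0 < cE P) (P_ge0 : nonneg_coefficients P) (h1 : hypH1 P)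
  (h2 : hypH2 P) (h3 : hypH3 P).
Variables (U : 'I_n -> R -> R -> L2 R -> L2 R)
  (Uev : forall i, evolution_operator (Gop P i) (U i)).
Implicit Types (x t s r T : R) (i : 'I_n) (w z : L2vec R n).

Definition regpt i s w x : R := reg P i s x (w i x) (w (ord_pred i) x) (w (ordS i) x).

Definition regL2 i s w : L2 R := toL2 (regpt i s w).

Lemma measurable_regpt i s w : 0 <= s -> measurable_fun setT (regpt i s w).
Proof. by move=> s0; apply: measurable_reg => //; exact: measurable_L2. Qed.

(** A majorant independent of time, as dominated convergence along a sequence of times requires. *)
Let dom i w : L2 R := absL2 (w i) + absL2 (w (ord_pred i)) + absL2 (w (ordS i)) + toL2 (qhat P i).

Let qhatL i : inL2 (qhat P i). Proof. exact: qhat_inL2. Qed.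

Let dom_ae i w : {ae leb, forall x, dom i w x =
  `|w i x| + `|w (ord_pred i) x| + `|w (ordS i) x| + qhat P i x}.
Proof.
near=> x; rewrite (near (L2D_ae _ (toL2 (qhat P i))) x)// (near (L2D_ae _ (absL2 (w (ordS i)))) x)//.
rewrite (near (L2D_ae _ (absL2 (w (ord_pred i)))) x)// (near (toL2_ae (qhatL i)) x)//.
by rewrite (near (absL2_norm (w i)).1 x)// (near (absL2_norm (w (ord_pred i))).1 x)// (near (absL2_norm (w (ordS i))).1 x).
Unshelve. all: by end_near. Qed.

(** The time s is quantified inside the almost everywhere statement, so that one null set serves all
    times. *)
Let regpt_dom_all : exists2 C : R, 0 <= C & forall i w,
  {ae leb, forall x, forall s, 0 <= s -> `|regpt i s w x| <= C * `|dom i w x|}.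
Proof.
have [C C0 HC] := reg_bound E_gt0 P_ge0 h1 h2 h3; exists C; first exact: ltW.
move=> i w; apply: filterS2 HC (dom_ae i w) => x H -> s s0.
apply: (le_trans (H i s _ _ _ s0)); rewrite ler_wpM2l ?(ltW C0)//; exact: ler_norm.
Qed.

Let regpt_dom : exists2 C : R, 0 <= C & forall i s w, 0 <= s ->
  {ae leb, forall x, `|regpt i s w x| <= C * `|dom i w x|}.
Proof.
have [C C0 HC] := regpt_dom_all; exists C => // i s w s0.
by apply: filterS (HC i w) => x; apply.
Qed.

Lemma regpt_inL2 i s w : 0 <= s -> inL2 (regpt i s w).
Proof.
move=> s0; have [C C0 HC] := regpt_dom.
exact: (norm_toL2 (measurable_regpt i w s0) C0 (HC i s w s0)).1.
Qed.

Lemma regL2_bound : exists2 C : R, 0 <= C & forall i s w, 0 <= s -> `|regL2 i s w| <= C * (1 + `|w|).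
Proof.
have [C C0 HC] := regpt_dom.
exists (C * (3 + \sum_i `|toL2 (qhat P i)|)); first by rewrite mulr_ge0// addr_ge0// sumr_ge0.
move=> i s w s0; apply: (le_trans (norm_toL2 (measurable_regpt i w s0) C0 (HC i s w s0)).2).
rewrite -mulrA ler_wpM2l//.
set S := \sum_j _; have S0 : 0 <= S by exact: sumr_ge0.
have qS : `|toL2 (qhat P i)| <= S by rewrite /S (bigD1 i)//= lerDl sumr_ge0.
have a j : `|absL2 (w j)| <= `|w| by rewrite (le_trans (absL2_norm (w j)).2)// norm_coord.
have w0 := normr_ge0 w; have Sw := mulr_ge0 S0 w0; rewrite /dom.
apply: (le_trans (ler_normD _ _)); apply: (le_trans (lerD (ler_normD _ _) qS)).
apply: (le_trans (lerD (lerD (ler_normD _ _) (a _)) (lexx _))).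
by have := a i; have := a (ord_pred i); lra.
Qed.

Lemma regL2_lipschitz : exists2 C : R, 0 <= C & forall i s w z, 0 <= s ->
  `|regL2 i s w - regL2 i s z| <= C * `|w - z|.
Proof.
have [C C0 HC] := reg_lipschitz E_gt0 h1 h2 h3.
exists (C * 3) => [|i s w z s0]; first by rewrite mulr_ge0// ltW.
rewrite -toL2B; [|exact: regpt_inL2|exact: regpt_inL2].
pose d j := absL2 (w j - z j); pose u := d i + d (ord_pred i) + d (ordS i).
have dj j : {ae leb, forall x, d j x = `|w j x - z j x|}.
  by apply: filterS2 (absL2_norm (w j - z j)).1 (L2B_ae (w j) (z j)) => x -> ->.
have [|||_ H] := @norm_toL2 _ (regpt i s w \- regpt i s z) u C.
- by apply: measurable_funB; exact: measurable_regpt.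
- exact: ltW.
- near=> x; have -> : u x = `|w i x - z i x| + `|w (ord_pred i) x - z (ord_pred i) x| +
      `|w (ordS i) x - z (ordS i) x|.
    rewrite (near (L2D_ae _ (d (ordS i))) x)// (near (L2D_ae _ (d (ord_pred i))) x)//.
    by rewrite (near (dj i) x)// (near (dj (ord_pred i)) x)// (near (dj (ordS i)) x).
  rewrite (le_trans (near HC x _ i s _ _ _ _ _ _ s0))// ler_wpM2l ?(ltW C0)//; exact: ler_norm.
apply: (le_trans H); rewrite -mulrA ler_wpM2l ?(ltW C0)//.
have a j : `|d j| <= `|w - z|.
  by rewrite (le_trans (absL2_norm _).2)// -vecB norm_coord.
apply: (le_trans (ler_normD _ _)); apply: (le_trans (lerD (ler_normD _ _) (lexx _))).
by have := a i; have := a (ord_pred i); have := a (ordS i); lra.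
Unshelve. all: by end_near. Qed.

Lemma regL2_seq i s w (sk : nat -> R) wk : 0 <= s -> (forall k, 0 <= sk k) ->
  sk k @[k --> \oo] --> s -> wk k @[k --> \oo] --> w ->
  regL2 i (sk k) (wk k) @[k --> \oo] --> regL2 i s w.
Proof.
move=> s0 sk0 sks /cvg_normP wkw; have [C C0 HC] := regL2_lipschitz.
rewrite (_ : (fun k => _) = (fun k => (regL2 i (sk k) (wk k) - regL2 i (sk k) w) + regL2 i (sk k) w)).
  rewrite -[X in _ --> X]add0r; apply: cvgD.
    apply: (@cvg_norm_le _ _ _ _ _ _ _ (fun k => C * `|wk k - w|)).
      by apply: nearW => k; rewrite subr0; exact: HC.
    by rewrite -[X in _ --> X](mulr0 C); apply: cvgM => //; exact: cvg_cst.
  have [D D0 HD] := regpt_dom_all.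
  have [|||||_ _ //] := @L2_dct _ (fun k => regpt i (sk k) w) (regpt i s w) (fun x => D * dom i w x).
  - by move=> k; exact: measurable_regpt.
  - exact: measurable_regpt.
  - exact: inL2Z.
  - by apply: filterS (HD i w) => x H k; rewrite [leRHS]normrM (ger0_norm D0); exact: H.
  - by apply: aeW => x; exact: reg_continuous.
by apply/funext => k; rewrite subrK.
Qed.

(** Extension of [evolve U t s (source P s w)] to every w: following [source_reg], the regular part
    is applied as it stands, and the term in qhat w, with its sign and denominator, through
    [Vop]. *)
Definition Phi t s w : L2vec R n := [ffun i => U i t s (regL2 i s w) + Vop P i (U i) t s (w i)].

Let Ulin i t s : 0 <= s -> s <= t -> linear (U i t s).
Proof. by move=> s0 st; apply: (evol_linear (Uev i)); rewrite s0. Qed.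

Let linear_add (f : L2 R -> L2 R) u v : linear f -> f (u + v) = f u + f v.
Proof. by move=> lf; have := lf 1 u v; rewrite !scale1r. Qed.

Lemma Phi_bound T : exists2 C : R, 0 <= C & forall s t w z, 0 <= s -> s < t -> t <= T ->
  `|Phi t s w| <= C * (t - s) `^ (- (1 / 2)) * (1 + `|w|) /\
  `|Phi t s w - Phi t s z| <= C * (t - s) `^ (- (1 / 2)) * `|w - z|.
Proof.
have [K K0 HK] := regL2_bound; have [L L0 HL] := regL2_lipschitz.
have HM i := smoothing h1 h2 T (Uev i).
have [M M0 {}HM] : exists2 M : R, 0 <= M & forall i s t (u : L2 R), 0 <= s -> s < t -> t <= T ->
    `|U i t s u| <= M * `|u|.
  apply: fin_bound => [i|i M M' MM' H s t u s0 st tT].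
    by have [M M0 H] := HM i; exists M => // s t u s0 st tT; have [] := H s t u s0 st tT.
  by rewrite (le_trans (H s t u s0 st tT))// ler_wpM2r.
have [B B0 HB] : exists2 B : R, 0 <= B & forall i s t (u : L2 R), 0 <= s -> s < t -> t <= T ->
    `|Vop P i (U i) t s u| <= B * (t - s) `^ (- (1 / 2)) * `|u|.
  apply: fin_bound => [i|i M' M'' MM' H s t u s0 st tT].
    exact: (Vop_bound P_ge0 h1 h2 h3 (Uev i)).
  by rewrite (le_trans (H s t u s0 st tT))// !ler_wpM2r// powR_ge0.
exists (M * (K + L) * (1 + `|T|) + B) => [|s t w z s0 st tT].
  by rewrite addr_ge0// !mulr_ge0// addr_ge0.
have ts0 : 0 < t - s by rewrite subr_gt0.
have tsT : t - s <= `|T| by rewrite (le_trans _ (ler_norm T))//; lra.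
(* The regular part is bounded without singularity; exponent 0 is raised to 1/2 to match the
   singular part. *)
have : (t - s) `^ (- 0) <= (1 + `|T|) * (t - s) `^ (- (1 / 2)) by apply: powRN_le => //; lra.
rewrite oppr0 powRr0; set p := (t - s) `^ _ => p1; have p0 : 0 <= p by exact: powR_ge0.
have key (a b c : R) (f g : L2 R) : 0 <= b -> `|f| <= M * (a * b) -> `|g| <= B * p * b -> 0 <= a -> a <= K + L ->
    `|f + g| <= (M * (K + L) * (1 + `|T|) + B) * p * b.
  move=> b0 fa ga a0 aK; apply: (le_trans (ler_normD _ _)); rewrite 2!mulrDl lerD//.
  rewrite (le_trans fa)// (@le_trans _ _ (M * (K + L) * b))//.
    by rewrite mulrA ler_wpM2r// ler_wpM2l.
  rewrite ler_wpM2r// -[X in _ <= X]mulrA -[X in X <= _]mulr1 ler_wpM2l// mulr_ge0// addr_ge0//.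
split; apply: norm_vec_le => [|i].
- by rewrite !mulr_ge0// ?addr_ge0// ?mulr_ge0// addr_ge0.
- rewrite ffunE; apply: (key K) => //; rewrite ?addr_ge0 ?lerDl//.
    by rewrite (le_trans (HM _ _ _ _ s0 st tT))// ler_wpM2l//; exact: HK.
  rewrite (le_trans (HB _ _ _ _ s0 st tT))// ler_wpM2l ?mulr_ge0//.
  by rewrite (le_trans (norm_coord w i))// lerDr.
- by rewrite !mulr_ge0// ?addr_ge0// ?mulr_ge0// addr_ge0.
rewrite vecB !ffunE opprD addrACA; apply: (key L) => //; rewrite ?lerDr//.
  rewrite -linear_sub; last exact: Ulin (ltW st).
  by rewrite (le_trans (HM _ _ _ _ s0 st tT))// ler_wpM2l//; exact: HL.
rewrite -(VopB P_ge0 h1 h2 h3 (Uev i))// (le_trans (HB _ _ _ _ s0 st tT))// ler_wpM2l ?mulr_ge0//.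
by rewrite -vecB norm_coord.
Qed.

Lemma kernelE s t : s < t -> kernel (s - t) = (t - s) `^ (- (3 / 4)).
Proof. by move=> st; rewrite /kernel subr_lt0 st opprB. Qed.

(** The exponent 1/2 is weakened to 3/4, the one dictated by the sup bound of [Phi_ae_bdd], so that
    a single kernel is studied. *)
Lemma Phi_kernel_bound T : exists2 C : R, 0 <= C & forall s t w z, 0 <= s -> s < t -> t <= T ->
  `|Phi t s w| <= C * kernel (s - t) * (1 + `|w|) /\
  `|Phi t s w - Phi t s z| <= C * kernel (s - t) * `|w - z|.
Proof.
have [C C0 HC] := Phi_bound T; exists (C * (1 + `|T|)); first by rewrite mulr_ge0// addr_ge0.
move=> s t w z s0 st tT; have [H1 H2] := HC s t w z s0 st tT.
have ts0 : 0 < t - s by rewrite subr_gt0.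
have tsT : t - s <= `|T| by rewrite (le_trans _ (ler_norm T))//; lra.
have : (t - s) `^ (- (1 / 2)) <= (1 + `|T|) * (t - s) `^ (- (3 / 4)) by apply: powRN_le => //; lra.
rewrite kernelE// => h; split.
  by rewrite (le_trans H1)// ler_wpM2r ?addr_ge0// -mulrA ler_wpM2l.
by rewrite (le_trans H2)// ler_wpM2r// -mulrA ler_wpM2l.
Qed.

Lemma Phi_comp r s t w : 0 <= r -> r < s -> s <= t -> Phi t r w = evolve U t s (Phi s r w).
Proof.
move=> r0 rs st; have s0 : 0 <= s by rewrite (le_trans r0)// ltW.
apply/ffunP => i; rewrite !ffunE linear_add; last exact: Ulin.
rewrite (Vop_comp P_ge0 h1 h2 h3 (Uev i) _ r0 rs st); congr (_ + _).
by rewrite (@evol_comp _ _ _ (Uev i) t s r)// ltW.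
Qed.

Lemma Phi_continuous (u : R -> L2vec R n) t : {within `[0, +oo[, continuous u} -> 0 < t ->
  {within `[0, t[, continuous (fun s => Phi t s (u s))}.
Proof.
move=> cu t0; apply: within_seqP => s sk; rewrite /= in_itv/= => /andP[s0 st] skt sks.
have sk0 k : 0 <= sk k by have /= := skt k; rewrite in_itv/= => /andP[].
have skt' k : sk k < t by have /= := skt k; rewrite in_itv/= => /andP[].
have uk : u (sk k) @[k --> \oo] --> u s.
  by apply: (within_seq cu) => // [|k]; rewrite /= in_itv/= ?s0 ?sk0.
apply: cvg_vec => i; under eq_fun do rewrite ffunE; rewrite ffunE; apply: cvgD.
  apply: (evol_seq h1 h2 (Uev i)) => //; first exact: ltW.
    by move=> k; rewrite sk0 ltW.
  exact: regL2_seq.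
apply: (Vop_seq P_ge0 h1 h2 h3 (Uev i)) => //; last exact: cvg_coord.
Qed.

Lemma evolve_bound T : exists2 M : R, 0 <= M & forall s t w, 0 <= s -> s <= t -> t <= T ->
  `|evolve U t s w| <= M * `|w|.
Proof.
have [M M0 HM] : exists2 M : R, 0 <= M & forall i s t (u : L2 R), 0 <= s -> s <= t -> t <= T ->
    `|U i t s u| <= M * `|u|.
  apply: fin_bound => [i|i M M' MM' H s t u s0 st tT]; last first.
    by rewrite (le_trans (H s t u s0 st tT))// ler_wpM2r.
  have [M M0 H] := smoothing h1 h2 T (Uev i); exists (M + 1) => [|s t u s0]; first by rewrite addr_ge0.
  rewrite le_eqVlt => /predU1P[<-|st] tT.
    by rewrite (evol_id (Uev i))// mulrDl mul1r lerDr mulr_ge0.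
  by have [h _ _] := H s t u s0 st tT; rewrite (le_trans h)// mulrDl lerDl mul1r.
exists M => // s t w s0 st tT; apply: norm_vec_le => [|i]; first by rewrite mulr_ge0.
by rewrite ffunE (le_trans (HM _ _ _ _ s0 st tT))// ler_wpM2l// norm_coord.
Qed.

Lemma evolve_linear t s : 0 <= s -> s <= t -> linear (evolve U t s).
Proof. by move=> s0 st a u v; apply/ffunP => i; rewrite !ffunE (Ulin _ s0 st). Qed.

Lemma evolve_comp t s r w : 0 <= r -> r <= s -> s <= t ->
  evolve U t r w = evolve U t s (evolve U s r w).
Proof. by move=> r0 rs st; apply/ffunP => i; rewrite !ffunE; exact: (evol_comp (Uev i)). Qed.

Lemma evolve_continuous s w : 0 <= s -> {within `[s, +oo[, continuous (fun t => evolve U t s w)}.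
Proof.
move=> s0; apply: within_seqP => t tk; rewrite /= in_itv/= andbT => st tks tkt.
apply: cvg_vec => i; under eq_fun do rewrite ffunE; rewrite ffunE.
have /subspace_continuousP/(_ (t, s)) := @evol_continuous _ _ _ (Uev i) (w i).
rewrite /time_triangle/= s0 st => /(_ isT) H.
have K : (tk k, s) @[k --> \oo] --> within (@time_triangle R) (nbhs (t, s)).
  have C : (tk k, s) @[k --> \oo] --> (t, s) by exact: cvg_pair tkt (cvg_cst s).
  move=> A AT; have H' : \forall k \near \oo, time_triangle (tk k, s) -> A (tk k, s) by exact: C AT.
  apply: filterS H' => k; apply; have /= := tks k; rewrite in_itv/= andbT => h.
  by rewrite /time_triangle/= s0.
exact: (cvg_comp _ _ K H).
Qed.

Theorem mild_volterra (phi : L2vec R n) : exists u : R -> L2vec R n,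
  [/\ {within `[0, +oo[, continuous u},
  forall t, 0 <= t -> is_bochner_integral leb `[0, t] (fun s => Phi t s (u s)) (u t - evolve U t 0 phi) &
  forall v : R -> L2vec R n, {within `[0, +oo[, continuous v} ->
    (forall t, 0 <= t -> is_bochner_integral leb `[0, t] (fun s => Phi t s (v s)) (v t - evolve U t 0 phi)) ->
    forall t, 0 <= t -> v t = u t].
Proof.
apply: volterra_solution.
- exact: vec_complete.
- exact: vec_norming.
- by move=> t s; exact: evolve_linear.
- exact: evolve_bound.
- by move=> t s w s0 st; exact: evolve_comp.
- by move=> s w; exact: evolve_continuous.
- exact: Phi_kernel_bound.
- by move=> r s t w; exact: Phi_comp.
- exact: Phi_continuous.
Qed.

End mild_kernel.

(** * Regularity of the solution *)

(** The operator bound c of l does not enter the conclusion, only the size of l along f. This allows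
    truncated multiplications, whose norm grows with the truncation level, to be estimated
    uniformly. *)
Lemma bochner_kernel_bound (R : realType) (V : normedModType R) (f : R -> V) I (l : V -> R) (t c K : R) :
  linear l -> 0 < c -> (forall v, `|l v| <= c * `|v|) -> 0 <= t -> 0 <= K ->
  {within `[0, t[, continuous f} -> is_bochner_integral (@lebesgue_measure R) `[0, t] f I ->
  (forall s, 0 <= s -> s < t -> `|l (f s)| <= K * kernel (s - t)) -> `|l I| <= K * (4 * t `^ (1 / 4)).
Proof.
move=> ll c0 lc t0 K0 cf fI lf; pose l' v := c^-1 * l v.
have c'0 : 0 < c^-1 by rewrite invr_gt0.
have fl : functional l'.
  split=> [a u v|v]; first by rewrite /l' ll mulrDr /GRing.scale/= mulrCA.
  by rewrite normrM (gtr0_norm c'0) ler_pdivrMl.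
have mD := measurable_itv `[0, t].
have E := @bochner_functional_le _ _ R V (@lebesgue_measure R) _ mD f I l' fl (within_weakly_measurable cf) fI.
have H : (\int[lebesgue_measure]_(x in `[0%R, t]) `|l' (f x)|%:E <= (c^-1 * K * (4 * t `^ (1 / 4)))%:E)%E.
  apply: (@le_trans _ _ (\int[lebesgue_measure]_(x in `[0%R, t]) ((c^-1 * K)%:E * (kernel (x - t))%:E))%E).
    apply: le_integral_ae => [x _|x _|]; rewrite -?EFinM ?lee_fin ?mulr_ge0 ?kernel_ge0 ?(ltW c'0)//.
    apply: filterS (ae_neq t) => x xt; rewrite /= in_itv/= => /andP[x0 xt'].
    rewrite lee_fin /l' normrM (gtr0_norm c'0) -mulrA ler_wpM2l ?(ltW c'0)//.
    by apply: lf => //; rewrite lt_neqAle xt xt'.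
  rewrite ge0_integralZl_EFin//; last 3 first.
  - by move=> x _; rewrite lee_fin kernel_ge0.
  - exact: measurable_int (integrable_kernel t0).
  - by rewrite mulr_ge0// ltW.
  rewrite [leRHS]EFinM; apply: lee_wpmul2l; first by rewrite lee_fin mulr_ge0// ltW.
  by have := kernel_integral t0; rewrite subr0.
have : `|l' I| <= c^-1 * K * (4 * t `^ (1 / 4)).
  by rewrite -lee_fin; exact: le_trans E H.
by rewrite /l' normrM (gtr0_norm c'0) -mulrA ler_pM2l.
Qed.

Section regularity.
Context {R : realType} (n : nat) (P : coefficients R n).
Local Notation leb := (@lebesgue_measure R).
Hypotheses (E_gt0 : 0 < cE P) (P_ge0 : nonneg_coefficients P) (h1 : hypH1 P)
  (h2 : hypH2 P) (h3 : hypH3 P).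
Variables (U : 'I_n -> R -> R -> L2 R -> L2 R)
  (Uev : forall i, evolution_operator (Gop P i) (U i)).
Implicit Types (x t s r T : R) (i : 'I_n) (w z : L2vec R n) (u : R -> L2vec R n).

Let qhatL i : inL2 (qhat P i). Proof. exact: qhat_inL2. Qed.

Lemma norm_trunc_mul i m (v : L2 R) B : 0 <= B -> ae_bdd v B ->
  `|mulL2 (trunc P i m) v| <= B * `|toL2 (qhat P i)|.
Proof.
move=> B0 vB; have tb := trunc_bdd P_ge0 h3 i m.
apply: (norm_toL2 _ B0 _).2.
  by apply: measurable_funM; [case: tb|exact: measurable_L2].
apply: filterS2 vB (toL2_ae (qhatL i)) => x xB ->.
rewrite normrM mulrC ler_pM//.
have /andP[_ b] := trunc_le P i x (leqnn m); have a := trunc_ge0 P_ge0 i m x.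
by rewrite !ger0_norm// (le_trans a).
Qed.

Lemma Phi_ae_bdd T (W : R) : 0 <= W -> exists2 K : R, 0 <= K & forall s t w i, 0 <= s -> s < t -> t <= T ->
  `|w| <= W -> ae_bdd (Phi P U t s w i) (K * kernel (s - t)).
Proof.
move=> W0; have [C C0 HC] := Phi_bound E_gt0 P_ge0 h1 h2 h3 Uev T.
have [M M0 HM] : exists2 M : R, 0 <= M & forall i s t (v : L2 R), 0 <= s -> s < t -> t <= T ->
    ae_bdd (U i t s v) (M * (t - s) `^ (- (1 / 4)) * `|v|).
  apply: fin_bound => [i|i M M' MM' H s t v s0 st tT].
    have [M M0 H] := smoothing h1 h2 T (Uev i); exists M => // s t v s0 st tT.
    by have [_ _] := H s t v s0 st tT.
  apply: filterS (H s t v s0 st tT) => x h; rewrite (le_trans h)//.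
  by rewrite !ler_wpM2r// powR_ge0.
(* The last factor compensates for the halving of the time step: the two estimates are applied over
   (t - s) / 2. *)
exists (M * C * (1 + W) * (1 / 2) `^ (- (3 / 4))).
  by rewrite !mulr_ge0 ?powR_ge0// addr_ge0.
move=> s t w i s0 st tT wW; pose r := (s + t) / 2.
have sr : s < r by rewrite /r ltr_pdivlMr//; lra.
have rt : r < t by rewrite /r ltr_pdivrMr//; lra.
have r0 : 0 <= r by rewrite (le_trans s0)// ltW.
rewrite (Phi_comp P_ge0 h1 h2 h3 Uev _ s0 sr (ltW rt)) ffunE.
have [H _] := HC s r w w s0 sr (le_trans (ltW rt) tT).
apply: filterS (HM i r t (Phi P U r s w i) r0 rt tT) => x h; apply: (le_trans h).
set h' := t - r; have h'0 : 0 < h' by rewrite subr_gt0.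
have rs : r - s = h' by rewrite /h' /r; field.
rewrite rs in H; rewrite kernelE//.
have -> : (t - s) `^ (- (3 / 4)) = (2 * h') `^ (- (3 / 4)) by congr (_ `^ _); rewrite /h' /r; field.
have -> : M * C * (1 + W) * (1 / 2) `^ (- (3 / 4)) * (2 * h') `^ (- (3 / 4)) =
    M * C * (1 + W) * h' `^ (- (3 / 4)).
  by rewrite -mulrA -powRM ?mulr_ge0 ?(ltW h'0)//; congr (_ * _ `^ _); field.
have -> : - (3 / 4) = - (1 / 4) + - (1 / 2) :> R by field.
rewrite powRD ?(gt_eqF h'0) ?implybT//.
set p := h' `^ (- (1 / 4)); set q := h' `^ (- (1 / 2)) in H *.
have p0 : 0 <= p by exact: powR_ge0.
have q0 : 0 <= q by exact: powR_ge0.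
have -> : M * C * (1 + W) * (p * q) = M * p * (C * q * (1 + W)) by ring.
rewrite ler_wpM2l ?mulr_ge0// (le_trans (norm_coord _ _))// (le_trans H)//.
by rewrite ler_wpM2l ?mulr_ge0// lerD2l.
Qed.

(** The truncations of qhat times u(t) are bounded in L2 independently of the level: the sup bound
    on the integrand makes its products with qhat integrable in time, and the free term U(t,0) phi
    is bounded outright. Fatou's lemma removes the truncation. *)
Lemma qhat_mul_inL2 u phi t i : {within `[0, +oo[, continuous u} -> 0 < t ->
  is_bochner_integral leb `[0, t] (fun s => Phi P U t s (u s)) (u t - evolve U t 0 phi) ->
  inL2 (fun x => qhat P i x * u t i x).
Proof.
move=> cu t0 I; have [W W0 uW] := cont_bounded t cu; have [K K0 HK] := Phi_ae_bdd t W0.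
have [M M0 HM] := smoothing h1 h2 t (Uev i); have [_ _ Ubd] := HM 0 t (phi i) (lexx 0) t0 (lexx t).
set B := M * _ * _ in Ubd; have B0 : 0 <= B by rewrite !mulr_ge0// powR_ge0.
set q := `|toL2 (qhat P i)|; have q0 : 0 <= q by exact: normr_ge0.
set J := u t - evolve U t 0 phi in I.
have tb m := trunc_bdd P_ge0 h3 i m.
have HJ m : `|mulL2 (trunc P i m) (J i)| <= K * q * (4 * t `^ (1 / 4)).
  have [->|J0] := eqVneq (mulL2 (trunc P i m) (J i)) 0.
    by rewrite normr0 !mulr_ge0 ?powR_ge0.
  (* The vector to be estimated also serves as the vector to test against; one factor |psi| is
     simplified at the end. *)
  set psi := mulL2 _ _ in J0 *; have psi0 : 0 < `|psi| by rewrite normr_gt0.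
  have b (v : L2 R) : `|mulL2 (trunc P i m) v| <= (m%:R + 1) * `|v|.
    by rewrite (le_trans (norm_mulL2 v (tb m)))// ler_wpM2r// lerDl.
  have c0 : 0 < (m%:R + 1) * `|psi| by rewrite mulr_gt0// ltr_wpDl.
  have := @bochner_kernel_bound R _ _ _ (fun v : L2vec R n => dot (mulL2 (trunc P i m) (v i)) psi) t _ (K * q * `|psi|) _ c0 _ (ltW t0) _ (Phi_continuous E_gt0 P_ge0 h1 h2 h3 Uev cu t0) I.
  rewrite dot_normE ger0_norm ?exprn_ge0// expr2.
  have -> : K * q * `|psi| * (4 * t `^ (1 / 4)) = K * q * (4 * t `^ (1 / 4)) * `|psi| by ring.
  rewrite ler_pM2r//; apply.
  - move=> a v z; rewrite !ffunE (mulL2D _ _ (tb m)) (mulL2Z _ _ (tb m)).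
    by rewrite dotDl dotZl.
  - move=> v; rewrite (le_trans (dot_le _ _))// mulrAC ler_wpM2r//.
    by rewrite (le_trans (b _))// ler_wpM2l ?addr_ge0// norm_coord.
  - by rewrite !mulr_ge0.
  move=> s s0 st; rewrite (le_trans (dot_le _ _))// mulrAC ler_wpM2r// mulrAC.
  apply: norm_trunc_mul; first by rewrite mulr_ge0// kernel_ge0.
  by apply: HK => //; apply: uW => //; exact: ltW.
have Hu m : `|mulL2 (trunc P i m) (u t i)| <= K * q * (4 * t `^ (1 / 4)) + B * q.
  have -> : u t i = J i + evolve U t 0 phi i by rewrite /J vecB subrK.
  rewrite (mulL2D _ _ (tb m)) (le_trans (ler_normD _ _))// lerD//.
  by rewrite ffunE; exact: norm_trunc_mul.
apply: (@L2_fatou _ (fun m => mulL2 (trunc P i m) (u t i)) _ _ _ _ Hu _).1.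
- by rewrite addr_ge0// !mulr_ge0 ?powR_ge0// normr_ge0.
- by apply: measurable_funM; [exact: inL2_measurable|exact: measurable_L2].
have H : {ae leb, forall x, forall m, mulL2 (trunc P i m) (u t i) x = trunc P i m x * u t i x}.
  by apply: ae_foralln => m; exact: mulL2_ae (tb m).
apply: filterS H => x H; under eq_fun do rewrite H.
by apply: cvgM; [exact: trunc_cvg|exact: cvg_cst].
Qed.

Lemma denomV_mul_inL2 i s f : 0 <= s -> inL2 f -> inL2 (fun x => (denom P i x s)^-1 * f x).
Proof.
move=> s0; have [k k0 Hk] := denomV_bound h1 h2; apply: (@inL2M _ _ _ k).
  exact: measurable_denomV.
by move=> x; have /andP[a b] := Hk i x s s0; rewrite ger0_norm.
Qed.

Let source_regpt i s w : source_at P s w i = (regpt P i s w) \- (fun x => (denom P i x s)^-1 * (qhat P i x * w i x)).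
Proof. by apply/funext => x; exact: source_reg. Qed.

Lemma source_defined_qhat s w : 0 <= s -> (forall i, inL2 (fun x => qhat P i x * w i x)) -> source_defined P s w.
Proof.
move=> s0 H i; rewrite source_regpt; apply: inL2B; first exact: regpt_inL2.
exact: denomV_mul_inL2.
Qed.

(** The regular part is always in L2, so the source is defined only if qhat w / denom is in L2, in
    which case [Vop] is the evolution of that function. *)
Lemma Phi_source t s w : 0 <= s -> s < t -> source_defined P s w ->
  Phi P U t s w = evolve U t s (source P s w).
Proof.
move=> s0 st sd; apply/ffunP => i; rewrite !ffunE.
set g := fun x => (denom P i x s)^-1 * (qhat P i x * w i x).
have r2 := regpt_inL2 E_gt0 P_ge0 h1 h2 h3 i w s0.
have g2 : inL2 g.
  have := inL2B r2 (sd i); rewrite source_regpt; congr inL2; apply/funext => x /=.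
  by rewrite subKr.
have lU : linear (U i t s) by apply: (evol_linear (Uev i)); rewrite s0 ltW.
rewrite (Vop_defined P_ge0 h1 h2 h3 (Uev i) s0 st g2) source_regpt.
by rewrite (toL2B r2 g2) (linear_sub _ _ lU).
Qed.

End regularity.

Lemma bochner_ae_eq_itv (R : realType) (V : normedModType R) (f g : R -> V) (t : R) I :
  {ae lebesgue_measure, forall s, 0 <= s -> s < t -> f s = g s} ->
  is_bochner_integral lebesgue_measure `[0, t] f I -> is_bochner_integral lebesgue_measure `[0, t] g I.
Proof.
move=> fg; apply: bochner_ae_eq; apply: filterS2 fg (ae_neq t) => s H st.
by rewrite /= in_itv/= => /andP[s0 st']; apply: H => //; rewrite lt_neqAle st.
Qed.

Theorem theorem1p3 (R : realType) (n : nat) (n_ge2 : (2 <= n)%N)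
    (P : coefficients R n) (E_gt0 : 0 < cE P)
    (P_ge0 : nonneg_coefficients P) (h1 : hypH1 P) (h2 : hypH2 P) (h3 : hypH3 P)
    (U : 'I_n -> R -> R -> L2 R -> L2 R)
    (U_evol : forall i, evolution_operator (Gop P i) (U i))
    (phi : L2vec R n) :
  exists u : R -> L2vec R n,
    mild_solution P U phi u /\
    forall v : R -> L2vec R n, mild_solution P U phi v ->
      forall t : R, 0 <= t -> v t = u t.
Proof.
have [u [cu uI uniq]] := mild_volterra E_gt0 P_ge0 h1 h2 h3 U_evol phi.
have sd t : 0 < t -> source_defined P t (u t).
  move=> t0; apply: (source_defined_qhat E_gt0 P_ge0 h1 h2 h3 (ltW t0)) => i.
  exact: (qhat_mul_inL2 E_gt0 P_ge0 h1 h2 h3 U_evol i cu t0 (uI t (ltW t0))).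
(* Time 0 is left out: u(0) = phi is arbitrary in L2, and its product with qhat may fail to be in
   L2. *)
have sd_ae : {ae lebesgue_measure, forall tau : R, 0 <= tau -> source_defined P tau (u tau)}.
  by apply: filterS (ae_neq 0) => t tN0 t0; apply: sd; rewrite lt_neqAle eq_sym tN0.
(* Applied to u for existence and to any competitor v for uniqueness: once the source is defined at
   almost every time, the stated equation and the one with [Phi] have almost everywhere equal
   integrands. *)
have eqPhi v t : {ae lebesgue_measure, forall tau : R, 0 <= tau -> source_defined P tau (v tau)} ->
    {ae lebesgue_measure, forall s, 0 <= s -> s < t ->
      Phi P U t s (v s) = evolve U t s (source P s (v s))}.
  apply: filterS => s vs s0 st.
  exact: (Phi_source E_gt0 P_ge0 h1 h2 h3 U_evol s0 st (vs s0)).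
exists u; split.
  split; [exact: cu|exact: sd_ae|move=> t t0].
  by apply: bochner_ae_eq_itv (uI t t0); exact: eqPhi.
move=> v [cv vd vI]; apply: (uniq v cv) => t t0; apply: bochner_ae_eq_itv (vI t t0).
by apply: filterS (eqPhi v t vd) => s H s0 st; rewrite H.
Qed.
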